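(* Let $\mathbb{G}$ be a compact quantum group (with faithful Haar state) and let $\Delta_N:N\to L^\infty(\mathbb{G})\bar\otimes N$ be an ergodic coaction of $\mathbb{G}$ on a von Neumann algebra $N$. Then $(N,\Delta_N)$ is a quantum homogeneous space of $\mathbb{G}$ (QHS).
   Context: Compact quantum groups. A compact quantum group $\mathbb{G}=(A,\Delta)$ is a unital $C^*$-algebra $A=C_0(\mathbb{G})$ with a unital coassociative $*$-homomorphism $\Delta=\Delta_{\mathbb{G}}:A\to A\otimes A$ such that $[\Delta(A)(A\otimes 1)]=A\otimes A=[\Delta(A)(1\otimes A)]$. The Haar state is the unique state $\phi$ with $(\phi\otimes\iota)\Delta(a)=\phi(a)1=(\iota\otimes\phi)\Delta(a)$. When $\phi$ is faithful, $L^2(\mathbb{G})$ is its GNS space, $A$ is viewed as acting on $L^2(\mathbb{G})$, and $L^\infty(\mathbb{G})$ is the strong closure of $A$, so $\mathbb{G}$ is also a locally compact quantum group. Conventions. $\mathcal{K}(L^2(\mathbb{G}))$ denotes the compact operators, $\otimes$ is the minimal tensor product of $C^*$-algebras, $\mathrm{M}(A)$ is the multiplier algebra, $\mathrm{Mor}(A,B)$ is the set of nondegenerate $*$-homomorphisms $A\to \mathrm{M}(B)$, and $[\,\cdot\,]$ denotes closed linear span. $\mathcal{L}(L^2(\mathbb{G})\otimes D)$ is the algebra of adjointable operators on the Hilbert $D$-module $L^2(\mathbb{G})\otimes D$, identified with $\mathrm{M}(\mathcal{K}(L^2(\mathbb{G}))\otimes D)$. Coaction on a von Neumann algebra. A (left)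 coaction of $\mathbb{G}$ on $N$ is an injective normal unital $*$-homomorphism $\Delta_N:N\to L^\infty(\mathbb{G})\bar\otimes N$ with $(\iota\otimes\Delta_N)\circ\Delta_N=(\Delta_{\mathbb{G}}\otimes\iota)\circ\Delta_N$. It is ergodic if $\{x\in N:\Delta_N(x)=1\otimes x\}=\mathbb{C}1$. $\mathbb{G}$-$C^*$-algebra. A pair $\mathbb{D}=(C_0(\mathbb{D}),\Delta_{\mathbb{D}})$ where $C_0(\mathbb{D})$ is a $C^*$-algebra and $\Delta_{\mathbb{D}}\in\mathrm{Mor}(C_0(\mathbb{D}),C_0(\mathbb{G})\otimes C_0(\mathbb{D}))$ is injective, satisfies $(\iota\otimes\Delta_{\mathbb{D}})\circ\Delta_{\mathbb{D}}=(\Delta_{\mathbb{G}}\otimes\iota)\circ\Delta_{\mathbb{D}}$, and is continuous: $[\Delta_{\mathbb{D}}(C_0(\mathbb{D}))(C_0(\mathbb{G})\otimes 1)]=C_0(\mathbb{G})\otimes C_0(\mathbb{D})$. Strictness. A unital $*$-homomorphism $\pi:N\to\mathcal{L}(\mathcal{E})$ ($\mathcal{E}$ a Hilbert $C^*$-module) is strict if it is $*$-strongly continuous on the unit ball of $N$: for every uniformly bounded $*$-strongly convergent net $x_i\in N$ and every $v\in\mathcal{E}$, the nets $\pi(x_i)v$ and $\pi(x_i^* )v$ converge in norm (to the values at the limit). Quantum homogeneous space (QHS). A von Neumann algebra $N$ with an ergodic coaction $\Delta_N:N\to L^\infty(\mathbb{G})\bar\otimes N$ is a QHS of $\mathbb{G}$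 if there exists a $\mathbb{G}$-$C^*$-algebra $\mathbb{D}$ such that: (1) $C_0(\mathbb{D})$ is a strongly dense $C^*$-subalgebra of $N$; (2) $\Delta_{\mathbb{D}}$ is the restriction of $\Delta_N$ to $C_0(\mathbb{D})$; (3) $\Delta_N(N)\subset \mathrm{M}(\mathcal{K}(L^2(\mathbb{G}))\otimes C_0(\mathbb{D}))$ and the map $\Delta_N:N\to\mathcal{L}(L^2(\mathbb{G})\otimes C_0(\mathbb{D}))$ is strict. *)

(* Defs.v *)
From HB Require Import structures.
From mathcomp Require Import all_boot all_order all_algebra.
From mathcomp Require Import complex.
From mathcomp Require Import all_classical all_reals all_analysis.

Set Implicit Arguments.
Unset Strict Implicit.
Unset Printing Implicit Defensive.

Import Order.TTheory GRing.Theory Num.Theory.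
Import numFieldNormedType.Exports.
Local Open Scope classical_set_scope.
Local Open Scope ring_scope.
Local Open Scope complex_scope.

(* Operator algebras are concrete throughout: a C*-algebra is a norm-closed    *)
(* *-algebra of bounded operators on a Hilbert space, a von Neumann algebra a  *)
(* strongly closed unital one.  An algebra of operators is a set of functions  *)
(* H -> H; products are compositions, the unit is idfun.  Tensor products and  *)
(* multiplier algebras are the spatial ones.  A map between operator algebras  *)
(* is a total function, of which only the values on its domain matter.         *)

HB.mixin Record isHilbert (R : realType) V of CompleteNormedModule R[i] V := {
  hdot : {dot V for (@Num.conj R[i])} ;
  hdot_norm : forall x : V, hdot x x = `|x| ^+ 2
}.

#[short(type="hilbertType")]
HB.structure Definition Hilbert (R : realType) :=
  {V of isHilbert R V & CompleteNormedModule R[i] V}.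

Section Operators.
Variable R : realType.
Implicit Types H K L : hilbertType R.

Definition lspan (V : lmodType R[i]) (X : set V) : set V :=
  [set v | exists (n : nat) (c : 'I_n -> R[i]) (x : 'I_n -> V),
     (forall k, X (x k)) /\ v = \sum_(k < n) c k *: x k].

Definition linear_on (V W : lmodType R[i]) (X : set V) (f : V -> W) :=
  forall (c : R[i]) v w, X v -> X w -> f (c *: v + w) = c *: f v + f w.

Definition bounded_op H K (T : H -> K) : Prop := linear T /\ continuous T.

(* `|T| <= M in operator norm *)
Definition opnorm_le H K (T : H -> K) (M : R[i]) : Prop :=
  forall x, `|T x| <= M * `|x|.

Definition opnorm_cvg H K (I : Type) (F : set_system I)
    (T_ : I -> H -> K) (T : H -> K) : Prop :=
  forall e : R[i], 0 < e -> \forall i \near F, opnorm_le (T_ i - T) e.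

Definition norm_closure H K (X : set (H -> K)) : set (H -> K) :=
  [set T | forall e : R[i], 0 < e -> exists2 S, X S & opnorm_le (T - S) e].

(* [X], the closed linear span *)
Definition cspan H K (X : set (H -> K)) : set (H -> K) :=
  norm_closure (lspan X).

(* {ptws H -> K} carries the topology of pointwise convergence, which on      *)
(* bounded operators is the strong operator topology.                         *)
Definition strong_closure H K (X : set (H -> K)) : set (H -> K) :=
  @bounded_op H K `&` @closure {ptws H -> K} X.

(* By Riesz representation the defining set is a singleton for bounded T.     *)
Definition adj H K (T : H -> K) : K -> H :=
  get [set S : K -> H | forall x y, hdot (T x) y = hdot x (S y)].

(* Every product S T with S in X and T in Y. *)
Definition opmul H K L (X : set (K -> L)) (Y : set (H -> K)) : set (H -> L) :=
  [set U | exists2 S, X S & exists2 T, Y T & U = S \o T].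

Definition compact_op H : set (H -> H) :=
  [set T | bounded_op T /\ precompact (T @` [set x | `|x| <= 1])].

Record star_algebra H (A : set (H -> H)) : Prop := {
  star_algebra_bounded : A `<=` @bounded_op H H ;
  star_algebra0 : A 0 ;
  star_algebra_linear : forall (c : R[i]) S T, A S -> A T -> A (c *: S + T) ;
  star_algebra_mul : forall S T, A S -> A T -> A (S \o T) ;
  star_algebra_adj : forall S, A S -> A (adj S)
}.

Definition cstar_algebra H (A : set (H -> H)) : Prop :=
  star_algebra A /\ norm_closure A `<=` A.

Definition nondegenerate H (A : set (H -> H)) : Prop :=
  closure (lspan [set v | exists T x, A T /\ v = T x]) = setT.

Definition von_neumann_algebra H (N : set (H -> H)) : Prop :=
  [/\ star_algebra N, N idfun & strong_closure N `<=` N].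

(* The multiplier algebra of a C*-algebra acting nondegenerately on H. *)
Definition multiplier H (A : set (H -> H)) : set (H -> H) :=
  [set T | bounded_op T /\ forall S, A S -> A (T \o S) /\ A (S \o T)].

Record star_hom H K (A : set (H -> H)) (f : (H -> H) -> (K -> K)) : Prop := {
  star_hom_bounded : forall S, A S -> bounded_op (f S) ;
  star_hom_linear : linear_on A f ;
  star_hom_mul : forall S T, A S -> A T -> f (S \o T) = f S \o f T ;
  star_hom_adj : forall S, A S -> f (adj S) = adj (f S)
}.

(* Mor(A, B) *)
Definition mor H K (A : set (H -> H)) (B : set (K -> K))
    (f : (H -> H) -> (K -> K)) : Prop :=
  [/\ star_hom A f,
      forall S, A S -> multiplier B (f S) &
      cspan (opmul (f @` A) B) = B].

(* f is the canonical extension to M(A) of a nondegenerate morphism A -> M(B) *)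
Definition mor_ext H K (A : set (H -> H)) (B : set (K -> K))
    (f : (H -> H) -> (K -> K)) : Prop :=
  mor A B f /\ star_hom (multiplier A) f.

(* The functionals in the predual of B(H): w(T) = sum_n <T xi_n, eta_n> with  *)
(* square-summable sequences of vectors; they define the sigma-weak topology. *)
Definition normal_functional H (w : (H -> H) -> R[i]^o) : Prop :=
  exists xi eta : nat -> H,
    [/\ cvgn (fun n => \sum_(0 <= k < n) (`|xi k| ^+ 2 : R[i]^o)),
        cvgn (fun n => \sum_(0 <= k < n) (`|eta k| ^+ 2 : R[i]^o)) &
        forall T : H -> H, bounded_op T ->
          (fun n => \sum_(0 <= k < n) (hdot (T (xi k)) (eta k) : R[i]^o))
            @ \oo --> w T].

Definition sigma_weak_cvg H (I : Type) (F : set_system I)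
    (T_ : I -> H -> H) (T : H -> H) : Prop :=
  forall w : (H -> H) -> R[i]^o, normal_functional w ->
    w (T_ i) @[i --> F] --> w T.

(* Nets are families indexed by a set with a proper filter (for a directed    *)
(* set, the filter generated by its tails).                                   *)
Definition normal_on H K (N : set (H -> H)) (f : (H -> H) -> (K -> K)) : Prop :=
  forall (I : Type) (F : set_system I), ProperFilter F ->
  forall (x_ : I -> H -> H) (x : H -> H),
    (forall i, N (x_ i)) -> N x ->
    sigma_weak_cvg F x_ x -> sigma_weak_cvg F (fun i => f (x_ i)) (f x).

Definition state_on H (A : set (H -> H)) (phi : (H -> H) -> R[i]^o) : Prop :=
  [/\ linear_on A phi,
      forall S, A S -> 0 <= phi (adj S \o S) & phi idfun = 1].

Definition faithful_on H (A : set (H -> H)) (phi : (H -> H) -> R[i]^o) : Prop :=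
  forall S, A S -> phi (adj S \o S) = 0 -> S = 0.

(* H, with the inclusion of A in B(H) and the vector xi, is the GNS           *)
(* representation of phi.                                                     *)
Definition gns H (A : set (H -> H)) (phi : (H -> H) -> R[i]^o) (xi : H) : Prop :=
  (forall S, A S -> phi S = hdot (S xi) xi) /\
  closure [set S xi | S in A] = setT.

(* L(E), for a Hilbert module E given concretely as a closed space of         *)
(* operators H -> K, with inner product <v, w> = v^* w and with the operator  *)
(* norm as norm; operators on K act on E by composition on the left.          *)
Definition adjointable H K (E : set (H -> K)) : set (K -> K) :=
  [set T | bounded_op T /\ forall v, E v -> E (T \o v) /\ E (adj T \o v)].

Definition strict H K L (N : set (L -> L)) (E : set (H -> K))
    (f : (L -> L) -> (K -> K)) : Prop :=
  forall (I : Type) (F : set_system I), ProperFilter F ->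
  forall (x_ : I -> L -> L) (x : L -> L),
    (forall i, N (x_ i)) -> N x ->
    (exists M : R[i], forall i, opnorm_le (x_ i) M) ->
    (forall z, x_ i z @[i --> F] --> x z) ->
    (forall z, adj (x_ i) z @[i --> F] --> adj x z) ->
    forall v, E v ->
      opnorm_cvg F (fun i => f (x_ i) \o v) (f x \o v) /\
      opnorm_cvg F (fun i => f (adj (x_ i)) \o v) (f (adj x) \o v).

(* A Hilbert space tensor product of H and K, determined up to a unique       *)
(* unitary compatible with elementary tensors.                                *)
Record hilbertTensor H K := HilbertTensor {
  tensor_space :> hilbertType R ;
  elt : {bilinear H -> K -> tensor_space} ;
  elt_dot : forall x x' y y',
    hdot (elt x y) (elt x' y') = hdot x x' * hdot y y' ;
  elt_total : closure (lspan [set v | exists x y, v = elt x y]) = setT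
}.

End Operators.

Section QuantumGroups.
Variable R : realType.
(* a model of the tensor product of each pair of Hilbert spaces *)
Variable tens : forall H K : hilbertType R, hilbertTensor H K.
Implicit Types H K L : hilbertType R.

Local Notation "H ⊗ K" := (tensor_space (tens H K))
  (at level 40, left associativity).
Local Notation "x ⊙ y" := (elt (tens _ _) x y)
  (at level 40, left associativity).

Definition optens H K (S : H -> H) (T : K -> K) : H ⊗ K -> H ⊗ K :=
  get [set U | bounded_op U /\ forall x y, U (x ⊙ y) = S x ⊙ T y].

Definition eltens H K (A : set (H -> H)) (B : set (K -> K)) :
    set (H ⊗ K -> H ⊗ K) :=
  [set U | exists2 S, A S & exists2 T, B T & U = optens S T].

(* minimal tensor product of C*-algebras *)
Definition ctens H K (A : set (H -> H)) (B : set (K -> K)) :=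
  cspan (eltens A B).

(* tensor product of von Neumann algebras *)
Definition wtens H K (M : set (H -> H)) (N : set (K -> K)) :=
  strong_closure (lspan (eltens M N)).

(* The Hilbert module H (x) D over a C*-algebra D on K: the vector xi (x) d   *)
(* is realized as the operator z |-> xi (x) d z from K to H (x) K.            *)
Definition modtens H K (D : set (K -> K)) : set (K -> H ⊗ K) :=
  cspan [set v | exists (xi : H) (d : K -> K),
    D d /\ v = (fun z => xi ⊙ d z)].

(* F extends f (x) iota, resp. iota (x) f, off the elementary tensors of A    *)
(* and B.  Combined with star_hom on the C*-tensor product, mor_ext, or       *)
(* normality on the von Neumann tensor product, this determines F there.      *)
Definition tens_id H K L (A : set (H -> H)) (B : set (K -> K))
    (f : (H -> H) -> (L -> L)) (F : (H ⊗ K -> H ⊗ K) -> (L ⊗ K -> L ⊗ K)) :=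
  forall S T, A S -> B T -> F (optens S T) = optens (f S) T.

Definition id_tens H K L (A : set (H -> H)) (B : set (K -> K))
    (f : (K -> K) -> (L -> L)) (F : (H ⊗ K -> H ⊗ K) -> (H ⊗ L -> H ⊗ L)) :=
  forall S T, A S -> B T -> F (optens S T) = optens S (f T).

(* U and V correspond under the identification (H(x)K)(x)L = H(x)(K(x)L). *)
Definition same_assoc H K L (U : H ⊗ K ⊗ L -> H ⊗ K ⊗ L)
    (V : H ⊗ (K ⊗ L) -> H ⊗ (K ⊗ L)) : Prop :=
  exists a : H ⊗ K ⊗ L -> H ⊗ (K ⊗ L),
    [/\ bounded_op a,
        forall x y z, a (x ⊙ y ⊙ z) = x ⊙ (y ⊙ z) &
        a \o U = V \o a].

Record compact_quantum_group := CompactQuantumGroup {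
  cqg_space :> hilbertType R ;
  cqg_alg : set (cqg_space -> cqg_space) ;
  comult : (cqg_space -> cqg_space) ->
    (cqg_space ⊗ cqg_space -> cqg_space ⊗ cqg_space) ;
  cqg_cstar : cstar_algebra cqg_alg ;
  cqg_unital : cqg_alg idfun ;
  comult_hom : star_hom cqg_alg comult ;
  comult_unital : comult idfun = idfun ;
  comult_in : forall S, cqg_alg S -> ctens cqg_alg cqg_alg (comult S) ;
  comult_coassoc : exists F1 F2,
    [/\ star_hom (ctens cqg_alg cqg_alg) F1 /\
          id_tens cqg_alg cqg_alg comult F1,
        star_hom (ctens cqg_alg cqg_alg) F2 /\
          tens_id cqg_alg cqg_alg comult F2 &
        forall S, cqg_alg S ->
          same_assoc (F2 (comult S)) (F1 (comult S))] ;
  comult_densel :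
    cspan (opmul (comult @` cqg_alg) (eltens cqg_alg [set idfun])) =
    ctens cqg_alg cqg_alg ;
  comult_denser :
    cspan (opmul (comult @` cqg_alg) (eltens [set idfun] cqg_alg)) =
    ctens cqg_alg cqg_alg
}.

Implicit Type G : compact_quantum_group.

Definition bounded_map_on H K (X : set (H -> H)) (f : (H -> H) -> (K -> K)) :=
  exists M : R[i], forall S, X S ->
    forall m : R[i], opnorm_le S m -> opnorm_le (f S) (M * m).

(* s is phi (x) iota, resp. iota (x) phi, on the C*-tensor square of C_0(G) *)
Definition slicel G (phi : (G -> G) -> R[i]^o)
    (s : (G ⊗ G -> G ⊗ G) -> (G -> G)) : Prop :=
  [/\ linear_on (ctens (@cqg_alg G) (@cqg_alg G)) s,
      bounded_map_on (ctens (@cqg_alg G) (@cqg_alg G)) s &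
      forall S T, cqg_alg S -> cqg_alg T -> s (optens S T) = phi S *: T].

Definition slicer G (phi : (G -> G) -> R[i]^o)
    (s : (G ⊗ G -> G ⊗ G) -> (G -> G)) : Prop :=
  [/\ linear_on (ctens (@cqg_alg G) (@cqg_alg G)) s,
      bounded_map_on (ctens (@cqg_alg G) (@cqg_alg G)) s &
      forall S T, cqg_alg S -> cqg_alg T -> s (optens S T) = phi T *: S].

Definition haar_state G (phi : (G -> G) -> R[i]^o) : Prop :=
  state_on (@cqg_alg G) phi /\
  exists sl sr, [/\ slicel phi sl, slicer phi sr &
    forall S, cqg_alg S ->
      sl (comult S) = phi S *: (idfun : G -> G) /\
      sr (comult S) = phi S *: (idfun : G -> G)].

(* L^oo(G), when the space of G is L^2(G) *)
Definition Linfty G : set (G -> G) := strong_closure (@cqg_alg G).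

(* the normal extension of the comultiplication to L^oo(G) *)
Definition Linfty_comult G
    (dG : (G -> G) -> (G ⊗ G -> G ⊗ G)) : Prop :=
  [/\ star_hom (@Linfty G) dG, normal_on (@Linfty G) dG &
      forall S, cqg_alg S -> dG S = comult S].

Record coaction G K (N : set (K -> K))
    (dN : (K -> K) -> (G ⊗ K -> G ⊗ K)) : Prop := {
  coaction_hom : star_hom N dN ;
  coaction_unital : dN idfun = idfun ;
  coaction_normal : normal_on N dN ;
  coaction_inj : forall x y, N x -> N y -> dN x = dN y -> x = y ;
  coaction_in : forall x, N x -> wtens (@Linfty G) N (dN x) ;
  coaction_coassoc : exists dG F1 F2,
    [/\ Linfty_comult dG,
        [/\ star_hom (wtens (@Linfty G) N) F1,
            normal_on (wtens (@Linfty G) N) F1 &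
            id_tens (@Linfty G) N dN F1],
        [/\ star_hom (wtens (@Linfty G) N) F2,
            normal_on (wtens (@Linfty G) N) F2 &
            tens_id (@Linfty G) N dG F2] &
        forall x, N x -> same_assoc (F2 (dN x)) (F1 (dN x))]
}.

Definition ergodic G K (N : set (K -> K))
    (dN : (K -> K) -> (G ⊗ K -> G ⊗ K)) : Prop :=
  [set x | N x /\ dN x = optens idfun x] =
  [set c *: (idfun : K -> K) | c in [set: R[i]]].

Record G_cstar_algebra G K (D : set (K -> K))
    (dD : (K -> K) -> (G ⊗ K -> G ⊗ K)) : Prop := {
  G_cstar_cstar : cstar_algebra D ;
  G_cstar_nondegenerate : nondegenerate D ;
  G_cstar_mor : mor D (ctens (@cqg_alg G) D) dD ;
  G_cstar_inj : forall x y, D x -> D y -> dD x = dD y -> x = y ;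
  G_cstar_coassoc : exists F1 F2,
    [/\ mor_ext (ctens (@cqg_alg G) D)
          (ctens (@cqg_alg G) (ctens (@cqg_alg G) D)) F1 /\
          id_tens (@cqg_alg G) D dD F1,
        mor_ext (ctens (@cqg_alg G) D)
          (ctens (ctens (@cqg_alg G) (@cqg_alg G)) D) F2 /\
          tens_id (@cqg_alg G) D (@comult G) F2 &
        forall x, D x -> same_assoc (F2 (dD x)) (F1 (dD x))] ;
  G_cstar_continuous :
    cspan (opmul (dD @` D) (eltens (@cqg_alg G) [set idfun])) =
    ctens (@cqg_alg G) D
}.

Definition quantum_homogeneous_space G K (N : set (K -> K))
    (dN : (K -> K) -> (G ⊗ K -> G ⊗ K)) : Prop :=
  [/\ von_neumann_algebra N, coaction N dN, ergodic N dN &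
    exists (D : set (K -> K)) (dD : (K -> K) -> (G ⊗ K -> G ⊗ K)),
    [/\ G_cstar_algebra D dD,
        D `<=` N /\ N `<=` strong_closure D,
        forall x, D x -> dD x = dN x,
        forall x, N x ->
          multiplier (ctens (@compact_op R G) D) (dN x) /\
          adjointable (@modtens G K D) (dN x) &
        strict N (@modtens G K D) dN]].

End QuantumGroups.

(* Main.v *)
Require Import Defs.
From HB Require Import structures.
From mathcomp Require Import all_boot all_order all_algebra.
From mathcomp Require Import complex.
From mathcomp Require Import all_classical all_reals all_analysis.
From mathcomp Require finmap.
From mathcomp Require Import lra ring.

Set Implicit Arguments.
Unset Strict Implicit.
Unset Printing Implicit Defensive.

Import Order.TTheory GRing.Theory Num.Theory.
Import numFieldNormedType.Exports.
Local Open Scope classical_set_scope.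
Local Open Scope ring_scope.
Local Open Scope complex_scope.

(* An ergodic coaction has a faithful invariant state, because the slice of    *)
(* dN x at the cyclic vector xi on both sides is a scalar.  Hence              *)
(* |dN x (xi (x) k)| = c |k|, so that strong convergence of operators          *)
(* k |-> dN x (xi (x) k) is norm convergence, which is the source of           *)
(* strictness.  Let D be the closed span of all slices                         *)
(* k |-> (f (x) 1)^* dN x (e (x) k), x in N.  Slicing the coassociativity law  *)
(* and using the two density conditions on the comultiplication gives          *)
(* [dN(D)(A (x) 1)] = A (x) D; thus D is an algebra and carries a continuous   *)
(* coaction.  For strong density, the isometry                                 *)
(* Th (a xi) = Delta a (xi (x) xi) makes L^2(G) a Frobenius coalgebra.  The    *)
(* convolution operators of Th are compact, and their central projections form *)
(* an approximate unit u.  For selfadjoint x the slices of dN x at xi and u    *)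
(* then approximate x strongly after applying dN, their resolvents are bounded *)
(* elements of D, and normality and injectivity of dN put the resolvent of x   *)
(* in the bicommutant of D.                                                    *)

(** Write L for the GNS space of the Haar state, xi for its cyclic vector, A for C_0(G), and
    omega_{e,f}(T) = <T e, f>. The C*-algebra asked for is [sliceD], the closed span D of the slices
    (omega_{e,f} (x) iota) dN(x) with x in N. Three facts are needed: D is a C*-algebra carrying a
    continuous coaction, dN is strict into the adjointable operators on L (x) D, and D is strongly
    dense in N.

    Ergodicity enters at one point. By left invariance, the slice of dN(x) at the pair (xi, xi) is a
    fixed point of the coaction, hence a scalar ([nsl_xi_scalar]). Applied to x^* x, this makes k
    |-> dN(x)(xi (x) k) a multiple of an isometry ([dN_xi_norm]). Its operator norm can be read off
    at one nonzero vector, so pointwise convergence of such operators is norm convergence. With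
    normality of dN this gives strictness at xi, and then at every vector of L, because xi is cyclic
    for the commutant of A ([commutant_dense], [strict_half]). That cyclicity is dual to
    faithfulness of the Haar state on the von Neumann algebra of G ([Linfty_sep]).

    The fundamental unitary U(e (x) a xi) = Delta(a)(e (x) xi) turns slices into operators on L: if
    y is the slice of x by omega_{e,f}, then dN(y)(xi (x) k) = (lam e f (x) 1) dN(x)(xi (x) k),
    where [lam e f] is a convolution operator ([dN_nsl_xi]). Along a net u with [lam xi u] and
    [lam u xi] tending strongly to 1 ([approx_unit]), the corresponding slices approximate x at all
    vectors xi (x) k. This shows that dN(N) maps L (x) D into itself ([dN_E]). Passing to
    resolvents, which are bounded, it also shows that D is dense ([density_selfadj]).

    The net is found by a Peter-Weyl argument. The isometry [Th] satisfies a Frobenius identity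
    ([Th_frobenius]), so the operators [lam xi z] are closed under products. They are compact by
    left invariance and density ([lam_cpt]). Finite-dimensional eigenspaces of these compact
    operators produce central projections of the form [lam xi u] ([finite_unit]), which increase to
    1 ([cu_filter]).

    For the algebraic part, coassociativity is sliced at xi. The tensors a (x) b and the products
    Delta(c)(1 (x) d) have the same closed span, and comparing the two descriptions gives continuity
    of the coaction on D ([sliceD_continuous]). Continuity in turn makes D closed under products
    ([sliceD_mul]). *)

Notation ipd := hdot.

(** * Hilbert spaces and bounded operators *)

Section RealNorm.
Variable R : realType.
Implicit Type V : normedModType R[i].

(* The norm of the library takes its values in R[i]; nrm is its real value. *)
Definition nrm V (x : V) : R := complex.Re `|x|.

Lemma nrmE V (x : V) : `|x| = (nrm x)%:C.
Proof. by rewrite /nrm RRe_real // ger0_real. Qed.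

Lemma nrm_ge0 V (x : V) : 0 <= nrm x.
Proof. by rewrite -ler0c -nrmE. Qed.

Lemma nrm0 V : nrm (0 : V) = 0.
Proof. by rewrite /nrm normr0. Qed.

Lemma nrm_eq0 V (x : V) : nrm x = 0 -> x = 0.
Proof. by move=> h; apply/normr0_eq0; rewrite nrmE h. Qed.

Lemma nrmN V (x : V) : nrm (- x) = nrm x.
Proof. by rewrite /nrm normrN. Qed.

Lemma nrmBC V (x y : V) : nrm (x - y) = nrm (y - x).
Proof. by rewrite -nrmN opprB. Qed.

Lemma nrmD V (x y : V) : nrm (x + y) <= nrm x + nrm y.
Proof. by rewrite -lecR rmorphD /= -!nrmE ler_normD. Qed.

Lemma nrmB V (x y z : V) : nrm (x - y) <= nrm (x - z) + nrm (z - y).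
Proof. by rewrite (le_trans _ (nrmD _ _)) // addrA subrK. Qed.

Lemma nrmZ V (c : R[i]) (x : V) : nrm (c *: x) = nrm (c : R[i]^o) * nrm x.
Proof. by apply: complexI; rewrite rmorphM /= -!nrmE normrZ. Qed.

Lemma nrmM (c d : R[i]^o) : nrm (c * d : R[i]^o) = nrm c * nrm d.
Proof. exact: (nrmZ c d). Qed.

Lemma nrm_real (r : R) : 0 <= r -> nrm (r%:C : R[i]^o) = r.
Proof. by move=> r0; rewrite /nrm ger0_norm ?ler0c. Qed.

Lemma normr_nrm (r : R) : r ^+ 2 = nrm (r%:C : R[i]^o) ^+ 2.
Proof.
apply: complexI; rewrite [RHS]rmorphXn /= -nrmE -add_Re2_Im2 /=.
by rewrite expr0n addr0.
Qed.

Lemma nrm_conj (c : R[i]) : nrm (c^* : R[i]^o) = nrm (c : R[i]^o).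
Proof. by rewrite /nrm norm_conjC. Qed.

Lemma le_nrm0 V (x : V) : (forall e, 0 < e -> nrm x <= e) -> x = 0.
Proof.
move=> h; apply: nrm_eq0; apply/eqP; rewrite eq_le nrm_ge0 andbT.
by apply/ler_addgt0Pl => e e0; rewrite addr0 h.
Qed.

Lemma cvg_nrm V I (F : set_system I) (FF : Filter F) (f : I -> V) l :
  (f @ F --> l) <-> (forall e : R, 0 < e -> \forall i \near F, nrm (l - f i) <= e).
Proof.
split=> [/cvgrPdist_le h e e0|h].
  have := h e%:C; rewrite ltcR => /(_ e0); apply: filterS => i /=.
  by rewrite nrmE lecR.
apply/cvgrPdist_le => e e0.
have ee : e = (complex.Re e)%:C by rewrite RRe_real // gtr0_real.
move: e0; rewrite ee ltcR => /h; apply: filterS => i /=.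
by rewrite nrmE lecR.
Qed.

Lemma closure_nrm V (A : set V) x :
  closure A x <-> (forall e : R, 0 < e -> exists2 y, A y & nrm (x - y) <= e).
Proof.
split=> [h e e0|h].
  have e0' : 0 < e%:C by rewrite ltcR.
  have [y [Ay]] := h _ (nbhsx_ballx x e%:C e0').
  by rewrite -ball_normE /ball_ /= nrmE ltcR => /ltW; exists y.
move=> B /nbhs_ballP[e e0 eB].
have ee : e = (complex.Re e)%:C by rewrite RRe_real // gtr0_real.
move: e0; rewrite /= ee ltcR => e0.
have [y Ay xy] := h _ (divr_gt0 e0 (ltr0Sn _ 1)).
exists y; split => //; apply: eB; rewrite ee -ball_normE /ball_ /=.
rewrite nrmE ltcR; apply: le_lt_trans xy _; lra.
Qed.

(** The approximants of each precision form a relation instead of a sequence, so that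
    near-minimisers and values at nearby points can be used without choosing them. The sets [B d]
    are a base of a Cauchy filter. *)
Lemma complete_nrm (V : completeNormedModType R[i]) (P : R -> V -> Prop) :
  (forall e, 0 < e -> exists x, P e x) ->
  (forall e, 0 < e -> exists2 d, 0 < d & forall d1 d2 x y, 0 < d1 <= d ->
     0 < d2 <= d -> P d1 x -> P d2 y -> nrm (x - y) <= e) ->
  exists l, forall e, 0 < e -> exists2 d, 0 < d &
    forall d' x, 0 < d' <= d -> P d' x -> nrm (x - l) <= e.
Proof.
move=> exP cauP.
pose B (d : R) : set V := [set x | exists2 d', 0 < d' <= d & P d' x].
pose F := filter_from [set d : R | 0 < d] B.
have FF : ProperFilter F.
  apply: filter_from_proper; last first.
    move=> d /= d0; have [x Px] := exP d d0.
    by exists x; exists d => //; rewrite d0 lexx.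
  apply: filter_from_filter; first by exists 1; rewrite /= ltr01.
  move=> d1 d2 /= h1 h2; exists (Num.min d1 d2).
    by rewrite /= lt_min h1.
  move=> x [d' /andP[d'0 d'l] Px]; move: d'l; rewrite le_min => /andP[l1 l2].
  by split; exists d' => //; rewrite d'0.
have cF : cvg F.
  apply: cauchy_cvg; apply/cauchy_ballP => e e0.
  have ee : e = (complex.Re e)%:C by rewrite RRe_real // gtr0_real.
  move: e0; rewrite ee ltcR => e0.
  have [d d0 hd] := cauP _ (divr_gt0 e0 (ltr0Sn _ 1)).
  exists (B d, B d) => /=; first by split; exists d.
  move=> [x y] [/= [d1 h1 P1] [d2 h2 P2]]; rewrite -ball_normE /ball_ /=.
  by rewrite nrmE ltcR (le_lt_trans (hd _ _ _ _ h1 h2 P1 P2)) //; lra.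
move/cvg_ex: cF => [l hl]; exists l => e e0.
have {}hl : idfun @ F --> l by move=> A /hl.
have [d /= d0 hd] := (iffLR (cvg_nrm _ idfun l)) hl e e0.
by exists d => // d' x h Px; rewrite nrmBC; apply: hd; exists d'.
Qed.

Lemma complete_seq (V : completeNormedModType R[i]) (u : nat -> V) :
  (forall e : R, 0 < e -> exists N, forall m n, (N <= m)%N -> (N <= n)%N ->
     nrm (u m - u n) <= e) ->
  exists l, forall e : R, 0 < e -> exists N, forall n, (N <= n)%N ->
     nrm (u n - l) <= e.
Proof.
move=> cu.
have cF : cvg (u @ \oo).
  apply: cauchy_cvg; apply/cauchy_ballP => e e0.
  have ee : e = (complex.Re e)%:C by rewrite RRe_real // gtr0_real.
  move: e0; rewrite ee ltcR => e0.
  have [N hN] := cu _ (divr_gt0 e0 (ltr0Sn _ 1)).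
  pose A : set V := u @` [set n | (N <= n)%N].
  have uA : (u @ \oo) A by exists N => // n /= Nn; exists n.
  exists (A, A) => //= -[_ _] [/= [m Nm <-] [n Nn <-]].
  rewrite -ball_normE /ball_ /=.
  by rewrite nrmE ltcR (le_lt_trans (hN _ _ Nm Nn)) //; lra.
move/cvg_ex: cF => [l hl]; exists l => e e0.
have [N _ hN] := (iffLR (cvg_nrm _ u l)) hl e e0.
by exists N => n Nn; rewrite nrmBC; apply: hN.
Qed.

End RealNorm.

(** * Inner products and the projection theorem *)

Section Hilbert.
Variable R : realType.
Implicit Types H K L : hilbertType R.
Local Notation C := R[i].

Lemma ipdDl H (x y z : H) : ipd (x + y) z = ipd x z + ipd y z.
Proof. exact: linearDl. Qed.
Lemma ipdDr H (x y z : H) : ipd z (x + y) = ipd z x + ipd z y.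
Proof. exact: linearDr. Qed.
Lemma ipdBl H (x y z : H) : ipd (x - y) z = ipd x z - ipd y z.
Proof. exact: linearBl. Qed.
Lemma ipdBr H (x y z : H) : ipd z (x - y) = ipd z x - ipd z y.
Proof. exact: linearBr. Qed.
Lemma ipdNl H (x z : H) : ipd (- x) z = - ipd x z.
Proof. exact: linearNl. Qed.
Lemma ipdNr H (x z : H) : ipd z (- x) = - ipd z x.
Proof. exact: linearNr. Qed.
Lemma ipdZl H (c : C) (x z : H) : ipd (c *: x) z = c * ipd x z.
Proof. exact: linearZl_LR. Qed.
Lemma ipdZr H (c : C) (x z : H) : ipd z (c *: x) = (c^*)%C * ipd z x.
Proof. by rewrite linearZr_LR. Qed.
Lemma ipd0l H (z : H) : ipd 0 z = 0.
Proof. exact: linear0l. Qed.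
Lemma ipd0r H (z : H) : ipd z 0 = 0.
Proof. exact: linear0r. Qed.
Lemma ipdC H (x y : H) : ipd x y = ((ipd y x)^*)%C.
Proof. by rewrite hermC expr0 mul1r. Qed.
Lemma ipd_suml H I r (P : pred I) (f : I -> H) (z : H) :
  ipd (\sum_(i <- r | P i) f i) z = \sum_(i <- r | P i) ipd (f i) z.
Proof. exact: (big_morph (fun x => ipd x z) (fun x y => ipdDl x y z) (ipd0l z)). Qed.
Lemma ipd_sumr H I r (P : pred I) (f : I -> H) (z : H) :
  ipd z (\sum_(i <- r | P i) f i) = \sum_(i <- r | P i) ipd z (f i).
Proof. exact: (big_morph (fun x => ipd z x) (fun x y => ipdDr x y z) (ipd0r z)). Qed.

Lemma ipdxx H (x : H) : ipd x x = (nrm x ^+ 2)%:C.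
Proof. by rewrite hdot_norm nrmE rmorphXn. Qed.

Lemma nrm_sqr H (x : H) : nrm x ^+ 2 = complex.Re (ipd x x).
Proof. by rewrite ipdxx. Qed.

Lemma ipd_eq0 H (x : H) : ipd x x = 0 -> x = 0.
Proof. by rewrite ipdxx => /complexI /eqP; rewrite expf_eq0 /= => /eqP /nrm_eq0. Qed.

Lemma ipd_inj H (x y : H) : (forall z, ipd x z = ipd y z) -> x = y.
Proof.
move=> h; apply/eqP; rewrite -subr_eq0; apply/eqP/ipd_eq0.
by rewrite ipdBl h subrr.
Qed.

Lemma cauchy_schwarz H (x y : H) : nrm (ipd x y : C^o) <= nrm x * nrm y.
Proof.
rewrite -(@ler_pXn2r _ 2) // ?nnegrE ?mulr_ge0 ?nrm_ge0 // exprMn.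
have [->|y0] := eqVneq y 0.
  by rewrite ipd0r !nrm0 expr0n mulr0.
have B0 : 0 < nrm y ^+ 2.
  by rewrite exprn_gt0 // lt_def nrm_ge0 andbT; apply: contra_neq y0 => /nrm_eq0.
pose B := nrm y ^+ 2; pose A := nrm x ^+ 2; pose c := ipd x y.
have := sqr_ge0 (nrm (B%:C *: x - c *: y)).
rewrite nrm_sqr ipdBl !ipdBr !ipdZl !ipdZr !ipdxx (ipdC y x).
rewrite -/A -/B -/c in B0 *.
have cc : c * (c^*)%C = (nrm (c : C^o) ^+ 2)%:C.
  by rewrite rmorphXn /= -nrmE normCK.
have -> : (B%:C)^*%C = B%:C by exact: conjc_real.
have -> : B%:C * (B%:C * A%:C) - B%:C * ((c^*)%C * c) -
   (c * (B%:C * (c^*)%C) - c * ((c^*)%C * B%:C)) =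
   B%:C * (B%:C * A%:C - c * (c^*)%C) by ring.
rewrite cc -rmorphM -rmorphB -rmorphM /= pmulr_rge0 //; lra.
Qed.

Lemma parallelogram H (x y : H) :
  nrm (x + y) ^+ 2 + nrm (x - y) ^+ 2 = 2 * (nrm x ^+ 2 + nrm y ^+ 2).
Proof.
rewrite !nrm_sqr -!raddfD /=.
have -> : ipd (x + y) (x + y) + ipd (x - y) (x - y) =
   (ipd x x + ipd y y) + (ipd x x + ipd y y).
  by rewrite !ipdDl !ipdDr !ipdNl !ipdNr; ring.
by rewrite raddfD /=; lra.
Qed.

Lemma pythagoras H (x y : H) : ipd x y = 0 ->
  nrm (x + y) ^+ 2 = nrm x ^+ 2 + nrm y ^+ 2.
Proof.
move=> h; rewrite !nrm_sqr !ipdDl !ipdDr h (ipdC y x) h.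
by rewrite conjc0 add0r addr0 raddfD.
Qed.

Lemma nrmB_sq H (x y : H) :
  nrm (x - y) ^+ 2 = nrm x ^+ 2 - 2 * complex.Re (ipd x y) + nrm y ^+ 2.
Proof.
rewrite 3!nrm_sqr ipdBl !ipdBr (ipdC y x) !raddfB /=.
by case: (ipd x y) => a b /=; ring.
Qed.

Definition csub H (Y : set H) : Prop :=
  [/\ Y 0, forall (c : C) x y, Y x -> Y y -> Y (c *: x + y) &
      forall x, (forall e : R, 0 < e -> exists2 y, Y y & nrm (x - y) <= e) -> Y x].

Lemma csubD H (Y : set H) x y : csub Y -> Y x -> Y y -> Y (x + y).
Proof. by case=> _ h _ Yx Yy; rewrite -[x]scale1r; apply: h. Qed.
Lemma csubZ H (Y : set H) c x : csub Y -> Y x -> Y (c *: x).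
Proof. by case=> h0 h _ Yx; rewrite -[_ *: _]addr0; apply: h. Qed.
Lemma csubB H (Y : set H) x y : csub Y -> Y x -> Y y -> Y (x - y).
Proof. by move=> h Yx Yy; rewrite -scaleN1r; apply: csubD => //; apply: csubZ. Qed.

Lemma lspan0 (V : lmodType C) (X : set V) : lspan X 0.
Proof.
by exists 0%N, (fun=> 0), (fun=> 0); split => [[]//|]; rewrite big_ord0.
Qed.

Lemma lspan_sub (V : lmodType C) (X : set V) : X `<=` lspan X.
Proof.
move=> x Xx; exists 1%N, (fun=> 1), (fun=> x); split => //.
by rewrite big_ord1 scale1r.
Qed.

Lemma lspan_lin (V : lmodType C) (X : set V) c x y :
  lspan X x -> lspan X y -> lspan X (c *: x + y).
Proof.
move=> [n [a [u [Xu ->]]]] [m [b [v [Xv ->]]]].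
exists (n + m)%N,
  (fun k => match fintype.split k with inl i => c * a i | inr j => b j end),
  (fun k => match fintype.split k with inl i => u i | inr j => v j end).
split=> [k|]; first by case: (fintype.split k).
rewrite big_split_ord /= scaler_sumr; congr (_ + _); apply: eq_bigr => i _.
  by rewrite (unsplitK (inl i)) scalerA.
by rewrite (unsplitK (inr i)).
Qed.

Lemma lspan_min (V : lmodType C) (X Y : set V) : X `<=` Y -> Y 0 ->
  (forall (c : C) x y, Y x -> Y y -> Y (c *: x + y)) -> lspan X `<=` Y.
Proof.
move=> XY Y0 YL _ [n [a [u [Xu ->]]]].
by elim/big_ind: _ => // [x y Yx Yy|i _];
  [rewrite -[x]scale1r; apply: YL | rewrite -[_ *: _]addr0; apply: YL => //; apply: XY].
Qed.

Lemma closure_csub H (Y : set H) : Y 0 ->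
  (forall (c : C) x y, Y x -> Y y -> Y (c *: x + y)) -> csub (closure Y).
Proof.
move=> Y0 YL; split.
- exact: subset_closure.
- move=> c x y /closure_nrm Yx /closure_nrm Yy; apply/closure_nrm => e e0.
  pose d := e / 2 / (1 + nrm (c : C^o)).
  have c0 := nrm_ge0 (c : C^o).
  have d0 : 0 < d by rewrite /d !divr_gt0 //; lra.
  have [x' Yx' xx'] := Yx d d0; have [y' Yy' yy'] := Yy _ (divr_gt0 e0 (ltr0Sn _ 1)).
  exists (c *: x' + y'); first exact: YL.
  rewrite opprD addrACA -scalerBr (le_trans (nrmD _ _)) // nrmZ.
  rewrite [leRHS](splitr e) lerD // (le_trans (ler_wpM2l c0 xx')) //.
  rewrite /d mulrCA ger_pMr ?divr_gt0 // ler_pdivrMr; lra.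
- move=> x h; apply/closure_nrm => e e0.
  have [y /closure_nrm Yy xy] := h _ (divr_gt0 e0 (ltr0Sn _ 1)).
  have [z Yz yz] := Yy _ (divr_gt0 e0 (ltr0Sn _ 1)).
  by exists z => //; apply: le_trans (nrmB _ _ y) _; rewrite [leRHS](splitr e) lerD.
Qed.

Lemma closure_lspan_csub H (X : set H) : csub (closure (lspan X)).
Proof. by apply: closure_csub; [exact: lspan0 | exact: lspan_lin]. Qed.

Lemma closure_min H (X Y : set H) : csub Y -> X `<=` Y -> closure X `<=` Y.
Proof.
move=> [_ _ Yc] XY x /closure_nrm h; apply: Yc => e e0.
by have [y Xy xy] := h e e0; exists y => //; apply: XY.
Qed.

(** A first-order term dominated by a second-order one for every t must vanish. This is the
    variational step that turns minimality of a distance into orthogonality. *)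
Lemma ipd_small H (x z : H) (a : R) :
  0 <= a -> (forall t : R, 2 * t * a <= t ^+ 2 * nrm z ^+ 2) -> a = 0.
Proof.
move=> a0 h; apply/eqP; rewrite eq_le a0 andbT leNgt; apply/negP => ap.
have z0 := sqr_ge0 (nrm z).
have := h (a / (1 + nrm z ^+ 2)).
set Z := nrm z ^+ 2 in z0 *; set t := a / _.
have t0 : 0 < t by rewrite /t divr_gt0 //; lra.
have ta : t * (1 + Z) = a by rewrite /t divfK //; lra.
move=> {}h; have : t * (t * (1 + Z)) * 2 <= t * (t * Z) by rewrite ta; lra.
rewrite -mulrA ler_pM2l // => {}h.
have : 0 < t * Z + t + t by nra.
lra.
Qed.

(** Near-minimisers of the distance to x are Cauchy by the parallelogram identity. Their limit
    attains the infimum, and varying it inside [Y] gives orthogonality. *)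
Theorem projection H (Y : set H) x : csub Y ->
  exists2 y, Y y & forall z, Y z -> ipd (x - y) z = 0.
Proof.
move=> cY; have [Y0 YL Yc] := cY.
pose D := [set d : R | exists2 y, Y y & d = nrm (x - y) ^+ 2].
have lD : has_inf D.
  split; first by exists (nrm (x - 0) ^+ 2); exists 0.
  by exists 0 => _ [y _ ->]; rewrite sqr_ge0.
pose d := inf D.
have dle y : Y y -> d <= nrm (x - y) ^+ 2.
  by move=> Yy; apply: ge_inf; [case: lD | exists y].
pose P (e : R) y := Y y /\ nrm (x - y) ^+ 2 <= d + e.
have [e e0||y hy] := @complete_nrm _ H P.
- have [_ [y Yy ->] h] := inf_adherent e0 lD.
  by exists y; split => //; apply: ltW.
(* The parallelogram identity gives |y - z|^2 <= 2 (d1 + d2), hence the bound e^2 / 4 on each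
   excess. *)
- move=> e e0; exists (e ^+ 2 / 4); first by rewrite divr_gt0 ?exprn_gt0.
  move=> d1 d2 y z /andP[_ h1] /andP[_ h2] [Yy hy] [Yz hz].
  rewrite -(@ler_pXn2r _ 2) // ?nnegrE ?nrm_ge0 ?(ltW e0) //.
  have := parallelogram (x - y) (x - z).
  have -> : x - y - (x - z) = z - y by rewrite opprB addrC addrA subrK.
  rewrite (nrmBC z).
  have -> : x - y + (x - z) = (2 : C) *: (x - (2^-1 : C) *: (y + z)).
    rewrite scalerBr scalerA divff ?pnatr_eq0 // scale1r.
    by rewrite (_ : (2:C) = 1 + 1) ?scalerDl ?scale1r // opprD addrACA.
  rewrite nrmZ exprMn (_ : nrm (2 : C^o) = 2); last first.
    by rewrite -[RHS](@nrm_real R) // rmorph_nat.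
  have := dle (2^-1 *: (y + z)) (csubZ _ cY (csubD cY Yy Yz)).
  set a := nrm _ ^+ 2; set b := nrm _ ^+ 2; lra.
have Yy : Y y.
  apply: Yc => e e0; have [c c0 hc] := hy e e0.
  have [_ [z Yz ->] h] := inf_adherent c0 lD.
  exists z => //; rewrite nrmBC; apply: (hc c) => //; first by rewrite c0 lexx.
  by split => //; apply: ltW.
have yd : nrm (x - y) ^+ 2 <= d.
  apply/ler_addgt0Pr => e e0.
  have sq : 0 <= nrm (x - y) by exact: nrm_ge0.
  pose t := Num.min 1 (e / 2 / (2 * nrm (x - y) + 1)).
  have t0 : 0 < t by rewrite lt_min ltr01 !divr_gt0 //; lra.
  have [c c0 hc] := hy t t0.
  pose c' := Num.min c (e / 2).
  have c'0 : 0 < c' by rewrite lt_min c0 divr_gt0.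
  have [_ [z Yz ->] /ltW h] := inf_adherent c'0 lD.
  have tz : nrm (z - y) <= t.
    by apply: (hc c'); [rewrite c'0 ge_min lexx | split].
  have t1 : t <= 1 by rewrite ge_min lexx.
  have t2 : t * (2 * nrm (x - y) + 1) <= e / 2.
    by rewrite -ler_pdivlMr ?ge_min ?lexx ?orbT //; lra.
  have ce : c' <= e / 2 by rewrite ge_min lexx orbT.
  have h1 : nrm (x - y) <= nrm (x - z) + nrm (z - y) by exact: nrmB.
  have h2 : nrm (x - z) <= nrm (x - y) + nrm (z - y).
    by rewrite (nrmBC z y); exact: nrmB.
  have h3 := nrm_ge0 (x - z); have h4 := nrm_ge0 (z - y).
  move: h; rewrite -/d => h.
  have : nrm (x - y) ^+ 2 - nrm (x - z) ^+ 2 <= t * (2 * nrm (x - y) + 1).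
    have -> : nrm (x - y) ^+ 2 - nrm (x - z) ^+ 2 =
      (nrm (x - y) - nrm (x - z)) * (nrm (x - y) + nrm (x - z)) by ring.
    apply: le_trans (_ : nrm (z - y) * (nrm (x - y) + nrm (x - z)) <= _).
      by apply: ler_wpM2r; lra.
    by apply: ler_pM => //; lra.
  lra.
exists y => // z Yz; apply: nrm_eq0.
pose c := ipd (x - y) z.
suff : nrm (c : C^o) ^+ 2 = 0 by move/eqP; rewrite expf_eq0 /= => /eqP.
(* The minimiser is moved by t c z, where c is the inner product to be killed; the linear term then
   is the real number 2 t |c|^2. *)
apply: (@ipd_small H x ((c : C) *: z)); first exact: sqr_ge0.
move=> t.
have := dle (y + (t%:C * c) *: z) (csubD cY Yy (csubZ _ cY Yz)).
move/(le_trans yd); rewrite opprD addrA -scalerA; move: (x - y) @c => w c.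
rewrite nrmB_sq nrmZ exprMn -normr_nrm ipdZr conjc_real ipdZr -/c.
rewrite [c in _ * (_ * c)]lock (mulrC (c^*)%C) -lock.
rewrite (_ : c * (c^*)%C = (nrm (c : C^o) ^+ 2)%:C); last first.
  by rewrite rmorphXn /= -nrmE normCK.
by rewrite -rmorphM /=; lra.
Qed.

End Hilbert.

(** * Completeness of the scalars *)

Section ComplexComplete.
Variable R : realType.
Local Notation C := R[i].

Lemma nrm_ReIm (z : C) : nrm (z : C^o) <= `|complex.Re z| + `|complex.Im z|.
Proof.
have h : (complex.Re z)%:C + 'i%C * (complex.Im z)%:C = z by rewrite -complexE.
have nr (r : R) : nrm (r%:C : C^o) = `|r|.
  apply/eqP; rewrite -(@eqrXn2 _ 2) ?nrm_ge0 ?normr_ge0 //.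
  by rewrite -normr_nrm real_normK ?num_real.
rewrite -{1}h (le_trans (@nrmD _ C^o _ _)) // (@nrmM R) !nr lerD2l.
rewrite (_ : nrm ('i%C : C^o) = 1) ?mul1r //.
by rewrite /nrm normc_def /= expr0n expr1n add0r sqrtr1.
Qed.

Lemma Re_le_nrm (z : C) : `|complex.Re z| <= nrm (z : C^o).
Proof. by rewrite -lecR -nrmE normc_ge_Re. Qed.

Lemma Im_le_nrm (z : C) : `|complex.Im z| <= nrm (z : C^o).
Proof.
have -> : complex.Im z = - complex.Re (z * 'i%C) by rewrite ReiNIm opprK.
rewrite normrN (le_trans (Re_le_nrm _)) // (@nrmM R).
rewrite (_ : nrm ('i%C : C^o) = 1) ?mulr1 //.
by rewrite /nrm normc_def /= expr0n expr1n add0r sqrtr1.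
Qed.

Lemma complete_seqR (u : nat -> R) :
  (forall e : R, 0 < e -> exists N, forall m n, (N <= m)%N -> (N <= n)%N ->
     `|u m - u n| <= e) ->
  exists l, forall e : R, 0 < e -> exists N, forall n, (N <= n)%N -> `|u n - l| <= e.
Proof.
move=> cu.
have cF : cvg (u @ \oo).
  apply: cauchy_cvg; apply/cauchy_ballP => e e0.
  have [N hN] := cu _ (divr_gt0 e0 (ltr0Sn _ 1)).
  pose A : set R := u @` [set n | (N <= n)%N].
  have uA : (u @ \oo) A by exists N => // n /= Nn; exists n.
  exists (A, A) => //= -[_ _] [/= [m Nm <-] [n Nn <-]].
  by rewrite -ball_normE /ball_ /= (le_lt_trans (hN _ _ Nm Nn)) //; lra.
move/cvg_ex: cF => [l hl]; exists l => e e0.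
have [N _ hN] := (iffLR (cvgrPdist_le u l)) hl e e0.
by exists N => n Nn; rewrite distrC; apply: hN.
Qed.

Lemma complete_seqC (u : nat -> C) :
  (forall e : R, 0 < e -> exists N, forall m n, (N <= m)%N -> (N <= n)%N ->
     nrm (u m - u n : C^o) <= e) ->
  exists l, forall e : R, 0 < e -> exists N, forall n, (N <= n)%N ->
     nrm (u n - l : C^o) <= e.
Proof.
move=> cu.
have [a ha] : exists l, forall e : R, 0 < e -> exists N, forall n, (N <= n)%N ->
   `|complex.Re (u n) - l| <= e.
  apply: complete_seqR => e e0; have [N hN] := cu e e0; exists N => m n Nm Nn.
  by rewrite -raddfB (le_trans (Re_le_nrm _)) ?hN.
have [b hb] : exists l, forall e : R, 0 < e -> exists N, forall n, (N <= n)%N ->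
   `|complex.Im (u n) - l| <= e.
  apply: complete_seqR => e e0; have [N hN] := cu e e0; exists N => m n Nm Nn.
  by rewrite -raddfB (le_trans (Im_le_nrm _)) ?hN.
exists (a +i* b) => e e0; have e2 := divr_gt0 e0 (ltr0Sn R 1).
have [N hN] := ha _ e2; have [N' hN'] := hb _ e2.
exists (maxn N N') => n; rewrite geq_max => /andP[Nn N'n].
rewrite (le_trans (nrm_ReIm _)) // [leRHS](splitr e) lerD //.
  by rewrite raddfB /= hN.
by rewrite raddfB /= hN'.
Qed.

End ComplexComplete.

(** * Bounded operators and adjoints *)

Section Bounded.
Variable R : realType.
Implicit Types H K L : hilbertType R.
Local Notation C := R[i].

Definition opn H K (T : H -> K) (m : R) := forall x, nrm (T x) <= m * nrm x.

Lemma opnW H K (T : H -> K) m m' : m <= m' -> opn T m -> opn T m'.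
Proof. by move=> mm h x; rewrite (le_trans (h x)) // ler_wpM2r ?nrm_ge0. Qed.

Lemma bopP H K (T : H -> K) :
  bounded_op T <-> linear T /\ exists2 m, 0 <= m & opn T m.
Proof.
split=> [[lT cT]|[lT [m m0 hm]]].
- split => //.
  have TZ (c : C) x : T (c *: x) = c *: T x.
    have T0 : T 0 = 0 by have := lT (-1) 0 0; rewrite scaler0 addr0 scaleN1r addNr.
    by have := lT c x 0; rewrite !addr0 T0 addr0.
  have T0 : T 0 = 0 by have := TZ 0 0; rewrite !scale0r.
  have := cT 0; move/(iffLR (cvg_nrm _ T _)) => /(_ 1 ltr01) /nbhs_ballP[e e0 he].
  have ee : e = (complex.Re e)%:C by rewrite RRe_real // gtr0_real.
  move: e0; rewrite /= ee ltcR; set d := complex.Re e => d0.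
  (* The test vector t x used below has norm d / 2, inside the ball on which T is bounded by 1. *)
  exists (2 / d); first by rewrite divr_ge0 ?ltW.
  move=> x; have [->|x0] := eqVneq x 0; first by rewrite T0 !nrm0 mulr0.
  have n0 : 0 < nrm x by rewrite lt_def nrm_ge0 andbT; apply: contra_neq x0 => /nrm_eq0.
  pose t := d / 2 / nrm x.
  have t0 : 0 < t by rewrite !divr_gt0.
  have := he (t%:C *: x); rewrite -ball_normE /ball_ /= sub0r normrN nrmE ee ltcR -/d.
  rewrite nrmZ nrm_real ?(ltW t0) // T0 sub0r nrmN TZ nrmZ nrm_real ?(ltW t0) //.
  rewrite /t divfK ?gt_eqF // ltr_pdivrMr // ltr_pMr // ltr1n => /(_ isT) h.
  rewrite -(ler_pM2l t0) (le_trans h) //.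
  suff -> : t * (2 / d * nrm x) = 1 by [].
  by rewrite /t; field; rewrite !gt_eqF.
- split => // x.
  apply/(cvg_nrm (nbhs_filter x) T (T x)) => e e0.
  have d0 : 0 < e / (m + 1) by rewrite divr_gt0 //; lra.
  have TB y : T x - T y = T (x - y).
    by rewrite [x - y]addrC -[- y]scaleN1r lT scaleN1r addrC.
  have := (iffLR (cvg_nrm (nbhs_filter x) idfun x)) (@cvg_id _ (nbhs x)) _ d0.
  apply: filterS => y /= h.
  rewrite TB (le_trans (hm _)) // (le_trans (ler_wpM2l m0 h)) //.
  by rewrite mulrCA ger_pMr // ler_pdivrMr; lra.
Qed.

Lemma bopL H K (T : H -> K) : bounded_op T ->
  forall (c : C) x y, T (c *: x + y) = c *: T x + T y.
Proof. by case. Qed.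
Lemma bopD H K (T : H -> K) x y : bounded_op T -> T (x + y) = T x + T y.
Proof. by move=> bT; rewrite -[x]scale1r (bopL bT) !scale1r. Qed.
Lemma bop0 H K (T : H -> K) : bounded_op T -> T 0 = 0.
Proof.
by move=> bT; have := bopL bT (-1) 0 0; rewrite scaler0 addr0 scaleN1r addNr.
Qed.
Lemma bopZ H K (T : H -> K) (c : C) x : bounded_op T -> T (c *: x) = c *: T x.
Proof. by move=> bT; have := bopL bT c x 0; rewrite (bop0 bT) !addr0. Qed.
Lemma bopN H K (T : H -> K) x : bounded_op T -> T (- x) = - T x.
Proof. by move=> bT; rewrite -scaleN1r (bopZ _ _ bT) scaleN1r. Qed.
Lemma bopB H K (T : H -> K) x y : bounded_op T -> T (x - y) = T x - T y.
Proof. by move=> bT; rewrite (bopD _ _ bT) (bopN _ bT). Qed.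
Lemma bop_sum H K (T : H -> K) I r (P : pred I) (f : I -> H) : bounded_op T ->
  T (\sum_(i <- r | P i) f i) = \sum_(i <- r | P i) T (f i).
Proof.
by move=> bT; apply: (big_morph T (fun x y => bopD x y bT) (bop0 bT)).
Qed.

Lemma bop_opn H K (T : H -> K) : bounded_op T -> exists2 m, 0 < m & opn T m.
Proof.
case/bopP => _ [m m0 h]; exists (m + 1); first lra.
by apply: opnW h; lra.
Qed.

Lemma bop_mk H K (T : H -> K) m : 0 <= m ->
  (forall (c : C) x y, T (c *: x + y) = c *: T x + T y) -> opn T m -> bounded_op T.
Proof. by move=> m0 lT hT; apply/bopP; split => //; exists m. Qed.

Lemma bop_id H : bounded_op (idfun : H -> H).
Proof. by apply: (@bop_mk _ _ _ 1) => // x; rewrite mul1r. Qed.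

Lemma opn_comp H K L (S : K -> L) (T : H -> K) a b :
  0 <= a -> opn S a -> opn T b -> opn (S \o T) (a * b).
Proof.
by move=> a0 hS hT x; rewrite (le_trans (hS _)) // -mulrA ler_wpM2l.
Qed.

Lemma bop_comp H K L (S : K -> L) (T : H -> K) :
  bounded_op S -> bounded_op T -> bounded_op (S \o T).
Proof.
move=> bS bT; have [a a0 ha] := bop_opn bS; have [b b0 hb] := bop_opn bT.
apply: (@bop_mk _ _ _ (a * b)); first by rewrite mulr_ge0 ?ltW.
  by move=> c x y /=; rewrite (bopL bT) (bopL bS).
exact: opn_comp (ltW a0) ha hb.
Qed.

Lemma opnD H K (S T : H -> K) a b : opn S a -> opn T b -> opn (S + T) (a + b).
Proof.
by move=> hS hT x; rewrite (le_trans (nrmD _ _)) // mulrDl lerD.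
Qed.

Lemma opnZ H K (T : H -> K) (c : C) b :
  opn T b -> opn (c *: T) (nrm (c : C^o) * b).
Proof. by move=> hT x; rewrite nrmZ -mulrA ler_wpM2l ?nrm_ge0. Qed.

Lemma opn_tri H K (U S T : H -> K) a b :
  opn (S - U) a -> opn (U - T) b -> opn (S - T) (a + b).
Proof. by move=> h1 h2; have := opnD h1 h2; rewrite addrA subrK. Qed.

Lemma bop_lin H K (c : C) (S T : H -> K) :
  bounded_op S -> bounded_op T -> bounded_op (c *: S + T).
Proof.
move=> bS bT; have [a a0 ha] := bop_opn bS; have [b b0 hb] := bop_opn bT.
apply: (@bop_mk _ _ _ (nrm (c : C^o) * a + b)).
- by rewrite addr_ge0 ?mulr_ge0 ?nrm_ge0 ?ltW.
- move=> d x y; rewrite !fctE (bopL bS) (bopL bT) !scalerDr addrACA; congr (_ + _).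
  by rewrite scalerA mulrC -scalerA.
- exact: opnD (opnZ _ ha) hb.
Qed.

Lemma op0E H K x : (0 : H -> K) x = 0. Proof. by []. Qed.

Lemma bop_zero H K : bounded_op (0 : H -> K).
Proof.
apply: (@bop_mk _ _ _ 0) => // [c x y|x]; first by rewrite !op0E scaler0 addr0.
by rewrite op0E nrm0 mul0r.
Qed.

Lemma bop_add H K (S T : H -> K) :
  bounded_op S -> bounded_op T -> bounded_op (S + T).
Proof. by move=> bS bT; rewrite -[S]scale1r; apply: bop_lin. Qed.
Lemma bop_scale H K (c : C) (S : H -> K) : bounded_op S -> bounded_op (c *: S).
Proof. by move=> bS; rewrite -[_ *: _]addr0; apply/bop_lin/bop_zero. Qed.
Lemma bop_sub H K (S T : H -> K) :
  bounded_op S -> bounded_op T -> bounded_op (S - T).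
Proof. by move=> bS bT; rewrite addrC -scaleN1r; apply: bop_lin. Qed.

Lemma bop_sumop H K I r (P : pred I) (f : I -> H -> K) :
  (forall i, P i -> bounded_op (f i)) -> bounded_op (\sum_(i <- r | P i) f i).
Proof.
move=> h; elim/big_ind: _ => //; [exact: bop_zero | exact: bop_add].
Qed.

Lemma riesz H (f : H -> C) m :
  (forall (c : C) x y, f (c *: x + y) = c * f x + f y) ->
  (forall x, nrm (f x : C^o) <= m * nrm x) -> exists y, forall x, f x = ipd x y.
Proof.
move=> lf hf; pose Y := [set x | f x = 0].
have f0 : f 0 = 0 by have := lf (-1) 0 0; rewrite scaler0 addr0 mulN1r addNr.
have fZ (c : C) x : f (c *: x) = c * f x by have := lf c x 0; rewrite f0 !addr0.
have fB x y : f (x - y) = f x - f y by rewrite addrC -scaleN1r lf mulN1r addrC.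
have cY : csub Y.
  split=> [//|c x y|x hx]; first by rewrite /Y /= => hx hy; rewrite lf hx hy mulr0 addr0.
  apply: (@le_nrm0 _ C^o) => e e0.
  have m1 : 0 < Num.max m 0 + 1 by rewrite ltr_pwDr // le_max lexx orbT.
  have [y Yy xy] := hx _ (divr_gt0 e0 m1).
  have -> : f x = f (x - y) by rewrite fB Yy subr0.
  rewrite (le_trans (hf _)) // (@le_trans _ _ ((Num.max m 0 + 1) * nrm (x - y))) //.
    rewrite ler_wpM2r ?nrm_ge0 // (@le_trans _ _ (Num.max m 0)) ?le_max ?lexx //.
    by rewrite lerDl.
  by rewrite mulrC -ler_pdivlMr.
have [all0|] := pselect (forall x, f x = 0).
  by exists 0 => x; rewrite ipd0r.
move/existsNP => [x0 /eqP fx0].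
have [y Yy hy] := projection x0 cY.
pose z := x0 - y.
have fz : f z = f x0 by rewrite fB Yy subr0.
have z0 : ipd z z != 0.
  apply: contra_neq fx0 => /ipd_eq0; rewrite -fz => ->; exact: f0.
exists (((f z / ipd z z)^*)%C *: z) => x.
have : ipd (x - (f x / f z) *: z) z = 0.
  rewrite ipdC (hy (x - (f x / f z) *: z)) ?conjc0 //.
  by rewrite /Y /= fB fZ divfK ?subrr ?fz.
rewrite ipdBl ipdZl => /eqP; rewrite subr_eq0 => /eqP xz.
by rewrite ipdZr conjcK xz; field; rewrite z0 fz fx0.
Qed.

(** Riesz representation gives a value at each y and choice assembles them, so the set under [get]
    in [adj] is inhabited. *)
Lemma adjP H K (T : H -> K) : bounded_op T ->
  forall x y, ipd (T x) y = ipd x (adj T y).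
Proof.
move=> bT; rewrite /adj.
have /(_ _)/cid-/all_sig[S hS] y : exists z, forall x, ipd (T x) y = ipd x z.
  have [m m0 hm] := bop_opn bT.
  apply: (@riesz H (fun x => ipd (T x) y) (m * nrm y)) => [c u v|x].
    by rewrite (bopL bT) ipdDl ipdZl.
  by rewrite (le_trans (cauchy_schwarz _ _)) // mulrAC ler_wpM2r ?nrm_ge0.
apply: (@getPex _ [set S0 : K -> H | forall x y, ipd (T x) y = ipd x (S0 y)]).
by exists S => x y; rewrite hS.
Qed.

Lemma adjPr H K (T : H -> K) : bounded_op T ->
  forall x y, ipd y (T x) = ipd (adj T y) x.
Proof. by move=> bT x y; rewrite ipdC adjP // -ipdC. Qed.

Lemma adj_uniq H K (T : H -> K) (S : K -> H) : bounded_op T ->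
  (forall x y, ipd (T x) y = ipd x (S y)) -> adj T = S.
Proof.
move=> bT h; apply/funext => y; apply: ipd_inj => x.
by rewrite ipdC -adjP // h -ipdC.
Qed.

Lemma bop_adj H K (T : H -> K) : bounded_op T -> bounded_op (adj T).
Proof.
move=> bT; have [m m0 hm] := bop_opn bT.
apply: (@bop_mk _ _ _ m); first exact: ltW.
  move=> c x y; apply: ipd_inj => z.
  by rewrite -adjPr // ipdDl ipdZl !adjPr // ipdDl ipdZl.
move=> y; have [h|] := leP (nrm (adj T y)) 0.
  by rewrite (le_trans h) // mulr_ge0 ?nrm_ge0 ?ltW.
move=> n0; rewrite -(ler_pM2l n0) -expr2 nrm_sqr -adjP // mulrCA.
have h : complex.Re (ipd (T (adj T y)) y) <= nrm (ipd (T (adj T y)) y : C^o).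
  by rewrite -lecR -nrmE (le_trans _ (normc_ge_Re _)) // lecR ler_norm.
rewrite (le_trans h) // (le_trans (cauchy_schwarz _ _)) //.
by rewrite mulrA ler_wpM2r ?nrm_ge0.
Qed.

Lemma adjK H K (T : H -> K) : bounded_op T -> adj (adj T) = T.
Proof.
by move=> bT; apply: adj_uniq; [exact: bop_adj | move=> x y; rewrite -adjPr].
Qed.

Lemma opn_adj H K (T : H -> K) m : bounded_op T -> 0 <= m -> opn T m -> opn (adj T) m.
Proof.
move=> bT m0 hm y; have [h|n0] := leP (nrm (adj T y)) 0.
  by rewrite (le_trans h) // mulr_ge0 ?nrm_ge0.
rewrite -(ler_pM2l n0) -expr2 nrm_sqr -adjP // mulrCA.
have h : complex.Re (ipd (T (adj T y)) y) <= nrm (ipd (T (adj T y)) y : C^o).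
  by rewrite -lecR -nrmE (le_trans _ (normc_ge_Re _)) // lecR ler_norm.
rewrite (le_trans h) // (le_trans (cauchy_schwarz _ _)) //.
by rewrite mulrA ler_wpM2r ?nrm_ge0.
Qed.

Lemma adj_comp H K L (S : K -> L) (T : H -> K) :
  bounded_op S -> bounded_op T -> adj (S \o T) = adj T \o adj S.
Proof.
move=> bS bT; apply: adj_uniq; first exact: bop_comp.
by move=> x y /=; rewrite !adjP.
Qed.

Lemma adj_lin H K (c : C) (S T : H -> K) :
  bounded_op S -> bounded_op T -> adj (c *: S + T) = (c^*)%C *: adj S + adj T.
Proof.
move=> bS bT; apply: adj_uniq; first exact: bop_lin.
by move=> x y; rewrite !fctE ipdDl ipdZl !adjP // ipdDr ipdZr conjcK.
Qed.

Lemma adj_id H : adj (idfun : H -> H) = idfun.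
Proof. by apply: adj_uniq; [exact: bop_id|]. Qed.

Lemma adj0 H K : adj (0 : H -> K) = 0.
Proof.
by apply: adj_uniq; [exact: bop_zero | move=> x y; rewrite !op0E ipd0l ipd0r].
Qed.

Lemma bop_ext_dense H K (S T : H -> K) (X : set H) :
  bounded_op S -> bounded_op T -> closure (lspan X) = setT ->
  (forall x, X x -> S x = T x) -> S = T.
Proof.
move=> bS bT dX h; apply/funext => x.
have cY : csub [set x | S x = T x].
  split=> [|c u v|u hu] /=; first by rewrite (bop0 bS) (bop0 bT).
    by move=> hu hv; rewrite (bopL bS) (bopL bT) hu hv.
  apply/eqP; rewrite -subr_eq0; apply/eqP; apply: le_nrm0 => e e0.
  have [m m0 hm] := bop_opn (bop_sub bS bT).
  have [y Yy xy] := hu _ (divr_gt0 e0 m0).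
  have -> : S u - T u = (S - T) (u - y).
    by rewrite (bopB _ _ (bop_sub bS bT)) !fctE Yy subrr subr0.
  by rewrite (le_trans (hm _)) // mulrC -ler_pdivlMr.
have : closure (lspan X) x by rewrite dX.
apply: (closure_min cY); apply: lspan_min => //; case: cY => //.
Qed.

End Bounded.

(** * Norm closures and closed spans of operators *)

Section Closures.
Variable R : realType.
Implicit Types H K L : hilbertType R.
Local Notation C := R[i].

Lemma opnorm_leR H K (T : H -> K) (m : R) : opnorm_le T m%:C <-> opn T m.
Proof.
by split => h x; have := h x; rewrite !nrmE -rmorphM lecR.
Qed.

Lemma norm_closureP H K (X : set (H -> K)) T :
  norm_closure X T <-> (forall e : R, 0 < e -> exists2 S, X S & opn (T - S) e).
Proof.
split=> [h e e0|h e e0].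
  by have [|S XS /opnorm_leR] := h e%:C; [rewrite ltcR | exists S].
have ee : e = (complex.Re e)%:C by rewrite RRe_real // gtr0_real.
move: e0; rewrite ee ltcR => /h[S XS hS]; exists S => //; exact/opnorm_leR.
Qed.

(** Closed subspaces of operators: most inclusions below are checked on generators and extended to a
    [cspan] by [cspan_min]. *)
Definition clin H K (Y : set (H -> K)) : Prop :=
  [/\ Y 0, forall (c : C) S T, Y S -> Y T -> Y (c *: S + T) & norm_closure Y `<=` Y].

Lemma clinZ H K (Y : set (H -> K)) (c : C) S : clin Y -> Y S -> Y (c *: S).
Proof. by case=> h0 h _ YS; rewrite -[_ *: _]addr0; apply: h. Qed.
Lemma clinD H K (Y : set (H -> K)) S T : clin Y -> Y S -> Y T -> Y (S + T).
Proof. by case=> _ h _ YS YT; rewrite -[S]scale1r; apply: h. Qed.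
Lemma clinB H K (Y : set (H -> K)) S T : clin Y -> Y S -> Y T -> Y (S - T).
Proof. by move=> h YS YT; rewrite -scaleN1r; apply: clinD => //; apply: clinZ. Qed.
Lemma clin_sum H K (Y : set (H -> K)) I r (P : pred I) (f : I -> H -> K) :
  clin Y -> (forall i, P i -> Y (f i)) -> Y (\sum_(i <- r | P i) f i).
Proof.
move=> cY h; elim/big_ind: _ => //; first by case: cY.
by move=> *; apply: clinD.
Qed.
Lemma clin_cl H K (Y : set (H -> K)) T : clin Y ->
  (forall e : R, 0 < e -> exists2 S, Y S & opn (T - S) e) -> Y T.
Proof. by case=> _ _ h hT; apply/h/norm_closureP. Qed.

Lemma cspan_clin H K (X : set (H -> K)) : clin (cspan X).
Proof.
split.
- by apply/norm_closureP => e e0; exists 0; [exact: lspan0 | move=> x; rewrite subr0 nrm0 mulr_ge0 ?nrm_ge0 ?ltW].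
- move=> c S T /norm_closureP hS /norm_closureP hT; apply/norm_closureP => e e0.
  have c0 := nrm_ge0 (c : C^o).
  have d0 : 0 < e / 2 / (1 + nrm (c : C^o)) by rewrite !divr_gt0 //; lra.
  have [S' XS' hS'] := hS _ d0; have [T' XT' hT'] := hT _ (divr_gt0 e0 (ltr0Sn _ 1)).
  exists (c *: S' + T'); first exact: lspan_lin.
  rewrite opprD addrACA -scalerBr.
  apply: opnW (opnD (opnZ c hS') hT'); rewrite [leRHS](splitr e) lerD //.
  rewrite mulrCA ger_pMr ?divr_gt0 // ler_pdivrMr; lra.
- move=> T /norm_closureP hT; apply/norm_closureP => e e0.
  have e2 := divr_gt0 e0 (ltr0Sn R 1).
  have [S /norm_closureP hS TS] := hT _ e2; have [U XU SU] := hS _ e2.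
  by exists U => //; rewrite [e](splitr e); apply: opn_tri TS SU.
Qed.

Lemma cspan_sub H K (X : set (H -> K)) : X `<=` cspan X.
Proof.
move=> T XT; apply/norm_closureP => e e0; exists T; first exact: lspan_sub.
by move=> x; rewrite subrr nrm0 mulr_ge0 ?nrm_ge0 ?ltW.
Qed.

Lemma cspan_min H K (X Y : set (H -> K)) : clin Y -> X `<=` Y -> cspan X `<=` Y.
Proof.
move=> cY XY T /norm_closureP hT; apply: (clin_cl cY) => e e0.
have [S XS TS] := hT e e0; exists S => //; move: XS; apply: lspan_min => //; by case: cY.
Qed.

Lemma clin_preim H K H' K' (L : (H -> K) -> (H' -> K')) (m : R) (Y : set (H' -> K')) :
  0 <= m -> (forall (c : C) S T, L (c *: S + T) = c *: L S + L T) ->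
  (forall T e, 0 <= e -> opn T e -> opn (L T) (m * e)) ->
  clin Y -> clin [set T : H -> K | Y (L T)].
Proof.
move=> m0 lL hL cY; have L0 : L 0 = 0.
  by have := lL (-1) 0 0; rewrite scaler0 addr0 scaleN1r addNr.
split=> [|c S T|T /norm_closureP hT] /=; first by rewrite L0; case: cY.
  by rewrite lL; case: cY => _ h _; exact: h.
apply: (clin_cl cY) => e e0.
have d0 : 0 < e / (m + 1) by rewrite divr_gt0 //; lra.
have [S YS TS] := hT _ d0; exists (L S) => //.
have -> : L T - L S = L (T - S).
  by rewrite [T - S]addrC -[- S]scaleN1r lL scaleN1r addrC.
apply: opnW (hL _ _ (ltW d0) TS).
by rewrite mulrCA ger_pMr // ler_pdivrMr; lra.
Qed.

Lemma comp_lin H K H' K' (A : K -> K') (B : H' -> H) (c : C) (S T : H -> K) :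
  bounded_op A -> A \o (c *: S + T) \o B = c *: (A \o S \o B) + (A \o T \o B).
Proof. by move=> bA; apply/funext => x /=; rewrite !fctE (bopL bA). Qed.

Lemma compl_lin H K K' (A : K -> K') (c : C) (S T : H -> K) :
  bounded_op A -> A \o (c *: S + T) = c *: (A \o S) + (A \o T).
Proof. by move=> bA; apply/funext => x /=; rewrite !fctE (bopL bA). Qed.

Lemma clin_comp H K H' K' (A : K -> K') (B : H' -> H) (Y : set (H' -> K')) :
  bounded_op A -> bounded_op B -> clin Y -> clin [set T : H -> K | Y (A \o T \o B)].
Proof.
move=> bA bB; have [a a0 ha] := bop_opn bA; have [b b0 hb] := bop_opn bB.
apply: (@clin_preim _ _ _ _ (fun T => A \o T \o B) (a * b)).
- by rewrite mulr_ge0 ?ltW.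
- by move=> c S T; rewrite comp_lin.
- move=> T e e0 hT; have := opn_comp (ltW a0) ha (opn_comp e0 hT hb).
  by apply: opnW; rewrite -mulrA (mulrC e).
Qed.

(** The ambient space contains all functions, so linearity of a norm limit has to be proved along
    with its boundedness. *)
Lemma clin_bop H K : clin (@bounded_op R H K).
Proof.
split; [exact: bop_zero | by move=> *; apply: bop_lin |].
move=> T /norm_closureP hT; have [S1 bS1 h1] := hT 1 ltr01.
have [m m0 hm] := bop_opn bS1.
apply: (@bop_mk _ _ _ _ (1 + m)); first lra.
  move=> c x y; apply/eqP; rewrite -subr_eq0; apply/eqP/le_nrm0 => e e0.
  pose M := nrm (c *: x + y) + nrm (c : C^o) * nrm x + nrm y + 1.
  have M0 : 0 < M by rewrite ltr_wpDl // !addr_ge0 ?mulr_ge0 ?nrm_ge0.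
  have [S bS hS] := hT _ (divr_gt0 e0 M0).
  have -> : T (c *: x + y) - (c *: T x + T y) =
     (T - S) (c *: x + y) - (c *: (T - S) x + (T - S) y).
    by rewrite !fctE (bopL bS) scalerBr [X in _ = _ - X]addrACA -opprD opprB addrA subrK.
  rewrite (le_trans (nrmD _ _)) // nrmN.
  have := hS (c *: x + y); have := hS x; have := hS y => h2 h3 h4.
  have h5 : nrm (c *: (T - S) x + (T - S) y) <=
     nrm (c : C^o) * (e / M * nrm x) + e / M * nrm y.
    by rewrite (le_trans (nrmD _ _)) // lerD // nrmZ ler_wpM2l ?nrm_ge0.
  rewrite (le_trans (lerD h4 h5)) //.
  have -> : e / M * nrm (c *: x + y) + (nrm (c : C^o) * (e / M * nrm x) +
     e / M * nrm y) = e / M * (M - 1) by rewrite /M; ring.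
  rewrite mulrAC ler_pdivrMr // ler_pM2l //; lra.
have -> : T = (T - S1) + S1 by rewrite subrK.
exact: opnD.
Qed.

Lemma clin0 H K : clin [set 0 : H -> K].
Proof.
split=> [//|c S T /= -> ->|T /norm_closureP hT /=]; first by rewrite scaler0 addr0.
apply/funext => x; apply: le_nrm0 => e e0.
have n0 : 0 < nrm x + 1 by rewrite ltr_wpDl ?nrm_ge0.
have [S /= -> h] := hT _ (divr_gt0 e0 n0).
have := h x; rewrite subr0 => /le_trans; apply.
by rewrite mulrAC ler_pdivrMr // ler_pM2l //; lra.
Qed.

Lemma clin_equal H K H' K' (A A' : K -> K') (B B' : H' -> H) :
  bounded_op A -> bounded_op B -> bounded_op A' -> bounded_op B' ->
  clin [set T : H -> K | A \o T \o B = A' \o T \o B'].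
Proof.
move=> bA bB bA' bB'.
have [a a0 ha] := bop_opn bA; have [b b0 hb] := bop_opn bB.
have [a' a'0 ha'] := bop_opn bA'; have [b' b'0 hb'] := bop_opn bB'.
have -> : [set T : H -> K | A \o T \o B = A' \o T \o B'] =
  [set T : H -> K | [set 0 : H' -> K'] ((A \o T \o B) - (A' \o T \o B'))].
  apply/seteqP; split=> T /= => [->|/eqP]; first by rewrite subrr.
  by rewrite subr_eq0 => /eqP.
apply: (@clin_preim _ _ _ _ (fun T => (A \o T \o B) - (A' \o T \o B')) (a * b + a' * b')).
- by rewrite addr_ge0 ?mulr_ge0 ?ltW.
- by move=> c S T; rewrite !comp_lin // scalerBr opprD addrACA.
- move=> T e e0 hT; rewrite -scaleN1r mulrDl addrC.
  have h1 := opn_comp (ltW a0) ha (opn_comp e0 hT hb).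
  have h2 := opn_comp (ltW a'0) ha' (opn_comp e0 hT hb').
  have -> : a * b * e + a' * b' * e = nrm (-1 : C^o) * (a' * (e * b')) + a * (e * b).
    by rewrite nrmN (_ : nrm (1 : C^o) = 1) ?mul1r; [ring | exact: (nrm_real ler01)].
  exact: opnD (opnZ _ h2) h1.
- exact: clin0.
Qed.

Lemma bop_cspan H K (X : set (H -> K)) : X `<=` @bounded_op R H K ->
  cspan X `<=` @bounded_op R H K.
Proof. by move=> h; apply: cspan_min => //; exact: clin_bop. Qed.

Lemma cstar_clin H (A : set (H -> H)) : cstar_algebra A -> clin A.
Proof. by case=> [[]] *; split. Qed.

End Closures.

(** * Orthogonal projections, extension from dense subspaces, orthonormalisation *)

Section Projections.
Variable R : realType.
Implicit Types H K L : hilbertType R.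
Local Notation C := R[i].

(* The orthogonal projection; a junk value unless Y is a closed subspace. *)
Definition prj H (Y : set H) (x : H) : H :=
  get [set y | Y y /\ forall z, Y z -> ipd (x - y) z = 0].

Lemma prjP H (Y : set H) x : csub Y ->
  Y (prj Y x) /\ forall z, Y z -> ipd (x - prj Y x) z = 0.
Proof.
move=> cY; have [y Yy hy] := projection x cY.
apply: (@getPex _ [set y | Y y /\ forall z, Y z -> ipd (x - y) z = 0]).
by exists y; split.
Qed.

Lemma prj_in H (Y : set H) x : csub Y -> Y (prj Y x).
Proof. by move=> /(prjP x)[]. Qed.

Lemma prj_orth H (Y : set H) x z : csub Y -> Y z -> ipd (x - prj Y x) z = 0.
Proof. by move=> /(prjP x)[] _; apply. Qed.

Lemma prj_eq H (Y : set H) x y : csub Y -> Y y ->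
  (forall z, Y z -> ipd (x - y) z = 0) -> prj Y x = y.
Proof.
move=> cY Yy h; apply/eqP; rewrite -subr_eq0; apply/eqP/ipd_eq0.
have Yd : Y (prj Y x - y) by apply: csubB => //; exact: prj_in.
rewrite {1}(_ : prj Y x - y = (x - y) - (x - prj Y x)); last first.
  by rewrite opprB [RHS]addrC addrA subrK.
by rewrite ipdBl h // prj_orth // subrr.
Qed.

Lemma prj_id H (Y : set H) x : csub Y -> Y x -> prj Y x = x.
Proof. by move=> cY Yx; apply: prj_eq => // z _; rewrite subrr ipd0l. Qed.

Lemma nrm_prj H (Y : set H) x : csub Y ->
  nrm x ^+ 2 = nrm (prj Y x) ^+ 2 + nrm (x - prj Y x) ^+ 2.
Proof.
move=> cY; rewrite -pythagoras; first by rewrite addrC subrK.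
by rewrite ipdC prj_orth ?conjc0 //; exact: prj_in.
Qed.

Lemma opn_prj H (Y : set H) : csub Y -> opn (prj Y) 1.
Proof.
move=> cY x; rewrite mul1r -(@ler_pXn2r _ 2) // ?nnegrE ?nrm_ge0 //.
by rewrite (nrm_prj x cY) lerDl sqr_ge0.
Qed.

Lemma bop_prj H (Y : set H) : csub Y -> bounded_op (prj Y).
Proof.
move=> cY; apply: (@bop_mk _ _ _ _ 1) => //; last exact: opn_prj.
move=> c x y; apply: prj_eq => //.
  by case: (cY) => _ h _; apply: h; exact: prj_in.
move=> z Yz; rewrite opprD addrACA -scalerBr ipdDl ipdZl !prj_orth //.
by rewrite mulr0 addr0.
Qed.

Lemma ipd_prj H (Y : set H) x y : csub Y -> ipd (prj Y x) y = ipd x (prj Y y).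
Proof.
move=> cY.
have h1 : ipd (prj Y x) y = ipd (prj Y x) (prj Y y).
  apply/eqP; rewrite -subr_eq0 -ipdBr ipdC prj_orth ?conjc0 //; exact: prj_in.
rewrite h1; apply/esym/eqP; rewrite -subr_eq0 -ipdBl prj_orth //; exact: prj_in.
Qed.

Lemma adj_prj H (Y : set H) : csub Y -> adj (prj Y) = prj Y.
Proof.
by move=> cY; apply: adj_uniq; [exact: bop_prj | move=> x y; rewrite ipd_prj].
Qed.

Lemma prj_comm H (Y : set H) (T : H -> H) : csub Y -> bounded_op T ->
  (forall y, Y y -> Y (T y)) -> (forall y, Y y -> Y (adj T y)) ->
  forall x, prj Y (T x) = T (prj Y x).
Proof.
move=> cY bT h1 h2 x; apply: prj_eq => //; first by apply: h1; exact: prj_in.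
by move=> z Yz; rewrite -(bopB _ _ bT) adjP // prj_orth //; apply: h2.
Qed.

Lemma prj_dense H (Y : set H) : csub Y ->
  (forall x, (forall y, Y y -> ipd x y = 0) -> x = 0) -> forall x, Y x.
Proof.
move=> cY h x; have /eqP := h (x - prj Y x) (fun y Yy => prj_orth _ cY Yy).
by rewrite subr_eq0 => /eqP ->; exact: prj_in.
Qed.

Lemma csub_orth H (X : set H) : csub [set z | forall w, X w -> ipd z w = 0].
Proof.
split=> [w _|c x y hx hy w Xw|x hx w Xw]; first by rewrite ipd0l.
  by rewrite ipdDl ipdZl hx // hy // mulr0 addr0.
apply: (@le_nrm0 _ C^o) => e e0.
have w0 : 0 < nrm w + 1 by rewrite ltr_wpDl ?nrm_ge0.
have [t ht st] := hx _ (divr_gt0 e0 w0).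
have -> : ipd x w = ipd (x - t) w by rewrite ipdBl ht // subr0.
rewrite (le_trans (cauchy_schwarz _ _)) //.
apply: (@le_trans _ _ (e / (nrm w + 1) * (nrm w + 1))); last by rewrite divfK ?gt_eqF.
by rewrite ler_pM ?nrm_ge0 // lerDl.
Qed.

Lemma dense_eq0 H (X : set H) w : closure (lspan X) = setT ->
  (forall x, X x -> ipd x w = 0) -> w = 0.
Proof.
move=> dX h; apply: ipd_eq0.
have cY := @csub_orth H [set w].
have : closure (lspan X) w by rewrite dX.
move/(closure_min cY) => -> //; apply: lspan_min; [|by case: cY|by case: cY].
by move=> x Xx _ ->; apply: h.
Qed.

(** A densely defined operator is given by its graph. The norm estimate on a linear graph already
    forces it to be single valued, so linear dependences among generators never have to be
    examined. *)
Lemma extend_graph H K (Gr : set (H * K)) (M : R) : 0 <= M ->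
  Gr (0, 0) -> (forall (c : C) p q, Gr p -> Gr q -> Gr (c *: p + q)) ->
  (forall p, Gr p -> nrm p.2 <= M * nrm p.1) ->
  (forall x e, 0 < e -> exists2 p, Gr p & nrm (x - p.1) <= e) ->
  exists V : H -> K, [/\ bounded_op V, opn V M & forall p, Gr p -> V p.1 = p.2].
Proof.
move=> M0 G0 GL GM dG.
pose P v d y := exists2 x, Gr (x, y) & nrm (v - x) <= d.
have GB p q : Gr p -> Gr q -> nrm (p.2 - q.2) <= M * nrm (p.1 - q.1).
  move=> Gp Gq; have := GM _ (GL (-1) q p Gq Gp).
  by rewrite /= !scaleN1r ![- _ + _]addrC.
have M1 : 0 < 2 * (M + 1) by lra.
have /(_ _)/cid-/all_sig[V hV] v : exists l, forall e, 0 < e -> exists2 d, 0 < d &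
    forall d' x, 0 < d' <= d -> P v d' x -> nrm (x - l) <= e.
  apply: complete_nrm => e e0.
    by have [[x y] Gp hp] := dG v e e0; exists y, x.
  pose d := e / (2 * (M + 1)).
  have dE : d * (2 * (M + 1)) = e by rewrite divfK ?gt_eqF.
  have d0 : 0 < d by rewrite divr_gt0.
  exists d => // d1 d2 y1 y2 /andP[_ h1] /andP[_ h2] [x1 G1 k1] [x2 G2 k2].
  rewrite (le_trans (GB _ _ G1 G2)) //=.
  have h3 : nrm (x1 - x2) <= 2 * d.
    by rewrite (le_trans (nrmB _ _ v)) // (nrmBC x1); lra.
  by rewrite (le_trans (ler_wpM2l M0 h3)) // -dE; lra.
(* This single estimate yields the bound on V, its values on the graph and its linearity. *)
have key v p : Gr p -> nrm (V v - p.2) <= M * nrm (v - p.1).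
  move=> Gp; apply/ler_addgt0Pr => e e0.
  have e2 := divr_gt0 e0 (ltr0Sn R 1).
  have [d d0 hd] := hV v _ e2.
  pose d' := Num.min d (e / 2 / (M + 1)).
  have d'0 : 0 < d' by rewrite lt_min d0 !divr_gt0 //; lra.
  have [[x y] Gq hq] := dG v _ d'0.
  have h1 : nrm (y - V v) <= e / 2.
    by apply: (hd d'); [rewrite d'0 ge_min lexx | exists x].
  have h2 : d' * (M + 1) <= e / 2 by rewrite -ler_pdivlMr ?ge_min ?lexx ?orbT //; lra.
  have h3 := GB _ _ Gq Gp; rewrite /= in hq h3.
  have h4 : nrm (x - p.1) <= nrm (v - p.1) + nrm (v - x).
    by rewrite (nrmBC v x) [leRHS]addrC; exact: nrmB.
  have h5 : nrm (V v - p.2) <= nrm (V v - y) + nrm (y - p.2) by exact: nrmB.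
  rewrite (nrmBC (V v) y) in h5.
  have h6 : M * nrm (x - p.1) <= M * (nrm (v - p.1) + d').
    by rewrite ler_wpM2l // (le_trans h4) // lerD2l.
  move: h6; rewrite mulrDr => h6; lra.
have VM : opn V M by move=> v; have := key v _ G0; rewrite !subr0.
have VE p : Gr p -> V p.1 = p.2.
  move=> Gp; apply/eqP; rewrite -subr_eq0; apply/eqP/nrm_eq0/eqP.
  by rewrite eq_le nrm_ge0 andbT; have := key p.1 p Gp; rewrite subrr nrm0 mulr0.
exists V; split => //; apply: (bop_mk M0) => // c x y.
apply/eqP; rewrite -subr_eq0; apply/eqP/le_nrm0 => e e0.
have c0 := nrm_ge0 (c : C^o).
pose d := e / (2 * (nrm (c : C^o) + 1) * (M + 1)).
have D0 : 0 < 2 * (nrm (c : C^o) + 1) * (M + 1) by rewrite !mulr_gt0 //; lra.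
have d0 : 0 < d by rewrite divr_gt0.
have [p Gp hp] := dG x d d0; have [q Gq hq] := dG y d d0.
have k1 := key x _ Gp; have k2 := key y _ Gq.
have k3 := key (c *: x + y) _ (GL c p q Gp Gq).
rewrite (le_trans (nrmB _ _ (c *: p + q).2)) //.
have l3 : nrm (c *: x + y - (c *: p + q).1) <= (nrm (c : C^o) + 1) * d.
  rewrite /= opprD addrACA -scalerBr (le_trans (nrmD _ _)) // nrmZ mulrDl mul1r.
  by rewrite lerD // ler_wpM2l.
have l4 : nrm ((c *: p + q).2 - (c *: V x + V y)) <= (nrm (c : C^o) + 1) * (M * d).
  rewrite /= opprD addrACA -scalerBr (le_trans (nrmD _ _)) // nrmZ mulrDl mul1r.
  apply: lerD; last by rewrite nrmBC; exact: le_trans k2 (ler_wpM2l M0 hq).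
  by apply: ler_wpM2l => //; rewrite nrmBC; exact: le_trans k1 (ler_wpM2l M0 hp).
rewrite (le_trans (lerD k3 l4)) //.
apply: (@le_trans _ _ (M * ((nrm (c : C^o) + 1) * d) + (nrm (c : C^o) + 1) * (M * d))).
  by rewrite lerD2r ler_wpM2l.
have -> : e = (2 * (nrm (c : C^o) + 1) * (M + 1)) * d by rewrite mulrC divfK ?gt_eqF.
have : 0 <= (nrm (c : C^o) + 1) * d by rewrite mulr_ge0 ?(ltW d0) //; lra.
set s := (nrm (c : C^o) + 1); lra.
Qed.

Lemma ext_op (I : Type) H K (u : I -> H) (v : I -> K) (M : R) : 0 <= M ->
  (forall n (c : 'I_n -> C) (i : 'I_n -> I),
     nrm (\sum_k c k *: v (i k)) <= M * nrm (\sum_k c k *: u (i k))) ->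
  closure (lspan (range u)) = setT ->
  exists V : H -> K, [/\ bounded_op V, opn V M & forall i, V (u i) = v i].
Proof.
move=> M0 hM du.
pose Gr : set (H * K) := lspan (range (fun i => (u i, v i))).
have sumE n (c : 'I_n -> C) (x : 'I_n -> H * K) :
   \sum_k c k *: x k = (\sum_k c k *: (x k).1, \sum_k c k *: (x k).2).
  rewrite [LHS]surjective_pairing; congr (_, _).
    exact: (big_morph fst (fun _ _ => erefl) erefl).
  exact: (big_morph snd (fun _ _ => erefl) erefl).
have [|||x e e0|V [bV VM VE]] := @extend_graph H K Gr M M0.
- exact: lspan0.
- exact: lspan_lin.
- move=> _ [n [c [x [hx ->]]]]; rewrite sumE /=.
  have /(_ _)/cid2-/all_sig2[i _ hi] k : exists2 i, True & (u i, v i) = x k.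
    by have [i _ <-] := hx k; exists i.
  have e1 : \sum_k c k *: (x k).1 = \sum_k c k *: u (i k).
    by apply: eq_bigr => k _; rewrite -hi.
  have e2 : \sum_k c k *: (x k).2 = \sum_k c k *: v (i k).
    by apply: eq_bigr => k _; rewrite -hi.
  by rewrite e1 e2.
- have : closure (lspan (range u)) x by rewrite du.
  move/closure_nrm/(_ e e0) => [_ [n [c [w [hw ->]]]] xy].
  have /(_ _)/cid2-/all_sig2[i _ hi] k : exists2 i, True & u i = w k.
    by have [i _ <-] := hw k; exists i.
  exists (\sum_k c k *: (u (i k), v (i k))).
    by exists n, c, (fun k => (u (i k), v (i k))); split => // k; exists (i k).
  rewrite sumE /=; move: xy; congr (nrm (_ - _) <= _).
  by apply: eq_bigr => k _; rewrite hi.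
by exists V; split => // i; apply: (VE (u i, v i)); apply: lspan_sub; exists i.
Qed.

Lemma ext_isometry (I : Type) H K (u : I -> H) (v : I -> K) :
  (forall i j, ipd (v i) (v j) = ipd (u i) (u j)) ->
  closure (lspan (range u)) = setT ->
  exists V : H -> K, [/\ bounded_op V, forall x y, ipd (V x) (V y) = ipd x y
     & forall i, V (u i) = v i].
Proof.
move=> huv du.
have [n c i|V [bV _ VE]] := @ext_op _ _ _ u v 1 ler01 _ du.
  rewrite mul1r -(@ler_pXn2r _ 2) // ?nnegrE ?nrm_ge0 // !nrm_sqr.
  rewrite !ipd_suml le_eqVlt; apply/orP; left; apply/eqP; congr (complex.Re _).
  apply: eq_bigr => k _; rewrite !ipd_sumr; apply: eq_bigr => l _.
  by rewrite !ipdZl !ipdZr huv.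
exists V; split => // x y; rewrite adjP //.
have -> : adj V (V y) = (adj V \o V) y by [].
suff -> : adj V \o V = idfun by [].
apply: (bop_ext_dense (bop_comp (bop_adj bV) bV) (bop_id H) du) => _ [j _ <-] /=.
rewrite VE.
apply/eqP; rewrite -subr_eq0; apply/eqP/(dense_eq0 du) => _ [i _ <-].
by rewrite ipdBr -adjP // VE huv subrr.
Qed.

Definition onf H n (e : 'I_n -> H) := forall i j, ipd (e i) (e j) = (i == j)%:R.

Lemma gram_schmidt H n (y : 'I_n -> H) : exists m (e : 'I_m -> H),
  [/\ onf e, forall j, lspan (range y) (e j) &
      forall k, y k = \sum_j ipd (y k) (e j) *: e j].
Proof.
elim: n y => [|n IHn] y.
  by exists 0%N, (fun=> 0); split => -[].
have [m [e [oe eY yE]]] := IHn (fun k => y (widen_ord (leqnSn n) k)).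
have sub : lspan (range (fun k => y (widen_ord (leqnSn n) k))) `<=` lspan (range y).
  apply: lspan_min; [|exact: lspan0|exact: lspan_lin].
  by move=> _ [k _ <-]; apply: lspan_sub; exists (widen_ord (leqnSn n) k).
pose z := y ord_max - \sum_j ipd (y ord_max) (e j) *: e j.
have ze j : ipd z (e j) = 0.
  rewrite /z ipdBl ipd_suml (bigD1 j) //= ipdZl oe eqxx mulr1.
  rewrite big1 ?addr0 ?subrr // => i ij.
  by rewrite ipdZl oe (negbTE ij) mulr0.
have zY : lspan (range y) z.
  rewrite /z addrC -scaleN1r; apply: lspan_lin; last by apply: lspan_sub; exists ord_max.
  elim/big_ind: _ => [|u v hu hv|j _]; first exact: lspan0.
    by rewrite -[u]scale1r; apply: lspan_lin.
  by rewrite -[_ *: _]addr0; apply: lspan_lin; [exact/sub/eY | exact: lspan0].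
have kP (k : 'I_n.+1) : {k' : 'I_n | k = widen_ord (leqnSn n) k'} + {k = ord_max}.
  have [k' ->|->] := unliftP ord_max k; [left; exists k' | by right].
  by apply: val_inj; rewrite /= /bump leqNgt ltn_ord.
have [z0|z0] := eqVneq z 0.
  exists m, e; split => // [j|k]; first exact/sub/eY.
  have [[k' ->]|->] := kP k; first exact: yE.
  by apply/eqP; rewrite -subr_eq0; apply/eqP.
have n0 : nrm z != 0 by apply: contra_neq z0 => /nrm_eq0.
pose f := (nrm z)^-1%:C *: z.
have ff : ipd f f = 1.
  rewrite /f ipdZl ipdZr conjc_real ipdxx -!rmorphM /= -(rmorph1 (real_complex R)).
  by congr _%:C; field.
have fe j : ipd f (e j) = 0 by rewrite /f ipdZl ze mulr0.
pose e' (j : 'I_m.+1) := if unlift ord_max j is Some j' then e j' else f.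
have e'w j : e' (widen_ord (leqnSn m) j) = e j.
  rewrite /e'; have -> : widen_ord (leqnSn m) j = lift ord_max j.
    by apply: val_inj; rewrite /= /bump leqNgt ltn_ord.
  by rewrite liftK.
have e'm : e' ord_max = f by rewrite /e' unlift_none.
exists m.+1, e'; split.
- move=> i j; rewrite /e'.
  have [i' ->|->] := unliftP ord_max i; have [j' ->|->] := unliftP ord_max j.
  + by rewrite oe (inj_eq lift_inj).
  + by rewrite ipdC fe conjc0 eq_sym (negbTE (neq_lift _ _)).
  + by rewrite fe (negbTE (neq_lift _ _)).
  + by rewrite ff eqxx.
- move=> j; rewrite /e'; case: (unliftP ord_max j) => [j' _|_]; first exact/sub/eY.
  by rewrite /f -[_ *: _]addr0; apply: lspan_lin => //; exact: lspan0.
- move=> k; rewrite big_ord_recr /= e'm.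
  under eq_bigr do rewrite e'w.
  have [[k' ->]|->] := kP k.
    rewrite -yE; suff -> : ipd (y (widen_ord (leqnSn n) k')) f = 0.
      by rewrite scale0r addr0.
    rewrite (yE k') ipd_suml big1 // => j _.
    by rewrite ipdZl (ipdC (e j)) fe conjc0 mulr0.
  have yz : ipd (y ord_max) f *: f = z.
    have -> : ipd (y ord_max) f = ipd z f.
      rewrite /z ipdBl ipd_suml big1 ?subr0 // => j _.
      by rewrite ipdZl (ipdC (e j)) fe conjc0 mulr0.
    rewrite /f ipdZr conjc_real scalerA ipdxx -!rmorphM /=.
    by rewrite (_ : _ * _ = 1) ?scale1r //; field.
  by rewrite yz addrC subrK.
Qed.

End Projections.

(** * Tensor products *)

Section Tensor.
Variable R : realType.
Variable tens : forall H K : hilbertType R, hilbertTensor H K.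
Implicit Types H K L : hilbertType R.
Local Notation C := R[i].
Local Notation "H ⊗ K" := (tensor_space (tens H K))
  (at level 40, left associativity).
Local Notation "x ⊙ y" := (elt (tens _ _) x y)
  (at level 40, left associativity).

Lemma eltDl H K (x x' : H) (y : K) : (x + x') ⊙ y = x ⊙ y + x' ⊙ y.
Proof. exact: linearDl. Qed.
Lemma eltDr H K (x : H) (y y' : K) : x ⊙ (y + y') = x ⊙ y + x ⊙ y'.
Proof. exact: linearDr. Qed.
Lemma eltZl H K (c : C) (x : H) (y : K) : (c *: x) ⊙ y = c *: (x ⊙ y).
Proof. exact: linearZl_LR. Qed.
Lemma eltZr H K (c : C) (x : H) (y : K) : x ⊙ (c *: y) = c *: (x ⊙ y).
Proof. exact: linearZr_LR. Qed.
Lemma elt0l H K (y : K) : (0 : H) ⊙ y = 0.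
Proof. exact: linear0l. Qed.
Lemma elt_suml H K I r (P : pred I) (f : I -> H) (y : K) :
  (\sum_(i <- r | P i) f i) ⊙ y = \sum_(i <- r | P i) (f i ⊙ y).
Proof. exact: (big_morph (fun x => x ⊙ y) (fun a b => eltDl a b y) (elt0l H y)). Qed.

Lemma nrm_elt H K (x : H) (y : K) : nrm (x ⊙ y) = nrm x * nrm y.
Proof.
apply/eqP; rewrite -(@eqrXn2 _ 2) ?mulr_ge0 ?nrm_ge0 //; apply/eqP/complexI.
by rewrite -[LHS]ipdxx elt_dot !ipdxx -rmorphM exprMn.
Qed.

Lemma tens_total H K :
  closure (lspan (range (fun p : H * K => p.1 ⊙ p.2))) = setT.
Proof.
rewrite -(elt_total (tens H K)); congr (closure (lspan _)).
by apply/seteqP; split=> [_ [[x y] _ <-]|_ [x [y ->]]]; [exists x, y | exists (x, y)].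
Qed.

Lemma tens_ext H K L (S T : H ⊗ K -> L) : bounded_op S -> bounded_op T ->
  (forall x y, S (x ⊙ y) = T (x ⊙ y)) -> S = T.
Proof.
move=> bS bT h; apply: (bop_ext_dense bS bT (tens_total H K)) => _ [[x y] _ <-].
exact: h.
Qed.

Lemma tens_eq0 H K (w : H ⊗ K) : (forall x y, ipd (x ⊙ y) w = 0) -> w = 0.
Proof. by move=> h; apply: (dense_eq0 (tens_total H K)) => _ [[x y] _ <-]; exact: h. Qed.

(** Expanding the second legs in an orthonormal family turns both norms into sums of squares, on
    which S acts term by term. Hence S (x) 1 is bounded by any bound of S. *)
Lemma tens_bound n H K H' (S : H -> H') m (c : 'I_n -> C) (x : 'I_n -> H)
    (y : 'I_n -> K) : bounded_op S -> 0 <= m -> opn S m ->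
  nrm (\sum_k c k *: (S (x k) ⊙ y k)) <= m * nrm (\sum_k c k *: (x k ⊙ y k)).
Proof.
move=> bS m0 hm; have [p [e [oe _ ye]]] := gram_schmidt y.
pose x' j := \sum_k (c k * ipd (y k) (e j)) *: x k.
have E H1 (T : H -> H1) : bounded_op T ->
    \sum_k c k *: (T (x k) ⊙ y k) = \sum_j T (x' j) ⊙ e j.
  move=> bT; under eq_bigr => k _ do rewrite {1}(ye k).
  under [RHS]eq_bigr => j _ do rewrite (bop_sum _ _ _ bT) elt_suml.
  rewrite exchange_big /=; apply: eq_bigr => k _.
  rewrite (big_morph (fun z => T (x k) ⊙ z) (fun a b => eltDr (T (x k)) a b)
    (linear0r _ (T (x k)))) scaler_sumr; apply: eq_bigr => j _.
  by rewrite eltZr (bopZ _ _ bT) eltZl scalerA.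
have N H1 (z : 'I_p -> H1) : nrm (\sum_j z j ⊙ e j) ^+ 2 = \sum_j nrm (z j) ^+ 2.
  rewrite nrm_sqr ipd_suml raddf_sum; apply: eq_bigr => j _.
  rewrite ipd_sumr (bigD1 j) //= elt_dot oe eqxx mulr1 big1 ?addr0 -?nrm_sqr //.
  by move=> i ij; rewrite elt_dot oe eq_sym (negbTE ij) mulr0.
rewrite (E _ S bS) (E _ idfun (bop_id H)).
rewrite -(@ler_pXn2r _ 2) // ?nnegrE ?mulr_ge0 ?nrm_ge0 //.
rewrite exprMn !N mulr_sumr ler_sum // => j _.
by rewrite -exprMn ler_pXn2r // ?nnegrE ?mulr_ge0 ?nrm_ge0.
Qed.

Lemma tens_bound_r n H K K' (S : K -> K') m (c : 'I_n -> C) (x : 'I_n -> H)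
    (y : 'I_n -> K) : bounded_op S -> 0 <= m -> opn S m ->
  nrm (\sum_k c k *: (x k ⊙ S (y k))) <= m * nrm (\sum_k c k *: (x k ⊙ y k)).
Proof.
move=> bS m0 hm; have [p [e [oe _ ye]]] := gram_schmidt x.
pose y' j := \sum_k (c k * ipd (x k) (e j)) *: y k.
have E K1 (T : K -> K1) : bounded_op T ->
    \sum_k c k *: (x k ⊙ T (y k)) = \sum_j e j ⊙ T (y' j).
  move=> bT; under eq_bigr => k _ do rewrite {1}(ye k).
  under [RHS]eq_bigr => j _ do rewrite (bop_sum _ _ _ bT)
    (big_morph (fun z => e j ⊙ z) (fun a b => eltDr (e j) a b) (linear0r _ (e j))).
  rewrite exchange_big /=; apply: eq_bigr => k _.
  rewrite elt_suml scaler_sumr; apply: eq_bigr => j _.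
  by rewrite eltZl (bopZ _ _ bT) eltZr scalerA.
have N K1 (z : 'I_p -> K1) : nrm (\sum_j e j ⊙ z j) ^+ 2 = \sum_j nrm (z j) ^+ 2.
  rewrite nrm_sqr ipd_suml raddf_sum; apply: eq_bigr => j _.
  rewrite ipd_sumr (bigD1 j) //= elt_dot oe eqxx mul1r big1 ?addr0 -?nrm_sqr //.
  by move=> i ij; rewrite elt_dot oe eq_sym (negbTE ij) mul0r.
rewrite (E _ S bS) (E _ idfun (bop_id K)).
rewrite -(@ler_pXn2r _ 2) // ?nnegrE ?mulr_ge0 ?nrm_ge0 //.
rewrite exprMn !N mulr_sumr ler_sum // => j _.
by rewrite -exprMn ler_pXn2r // ?nnegrE ?mulr_ge0 ?nrm_ge0.
Qed.

(** [optens] for operators between different spaces; on endomorphisms the two are convertible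
    ([optensE]). *)
Definition tmap H K H' K' (S : H -> H') (T : K -> K') : H ⊗ K -> H' ⊗ K' :=
  get [set U | bounded_op U /\ forall x y, U (x ⊙ y) = S x ⊙ T y].

Lemma tmap_exists H K H' K' (S : H -> H') (T : K -> K') a b :
  bounded_op S -> bounded_op T -> 0 <= a -> 0 <= b -> opn S a -> opn T b ->
  exists U : H ⊗ K -> H' ⊗ K', [/\ bounded_op U, opn U (a * b) &
    forall x y, U (x ⊙ y) = S x ⊙ T y].
Proof.
move=> bS bT a0 b0 ha hb.
have [n c i|U [bU hU UE]] := @ext_op R (H * K)%type (H ⊗ K) (H' ⊗ K')
   (fun p => p.1 ⊙ p.2) (fun p => S p.1 ⊙ T p.2) (a * b) (mulr_ge0 a0 b0) _
   (tens_total H K); last by exists U; split => // x y; rewrite (UE (x, y)).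
rewrite -mulrA (le_trans (tens_bound c (fun k => (i k).1) (fun k => T (i k).2) bS a0 ha)) //.
by rewrite ler_wpM2l // tens_bound_r.
Qed.

Lemma tmapP H K H' K' (S : H -> H') (T : K -> K') :
  bounded_op S -> bounded_op T ->
  bounded_op (tmap S T) /\ forall x y, tmap S T (x ⊙ y) = S x ⊙ T y.
Proof.
move=> bS bT; have [a a0 ha] := bop_opn bS; have [b b0 hb] := bop_opn bT.
have [U [bU _ UE]] := tmap_exists bS bT (ltW a0) (ltW b0) ha hb.
by apply: (@getPex _ [set U | bounded_op U /\ forall x y, U (x ⊙ y) = S x ⊙ T y]); exists U.
Qed.

Lemma bop_tmap H K H' K' (S : H -> H') (T : K -> K') :
  bounded_op S -> bounded_op T -> bounded_op (tmap S T).
Proof. by move=> bS bT; case: (tmapP bS bT). Qed.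

Lemma tmapE H K H' K' (S : H -> H') (T : K -> K') x y :
  bounded_op S -> bounded_op T -> tmap S T (x ⊙ y) = S x ⊙ T y.
Proof. by move=> bS bT; case: (tmapP bS bT). Qed.

Lemma optensE H K (S : H -> H) (T : K -> K) : @optens R tens H K S T = tmap S T.
Proof. by []. Qed.

Lemma tmap_uniq H K H' K' (S : H -> H') (T : K -> K') U :
  bounded_op S -> bounded_op T -> bounded_op U ->
  (forall x y, U (x ⊙ y) = S x ⊙ T y) -> tmap S T = U.
Proof.
move=> bS bT bU h; apply: tens_ext => //; first exact: bop_tmap.
by move=> x y; rewrite tmapE // h.
Qed.

Lemma opn_tmap H K H' K' (S : H -> H') (T : K -> K') a b :
  bounded_op S -> bounded_op T -> 0 <= a -> 0 <= b -> opn S a -> opn T b ->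
  opn (tmap S T) (a * b).
Proof.
move=> bS bT a0 b0 ha hb; have [U [bU hU UE]] := tmap_exists bS bT a0 b0 ha hb.
by rewrite (tmap_uniq bS bT bU UE).
Qed.

Lemma tmap_comp H K H' K' H'' K'' (S : H -> H') (T : K -> K')
    (S' : H' -> H'') (T' : K' -> K'') :
  bounded_op S -> bounded_op T -> bounded_op S' -> bounded_op T' ->
  tmap S' T' \o tmap S T = tmap (S' \o S) (T' \o T).
Proof.
move=> bS bT bS' bT'; apply/esym/tmap_uniq; try exact: bop_comp.
  by apply: bop_comp; apply: bop_tmap.
by move=> x y /=; rewrite !tmapE.
Qed.

Lemma tmap_id H K : tmap (idfun : H -> H) (idfun : K -> K) = idfun.
Proof. by apply: tmap_uniq => //; exact: bop_id. Qed.

Lemma adj_tmap H K H' K' (S : H -> H') (T : K -> K') :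
  bounded_op S -> bounded_op T -> adj (tmap S T) = tmap (adj S) (adj T).
Proof.
move=> bS bT; apply/esym/tmap_uniq; try exact: bop_adj.
  exact/bop_adj/bop_tmap.
move=> x y; apply/eqP; rewrite -subr_eq0; apply/eqP/tens_eq0 => x' y'.
rewrite ipdBr -adjP; last exact: bop_tmap.
by rewrite tmapE // !elt_dot !adjP // subrr.
Qed.

Lemma tmap_linl H K H' K' (c : C) (S S' : H -> H') (T : K -> K') :
  bounded_op S -> bounded_op S' -> bounded_op T ->
  tmap (c *: S + S') T = c *: tmap S T + tmap S' T.
Proof.
move=> bS bS' bT; apply: tmap_uniq => //; first exact: bop_lin.
  by apply: bop_lin; exact: bop_tmap.
by move=> x y; rewrite !fctE !tmapE // eltDl eltZl.
Qed.

Lemma tmap_linr H K H' K' (c : C) (S : H -> H') (T T' : K -> K') :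
  bounded_op S -> bounded_op T -> bounded_op T' ->
  tmap S (c *: T + T') = c *: tmap S T + tmap S T'.
Proof.
move=> bS bT bT'; apply: tmap_uniq => //; first exact: bop_lin.
  by apply: bop_lin; exact: bop_tmap.
by move=> x y; rewrite !fctE !tmapE // eltDr eltZr.
Qed.

(** Creation operators. Their adjoints slice tensors, so that [adj (lten K f) \o X \o lten K e] is
    the slice (omega_{e,f} (x) iota)(X). *)
Definition lten H K (x : H) : K -> H ⊗ K := fun y => x ⊙ y.
Definition rten H K (y : K) : H -> H ⊗ K := fun x => x ⊙ y.
Local Arguments lten {H} K x _ : rename.
Local Arguments rten H {K} y _ : rename.

Lemma opn_lten H K (x : H) : opn (lten K x) (nrm x).
Proof. by move=> y; rewrite /lten nrm_elt. Qed.
Lemma opn_rten H K (y : K) : opn (rten H y) (nrm y).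
Proof. by move=> x; rewrite /rten nrm_elt mulrC. Qed.

Lemma bop_lten H K (x : H) : bounded_op (lten K x).
Proof.
apply: (bop_mk (nrm_ge0 x)) (@opn_lten H K x) => c y z.
by rewrite /lten eltDr eltZr.
Qed.
Lemma bop_rten H K (y : K) : bounded_op (rten H y).
Proof.
apply: (bop_mk (nrm_ge0 y)) (@opn_rten H K y) => c x z.
by rewrite /rten eltDl eltZl.
Qed.

Lemma adj_ltenE H K (z x : H) (y : K) : adj (lten K z) (x ⊙ y) = ipd x z *: y.
Proof.
apply: ipd_inj => w; rewrite -adjPr; last exact: bop_lten.
by rewrite /lten elt_dot ipdZl.
Qed.
Lemma adj_rtenE H K (z : K) (x : H) (y : K) : adj (rten H z) (x ⊙ y) = ipd y z *: x.
Proof.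
apply: ipd_inj => w; rewrite -adjPr; last exact: bop_rten.
by rewrite /rten elt_dot ipdZl mulrC.
Qed.

Lemma ipd_lten H K (z : H) (y : K) (v : H ⊗ K) :
  ipd v (z ⊙ y) = ipd (adj (lten K z) v) y.
Proof. by rewrite -adjPr //; exact: bop_lten. Qed.
Lemma ipd_rten H K (x : H) (z : K) (v : H ⊗ K) :
  ipd v (x ⊙ z) = ipd (adj (rten H z) v) x.
Proof. by rewrite -adjPr //; exact: bop_rten. Qed.

Lemma lten_linE H K (c : C) (x y : H) : lten K (c *: x + y) = c *: lten K x + lten K y.
Proof. by apply/funext => z; rewrite /lten eltDl eltZl. Qed.
Lemma ltenB H K (x y : H) : lten K (x - y) = lten K x - lten K y.
Proof. by rewrite addrC -scaleN1r lten_linE scaleN1r addrC. Qed.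

Lemma adj_lten_tmap H K H' K' (S : H -> H') (T : K -> K') z :
  bounded_op S -> bounded_op T ->
  adj (lten K' z) \o tmap S T = T \o adj (lten K (adj S z)).
Proof.
move=> bS bT; apply: tens_ext.
- by apply: bop_comp; [exact/bop_adj/bop_lten | exact: bop_tmap].
- by apply: bop_comp => //; exact/bop_adj/bop_lten.
- by move=> x y /=; rewrite tmapE // !adj_ltenE (bopZ _ _ bT) -adjP.
Qed.

Lemma adj_rten_tmap H K H' K' (S : H -> H') (T : K -> K') z :
  bounded_op S -> bounded_op T ->
  adj (rten H' z) \o tmap S T = S \o adj (rten H (adj T z)).
Proof.
move=> bS bT; apply: tens_ext.
- by apply: bop_comp; [exact/bop_adj/bop_rten | exact: bop_tmap].
- by apply: bop_comp => //; exact/bop_adj/bop_rten.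
- by move=> x y /=; rewrite tmapE // !adj_rtenE (bopZ _ _ bS) -adjP.
Qed.

Lemma tens_inj_l H K (v w : H ⊗ K) :
  (forall z, adj (lten K z) v = adj (lten K z) w) -> v = w.
Proof.
move=> h; apply/eqP; rewrite -subr_eq0; apply/eqP/tens_eq0 => x y.
by rewrite ipdC ipd_lten (bopB _ _ (bop_adj (bop_lten K x))) h subrr ipd0l conjc0.
Qed.
Lemma tens_inj_r H K (v w : H ⊗ K) :
  (forall z, adj (rten H z) v = adj (rten H z) w) -> v = w.
Proof.
move=> h; apply/eqP; rewrite -subr_eq0; apply/eqP/tens_eq0 => x y.
by rewrite ipdC ipd_rten (bopB _ _ (bop_adj (bop_rten H y))) h subrr ipd0l conjc0.
Qed.

Lemma tens_ext3 H K L (M : hilbertType R) (S T : (H ⊗ K) ⊗ L -> M) : bounded_op S -> bounded_op T ->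
  (forall x y z, S ((x ⊙ y) ⊙ z) = T ((x ⊙ y) ⊙ z)) -> S = T.
Proof.
move=> bS bT h; apply: tens_ext => // v z.
have : S \o rten _ z = T \o rten _ z.
  apply: tens_ext; [exact: bop_comp bS (bop_rten _ z)|exact: bop_comp bT (bop_rten _ z)|].
  by move=> x y; exact: h.
by move=> /(congr1 (fun f => f v)).
Qed.

End Tensor.

#[export] Hint Resolve bop_id bop_comp bop_adj bop_add bop_lin bop_scale bop_sub
  bop_lten bop_rten bop_tmap bop_zero : bop.

(** * The bicommutant theorem *)

Section SquareSummable.
Variable R : realType.
Variable H : hilbertType R.
Local Notation C := R[i].

Definition psum (x : nat -> H) n : R := \sum_(k < n) nrm (x k) ^+ 2.
Definition sqsum (x : nat -> H) := exists M, forall n, psum x n <= M.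

Lemma psumS x n : psum x n.+1 = psum x n + nrm (x n) ^+ 2.
Proof. by rewrite /psum big_ord_recr. Qed.

Lemma psum_ge0 x n : 0 <= psum x n.
Proof. by apply: sumr_ge0 => k _; rewrite sqr_ge0. Qed.

Lemma psum_le x m n : (m <= n)%N -> psum x m <= psum x n.
Proof.
move=> /subnK <-; elim: (n - m)%N => // d IHd.
by rewrite addSn psumS (le_trans IHd) // lerDl sqr_ge0.
Qed.

Lemma psum_tail x : sqsum x -> forall e, 0 < e ->
  exists N, forall n, (N <= n)%N -> psum x n - psum x N <= e.
Proof.
move=> [M hM] e e0; pose S := [set r | exists n, r = psum x n].
have hS : has_sup S.
  by split; [exists (psum x 0%N); exists 0%N | exists M => _ [n ->]].
have [_ [N ->] h] := sup_adherent e0 hS.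
exists N => n _; have : psum x n <= sup S by apply: ub_le_sup; [case: hS | exists n].
lra.
Qed.

Definition l2pred : {pred nat -> H} := fun x => `[< sqsum x >].

Lemma nrmD_sq (x y : H) : nrm (x + y) ^+ 2 <= 2 * (nrm x ^+ 2 + nrm y ^+ 2).
Proof. by rewrite -parallelogram lerDl sqr_ge0. Qed.

Lemma l2pred_submod : submod_closed l2pred.
Proof.
split.
  by apply/asboolP; exists 0 => n; rewrite /psum big1 // => k _; change (nrm (0 : H) ^+ 2 = 0); rewrite nrm0 expr0n.
move=> c x y /asboolP[M hM] /asboolP[M' hM']; apply/asboolP.
exists (2 * (nrm (c : C^o) ^+ 2 * M + M')) => n.
apply: (@le_trans _ _ (2 * (nrm (c : C^o) ^+ 2 * psum x n + psum y n))).
  rewrite /psum mulr_sumr -big_split mulr_sumr ler_sum // => k _.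
  by rewrite !fctE (le_trans (nrmD_sq _ _)) // nrmZ exprMn.
by rewrite ler_wpM2l // lerD // ler_wpM2l // sqr_ge0.
Qed.

HB.instance Definition _ := GRing.isSubmodClosed.Build _ _ l2pred l2pred_submod.

(** The countable Hilbert sum of copies of H. Approximating one vector of it controls a whole
    square-summable sequence in H, which is what sigma-weak arguments require. *)
Record l2 := L2 { l2f : nat -> H ; l2P : l2f \in l2pred }.
HB.instance Definition _ := [isSub for l2f].
HB.instance Definition _ := [Choice of l2 by <:].
HB.instance Definition _ := [SubChoice_isSubLmodule of l2 by <:].

Lemma l2_sqsum (x : l2) : sqsum (l2f x).
Proof. by case: x => f /= /asboolP. Qed.

Lemma l2LE (c : C) (x y : l2) k : l2f (c *: x + y) k = c *: l2f x k + l2f y k.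
Proof. by []. Qed.

Lemma l2_inj (x y : l2) : (forall k, l2f x k = l2f y k) -> x = y.
Proof. by move=> h; apply/val_inj/funext. Qed.

Definition pip (x y : nat -> H) n : C := \sum_(k < n) ipd (x k) (y k).

Lemma pip_diff x y m n : (m <= n)%N ->
  2 * nrm (pip x y n - pip x y m : C^o) <=
    (psum x n - psum x m) + (psum y n - psum y m).
Proof.
move=> /subnK <-; elim: (n - m)%N => [|d IHd]; first by rewrite !subrr nrm0 mulr0 addr0.
rewrite addSn !psumS /pip big_ord_recr /= -/(pip x y (d + m)) addrAC.
set i := ipd _ _.
have h1 : nrm (pip x y (d + m) - pip x y m + i : C^o) <=
   nrm (pip x y (d + m) - pip x y m : C^o) + nrm (i : C^o) by exact: nrmD.
have h2 := cauchy_schwarz (x (d + m)%N) (y (d + m)%N); rewrite -/i in h2.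
set a := nrm (x _) in h2 *; set b := nrm (y _) in h2 *.
have := sqr_ge0 (a - b); rewrite sqrrB; lra.
Qed.

Definition ip_lim (x y : nat -> H) (l : C) := forall e : R, 0 < e ->
  exists N, forall n, (N <= n)%N -> nrm (pip x y n - l : C^o) <= e.

Lemma ip_lim_ex (x y : l2) : exists l, ip_lim (l2f x) (l2f y) l.
Proof.
apply: complete_seqC => e e0.
have [N hN] := psum_tail (l2_sqsum x) e0.
have [N' hN'] := psum_tail (l2_sqsum y) e0.
exists (maxn N N') => m n; rewrite !geq_max => /andP[Nm N'm] /andP[Nn N'n].
wlog mn : m n Nm N'm Nn N'n / (n <= m)%N.
  by move=> h; have [|/ltnW] := leqP n m; [exact: h | rewrite nrmBC; apply: h].
have := pip_diff (l2f x) (l2f y) mn.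
have := hN m Nm; have := hN' m N'm; have := psum_le (l2f x) Nn; have := psum_le (l2f y) N'n.
lra.
Qed.

Lemma ip_lim_uniq x y l l' : ip_lim x y l -> ip_lim x y l' -> l = l'.
Proof.
move=> h h'; apply/eqP; rewrite -subr_eq0; apply/eqP/(@le_nrm0 _ C^o) => e e0.
have e2 := divr_gt0 e0 (ltr0Sn R 1).
have [N hN] := h _ e2; have [N' hN'] := h' _ e2.
apply: le_trans (@nrmB _ C^o _ _ (pip x y (maxn N N'))) _.
rewrite (@nrmBC _ C^o) [leRHS](splitr e) lerD //; first by apply: hN; rewrite leq_maxl.
by apply: hN'; rewrite leq_maxr.
Qed.

Definition l2ip (x y : l2) : C := xget 0 [set l | ip_lim (l2f x) (l2f y) l].

Lemma l2ipP x y : ip_lim (l2f x) (l2f y) (l2ip x y).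
Proof.
have [l hl] := ip_lim_ex x y.
exact: (@xgetPex _ 0 [set l | ip_lim (l2f x) (l2f y) l] (ex_intro _ l hl)).
Qed.

Lemma l2ip_eq x y l : ip_lim (l2f x) (l2f y) l -> l2ip x y = l.
Proof. by move/(ip_lim_uniq (l2ipP x y)). Qed.

Lemma ip_lim_linl c x x' y l l' : ip_lim x y l -> ip_lim x' y l' ->
  ip_lim (c *: x + x') y (c * l + l').
Proof.
move=> h h' e e0; have c0 := nrm_ge0 (c : C^o).
have d0 : 0 < e / 2 / (nrm (c : C^o) + 1) by rewrite !divr_gt0 //; lra.
have [N hN] := h _ d0; have [N' hN'] := h' _ (divr_gt0 e0 (ltr0Sn R 1)).
exists (maxn N N') => n; rewrite geq_max => /andP[Nn N'n].
have -> : pip (c *: x + x') y n = c * pip x y n + pip x' y n.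
  rewrite /pip mulr_sumr -big_split /=; apply: eq_bigr => k _.
  by rewrite !fctE ipdDl ipdZl.
rewrite opprD addrACA -mulrBr (le_trans (@nrmD _ C^o _ _)) // (@nrmM R).
rewrite [leRHS](splitr e) lerD ?hN' // (le_trans (ler_wpM2l c0 (hN _ Nn))) //.
rewrite mulrCA ger_pMr ?divr_gt0 // ler_pdivrMr; lra.
Qed.

Lemma l2ip_lin c x x' y : l2ip (c *: x + x') y = c * l2ip x y + l2ip x' y.
Proof. by apply: l2ip_eq; apply: ip_lim_linl; exact: l2ipP. Qed.

Lemma l2ipC x y : l2ip x y = Num.conj (l2ip y x).
Proof.
apply: l2ip_eq => e e0; have [N hN] := l2ipP y x e0; exists N => n Nn.
have -> : pip (l2f x) (l2f y) n = Num.conj (pip (l2f y) (l2f x) n).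
  by rewrite /pip rmorph_sum; apply: eq_bigr => k _; rewrite ipdC.
by rewrite -rmorphB (nrm_conj (pip (l2f y) (l2f x) n - l2ip y x)) hN.
Qed.

Definition l2nsq (x : l2) : R := sup [set r | exists n, r = psum (l2f x) n].

Lemma has_sup_psum (x : l2) : has_sup [set r | exists n, r = psum (l2f x) n].
Proof.
split; first by exists (psum (l2f x) 0%N); exists 0%N.
by have [M hM] := l2_sqsum x; exists M => _ [n ->].
Qed.

Lemma psum_l2nsq x n : psum (l2f x) n <= l2nsq x.
Proof. by apply: ub_le_sup; [case: (has_sup_psum x) | exists n]. Qed.

Lemma l2nsq_le x M : (forall n, psum (l2f x) n <= M) -> l2nsq x <= M.
Proof.
by move=> h; apply: ge_sup; [case: (has_sup_psum x) | move=> _ [n ->]].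
Qed.

Lemma l2ipxx x : l2ip x x = (l2nsq x)%:C.
Proof.
apply: l2ip_eq => e e0.
have [_ [N ->] h] := sup_adherent e0 (has_sup_psum x).
exists N => n Nn.
have -> : pip (l2f x) (l2f x) n = (psum (l2f x) n)%:C.
  by rewrite /pip /psum rmorph_sum; apply: eq_bigr => k _; rewrite ipdxx.
rewrite -rmorphB -(@nrmN _ C^o) -rmorphN opprB nrm_real ?subr_ge0 ?psum_l2nsq //.
have := psum_le (l2f x) Nn; rewrite /l2nsq; lra.
Qed.

Lemma l2nsq_ge0 x : 0 <= l2nsq x.
Proof. exact: le_trans (psum_ge0 _ 0) (psum_l2nsq x 0). Qed.

Lemma l2nsq_eq0 x : l2nsq x = 0 -> x = 0.
Proof.
move=> h; apply: l2_inj => k; apply: nrm_eq0; apply/eqP.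
suff : nrm (l2f x k) ^+ 2 == 0 by rewrite expf_eq0.
rewrite eq_le sqr_ge0 andbT; have := psum_l2nsq x k.+1; rewrite h psumS.
by have := psum_ge0 (l2f x) k; lra.
Qed.

Lemma l2ip_linr : forall u, GRing.linear_for (Num.conj \; *%R) (l2ip u).
Proof.
move=> u c x y /=; rewrite l2ipC l2ip_lin rmorphD rmorphM /=.
by rewrite -!l2ipC.
Qed.

HB.instance Definition _ := @bilinear_isBilinear.Build C l2 l2 C
  *%R (Num.conj \; *%R) l2ip ((fun u' c x y => l2ip_lin c x y u'), l2ip_linr).

Lemma l2ip_herm : forall x y, l2ip x y = (-1) ^+ false * Num.conj (l2ip y x).
Proof. by move=> x y; rewrite expr0 mul1r l2ipC. Qed.

HB.instance Definition _ := @isHermitianSesquilinear.Build C l2 false Num.conj l2ip l2ip_herm.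

Lemma l2ip_gt0 : forall u, u != 0 -> 0 < l2ip u u.
Proof.
move=> u u0; rewrite l2ipxx ltcR lt_def l2nsq_ge0 andbT.
by apply: contra_neq u0 => /l2nsq_eq0.
Qed.

HB.instance Definition _ := @isDotProduct.Build C l2 l2ip l2ip_gt0.

Lemma l2ip0l w : l2ip 0 w = 0.
Proof. by have := l2ip_lin (-1) 0 0 w; rewrite scaler0 addr0 mulN1r addNr. Qed.
Lemma l2ipZl c x w : l2ip (c *: x) w = c * l2ip x w.
Proof. by rewrite -[c *: x]addr0 l2ip_lin l2ip0l addr0. Qed.
Lemma l2ip0r w : l2ip w 0 = 0.
Proof. by rewrite l2ipC l2ip0l rmorph0. Qed.
Lemma l2ipZr c x w : l2ip w (c *: x) = Num.conj c * l2ip w x.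
Proof. by rewrite l2ipC l2ipZl [l2ip w x]l2ipC; exact: rmorphM. Qed.

Definition l2norm (x : l2) : C := (Num.sqrt (l2nsq x))%:C.

Lemma l2nsqD x y : l2nsq (x + y) = l2nsq x + l2nsq y + 2 * complex.Re (l2ip x y).
Proof.
have lD u v w : l2ip (u + v) w = l2ip u w + l2ip v w.
  by rewrite -[u]scale1r l2ip_lin mul1r scale1r.
apply: complexI; rewrite -l2ipxx lD (l2ipC x (x + y)) (l2ipC y (x + y)) !lD.
rewrite !rmorphD !rmorphM /= -!l2ipC !l2ipxx.
have -> : (2%:C : C) * (complex.Re (l2ip x y))%:C = l2ip x y + l2ip y x.
  by rewrite rmorph_nat -addcJ [l2ip y x]l2ipC.
ring.
Qed.

Lemma l2nsqZ c x : l2nsq (c *: x) = nrm (c : C^o) ^+ 2 * l2nsq x.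
Proof.
apply: complexI; rewrite -l2ipxx.
have lZ u v w : l2ip (u *: v) w = u * l2ip v w.
  have l0 : l2ip 0 w = 0.
    by have := l2ip_lin (-1) 0 0 w; rewrite scaler0 addr0 mulN1r addNr.
  by rewrite -[u *: v]addr0 l2ip_lin l0 addr0.
rewrite lZ (l2ipC x (c *: x)) lZ l2ipxx.
have -> : Num.conj (c * (l2nsq x)%:C) = Num.conj c * (l2nsq x)%:C.
  by rewrite rmorphM; congr (_ * _); exact: conjc_real.
rewrite mulrA [RHS]rmorphM; congr (_ * _).
by rewrite rmorphXn /= -nrmE normCK.
Qed.

Lemma l2_re_le x y : complex.Re (l2ip x y) <= Num.sqrt (l2nsq x) * Num.sqrt (l2nsq y).
Proof.
set a := Num.sqrt (l2nsq x); set b := Num.sqrt (l2nsq y).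
have aE : l2nsq x = a ^+ 2 by rewrite sqr_sqrtr ?l2nsq_ge0.
have bE : l2nsq y = b ^+ 2 by rewrite sqr_sqrtr ?l2nsq_ge0.
have a0 : 0 <= a by rewrite sqrtr_ge0. have b0 : 0 <= b by rewrite sqrtr_ge0.
have [a1|a1] := eqVneq a 0.
  have -> : x = 0 by apply: l2nsq_eq0; rewrite aE a1 expr0n.
  by rewrite l2ip0l /= mulr_ge0.
have [b1|b1] := eqVneq b 0.
  have -> : y = 0 by apply: l2nsq_eq0; rewrite bE b1 expr0n.
  by rewrite l2ip0r /= mulr_ge0.
have := l2nsq_ge0 (b%:C *: x + (- a)%:C *: y).
rewrite l2nsqD !l2nsqZ -!normr_nrm aE bE l2ipZl l2ipZr.
have -> : Num.conj ((- a)%:C : C) = (- a)%:C by exact: conjc_real.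
have -> : complex.Re (b%:C * ((- a)%:C * l2ip x y)) = - (a * b) * complex.Re (l2ip x y).
  by case: (l2ip x y) => u v /=; ring.
move=> h.
have ab : 0 < a * b by rewrite mulr_gt0 // lt_def ?a1 ?b1.
rewrite -(ler_pM2l ab); lra.
Qed.

Lemma l2norm_tri x y : l2norm (x + y) <= l2norm x + l2norm y.
Proof.
rewrite /l2norm -rmorphD lecR.
rewrite -(@ler_pXn2r _ 2) // ?nnegrE ?addr_ge0 ?sqrtr_ge0 //.
rewrite sqr_sqrtr ?l2nsq_ge0 // l2nsqD sqrrD !sqr_sqrtr ?l2nsq_ge0 //.
have := l2_re_le x y; lra.
Qed.

Lemma l2normZ (c : C) x : l2norm (c *: x) = `|c| * l2norm x.
Proof.
rewrite /l2norm l2nsqZ sqrtrM ?sqr_ge0 // sqrtr_sqr ger0_norm ?nrm_ge0 //.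
by rewrite rmorphM /= -nrmE.
Qed.

Lemma l2norm_eq0 x : l2norm x = 0 -> x = 0.
Proof.
move/complexI/eqP; rewrite sqrtr_eq0 => h; apply: l2nsq_eq0; apply/eqP.
by rewrite eq_le h l2nsq_ge0.
Qed.

HB.instance Definition _ := Lmodule_isNormed.Build C l2 l2norm_tri l2normZ l2norm_eq0.

Lemma nrm_l2 (x : l2) : nrm x = Num.sqrt (l2nsq x).
Proof. by []. Qed.

Lemma nrm_l2sq (x : l2) : nrm x ^+ 2 = l2nsq x.
Proof. by rewrite nrm_l2 sqr_sqrtr ?l2nsq_ge0. Qed.

(** Each coordinate converges. The estimate on the first n coordinates is uniform in n, because it
    compares x with an x' chosen, depending on n, close to the limit there. *)
Lemma l2_complete (F : set_system l2) : ProperFilter F -> cauchy F -> cvg F.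
Proof.
move=> FF /cauchy_ballP hF; apply/cvg_ex.
have cau (e : R) : 0 < e -> exists2 A, F A & forall x y, A x -> A y -> nrm (x - y) <= e.
  move=> e0; have e0' : 0 < e%:C by rewrite ltcR.
  have [[A B] /= [FA FB] h] := hF _ e0'; exists (A `&` B); first exact: filterI.
  move=> x y [Ax _] [_ By]; have := h (x, y) (conj Ax By).
  by rewrite -ball_normE /ball_ /= nrmE ltcR => /ltW.
have coord (x : l2) k : nrm (l2f x k) <= nrm x.
  rewrite -(@ler_pXn2r _ 2) // ?nnegrE ?nrm_ge0 // nrm_l2sq.
  rewrite (le_trans _ (psum_l2nsq x k.+1)) // psumS lerDr; exact: psum_ge0.
have coordB (x y : l2) k : nrm (l2f x k - l2f y k) <= nrm (x - y) by exact: (coord (x - y) k).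
have /(_ _)/cid-/all_sig[y hy] k : exists l : H, forall e, 0 < e ->
    \forall x \near F, nrm (l2f x k - l) <= e.
  pose G := (fun x : l2 => l2f x k) @ F.
  have : cvg G.
    apply: cauchy_cvg; apply/cauchy_ballP => e e0.
    have ee : e = (complex.Re e)%:C by rewrite RRe_real // gtr0_real.
    move: e0; rewrite ee ltcR => e0; have e2 := divr_gt0 e0 (ltr0Sn R 1).
    have [A FA hA] := cau _ e2.
    pose B := (fun x : l2 => l2f x k) @` A.
    have GB : G B by apply: (@filterS _ F _ A _ _ FA) => x Ax; exists x.
    exists (B, B) => //= -[_ _] [/= [x Ax <-] [x' Ax' <-]].
    rewrite -ball_normE /ball_ /= nrmE ltcR (le_lt_trans (coordB x x' k)) //.
    by rewrite (le_lt_trans (hA _ _ Ax Ax')) //; lra.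
  move/cvg_ex => [l hl]; exists l => e e0.
  have := (iffLR (cvg_nrm FF (fun x : l2 => l2f x k) l)) hl e e0.
  by apply: filterS => x; rewrite nrmBC.
have near_all (e : R) n : 0 < e ->
    \forall x \near F, forall k, (k < n)%N -> nrm (l2f x k - y k) <= e.
  move=> e0; elim: n => [|n IHn]; first exact: filterE.
  apply: filterS2 IHn (hy n e e0) => x h1 h2 k; rewrite ltnS leq_eqVlt.
  by move=> /orP[/eqP ->|/h1].
have key (e : R) : 0 < e -> exists2 A, F A & forall x, A x -> forall n,
    psum (l2f x - y) n <= (2 * e) ^+ 2.
  move=> e0; have [A FA hA] := cau e e0; exists A => // x Ax n.
  have d0 : 0 < e / (n.+1%:R) by rewrite divr_gt0.
  have [x' [Ax' hx']] := filter_ex (filterI FA (near_all _ n d0)).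
  apply: (@le_trans _ _ (2 * (psum (l2f (x - x')) n + psum (l2f x' - y) n))).
    rewrite /psum -big_split mulr_sumr ler_sum // => k _.
    have -> : (l2f x - y) k = l2f (x - x') k + (l2f x' - y) k.
      by rewrite !fctE [RHS]addrA subrK.
    exact: nrmD_sq.
  have h1 : psum (l2f (x - x')) n <= e ^+ 2.
    rewrite (le_trans (psum_l2nsq _ n)) // -nrm_l2sq.
    by apply: lerXn2r; rewrite ?nnegrE ?nrm_ge0 ?(ltW e0) ?hA.
  have h2 : psum (l2f x' - y) n <= e ^+ 2.
    apply: (@le_trans _ _ (\sum_(k < n) (e / n.+1%:R) ^+ 2)).
      apply: ler_sum => k _; apply: lerXn2r; rewrite ?nnegrE ?nrm_ge0 ?(ltW d0) //.
      by rewrite hx'.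
    rewrite sumr_const card_ord -[_ *+ n]mulr_natr.
    have eE : e = e / n.+1%:R * n.+1%:R by rewrite divfK ?pnatr_eq0.
    apply: (@le_trans _ _ ((e / n.+1%:R * n.+1%:R) ^+ 2)); last by rewrite -eE.
    rewrite [leRHS]exprMn ler_wpM2l ?sqr_ge0 // -natrX ler_nat.
    by rewrite (leq_trans (leqnSn n)) // leq_pmulr.
  by rewrite exprMn; lra.
have yl2 : y \in l2pred.
  have [A FA hA] := key 1 ltr01; have [x Ax] := filter_ex FA.
  have dP : l2f x - y \in l2pred by apply/asboolP; exists ((2 * 1) ^+ 2) => n; exact: hA.
  have -> : y = l2f x - (l2f x - y) by rewrite opprB addrC subrK.
  have [_ sc] := l2pred_submod.
  by rewrite addrC -scaleN1r; apply: sc => //; exact: l2P.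
exists (L2 yl2).
have : idfun @ F --> (L2 yl2); last by move=> h A /h.
apply/cvg_nrm => e e0.
have [A FA hA] := key _ (divr_gt0 e0 (ltr0Sn R 1)).
apply: filterS FA => x Ax; rewrite nrmBC /=.
rewrite -(@ler_pXn2r _ 2) // ?nnegrE ?nrm_ge0 ?(ltW e0) // nrm_l2sq.
by apply: l2nsq_le => n; rewrite (le_trans (hA x Ax n)) // mulrC divfK.
Qed.

HB.instance Definition _ := Uniform_isComplete.Build l2 l2_complete.

Lemma l2_hdot_norm : forall x : l2, l2ip x x = `|x| ^+ 2.
Proof. by move=> x; rewrite nrmE -rmorphXn /= nrm_l2sq l2ipxx. Qed.

HB.instance Definition _ := isHilbert.Build R l2 l2_hdot_norm.

End SquareSummable.

(** * Amplification, commutants and strong closures *)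

Section Commutants.
Variable R : realType.
Implicit Types H K L : hilbertType R.
Local Notation C := R[i].

Lemma total_of_orth H (X : set H) :
  (forall w, (forall x, X x -> ipd x w = 0) -> w = 0) -> closure (lspan X) = setT.
Proof.
move=> h; apply/seteqP; split => // x _.
apply: (prj_dense (closure_lspan_csub X)) => w hw; apply: h => y Xy.
by rewrite ipdC hw ?conjc0 //; apply/subset_closure/lspan_sub.
Qed.

Section Amplification.
Variable H : hilbertType R.
Local Notation l2 := (l2 H).

Lemma amp_sq (T : H -> H) (x : l2) : bounded_op T ->
  (fun k => T (l2f x k)) \in @l2pred R H.
Proof.
move=> bT; have [m m0 hm] := bop_opn bT; apply/asboolP.
exists (m ^+ 2 * l2nsq x) => n.
apply: (@le_trans _ _ (m ^+ 2 * psum (l2f x) n)); last first.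
  by rewrite ler_wpM2l ?sqr_ge0 // psum_l2nsq.
rewrite /psum mulr_sumr ler_sum // => k _; rewrite -exprMn.
by apply: lerXn2r; rewrite ?nnegrE ?mulr_ge0 ?nrm_ge0 ?(ltW m0) ?hm.
Qed.

(** T acting entrywise. The default 0 of [insubd] would be taken only if the image were not square
    summable, which [amp_sq] excludes for bounded T. *)
Definition amp (T : H -> H) (x : l2) : l2 :=
  insubd (0 : l2) (fun k => T (l2f x k)).

Lemma ampE T x k : bounded_op T -> l2f (amp T x) k = T (l2f x k).
Proof. by move=> bT; rewrite /amp -[l2f _]/(val _) insubdK ?amp_sq. Qed.

Lemma bop_amp T : bounded_op T -> bounded_op (amp T).
Proof.
move=> bT; have [m m0 hm] := bop_opn bT.
apply: (bop_mk (ltW m0)) => [c x y|x].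
  by apply: l2_inj => k; rewrite l2LE !ampE // l2LE (bopL bT).
rewrite -(@ler_pXn2r _ 2) // ?nnegrE ?mulr_ge0 ?nrm_ge0 ?(ltW m0) //.
rewrite exprMn !nrm_l2sq; apply: l2nsq_le => n.
apply: (@le_trans _ _ (m ^+ 2 * psum (l2f x) n)); last first.
  by rewrite ler_wpM2l ?sqr_ge0 // psum_l2nsq.
rewrite /psum mulr_sumr ler_sum // => k _; rewrite ampE // -exprMn.
by apply: lerXn2r; rewrite ?nnegrE ?mulr_ge0 ?nrm_ge0 ?(ltW m0) ?hm.
Qed.

Lemma ip_lim_const x y N (l : C) :
  (forall n, (N <= n)%N -> @pip R H x y n = l) -> ip_lim x y l.
Proof.
move=> h e e0; exists N => n Nn; rewrite h // subrr nrm0; exact: ltW.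
Qed.

Definition l2d_fun k (v : H) : nat -> H := fun j => if j == k then v else 0.

Lemma l2d_sq k v : l2d_fun k v \in @l2pred R H.
Proof.
apply/asboolP; exists (nrm v ^+ 2) => n; rewrite /psum.
elim: n => [|n IHn]; first by rewrite big_ord0 sqr_ge0.
rewrite big_ord_recr /= /l2d_fun; case: (eqVneq n k) => [nk|_]; last first.
  by rewrite nrm0 expr0n addr0.
rewrite big1 ?add0r // => j _; rewrite -nk (ltn_eqF (ltn_ord j)).
by rewrite nrm0 expr0n.
Qed.

Definition l2d k v : l2 := L2 (l2d_sq k v).

Lemma l2dE k v j : l2f (l2d k v) j = if j == k then v else 0.
Proof. by []. Qed.

Lemma ipd_l2d k v (x : l2) : ipd (l2d k v) x = ipd v (l2f x k).
Proof.
apply: l2ip_eq; apply: (@ip_lim_const _ _ k.+1) => n kn.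
rewrite /pip (bigD1 (Ordinal kn)) //= /l2d_fun eqxx big1 ?addr0 // => j.
by rewrite -val_eqE /= => /negbTE ->; rewrite ipd0l.
Qed.

Lemma bop_l2d k : bounded_op (l2d k).
Proof.
apply: (@bop_mk _ _ _ _ 1) => // [c x y|x].
  apply: l2_inj => j; rewrite l2LE /= /l2d_fun; case: eqP => // _.
  by rewrite scaler0 addr0.
rewrite mul1r -(@ler_pXn2r _ 2) // ?nnegrE ?nrm_ge0 //.
by rewrite (nrm_sqr (l2d k x)) ipd_l2d /= /l2d_fun eqxx -nrm_sqr.
Qed.

Lemma adj_l2d k x : adj (l2d k) x = l2f x k.
Proof.
apply: ipd_inj => z; rewrite -adjPr; last exact: bop_l2d.
by rewrite (ipdC x) ipd_l2d -ipdC.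
Qed.

Lemma l2d_total : closure (lspan [set x | exists k v, x = l2d k v]) = setT.
Proof.
apply: total_of_orth => w hw; apply: l2_inj => k; apply: ipd_eq0.
by rewrite -ipd_l2d hw //; exists k, (l2f w k).
Qed.

Lemma amp_l2d T k v : bounded_op T -> amp T (l2d k v) = l2d k (T v).
Proof.
move=> bT; apply: l2_inj => j; rewrite ampE //= /l2d_fun; case: eqP => // _.
exact: bop0.
Qed.

Lemma adj_amp T : bounded_op T -> adj (amp T) = amp (adj T).
Proof.
move=> bT; have ba := bop_adj bT; apply: (bop_ext_dense _ _ l2d_total).
- exact/bop_adj/bop_amp.
- exact/bop_amp.
move=> _ [k [v ->]]; rewrite amp_l2d //; apply: ipd_inj => z.
rewrite -adjPr; last exact: bop_amp.
by rewrite !ipd_l2d ampE // adjPr.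
Qed.

End Amplification.

Local Opaque amp l2d prj.

Definition commutant H (A : set (H -> H)) : set (H -> H) :=
  [set T | bounded_op T /\ forall S, A S -> S \o T = T \o S].

Lemma commutantE H (A : set (H -> H)) S T x : commutant A T -> A S -> S (T x) = T (S x).
Proof. by move=> [_ h] /h /(congr1 (fun f => f x)). Qed.

Lemma commutant_adj H (A : set (H -> H)) T : star_algebra A ->
  commutant A T -> commutant A (adj T).
Proof.
move=> sA [bT cT]; split; first exact: bop_adj.
move=> S AS; have bS := star_algebra_bounded sA AS.
have /(congr1 (@adj _ _ _)) := cT _ (star_algebra_adj sA AS).
have bS' := bop_adj bS.
by rewrite (adj_comp bS' bT) (adj_comp bT bS') (adjK bS) => ->.
Qed.

Lemma commutant_id H (A : set (H -> H)) : commutant A idfun.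
Proof. by split; [exact: bop_id|]. Qed.

Lemma commutant_lin H (A : set (H -> H)) (c : C) S T : star_algebra A ->
  commutant A S -> commutant A T -> commutant A (c *: S + T).
Proof.
move=> sA hS hT; have [bS _] := hS; have [bT _] := hT.
split; first exact: bop_lin.
move=> U AU; have bU := star_algebra_bounded sA AU.
apply/funext => x.
change (U (c *: S x + T x) = c *: S (U x) + T (U x)); rewrite (bopL bU).
by rewrite (commutantE x hS AU) (commutantE x hT AU).
Qed.

Lemma commutant_comp H (A : set (H -> H)) S T : 
  commutant A S -> commutant A T -> commutant A (S \o T).
Proof.
move=> hS hT; split; first by apply: bop_comp; [case: hS | case: hT].
by move=> U AU; apply/funext => x /=; rewrite (commutantE _ hS AU) (commutantE _ hT AU).
Qed.

(** The argument of von Neumann on the amplification. The projection P onto the closure of the orbit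
    of x commutes with [amp S] for S in A, so its matrix entries [Pjk] lie in the commutant of A.
    They therefore commute with y, and P commutes with [amp y]. Since A is unital, x lies in the
    range of P, hence so does [amp y x]. *)
Lemma bicommutant_approx H (A : set (H -> H)) y : star_algebra A -> A idfun ->
  commutant (commutant A) y -> forall (x : l2 H) e, 0 < e ->
  exists2 S, A S & forall n, \sum_(k < n) nrm (S (l2f x k) - y (l2f x k)) ^+ 2 <= e.
Proof.
move=> sA A1 cy x e e0; have [by_ _] := cy.
have bA S := @star_algebra_bounded _ _ _ sA S.
pose E0 := [set z | exists2 S, A S & z = amp S x].
have cE : csub (closure E0).
  apply: closure_csub.
    exists 0; first exact: star_algebra0.
    by apply: l2_inj => k; rewrite ampE //; exact: bop_zero.
  move=> c u v [S AS ->] [T AT ->]; exists (c *: S + T).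
    exact: star_algebra_linear.
  have bS := bA _ AS; have bT := bA _ AT.
  by apply: l2_inj => k; rewrite l2LE !ampE //; exact: bop_lin.
pose P := prj (closure E0).
have bP : bounded_op P by exact: bop_prj.
have Einv S : A S -> forall z, closure E0 z -> closure E0 (amp S z).
  move=> AS z /closure_nrm hz; apply/closure_nrm => d d0.
  have bS := bop_amp (bA _ AS); have [m m0 hm] := bop_opn bS.
  have [_ [T AT ->] zT] := hz _ (divr_gt0 d0 m0).
  exists (amp (S \o T) x); first by exists (S \o T) => //; exact: star_algebra_mul.
  have -> : amp (S \o T) x = amp S (amp T x).
    have bS' := bA _ AS; have bT := bA _ AT.
    by apply: l2_inj => k; rewrite !ampE //; exact: bop_comp.
  by rewrite -(bopB _ _ bS) (le_trans (hm _)) // mulrC -ler_pdivlMr.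
have PA S : A S -> forall z, P (amp S z) = amp S (P z).
  move=> AS; apply: prj_comm => //; [exact/bop_amp/bA | exact: Einv |].
  by rewrite adj_amp; [apply: Einv; exact: star_algebra_adj | exact: bA].
pose Pjk j k (v : H) : H := l2f (P (l2d k v)) j.
have bPjk j k : bounded_op (Pjk j k).
  have -> : Pjk j k = adj (l2d j) \o P \o l2d k.
    by apply/funext => v; exact: (esym (adj_l2d j (P (l2d k v)))).
  apply: bop_comp; last exact: bop_l2d.
  by apply: bop_comp => //; exact/bop_adj/bop_l2d.
have cP j k : commutant A (Pjk j k).
  split => // S AS; apply/funext => v; have bS := bA _ AS.
  have E : P (l2d k (S v)) = amp S (P (l2d k v)).
    by rewrite -(PA _ AS) (amp_l2d k v bS).
  exact: etrans (esym (ampE (P (l2d k v)) j bS)) (congr1 (fun z => l2f z j) (esym E)).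
have Py : P \o amp y = amp y \o P.
  apply: (bop_ext_dense _ _ (l2d_total H)).
  - by apply: bop_comp => //; exact: bop_amp.
  - by apply: bop_comp => //; exact: bop_amp.
  move=> _ [k [v ->]]; apply: l2_inj => j.
  have E : P (amp y (l2d k v)) = P (l2d k (y v)) by rewrite (amp_l2d k v by_).
  apply: etrans (congr1 (fun z => l2f z j) E) _.
  apply: etrans (commutantE v cy (cP j k)) _.
  exact: (esym (ampE (P (l2d k v)) j by_)).
have Px : P x = x.
  apply: prj_id => //; apply: subset_closure; exists idfun => //.
  by apply: l2_inj => k; rewrite ampE //; exact: bop_id.
have : closure E0 (amp y x).
  have := congr1 (fun f => f x) Py; rewrite /= Px => <-; exact: prj_in.
have se : 0 < Num.sqrt e by rewrite sqrtr_gt0.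
move/closure_nrm/(_ _ se) => [_ [S AS ->] h]; exists S => // n.
have := psum_l2nsq (amp S x - amp y x) n; rewrite /psum => {}h'.
have -> : \sum_(k < n) nrm (S (l2f x k) - y (l2f x k)) ^+ 2 =
   \sum_(k < n) nrm (l2f (amp S x - amp y x) k) ^+ 2.
  apply: eq_bigr => k _; congr (nrm _ ^+ 2).
  by rewrite -(ampE x k (bA _ AS)) -(ampE x k by_).
rewrite (le_trans h') // -nrm_l2sq nrmBC -[leRHS]sqr_sqrtr ?(ltW e0) //.
by apply: lerXn2r; rewrite ?nnegrE ?nrm_ge0 ?sqrtr_ge0.
Qed.

Lemma strong_closure_filter H K (X : set (H -> K)) T : strong_closure X T ->
  exists G : set_system (H -> K), [/\ ProperFilter G, G X &
    forall v (e : R), 0 < e -> \forall S \near G, nrm (T v - S v) <= e].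
Proof.
move=> [_]; rewrite closureEcvg => -[G PG [cG sG]].
exists G; split => //; first exact: sG.
move=> v; have /(iffLR (pointwise_cvgP T _))/(_ v) : {ptws, G --> (T : {ptws H -> K})} by [].
by move/(iffLR (cvg_nrm _ (fun S : H -> K => S v) (T v))).
Qed.

Lemma strong_closure_mk H K (X : set (H -> K)) (G : set_system (H -> K)) T :
  bounded_op T -> ProperFilter G -> G X ->
  (forall v (e : R), 0 < e -> \forall S \near G, nrm (T v - S v) <= e) ->
  strong_closure X T.
Proof.
move=> bT PG GX h; split => //; rewrite closureEcvg; exists G => //; split.
  have := (iffRL (@pointwise_cvgP H K G T _)); apply => v.
  by apply/(cvg_nrm _ (fun S : H -> K => S v) (T v)) => e e0; exact: h.
by move=> B XB; apply: filterS GX.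
Qed.

Lemma strong_closure_bicomm H (A : set (H -> H)) :
  strong_closure A `<=` commutant (commutant A).
Proof.
move=> y hy; have [by_ _] := hy; split => // T cT; have [bT _] := cT.
have [G [PG GA hG]] := strong_closure_filter hy.
apply/funext => v /=; apply/eqP; rewrite -subr_eq0; apply/eqP/le_nrm0 => e e0.
have [m m0 hm] := bop_opn bT.
have d0 : 0 < e / 2 / m by rewrite !divr_gt0.
have [S [AS [h1 h2]]] := filter_ex (filterI GA (filterI (hG v _ d0) (hG (T v) _ (divr_gt0 e0 (ltr0Sn R 1))))).
rewrite (le_trans (nrmB _ _ (T (S v)))) // [leRHS](splitr e) lerD //.
  by rewrite -(bopB _ _ bT) (le_trans (hm _)) // mulrC -ler_pdivlMr.
by rewrite -(commutantE v cT AS) nrmBC.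
Qed.

(** One filter serves all square-summable sequences simultaneously; its base is indexed by pairs of
    a sequence and a precision. *)
Lemma ultrastrong_filter H (A : set (H -> H)) y : star_algebra A -> A idfun ->
  commutant (commutant A) y ->
  exists F : set_system (H -> H), [/\ ProperFilter F, F A &
    forall x : nat -> H, sqsum x -> forall e : R, 0 < e -> \forall S \near F,
      forall n, \sum_(k < n) nrm (S (x k) - y (x k)) ^+ 2 <= e].
Proof.
move=> sA A1 cy.
pose B (p : (nat -> H) * R) : set (H -> H) := [set S | A S /\
  forall n, \sum_(k < n) nrm (S (p.1 k) - y (p.1 k)) ^+ 2 <= p.2].
pose D : set ((nat -> H) * R) := [set p | sqsum p.1 /\ 0 < p.2].
have ne p : D p -> B p !=set0.
  case: p => x e [/= sx e0].
  have xl : x \in @l2pred R H by apply/asboolP.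
  by have [S AS h] := bicommutant_approx sA A1 cy (L2 xl) e0; exists S.
have D0 : D (fun=> 0, 1).
  split => //=; exists 0 => n; rewrite /psum big1 // => k _.
  by rewrite nrm0 expr0n.
exists (filter_from D B); split.
- apply: filter_from_proper => //; apply: filter_from_filter; first by exists (fun=> 0, 1).
  move=> [x e] [x' e'] [/= sx e0] [/= sx' e'0].
  (* Interleaving makes the base directed: a condition on z implies the conditions on x and on
     x'. *)
  pose z n := if odd n then x' n./2 else x n./2.
  have zz f n : \sum_(k < n.*2) (f (z k) : R) = \sum_(k < n) f (x k) + \sum_(k < n) f (x' k).
    elim: n => [|n IHn]; first by rewrite !big_ord0 addr0.
    rewrite doubleS !big_ord_recr /= IHn /z odd_double doubleK /= odd_double /= uphalf_double.
    by rewrite addrACA -!addrA.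
  exists (z, Num.min e e').
    split; last by rewrite /= lt_min e0.
    have [M hM] := sx; have [M' hM'] := sx'; exists (M + M') => n.
    rewrite (le_trans (psum_le _ (_ : n <= n.*2)%N)) //; first by rewrite -addnn leq_addr.
    by rewrite /psum (zz (fun v => nrm v ^+ 2)) lerD ?hM ?hM'.
  move=> S [AS /= h].
  have h' n : \sum_(k < n) nrm (S (x k) - y (x k)) ^+ 2 +
      \sum_(k < n) nrm (S (x' k) - y (x' k)) ^+ 2 <= Num.min e e'.
    by have := h n.*2; have /= -> := zz (fun v => nrm (S v - y v) ^+ 2) n.
  split; split => //= n; have := h' n; rewrite le_min => /andP[h1 h2].
    by apply: le_trans h1; rewrite lerDl sumr_ge0 // => k _; rewrite sqr_ge0.
  by apply: le_trans h2; rewrite lerDr sumr_ge0 // => k _; rewrite sqr_ge0.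
- by exists (fun=> 0, 1) => // S [].
- by move=> x sx e e0; exists (x, e) => // S [].
Qed.

Lemma ultrastrong_point H (y : H -> H) (F : set_system (H -> H)) (FF : ProperFilter F) :
  (forall x : nat -> H, sqsum x -> forall e : R, 0 < e -> \forall S \near F,
      forall n, \sum_(k < n) nrm (S (x k) - y (x k)) ^+ 2 <= e) ->
  forall v (e : R), 0 < e -> \forall S \near F, nrm (y v - S v) <= e.
Proof.
move=> h v e e0; have e2 : 0 < e ^+ 2 by rewrite exprn_gt0.
have := h (l2f (l2d 0 v)) (l2_sqsum _) _ e2; apply: filterS => S /(_ 1%N).
rewrite big_ord1 l2dE eqxx nrmBC => h'.
by rewrite -(@ler_pXn2r _ 2) // ?nnegrE ?nrm_ge0 ?ltW.
Qed.

Lemma bicommutant H (A : set (H -> H)) : star_algebra A -> A idfun ->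
  commutant (commutant A) `<=` strong_closure A.
Proof.
move=> sA A1 y cy; have [F [PF FA hF]] := ultrastrong_filter sA A1 cy.
by apply: (strong_closure_mk _ PF FA); [case: cy | exact: ultrastrong_point].
Qed.

Lemma vn_bicommutant H (N : set (H -> H)) : von_neumann_algebra N ->
  commutant (commutant N) `<=` N.
Proof. by move=> [sN N1 cN] y /(bicommutant sN N1)/cN. Qed.

Lemma opn_strong H K (X : set (H -> K)) T : norm_closure X T -> bounded_op T ->
  strong_closure X T.
Proof.
move=> /norm_closureP hT bT.
pose B (e : R) : set (H -> K) := [set S | X S /\ opn (T - S) e].
apply: (@strong_closure_mk _ _ X (filter_from [set e | 0 < e] B)) => //.
- apply: filter_from_proper; last by move=> e /hT[S XS h]; exists S.
  apply: filter_from_filter; first by exists 1; rewrite /= ltr01.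
  move=> a b /= a0 b0; exists (Num.min a b); first by rewrite /= lt_min a0.
  by move=> S [XS h]; split; split => //; apply: opnW h; rewrite ge_min lexx ?orbT.
- by exists 1; [rewrite /= ltr01 | move=> S []].
- move=> v e e0; have n0 : 0 < nrm v + 1 by rewrite ltr_wpDl ?nrm_ge0.
  exists (e / (nrm v + 1)); first by rewrite /= divr_gt0.
  move=> S [_ /(_ v)] /le_trans; apply; rewrite mulrAC ler_pdivrMr // ler_pM2l //; lra.
Qed.

Lemma vn_cstar H (N : set (H -> H)) : von_neumann_algebra N -> cstar_algebra N.
Proof.
move=> [sN N1 cN]; split => // T hT; apply: cN; apply: opn_strong => //.
by case: (clin_bop H H) => _ _; apply; move: hT => /norm_closureP hT;
  apply/norm_closureP => e /hT[S NS h]; exists S => //; exact: star_algebra_bounded NS.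
Qed.

(** The strong closure is identified with the bicommutant, for which closure under products and
    adjoints is visible. *)
Lemma vn_strong_closure H (A : set (H -> H)) : star_algebra A -> A idfun ->
  von_neumann_algebra (strong_closure A).
Proof.
move=> sA A1; have E : strong_closure A = commutant (commutant A).
  by apply/seteqP; split; [exact: strong_closure_bicomm | exact: bicommutant].
have sub : A `<=` commutant (commutant A).
  move=> S AS; split; first exact: star_algebra_bounded AS.
  by move=> T [_ cT]; rewrite cT.
have sC : star_algebra (commutant (commutant A)).
  split.
  - by move=> S [].
  - exact: (sub _ (star_algebra0 sA)).
  - move=> c S T hS hT; have [bS _] := hS; have [bT _] := hT.
    split; first exact: bop_lin.
    move=> U cU; have [bU _] := cU; apply/funext => x.
    change (U (c *: S x + T x) = c *: S (U x) + T (U x)); rewrite (bopL bU).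
    by rewrite (commutantE x hS cU) (commutantE x hT cU).
  - by move=> S T; exact: commutant_comp.
  - move=> S [bS hS]; split; first exact: bop_adj.
    move=> T cT; have cT' := commutant_adj sA cT; have [bT _] := cT.
    have /(congr1 (@adj _ _ _)) := hS _ cT'; have bT' := bop_adj bT.
    by rewrite (adj_comp bT' bS) (adj_comp bS bT') (adjK bT) => ->.
rewrite E; split => //; first exact/sub.
move=> y /strong_closure_bicomm [by_ hy]; split => // T cT; apply: hy.
by split; [case: cT | move=> S [_ hS]; rewrite hS].
Qed.

End Commutants.

(** * Normal functionals and weak limits *)

Section Normal.
Variable R : realType.
Implicit Types H K L : hilbertType R.
Local Notation C := R[i].

Lemma sqsum_cvg H (x : nat -> H) :
  cvgn (fun n => \sum_(0 <= k < n) (`|x k| ^+ 2 : C^o)) <-> sqsum x.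
Proof.
have E n : \sum_(0 <= k < n) (`|x k| ^+ 2 : C^o) = (psum x n)%:C.
  rewrite big_mkord /psum rmorph_sum; apply: eq_bigr => k _.
  by rewrite nrmE -rmorphXn.
under eq_fun do rewrite E.
split=> [/cvg_ex[l hl]|sx].
  have [N _ hN] := (iffLR (@cvg_nrm _ C^o _ _ _ (fun n => (psum x n)%:C) l)) hl 1 ltr01.
  exists (complex.Re l + 1) => n.
  have [nN|/ltnW Nn] := leqP n N; last first.
    have := le_trans (Re_le_nrm _) (hN n Nn); rewrite raddfB /= ler_norml => /andP[]; lra.
  apply: le_trans (psum_le x nN) _.
  have := le_trans (Re_le_nrm _) (hN N (leqnn N)); rewrite raddfB /= ler_norml => /andP[]; lra.
have [l hl] : exists l, forall e : R, 0 < e -> exists N, forall n, (N <= n)%N ->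
   nrm ((psum x n)%:C - l : C^o) <= e.
  apply: complete_seqC => e e0; have [N hN] := psum_tail sx e0.
  exists N => m n Nm Nn; wlog mn : m n Nm Nn / (n <= m)%N.
    by move=> h; have [|/ltnW] := leqP n m; [exact: h | rewrite (@nrmBC _ C^o); apply: h].
  rewrite -rmorphB nrm_real ?subr_ge0 ?psum_le //.
  have := hN m Nm; have := psum_le x Nn; lra.
apply/cvg_ex; exists l; apply/(@cvg_nrm _ C^o) => e e0.
by have [N hN] := hl e e0; exists N => // n Nn; rewrite (@nrmBC _ C^o); exact: hN.
Qed.

Definition nfun H (w : (H -> H) -> C) (x y : nat -> H) := [/\ sqsum x, sqsum y &
  forall T, bounded_op T -> forall e : R, 0 < e -> exists N, forall n, (N <= n)%N ->
    nrm (\sum_(k < n) ipd (T (x k)) (y k) - w T : C^o) <= e].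

Lemma normalP H (w : (H -> H) -> C^o) :
  normal_functional w <-> exists x y, nfun w x y.
Proof.
split=> -[x [y [hx hy h]]]; exists x, y; split; try exact/sqsum_cvg.
  move=> T bT e e0.
  have [N _ hN] := (iffLR (@cvg_nrm _ C^o _ _ _ _ _)) (h T bT) e e0.
  by exists N => n Nn; have := hN n Nn; rewrite (@nrmBC _ C^o) big_mkord.
move=> T bT; apply/(@cvg_nrm _ C^o) => e e0; have [N hN] := h T bT e e0.
by exists N => // n Nn; rewrite (@nrmBC _ C^o) big_mkord; exact: hN.
Qed.

Lemma normal_vec H (u v : H) : normal_functional (fun T => ipd (T u) v : C^o).
Proof.
have sq (z : H) : sqsum (fun k => if k == 0%N then z else 0).
  exists (nrm z ^+ 2) => -[|n]; first by rewrite /psum big_ord0 sqr_ge0.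
  by rewrite /psum big_ord_recl big1 ?addr0 //= => k _; rewrite nrm0 expr0n.
apply/normalP; exists (fun k => if k == 0%N then u else 0), (fun k => if k == 0%N then v else 0).
split; try exact: sq.
move=> T bT e e0; exists 1%N => -[//|n] _.
rewrite big_ord_recl big1 ?addr0 /= => [|k _]; last by rewrite (bop0 bT) ipd0l.
by rewrite subrr (@nrm0 _ C^o) ltW.
Qed.

Lemma sqsum_bop H K (x : nat -> H) (B : H -> K) : bounded_op B -> sqsum x ->
  sqsum (fun k => B (x k)).
Proof.
move=> bB [M hM]; have [m m0 hm] := bop_opn bB; exists (m ^+ 2 * M) => n.
apply: (@le_trans _ _ (m ^+ 2 * psum x n)); last by rewrite ler_wpM2l ?sqr_ge0.
rewrite /psum mulr_sumr ler_sum // => k _; rewrite -exprMn.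
by apply: lerXn2r; rewrite ?nnegrE ?mulr_ge0 ?nrm_ge0 ?(ltW m0) ?hm.
Qed.

Lemma normal_comp H K (w : (H -> H) -> C^o) (A : K -> H) (B : H -> K) :
  bounded_op A -> bounded_op B -> normal_functional w ->
  normal_functional (fun T : K -> K => w (A \o T \o B)).
Proof.
move=> bA bB /normalP[x [y [hx hy h]]]; apply/normalP.
exists (fun k => B (x k)), (fun k => adj A (y k)); split.
- exact: sqsum_bop.
- by apply: sqsum_bop => //; exact: bop_adj.
- move=> T bT e e0; have bABT : bounded_op (A \o T \o B).
    by apply: bop_comp => //; exact: bop_comp.
  have [N hN] := h _ bABT e e0; exists N => n Nn.
  rewrite (eq_bigr (fun k : 'I_n => ipd ((A \o T \o B) (x k)) (y k))); first exact: hN.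
  by move=> k _; rewrite -adjP.
Qed.

Lemma normal_diff H (w : (H -> H) -> C) x y S T e : nfun w x y ->
  bounded_op S -> bounded_op T -> 0 < e ->
  (forall n, nrm (\sum_(k < n) ipd (S (x k) - T (x k)) (y k) : C^o) <= e) ->
  nrm (w S - w T : C^o) <= e.
Proof.
move=> [_ _ h] bS bT e0 hn; apply/ler_addgt0Pr => d d0.
have [N hN] := h S bS _ (divr_gt0 d0 (ltr0Sn R 1)).
have [N' hN'] := h T bT _ (divr_gt0 d0 (ltr0Sn R 1)).
pose n := maxn N N'.
have h1 := hN n (leq_maxl _ _); have h2 := hN' n (leq_maxr _ _).
have -> : w S - w T = (\sum_(k < n) ipd (S (x k) - T (x k)) (y k)) -
   ((\sum_(k < n) ipd (S (x k)) (y k) - w S) - (\sum_(k < n) ipd (T (x k)) (y k) - w T)).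
  under eq_bigr do rewrite ipdBl.
  rewrite sumrB; ring.
rewrite (le_trans (@nrmD _ C^o _ _)) // lerD // nrmN (le_trans (@nrmD _ C^o _ _)) //.
by rewrite nrmN [leRHS](splitr d) lerD.
Qed.

(** Cauchy-Schwarz for partial sums in weighted form, which avoids square roots; the weight t is
    tuned by the caller. *)
Lemma sum_cs H (a b : nat -> H) (t : R) n : 0 < t ->
  2 * nrm (\sum_(k < n) ipd (a k) (b k) : C^o) <=
    t * psum a n + t^-1 * psum b n.
Proof.
move=> t0; elim: n => [|n IHn].
  by rewrite /psum !big_ord0 nrm0 !mulr0 addr0.
rewrite !psumS big_ord_recr /=.
have h1 := @nrmD _ C^o (\sum_(k < n) ipd (a k) (b k)) (ipd (a n) (b n)).
have h2 := cauchy_schwarz (a n) (b n).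
set p := nrm (a n) in h2 *; set q := nrm (b n) in h2 *.
have ti0 : 0 < t^-1 by rewrite invr_gt0.
have h3 : 2 * (p * q) <= t * p ^+ 2 + t^-1 * q ^+ 2.
  have h4 : 0 <= t * (p - t^-1 * q) ^+ 2 by rewrite mulr_ge0 ?sqr_ge0 ?ltW.
  have h5 : t * (p - t^-1 * q) ^+ 2 = t * p ^+ 2 - 2 * (p * q) + t^-1 * q ^+ 2.
    by field; rewrite gt_eqF.
  by move: h4; rewrite h5; lra.
rewrite !mulrDr.
have := lerD IHn (le_trans (ler_wpM2l (ler0n R 2) h2) h3).
lra.
Qed.

(** [normal_on] is tested on nets all of whose members lie in M. The ultrastrong filter ignores
    operators outside A, so those indices are sent to y itself. *)
Lemma sigma_weak_ultrastrong H (A : set (H -> H)) y : star_algebra A -> A idfun ->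
  commutant (commutant A) y ->
  exists F : set_system (H -> H), [/\ ProperFilter F, F A &
    forall M : set (H -> H), A `<=` M -> M y ->
    exists x_ : (H -> H) -> (H -> H), [/\ forall S, M (x_ S),
      forall S, A S -> x_ S = S & sigma_weak_cvg F x_ y]].
Proof.
move=> sA A1 cy; have [F [PF FA hF]] := ultrastrong_filter sA A1 cy.
exists F; split => // M AM My.
pose x_ S := if `[< A S >] then S else y.
have xA S : A S -> x_ S = S by move=> AS; rewrite /x_ asboolT.
exists x_; split => //.
  by move=> S; rewrite /x_; case: asboolP => // /AM.
move=> w /normalP[u [v nw]]; have [su sv hw] := nw.
apply/(@cvg_nrm _ C^o) => e e0; have [V hV] := sv.
(* With this weight each of the two terms of [sum_cs] is at most e. *)
pose t := (V + 1) / e.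
have V0 : 0 <= V by exact: le_trans (psum_ge0 v 0) (hV 0%N).
have t0 : 0 < t by rewrite divr_gt0 //; lra.
have := hF u su _ (divr_gt0 e0 t0); apply: filterS2 FA => S AS hS.
rewrite xA // (@nrmBC _ C^o); apply: (normal_diff nw) => //.
- exact: star_algebra_bounded AS.
- by case: cy.
- move=> n; have := @sum_cs H (fun k => S (u k) - y (u k)) v t n t0.
  have h1 : t * psum (fun k => S (u k) - y (u k)) n <= e.
    by rewrite mulrC -ler_pdivlMr //; exact: hS.
  have h2 : t^-1 * psum v n <= e.
    rewrite /t invf_div mulrAC ler_pdivrMr ?ler_pM2l //; last lra.
    by have := hV n; lra.
  lra.
Qed.

(** On bounded nets weak convergence is sigma-weak convergence: the tail of the defining series is
    small uniformly in the index, and finitely many terms remain. *)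
Lemma sigma_weak_bounded H I (F : set_system I) (x_ : I -> H -> H) x M :
  ProperFilter F -> (forall i, bounded_op (x_ i)) -> bounded_op x ->
  (forall i, opn (x_ i) M) ->
  (forall u v (e : R), 0 < e -> \forall i \near F, nrm (ipd (x_ i u) v - ipd (x u) v : C^o) <= e) ->
  sigma_weak_cvg F x_ x.
Proof.
move=> PF bx_ bx hM hx w /normalP[u [v nw]]; have [su sv hw] := nw.
have [m m0 hm] := bop_opn bx.
suff h e : 0 < e -> \forall i \near F, nrm (w (x_ i) - w x : C^o) <= 2 * e.
  apply/(@cvg_nrm _ C^o) => e e0; have e2 : 0 < e / 2 by rewrite divr_gt0.
  apply: filterS (h _ e2) => i; rewrite (@nrmBC _ C^o) => /le_trans; apply.
  by rewrite mulrC divfK.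
move=> e0.
pose c := `|M| + m; have c0 : 0 < c by rewrite ltr_wpDl.
(* The differences x_i - x have norm at most c, so the tail of u is cut at e / c^2 to absorb the
   factor c^2. *)
have [N1 hN1] := psum_tail su (divr_gt0 e0 (exprn_gt0 2 c0)).
have [N2 hN2] := psum_tail sv e0.
pose N := maxn N1 N2.
have nearp p : \forall i \near F, forall k, (k < p)%N ->
    nrm (ipd (x_ i (u k) - x (u k)) (v k) : C^o) <= e / N.+1%:R.
  elim: p => [|p IHp]; first by apply: filterE => i k.
  have e' : 0 < e / N.+1%:R by rewrite divr_gt0.
  apply: filterS2 IHp (hx (u p) (v p) _ e') => i h1 h2 k; rewrite ltnS leq_eqVlt.
  by move=> /orP[/eqP ->|/h1 //]; rewrite ipdBl.
apply: filterS (nearp N) => i hi; apply: (normal_diff nw) => //; first by rewrite mulr_gt0.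
pose s n := \sum_(k < n) ipd (x_ i (u k) - x (u k)) (v k).
have h1 n : (n <= N)%N -> nrm (s n : C^o) <= n%:R * (e / N.+1%:R).
  elim: n => [|n IHn] nN; first by rewrite /s big_ord0 nrm0 mul0r.
  rewrite /s big_ord_recr /= (le_trans (@nrmD _ C^o _ _)) // -natr1 mulrDl mul1r.
  by rewrite lerD ?hi // IHn // ltnW.
have h2 n : (n <= N)%N -> nrm (s n : C^o) <= e.
  move=> nN; apply: (le_trans (h1 n nN)); rewrite mulrCA ler_piMr ?(ltW e0) //.
  by rewrite ler_pdivrMr // mul1r ler_nat leqW.
have h3 n : 2 * nrm (s (N + n)%N : C^o) <= 2 * e + c ^+ 2 * (psum u (N + n) - psum u N) +
    (psum v (N + n) - psum v N).
  elim: n => [|n IHn].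
    by rewrite addn0 !subrr mulr0 !addr0 ler_pM2l // h2.
  rewrite addnS !psumS /s big_ord_recr /=.
  have k1 := @nrmD _ C^o (s (N + n)%N) (ipd (x_ i (u (N + n)%N) - x (u (N + n)%N)) (v (N + n)%N)).
  have k2 := cauchy_schwarz (x_ i (u (N + n)%N) - x (u (N + n)%N)) (v (N + n)%N).
  set p := nrm (x_ i _ - _) in k2; set q := nrm (v _) in k2 *.
  have k3 : p <= c * nrm (u (N + n)%N).
    rewrite /p (le_trans (nrmD _ _)) // nrmN /c mulrDl lerD ?hm //.
    by apply: (le_trans (hM i _)); rewrite ler_wpM2r ?nrm_ge0 // ler_norm.
  have k4 : 2 * (p * q) <= p ^+ 2 + q ^+ 2 by have := sqr_ge0 (p - q); lra.
  have k5 : p ^+ 2 <= c ^+ 2 * nrm (u (N + n)%N) ^+ 2.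
    by rewrite -exprMn lerXn2r ?nnegrE ?nrm_ge0 ?mulr_ge0 ?nrm_ge0 ?(ltW c0).
  by rewrite -/(s _); move: IHn; lra.
move=> n; rewrite -/(s n); have [nN|/ltnW Nn] := leqP n N.
  by apply: (le_trans (h2 n nN)); lra.
rewrite -(subnKC Nn); move: (n - N)%N (h3 (n - N)%N) => j h4.
have h5 : c ^+ 2 * (psum u (N + j) - psum u N) <= e.
  rewrite mulrC -ler_pdivlMr ?exprn_gt0 //.
  have a1 := hN1 (N + j)%N (leq_trans (leq_maxl _ _) (leq_addr _ _)).
  by have := psum_le u (leq_maxl N1 N2); rewrite -/N; lra.
have h6 : psum v (N + j) - psum v N <= e.
  have a1 := hN2 (N + j)%N (leq_trans (leq_maxr _ _) (leq_addr _ _)).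
  by have := psum_le v (leq_maxr N1 N2); rewrite -/N; lra.
lra.
Qed.

End Normal.

(** * Extension of identities by normality; limits along ultrafilters *)

Section Ultra.
Variable R : realType.
Implicit Types H K L : hilbertType R.
Local Notation C := R[i].

Definition swc H (M : set (H -> H)) (p : (H -> H) -> C) : Prop :=
  forall (I : Type) (F : set_system I), ProperFilter F ->
  forall (x_ : I -> H -> H) x, (forall i, M (x_ i)) -> M x ->
    sigma_weak_cvg F x_ x ->
  forall e : R, 0 < e -> \forall i \near F, nrm (p x - p (x_ i) : C^o) <= e.

Lemma swc_normal H K (M : set (H -> H)) (f : (H -> H) -> (K -> K)) w :
  normal_on M f -> normal_functional w -> swc M (fun T => w (f T)).
Proof.
move=> nf nw I F PF x_ x hx Mx h; apply/(@cvg_nrm _ C^o).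
exact: (nf I F PF x_ x hx Mx h w nw).
Qed.

Lemma normal_on_id H (M : set (H -> H)) : normal_on M id.
Proof. by []. Qed.

Lemma lim_uniqC I (F : set_system I) (r : I -> C) a b : ProperFilter F ->
  (forall e : R, 0 < e -> \forall i \near F, nrm (a - r i : C^o) <= e) ->
  (forall e : R, 0 < e -> \forall i \near F, nrm (b - r i : C^o) <= e) -> a = b.
Proof.
move=> PF ha hb; apply/eqP; rewrite -subr_eq0; apply/eqP.
apply: (@le_nrm0 _ C^o) => e e0; have e2 : 0 < e / 2 by rewrite divr_gt0.
have [i [h1 h2]] := filter_ex (filterI (ha _ e2) (hb _ e2)).
rewrite (le_trans (@nrmB _ C^o _ _ (r i))) // [leRHS](splitr e) lerD //.
by rewrite (@nrmBC _ C^o).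
Qed.

Lemma swc_agree H (A M : set (H -> H)) (p q : (H -> H) -> C) y :
  star_algebra A -> A idfun -> A `<=` M -> M y -> commutant (commutant A) y ->
  swc M p -> swc M q -> (forall S, A S -> p S = q S) -> p y = q y.
Proof.
move=> sA A1 AM My cy sp sq pq.
have [F [PF FA h]] := sigma_weak_ultrastrong sA A1 cy.
have [x_ [xM xA xy]] := h M AM My.
have hp := sp _ F PF x_ y xM My xy; have hq := sq _ F PF x_ y xM My xy.
apply: (lim_uniqC PF (r := fun i => p (x_ i))) => // e e0.
apply: filterS2 FA (hq e e0) => S AS hS.
by move: hS; rewrite /= !(xA S AS) (pq S AS).
Qed.

Lemma swc_ext H (M : set (H -> H)) (p q : (H -> H) -> C) :
  (forall x, M x -> p x = q x) -> swc M p -> swc M q.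
Proof.
move=> pq sp I F PF x_ x hx Mx h e e0.
by apply: filterS (sp I F PF x_ x hx Mx h e e0) => i; rewrite !pq.
Qed.

Lemma swc_op H K L L' (M : set (H -> H)) (f : (H -> H) -> (K -> K))
    (A : K -> L') (B : L -> K) u v :
  normal_on M f -> (forall x, M x -> bounded_op (f x)) ->
  bounded_op A -> bounded_op B ->
  swc M (fun T => ipd (A (f T (B u))) v).
Proof.
move=> nf bf bA bB; pose w (S : K -> K) : C^o := ipd (S (B u)) (adj A v).
apply: (swc_ext (p := fun T => w (f T))).
  by move=> x Mx; rewrite /w -adjP.
by apply: swc_normal => //; exact: normal_vec.
Qed.

(** The common density argument for the von Neumann algebra of G and for von Neumann tensor
    products: matrix coefficients of normal maps are sigma-weakly continuous, so an identity on A
    persists on the part of its bicommutant inside M. *)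
Lemma normal_agree H K K' L L' (A M : set (H -> H)) (f : (H -> H) -> (K -> K))
    (g : (H -> H) -> (K' -> K')) (P : K -> L') (Q : K' -> L') (B : L -> K) (B' : L -> K') y :
  star_algebra A -> A idfun -> A `<=` M -> M y -> commutant (commutant A) y ->
  normal_on M f -> (forall x, M x -> bounded_op (f x)) ->
  normal_on M g -> (forall x, M x -> bounded_op (g x)) ->
  bounded_op P -> bounded_op B -> bounded_op Q -> bounded_op B' ->
  (forall S, A S -> P \o f S \o B = Q \o g S \o B') ->
  P \o f y \o B = Q \o g y \o B'.
Proof.
move=> sA A1 AM My cy nf bf ng bg bP bB bQ bB' h.
apply/funext => u /=; apply/ipd_inj => v.
apply: (@swc_agree _ A M (fun T => ipd (P (f T (B u))) v)
  (fun T => ipd (Q (g T (B' u))) v)) => //.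
- exact: (@swc_op _ _ _ _ M f P B u v).
- exact: (@swc_op _ _ _ _ M g Q B' u v).
- by move=> S AS; have /(congr1 (fun g => g u)) /= -> := h S AS.
Qed.

Lemma ultra_limR I (F : set_system I) (r : I -> R) M : UltraFilter F ->
  (forall i, `|r i| <= M) ->
  exists l, forall e : R, 0 < e -> \forall i \near F, `|l - r i| <= e.
Proof.
move=> UF hM; pose S := [set t | \forall i \near F, t <= r i].
have SM : S (- M).
  by apply: filterE => i; have := hM i; rewrite ler_norml => /andP[].
have Sb : has_sup S.
  split; first by exists (- M).
  exists M => t St; have [i hi] := filter_ex St.
  by rewrite (le_trans hi) // (le_trans _ (hM i)) // ler_norm.
exists (sup S) => e e0.
have [t St ht] := sup_adherent e0 Sb.
have h2 : \forall i \near F, r i < sup S + e.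
  have [h|h] := in_ultra_setVsetC [set i | sup S + e <= r i] UF.
    by have := ub_le_sup Sb.2 h; lra.
  by apply: filterS h => i /= /negP; rewrite -ltNge.
apply: filterS2 St h2 => i h1 h2; rewrite ler_norml; apply/andP; split; lra.
Qed.

Lemma ultra_limC I (F : set_system I) (r : I -> C) M : UltraFilter F ->
  (forall i, nrm (r i : C^o) <= M) ->
  exists l, forall e : R, 0 < e -> \forall i \near F, nrm (l - r i : C^o) <= e.
Proof.
move=> UF hM.
have [a ha] : exists a, forall e : R, 0 < e -> \forall i \near F,
    `|a - complex.Re (r i)| <= e.
  by apply: (@ultra_limR _ _ _ M) => i; apply: le_trans (hM i); exact: Re_le_nrm.
have [b hb] : exists b, forall e : R, 0 < e -> \forall i \near F,
    `|b - complex.Im (r i)| <= e.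
  by apply: (@ultra_limR _ _ _ M) => i; apply: le_trans (hM i); exact: Im_le_nrm.
exists (a +i* b) => e e0; have e2 : 0 < e / 2 by rewrite divr_gt0.
apply: filterS2 (ha _ e2) (hb _ e2) => i h1 h2.
rewrite (le_trans (nrm_ReIm _)) // [leRHS](splitr e).
by case: (r i) h1 h2 => u v /= h1 h2; exact: lerD.
Qed.

(** Weak compactness of balls. Bounded inner products converge along an ultrafilter, and Riesz
    represents the limiting functional. *)
Lemma ultra_weak I (F : set_system I) H (x : I -> H) M : UltraFilter F ->
  (forall i, nrm (x i) <= M) ->
  exists2 y, nrm y <= M & forall v (e : R), 0 < e ->
    \forall i \near F, nrm (ipd y v - ipd (x i) v : C^o) <= e.
Proof.
move=> UF hM; have PF : ProperFilter F by exact: ultra_proper.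
have M0 : 0 <= M.
  by have [i _] := filter_ex (@filterT _ F _); apply: le_trans (hM i); exact: nrm_ge0.
have bd v i : nrm (ipd v (x i) : C^o) <= M * nrm v.
  by rewrite mulrC (le_trans (cauchy_schwarz _ _)) // ler_wpM2l ?nrm_ge0.
have [f hf] := boolp.choice (fun v => ultra_limC UF (bd v)).
have f_lin (c : C) v w : f (c *: v + w) = c * f v + f w.
  apply: (lim_uniqC PF (hf _)) => e e0.
  have c0 : 0 < nrm (c : C^o) + 1 by rewrite ltr_wpDl ?nrm_ge0.
  have e2 : 0 < e / 2 by rewrite divr_gt0.
  have e1 : 0 < e / 2 / (nrm (c : C^o) + 1) by rewrite divr_gt0.
  apply: filterS2 (hf v _ e1) (hf w _ e2) => i h1 h2.
  rewrite ipdDl ipdZl opprD addrACA -mulrBr (le_trans (@nrmD _ C^o _ _)) // nrmM.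
  rewrite [leRHS](splitr e) lerD //; move: h1; rewrite ler_pdivlMr // => h1.
  by have := @nrm_ge0 _ C^o (f v - ipd v (x i)); lra.
have f_bd v : nrm (f v : C^o) <= M * nrm v.
  apply/ler_addgt0Pr => e e0; have [i hi] := filter_ex (hf v e e0).
  have := @nrmD _ C^o (f v - ipd v (x i)) (ipd v (x i)); rewrite subrK => /le_trans; apply.
  by rewrite addrC lerD.
have [y hy] := riesz f_lin f_bd; exists y.
  have := f_bd y; rewrite hy ipdxx nrm_real ?sqr_ge0 // expr2.
  have [->|n0] := eqVneq (nrm y) 0; first by [].
  by rewrite ler_pM2r // lt_neqAle eq_sym n0 nrm_ge0.
move=> v e e0; apply: filterS (hf v e e0) => i; rewrite hy.
by rewrite (ipdC y) (ipdC (x i)) -rmorphB nrm_conj.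
Qed.

Lemma ultra_op I (F : set_system I) H K (T_ : I -> H -> K) M : UltraFilter F ->
  0 <= M -> (forall i, bounded_op (T_ i)) -> (forall i, opn (T_ i) M) ->
  exists T, [/\ bounded_op T, opn T M & forall u v (e : R), 0 < e ->
    \forall i \near F, nrm (ipd (T u) v - ipd (T_ i u) v : C^o) <= e].
Proof.
move=> UF M0 bT hM; have PF : ProperFilter F by exact: ultra_proper.
have h u : exists y, nrm y <= M * nrm u /\ forall v (e : R), 0 < e ->
    \forall i \near F, nrm (ipd y v - ipd (T_ i u) v : C^o) <= e.
  have [|y h1 h2] := @ultra_weak I F K (fun i => T_ i u) (M * nrm u) UF.
    by move=> i; exact: hM.
  by exists y.
have [T hT] := boolp.choice h.
have oT : opn T M by move=> u; have [] := hT u.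
exists T; split => //; last by move=> u; have [] := hT u.
apply: (@bop_mk _ _ _ _ M) => // c u w.
apply/ipd_inj => v; apply: (lim_uniqC PF ((hT _).2 v)) => e e0.
have c0 : 0 < nrm (c : C^o) + 1 by rewrite ltr_wpDl ?nrm_ge0.
have e2 : 0 < e / 2 by rewrite divr_gt0.
have e1 : 0 < e / 2 / (nrm (c : C^o) + 1) by rewrite divr_gt0.
apply: filterS2 ((hT u).2 v _ e1) ((hT w).2 v _ e2) => i h1 h2.
rewrite (bopL (bT i)) !ipdDl !ipdZl opprD addrACA -mulrBr.
rewrite (le_trans (@nrmD _ C^o _ _)) // nrmM.
rewrite [leRHS](splitr e) lerD //; move: h1; rewrite ler_pdivlMr // => h1.
by have := @nrm_ge0 _ C^o (ipd (T u) v - ipd (T_ i u) v); lra.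
Qed.

End Ultra.

(** Proves vector identities by pairing both sides with an arbitrary vector, which leaves a goal for
    [ring]. *)
Ltac hring := apply/ipd_inj => ?; rewrite ?(ipdDl, ipdBl, ipdZl, ipdNl, ipd0l); ring.

(** * Square roots and resolvents in a C*-algebra *)

Section Calculus.
Variable R : realType.
Implicit Types H K L : hilbertType R.
Local Notation C := R[i].

Lemma geometric_tail K (x : nat -> K) M q : 0 <= M -> 0 <= q -> q < 1 ->
  (forall n, nrm (x n.+1 - x n) <= M * q ^+ n) ->
  forall m d, nrm (x (m + d)%N - x m) <= M * q ^+ m / (1 - q).
Proof.
move=> M0 q0 q1 h; have q1' : 0 < 1 - q by lra.
move=> m d; rewrite ler_pdivlMr //.
suff : nrm (x (m + d)%N - x m) * (1 - q) <= M * q ^+ m - M * q ^+ (m + d).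
  by move=> /le_trans; apply; rewrite gerBl mulr_ge0 ?exprn_ge0.
elim: d => [|d IHd]; first by rewrite addn0 !subrr nrm0 mul0r.
rewrite addnS; have h1 := nrmB (x (m + d).+1) (x m) (x (m + d)%N).
have h2 := h (m + d)%N.
have h3 := ler_wpM2r (ltW q1') (le_trans h1 (lerD h2 (lexx _))).
apply: (le_trans h3); rewrite mulrDl exprS.
by have := IHd; move: (q ^+ (m + d)) (q ^+ m) => a b; lra.
Qed.

Lemma geom_small (M q e : R) : 0 <= M -> 0 <= q -> q < 1 -> 0 < e ->
  exists n, M * q ^+ n / (1 - q) <= e.
Proof.
move=> M0 q0 q1 e0; have q1' : 0 < 1 - q by lra.
have M1 : 0 < M + 1 by lra.
have /(@cvgrPdist_le _ R^o) h : (fun n => q ^+ n) @ \oo --> (0 : R).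
  by apply: cvg_expr; rewrite ger0_norm.
have [N _ hN] := h _ (divr_gt0 (mulr_gt0 e0 q1') M1); exists N.
rewrite ler_pdivrMr //; have := hN N (leqnn N).
rewrite sub0r normrN ger0_norm ?exprn_ge0 // ler_pdivlMr // => h1.
by have := exprn_ge0 N q0; move: h1; move: (q ^+ N) => a; lra.
Qed.

Lemma geometric_op H K (Y : set (H -> K)) (T_ : nat -> H -> K) M q :
  clin Y -> Y `<=` @bounded_op R H K -> (forall n, Y (T_ n)) ->
  0 <= M -> 0 <= q -> q < 1 ->
  (forall n, opn (T_ n.+1 - T_ n) (M * q ^+ n)) ->
  exists2 T, Y T & forall n, opn (T - T_ n) (M * q ^+ n / (1 - q)).
Proof.
move=> cY bY hY M0 q0 q1 h.
have tl x m d : nrm (T_ (m + d)%N x - T_ m x) <= M * nrm x * q ^+ m / (1 - q).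
  apply: (@geometric_tail K (fun n => T_ n x)); rewrite ?mulr_ge0 ?nrm_ge0 //.
  by move=> n; rewrite mulrAC; exact: h.
have lim x : exists y, forall e : R, 0 < e -> exists N, forall n, (N <= n)%N ->
    nrm (T_ n x - y) <= e.
  apply: complete_seq => e e0; have e2 : 0 < e / 2 by rewrite divr_gt0.
  have [N hN] := geom_small (mulr_ge0 M0 (nrm_ge0 x)) q0 q1 e2.
  exists N => m n Nm Nn; rewrite (le_trans (nrmB _ _ (T_ N x))) // [leRHS](splitr e) lerD //.
    by rewrite -(subnKC Nm) (le_trans (tl _ _ _)).
  by rewrite nrmBC -(subnKC Nn) (le_trans (tl _ _ _)).
have [T hT] := boolp.choice lim.
have oT n : opn (T - T_ n) (M * q ^+ n / (1 - q)).
  move=> x; apply/ler_addgt0Pr => e e0; have [N hN] := hT x e e0.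
  have := nrmB (T x) (T_ n x) (T_ (n + N)%N x) => /le_trans; apply.
  rewrite addrC lerD //; last by rewrite nrmBC hN ?leq_addl.
  by apply: (le_trans (tl _ _ _)); rewrite -!mulrA !(mulrCA (nrm x)) ![nrm x * _]mulrC !mulrA.
exists T => //; apply: (clin_cl cY) => e e0.
have [N hN] := geom_small M0 q0 q1 e0; exists (T_ N) => //.
exact: opnW hN (oT N).
Qed.

Lemma neumann H (A : set (H -> H)) S q : cstar_algebra A -> A idfun -> A S ->
  0 <= q -> q < 1 -> opn S q ->
  exists T, [/\ A T, forall x, T x - S (T x) = x & forall x, T x - T (S x) = x].
Proof.
move=> cA A1 AS q0 q1 oS; have [sA _] := cA; have cl := cstar_clin cA.
have bA := star_algebra_bounded sA; have bS := bA S AS.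
pose T_ := fix T_ n : H -> H := if n is n.+1 then idfun + (S \o T_ n) else 0.
have T_S n x : T_ n.+1 x = x + S (T_ n x) by [].
have AT n : A (T_ n).
  elim: n => [|n IHn] /=; first exact: star_algebra0 sA.
  exact: (clinD cl A1 (star_algebra_mul sA AS IHn)).
have T_C n : forall x, T_ n (S x) = S (T_ n x).
  elim: n => [|n IHn] x; first by rewrite /T_ !op0E (bop0 bS).
  by rewrite !T_S IHn (bopD _ _ bS).
have dT n : opn (T_ n.+1 - T_ n) (1 * q ^+ n).
  elim: n => [|n IHn] x.
    by rewrite mul1r expr0 mul1r -[(_ - _) x]/(x + S 0 - 0) (bop0 bS) addr0 subr0.
  rewrite -[(_ - _) x]/(x + S (T_ n.+1 x) - (x + S (T_ n x))) opprD addrACA subrr add0r.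
  rewrite -(bopB _ _ bS) (le_trans (oS _)) // exprS mulrCA -mulrA ler_wpM2l //; exact: IHn.
have [T hT oT] := geometric_op cl bA AT ler01 q0 q1 dT.
have bT := bA T hT.
have d0 n : 0 <= 1 * q ^+ n / (1 - q).
  by rewrite mul1r divr_ge0 ?exprn_ge0 // subr_ge0 ltW.
have E x : T x = x + S (T x).
  apply/eqP; rewrite -subr_eq0; apply/eqP; apply: le_nrm0 => e e0.
  have M0 : 0 <= 2 * nrm x by rewrite mulr_ge0 ?nrm_ge0.
  have [n hn] := geom_small M0 q0 q1 e0.
  have -> : T x - (x + S (T x)) = (T x - T_ n.+1 x) - S (T x - T_ n x).
    rewrite T_S (bopB _ _ bS); hring.
  rewrite (le_trans (nrmD _ _)) // nrmN.
  have h1 := oT n.+1 x; have h2 := le_trans (oS (T x - T_ n x)) (ler_wpM2l q0 (oT n x)).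
  have h3 : q * (1 * q ^+ n / (1 - q) * nrm x) <= 1 * q ^+ n / (1 - q) * nrm x.
    by apply: ler_piMl; rewrite ?(ltW q1) // mulr_ge0 ?nrm_ge0 // d0.
  have h4 : 1 * q ^+ n.+1 / (1 - q) * nrm x <= 1 * q ^+ n / (1 - q) * nrm x.
    rewrite ler_wpM2r ?nrm_ge0 // ler_wpM2r ?invr_ge0 ?subr_ge0 ?(ltW q1) // !mul1r exprS.
    by apply: ler_piMl; rewrite ?exprn_ge0 ?(ltW q1).
  have h5 : 2 * nrm x * q ^+ n / (1 - q) = 2 * (1 * q ^+ n / (1 - q) * nrm x) by ring.
  rewrite h5 in hn; apply: (le_trans _ hn); rewrite mulr_natl mulr2n lerD //.
    exact: le_trans h1 h4.
  exact: le_trans h2 h3.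
have TC x : T (S x) = S (T x).
  apply/eqP; rewrite -subr_eq0; apply/eqP; apply: le_nrm0 => e e0.
  have M0 : 0 <= 2 * nrm x by rewrite mulr_ge0 ?nrm_ge0.
  have [n hn] := geom_small M0 q0 q1 e0.
  have -> : T (S x) - S (T x) = (T (S x) - T_ n (S x)) - S (T x - T_ n x).
    rewrite T_C (bopB _ _ bS); hring.
  rewrite (le_trans (nrmD _ _)) // nrmN.
  have h1 := le_trans (oT n (S x)) (ler_wpM2l (d0 n) (oS x)).
  have h2 := le_trans (oS (T x - T_ n x)) (ler_wpM2l q0 (oT n x)).
  have h3 : q * (1 * q ^+ n / (1 - q) * nrm x) <= 1 * q ^+ n / (1 - q) * nrm x.
    by apply: ler_piMl; rewrite ?(ltW q1) // mulr_ge0 ?nrm_ge0 // d0.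
  rewrite mulrCA in h1.
  have h5 : 2 * nrm x * q ^+ n / (1 - q) = 2 * (1 * q ^+ n / (1 - q) * nrm x) by ring.
  rewrite h5 in hn; apply: (le_trans _ hn); rewrite mulr_natl mulr2n lerD //.
    exact: le_trans h1 h3.
  exact: le_trans h2 h3.
exists T; split => // x; last rewrite TC; by rewrite {1}E addrK.
Qed.

(* b = 1 - y, where y is the limit of y_(n+1) = (a + y_n^2) / 2. *)
Lemma sqrt_op H (A : set (H -> H)) a q : cstar_algebra A -> A idfun -> A a ->
  adj a = a -> 0 <= q -> q < 1 -> opn a q ->
  exists b, [/\ A b, adj b = b & forall x, b (b x) = x - a x].
Proof.
move=> cA A1 Aa aa q0 q1 oa; have [sA _] := cA; have cl := cstar_clin cA.
have bA := star_algebra_bounded sA; have ba := bA a Aa.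
pose h : C := 2^-1.
pose y_ := fix y_ n : H -> H := if n is n.+1 then h *: (a + (y_ n \o y_ n)) else 0.
have y_S n x : y_ n.+1 x = h *: (a x + y_ n (y_ n x)) by [].
have nh : nrm (h : C^o) = 2^-1.
  by rewrite -[h](_ : (2^-1 : R)%:C = h) ?nrm_real // /h rmorphV ?unitfE ?pnatr_eq0 // rmorph_nat.
have Ay n : A (y_ n).
  elim: n => [|n IHn] /=; first exact: star_algebra0 sA.
  exact: (clinZ _ cl (clinD cl Aa (star_algebra_mul sA IHn IHn))).
have byn n := bA _ (Ay n).
have oy n : opn (y_ n) q.
  elim: n => [|n IHn] x; first by rewrite /y_ op0E nrm0 mulr_ge0 ?nrm_ge0.
  rewrite y_S nrmZ nh mulrC ler_pdivrMr // (le_trans (nrmD _ _)) //.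
  rewrite mulr_natr mulr2n lerD ?oa // (le_trans (IHn _)) // ler_wpM2l //.
  by rewrite (le_trans (IHn x)) // ler_piMl ?nrm_ge0 // ltW.
have yy n u v : ipd (y_ n u) v = ipd u (y_ n v).
  elim: n u v => [|n IHn] u v; first by rewrite /y_ !op0E ipd0l ipd0r.
  rewrite !y_S ipdZl ipdZr !ipdDl !ipdDr !IHn -[X in ipd u (X v) + _]aa -adjP //.
  by congr (_ * _); rewrite /h conjc_inv conjc_nat.
have dy n : opn (y_ n.+1 - y_ n) (1 * q ^+ n).
  elim: n => [|n IHn] x.
    rewrite expr0 mulr1 -[(_ - _) x]/(h *: (a x + 0) - 0) addr0 subr0 nrmZ nh mulrC.
    rewrite ler_pdivrMr // (le_trans (oa x)) // mulrC mul1r ler_wpM2l ?nrm_ge0 //; lra.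
  rewrite -[(_ - _) x]/(h *: (a x + y_ n.+1 (y_ n.+1 x)) - h *: (a x + y_ n (y_ n x))).
  rewrite -scalerBr opprD addrACA subrr add0r nrmZ nh mulrC ler_pdivrMr //.
  rewrite (le_trans (nrmB _ _ (y_ n.+1 (y_ n x)))) // mulr_natr mulr2n lerD //.
    rewrite -(bopB _ _ (byn n.+1)) (le_trans (oy _ _)) // exprS mulrCA -mulrA.
    by rewrite ler_wpM2l //; exact: IHn.
  apply: (le_trans (IHn (y_ n x))); rewrite exprS !mul1r [q * _]mulrC -mulrA.
  by rewrite ler_wpM2l ?exprn_ge0 //; exact: oy.
have [y hy oyn] := geometric_op cl bA Ay ler01 q0 q1 dy.
have bY := bA y hy.
have d0 n : 0 <= 1 * q ^+ n / (1 - q).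
  by rewrite mul1r divr_ge0 ?exprn_ge0 // subr_ge0 ltW.
have oy' : opn y 1.
  move=> x; apply/ler_addgt0Pr => e e0.
  have [n hn] := geom_small (nrm_ge0 x) q0 q1 e0.
  have := nrmD (y x - y_ n x) (y_ n x); rewrite subrK => /le_trans; apply.
  rewrite addrC lerD //.
    by rewrite (le_trans (oy n x)) // ler_wpM2r ?nrm_ge0 // ltW.
  by apply: le_trans hn; rewrite (le_trans (oyn n x)) // mul1r mulrC !mulrA.
have ay u v : ipd (y u) v = ipd u (y v).
  apply/eqP; rewrite -subr_eq0; apply/eqP; apply: (@le_nrm0 _ C^o) => e e0.
  have M0 : 0 <= 2 * nrm u * nrm v by rewrite !mulr_ge0 ?nrm_ge0.
  have [n hn] := geom_small M0 q0 q1 e0; apply: le_trans hn.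
  have -> : ipd (y u) v - ipd u (y v) = ipd (y u - y_ n u) v - ipd u (y v - y_ n v).
    by rewrite ipdBl ipdBr yy; ring.
  rewrite (le_trans (@nrmD _ C^o _ _)) // nrmN.
  have h1 := le_trans (cauchy_schwarz (y u - y_ n u) v) (ler_wpM2r (nrm_ge0 v) (oyn n u)).
  have h2 := le_trans (cauchy_schwarz u (y v - y_ n v)) (ler_wpM2l (nrm_ge0 u) (oyn n v)).
  have -> : 2 * nrm u * nrm v * q ^+ n / (1 - q) =
    1 * q ^+ n / (1 - q) * nrm u * nrm v + nrm u * (1 * q ^+ n / (1 - q) * nrm v) by ring.
  exact: lerD.
have Ey x : y x = h *: (a x + y (y x)).
  apply/eqP; rewrite -subr_eq0; apply/eqP; apply: le_nrm0 => e e0.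
  have M0 : 0 <= 2 * nrm x by rewrite mulr_ge0 ?nrm_ge0.
  have [n hn] := geom_small M0 q0 q1 e0; apply: le_trans hn.
  have -> : y x - h *: (a x + y (y x)) =
     (y x - y_ n.+1 x) - h *: (y (y x - y_ n x) + (y (y_ n x) - y_ n (y_ n x))).
    rewrite y_S (bopB _ _ bY); hring.
  rewrite (le_trans (nrmD _ _)) // nrmN nrmZ nh.
  have h1 := oyn n.+1 x; have h2 := nrmD (y (y x - y_ n x)) (y (y_ n x) - y_ n (y_ n x)).
  have h3 := le_trans (oy' (y x - y_ n x)) (ler_wpM2l ler01 (oyn n x)).
  have h4 := le_trans (oyn n (y_ n x)) (ler_wpM2l (d0 n) (oy n x)).
  have h5 : q * (1 * q ^+ n / (1 - q) * nrm x) <= 1 * q ^+ n / (1 - q) * nrm x.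
    by apply: ler_piMl; rewrite ?(ltW q1) // mulr_ge0 ?nrm_ge0 // d0.
  rewrite mulrCA in h4.
  have h6 : 1 * q ^+ n.+1 / (1 - q) * nrm x <= 1 * q ^+ n / (1 - q) * nrm x.
    rewrite ler_wpM2r ?nrm_ge0 // ler_wpM2r ?invr_ge0 ?subr_ge0 ?(ltW q1) // !mul1r exprS.
    by apply: ler_piMl; rewrite ?exprn_ge0 ?(ltW q1).
  have -> : 2 * nrm x * q ^+ n / (1 - q) = 2 * (1 * q ^+ n / (1 - q) * nrm x) by ring.
  move: h1 h2 h3 h4 h5 h6; move: (1 * q ^+ n / (1 - q) * nrm x) => r.
  move: (nrm (y x - y_ n.+1 x)) (nrm (y (y x - y_ n x) + _)) => a1 a2; lra.
have bY1 : bounded_op (idfun - y) by apply: bop_sub => //; exact: bop_id.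
exists (idfun - y); split; first exact: clinB.
  by apply: adj_uniq => // u v; rewrite ipdBl ipdBr ay.
move=> x; rewrite -[LHS]/(x - y x - y (x - y x)) (bopB _ _ bY).
have h2 : a x = y x + y x - y (y x).
  have h3 : a x + y (y x) = 2 *: y x.
    by rewrite [in RHS]Ey scalerA mulfV ?scale1r ?pnatr_eq0.
  by rewrite -[a x](addrK (y (y x))) h3 scaler_nat mulr2n.
rewrite h2; hring.
Qed.

End Calculus.

(** * Contractivity of homomorphisms and resolvents of selfadjoint operators *)

Section Contraction.
Variable R : realType.
Implicit Types H K L : hilbertType R.
Local Notation C := R[i].

Lemma adj_selfcomp H K (S : H -> K) : bounded_op S -> adj (adj S \o S) = adj S \o S.
Proof. by move=> bS; rewrite adj_comp ?adjK //; exact: bop_adj. Qed.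

Lemma opn_selfcomp H K (S : H -> K) m : bounded_op S -> 0 <= m -> opn S m ->
  opn (adj S \o S) (m * m).
Proof. by move=> bS m0 oS; apply: opn_comp => //; exact: opn_adj. Qed.

Lemma linear_on_B (V W : lmodType C) (X : set V) (f : V -> W) v w :
  linear_on X f -> X v -> X w -> f (v - w) = f v - f w.
Proof. by move=> lf Xv Xw; rewrite addrC -scaleN1r lf // scaleN1r addrC. Qed.

(* If b is the square root of 1 - S^* S then f(b)^2 + f(S)^* f(S) = 1. *)
Lemma star_hom_contr H K (A : set (H -> H)) (f : (H -> H) -> (K -> K)) S m :
  cstar_algebra A -> A idfun -> star_hom A f -> f idfun = idfun -> A S ->
  0 <= m -> opn S m -> opn (f S) m.
Proof.
move=> cA A1 hf f1 AS m0 oS; have [sA _] := cA; have cl := cstar_clin cA.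
have lf := star_hom_linear hf.
have f0 : f 0 = 0 by rewrite -[0](subrr (idfun : H -> H)) (linear_on_B lf) ?subrr.
(* The iteration for the square root converges for norms below 1, so this case comes first; S is
   then rescaled by 1 / (m + d) and d tends to 0. *)
have unit_case S' r : A S' -> 0 <= r -> r < 1 -> opn S' r -> opn (f S') 1.
  move=> AS' r0 r1 oS'; have bS' := star_algebra_bounded sA AS'.
  have Aa : A (adj S' \o S') by apply: star_algebra_mul => //; exact: star_algebra_adj.
  have rr1 : r * r < 1 by rewrite mulr_ilt1.
  have [b [Ab bb hb]] := sqrt_op cA A1 Aa (adj_selfcomp bS') (mulr_ge0 r0 r0) rr1
    (opn_selfcomp bS' r0 oS').
  have bfb := star_hom_bounded hf Ab; have bfS := star_hom_bounded hf AS'.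
  have E : f b \o f b = idfun - (adj (f S') \o f S').
    rewrite -(star_hom_mul hf) // (_ : b \o b = idfun - (adj S' \o S')).
      have h1 := linear_on_B lf A1 Aa; have h2 := star_hom_mul hf (star_algebra_adj sA AS') AS'.
      by rewrite (star_hom_adj hf AS') in h2; rewrite f1 h2 in h1.
    by apply/funext => x /=; rewrite hb.
  move=> x; rewrite mul1r -(ler_pXn2r (n := 2)) ?nnegrE ?nrm_ge0 //.
  have h : ipd (f b (f b x)) x = ipd x x - ipd (f S' x) (f S' x).
    by rewrite -[f b (f b x)]/((f b \o f b) x) E /= ipdBl -adjPr //.
  have h2 : ipd (f b (f b x)) x = ipd (f b x) (f b x).
    by rewrite adjP // -(star_hom_adj hf) // bb.
  move: h; rewrite h2 !ipdxx -rmorphB => /(congr1 (@complex.Re R)) /= h.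
  by have := sqr_ge0 (nrm (f b x)); lra.
move=> x; apply/ler_addgt0Pr => e e0.
pose d := e / (nrm x + 1); have x0 : 0 < nrm x + 1 by rewrite ltr_wpDl ?nrm_ge0.
have d0 : 0 < d by rewrite divr_gt0.
have md : 0 < m + d by rewrite ltr_wpDl.
have nc : nrm (((m + d)^-1)%:C : C^o) = (m + d)^-1 by rewrite nrm_real // invr_ge0 ltW.
have oS' : opn (((m + d)^-1)%:C *: S) (m / (m + d)).
  by have := opnZ ((m + d)^-1)%:C oS; rewrite nc [_^-1 * m]mulrC.
have r1 : m / (m + d) < 1 by rewrite ltr_pdivrMr // mul1r ltrDl.
have r0 : 0 <= m / (m + d) by rewrite divr_ge0 // ltW.
have := unit_case _ _ (clinZ _ cl AS) r0 r1 oS' x.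
have -> : f (((m + d)^-1)%:C *: S) = ((m + d)^-1)%:C *: f S.
  rewrite -[in LHS](addr0 (_ *: S)) lf ?f0 ?addr0 //; exact: star_algebra0 sA.
rewrite -[(_ *: f S) x]/(_ *: (f S x)) nrmZ nc mul1r mulrC ler_pdivrMr // => h.
apply: (le_trans h); rewrite mulrC mulrDl lerD2l /d mulrAC ler_pdivrMr //.
by rewrite ler_wpM2l ?(ltW e0) // lerDl.
Qed.

Definition imC (t : R) : C := 0 +i* t.

Lemma nrm_imC t : 0 <= t -> nrm (imC t : C^o) = t.
Proof.
move=> t0; have := @nrmE _ C^o (imC t); rewrite normc_def /= expr0n add0r sqrtr_sqr.
by rewrite ger0_norm // => /(congr1 (@complex.Re R)).
Qed.

Lemma nrmV (c : C) : c != 0 -> nrm (c^-1 : C^o) = (nrm (c : C^o))^-1.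
Proof.
move=> c0; have h : nrm (c : C^o) * nrm (c^-1 : C^o) = 1.
  by rewrite -nrmM mulfV // (nrm_real (ler01 : 0 <= 1 :> R)).
have n0 : nrm (c : C^o) != 0 by apply/eqP => n0; move: h; rewrite n0 mul0r => /esym/eqP; rewrite oner_eq0.
by apply: (mulfI n0); rewrite h mulfV.
Qed.

(** The cross terms cancel because d is selfadjoint and the scalar is imaginary. The identity makes
    d + i t injective and bounds its inverse by 1 / t for t > 0. *)
Lemma selfadj_lower H (d : H -> H) t x : bounded_op d -> adj d = d ->
  nrm (d x + imC t *: x) ^+ 2 = nrm (d x) ^+ 2 + t ^+ 2 * nrm x ^+ 2.
Proof.
move=> bd dd; have : (nrm (d x + imC t *: x) ^+ 2)%:C =
  (nrm (d x) ^+ 2 + t ^+ 2 * nrm x ^+ 2)%:C.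
  have h : ipd (d x) x = ipd x (d x) by rewrite adjP // dd.
  have cE u v : ipd u (imC t *: v) = - imC t * ipd u v :> C.
    rewrite ipdZr; congr (_ * _); change (conjc (imC t) = - imC t).
    by rewrite /imC /=; simpc.
  rewrite -ipdxx ipdDl !ipdDr !ipdZl !cE h !ipdxx.
  rewrite [RHS](_ : _ = (nrm (d x) ^+ 2)%:C + (t ^+ 2)%:C * (nrm x ^+ 2)%:C); last by simpc.
  have -> : (t ^+ 2)%:C = - (imC t * imC t) by rewrite /imC; simpc; rewrite expr2.
  ring.
by move=> /(congr1 (@complex.Re R)).
Qed.

(** Two Neumann series. The first inverts d + i t for t = m + 1, where m bounds d. Its inverse g has
    norm at most 1 / t, so i m g is a strict contraction, and the second series moves the parameter
    from t down to 1. Both stay inside A. *)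
Lemma resolvent H (A : set (H -> H)) d : cstar_algebra A -> A idfun -> A d ->
  adj d = d -> exists g, [/\ A g, opn g 1, forall x, d (g x) + imC 1 *: g x = x &
    forall x, g (d x + imC 1 *: x) = x].
Proof.
move=> cA A1 Ad dd; have [sA _] := cA; have cl := cstar_clin cA.
have bd := star_algebra_bounded sA Ad.
have bnd t g : 0 < t -> A g -> (forall x, d (g x) + imC t *: g x = x) -> opn g t^-1.
  move=> t0 Ag hg x; rewrite -(ler_pM2l t0) mulrA mulfV ?gt_eqF // mul1r.
  rewrite -(ler_pXn2r (n := 2)) ?nnegrE ?mulr_ge0 ?nrm_ge0 ?(ltW t0) //.
  by rewrite -[in leRHS](hg x) selfadj_lower // exprMn lerDr sqr_ge0.
have inj t x y : 0 < t -> d x + imC t *: x = d y + imC t *: y -> x = y.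
  move=> t0 h; apply/eqP; rewrite -subr_eq0; apply/eqP/nrm_eq0.
  have : nrm (d (x - y) + imC t *: (x - y)) ^+ 2 = 0.
    rewrite (bopB _ _ bd) scalerBr addrACA -opprD h subrr nrm0 expr0n //.
  rewrite selfadj_lower // -exprMn => /eqP; rewrite paddr_eq0 ?sqr_ge0 // => /andP[_].
  by rewrite expf_eq0 /= mulf_eq0 gt_eqF //= => /eqP.
have [m m0 hm] := bop_opn bd; pose t := m + 1; have t0 : 0 < t by rewrite /t; lra.
have zt : imC t != 0 by rewrite eq_complex /= negb_and (gt_eqF t0) orbT.
have nti : nrm ((imC t)^-1 : C^o) = t^-1 by rewrite nrmV // nrm_imC // ltW.
have [g [Ag hg]] : exists g, A g /\ forall x, d (g x) + imC t *: g x = x.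
  have oS : opn (- (imC t)^-1 *: d) (m / t).
    by have := opnZ (- (imC t)^-1) hm; rewrite (@nrmN _ C^o) nti [_^-1 * m]mulrC.
  have q1 : m / t < 1 by rewrite ltr_pdivrMr // mul1r /t; lra.
  have [T [AT hT _]] := neumann cA A1 (clinZ _ cl Ad) (divr_ge0 (ltW m0) (ltW t0)) q1 oS.
  exists ((imC t)^-1 *: T); split; first exact: clinZ.
  move=> x; rewrite -[((_ *: T) x)]/((imC t)^-1 *: T x) (bopZ _ _ bd) scalerA mulfV // scale1r.
  rewrite -[RHS]hT -[(_ *: d) _]/(- (imC t)^-1 *: d (T x)) scaleNr opprK addrC //.
have og := bnd _ _ t0 Ag hg; have bg := star_algebra_bounded sA Ag.
have oS : opn (imC m *: g) (m / t).
  by have := opnZ (imC m) og; rewrite (nrm_imC (ltW m0)).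
have q1 : m / t < 1 by rewrite ltr_pdivrMr // mul1r /t; lra.
have [T [AT hT _]] := neumann cA A1 (clinZ _ cl Ag) (divr_ge0 (ltW m0) (ltW t0)) q1 oS.
have h1 x : d (g (T x)) + imC 1 *: g (T x) = x.
  rewrite -[RHS](hT x) -[X in _ = X - _](hg (T x)) -addrA -[(_ *: g) _]/(imC m *: g (T x)).
  by rewrite -scalerBl; congr (_ + _ *: _); rewrite /imC /t; simpc; rewrite addrAC subrr add0r.
have A' : A (g \o T) by exact: star_algebra_mul.
exists (g \o T); split => //.
  by rewrite -[1]invr1; apply: bnd.
by move=> x; apply: (inj 1) => //; exact: h1.
Qed.

End Contraction.

(** * Bounded linear maps between spaces of operators *)

Section BoundedMaps.
Variable R : realType.
Implicit Types H K L : hilbertType R.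
Local Notation C := R[i].

(** The condition under which inclusions and equalities pass from generators to closed spans
    ([cmap_into], [cmap_agree]); L is a total function controlled only on Y. *)
Definition cmap H K H' K' (Y : set (H -> K)) (L : (H -> K) -> (H' -> K')) : Prop :=
  linear_on Y L /\ exists2 m : R, 0 <= m &
    forall T e, Y T -> 0 <= e -> opn T e -> opn (L T) (m * e).

Lemma clin_cmap H K H' K' (Y : set (H -> K)) (L : (H -> K) -> (H' -> K')) Z :
  clin Y -> cmap Y L -> clin Z -> clin [set T | Y T /\ Z (L T)].
Proof.
move=> cY [lL [m m0 hm]] cZ; split.
- split; first by case: cY.
  by rewrite -[0](subrr (0 : H -> K)) (linear_on_B lL) ?subrr; case: cY; case: cZ.
- move=> c S T [YS ZS] [YT ZT]; split; first by case: cY => _ h _; exact: h.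
  by rewrite lL //; case: cZ => _ h _; exact: h.
- move=> T /norm_closureP hT.
  have YT : Y T by apply: (clin_cl cY) => e /hT[S [YS _]]; exists S.
  split => //; apply: (clin_cl cZ) => e e0.
  have m1 : 0 < m + 1 by lra.
  have [S [YS ZS] hS] := hT _ (divr_gt0 e0 m1); exists (L S) => //.
  rewrite -(linear_on_B lL) //; apply: opnW (hm _ (e / (m + 1)) _ _ hS).
  + by rewrite mulrA ler_pdivrMr // mulrC ler_pM2l //; lra.
  + exact: clinB.
  + by rewrite ltW // divr_gt0.
Qed.

Lemma cmap_into H K H' K' (Y E : set (H -> K)) (L : (H -> K) -> (H' -> K')) Z :
  clin Y -> E `<=` Y -> cmap Y L -> clin Z -> (forall T, E T -> Z (L T)) ->
  forall T, cspan E T -> Z (L T).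
Proof.
move=> cY EY cL cZ h T hT.
suff : [set T | Y T /\ Z (L T)] T by case.
apply: cspan_min T hT; first exact: clin_cmap.
by move=> S ES; split; [exact: EY | exact: h].
Qed.

Lemma cmap_diff H K H' K' (Y : set (H -> K)) (L L' : (H -> K) -> (H' -> K')) :
  cmap Y L -> cmap Y L' -> cmap Y (fun T => L T - L' T).
Proof.
move=> [l1 [m m0 h1]] [l2 [m' m'0 h2]]; split.
  by move=> c S T YS YT; rewrite l1 // l2 // scalerBr opprD addrACA.
exists (m + m'); first by rewrite addr_ge0.
move=> T e YT e0 oT; rewrite mulrDl; apply: opnD; first exact: h1.
by move=> x; rewrite -[(- _) x]/(- (L' T x)) nrmN; exact: h2.
Qed.

Lemma cmap_agree H K H' K' (Y E : set (H -> K)) (L L' : (H -> K) -> (H' -> K')) :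
  clin Y -> E `<=` Y -> cmap Y L -> cmap Y L' -> (forall T, E T -> L T = L' T) ->
  forall T, cspan E T -> L T = L' T.
Proof.
move=> cY EY c1 c2 h T hT; apply/eqP; rewrite -subr_eq0; apply/eqP.
apply: (cmap_into cY EY (cmap_diff c1 c2) (clin0 H' K')) hT.
by move=> S ES /=; rewrite h // subrr.
Qed.

Lemma cmap_then H K H' K' H2 K2 (Y : set (H -> K)) (Y' : set (H' -> K'))
    (L : (H -> K) -> (H' -> K')) (L' : (H' -> K') -> (H2 -> K2)) :
  cmap Y L -> (forall T, Y T -> Y' (L T)) -> cmap Y' L' -> cmap Y (L' \o L).
Proof.
move=> [l [m m0 h]] YY [l' [m' m'0 h']]; split.
  by move=> c S T YS YT /=; rewrite l // l' //; exact: YY.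
exists (m' * m); first by rewrite mulr_ge0.
by move=> T e YT e0 oT; rewrite -mulrA; apply: h'; rewrite ?mulr_ge0 //; [exact: YY | exact: h].
Qed.

Lemma cmap_comp H K H' K' (A : K -> K') (B : H' -> H) (Y : set (H -> K)) :
  bounded_op A -> bounded_op B -> cmap Y (fun T => A \o T \o B).
Proof.
move=> bA bB; split; first by move=> c S T _ _; exact: comp_lin.
have [a a0 ha] := bop_opn bA; have [b b0 hb] := bop_opn bB.
exists (a * b); first by rewrite mulr_ge0 ?ltW.
move=> T e _ e0 oT x /=; apply: (le_trans (ha _)).
rewrite [leRHS](_ : _ = a * (e * (b * nrm x))); last by ring.
rewrite ler_wpM2l ?(ltW a0) // (le_trans (oT _)) // ler_wpM2l //; exact: hb.
Qed.

Lemma cmap_compl H K K' (A : K -> K') (Y : set (H -> K)) :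
  bounded_op A -> cmap Y (fun T => A \o T).
Proof. by move=> bA; exact: (cmap_comp Y bA (bop_id H)). Qed.

Lemma cmap_compr H K H' (B : H' -> H) (Y : set (H -> K)) :
  bounded_op B -> cmap Y (fun T => T \o B).
Proof. by move=> bB; exact: (cmap_comp Y (bop_id K) bB). Qed.

Lemma cmap_hom H K (A : set (H -> H)) (f : (H -> H) -> (K -> K)) :
  cstar_algebra A -> A idfun -> star_hom A f -> f idfun = idfun -> cmap A f.
Proof.
move=> cA A1 hf f1; split; first exact: (star_hom_linear hf).
by exists 1 => // T e AT e0 oT; rewrite mul1r; exact: (star_hom_contr cA A1 hf f1 AT e0 oT).
Qed.

Lemma cmap_bounded H K (A : set (H -> H)) (s : (H -> H) -> (K -> K)) :
  linear_on A s -> bounded_map_on A s -> cmap A s.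
Proof.
move=> ls [M hM]; split => //; exists (nrm (M : C^o)); first exact: nrm_ge0.
move=> T e AT e0 oT x; have oT' : opnorm_le T e%:C by apply/opnorm_leR.
have := hM T AT e%:C oT' x; rewrite !nrmE lecE /= => /andP[_ h].
apply: (le_trans h); have := Re_le_nrm (M * e%:C * (nrm x)%:C).
by rewrite !(@nrmM _) !nrm_real ?nrm_ge0 //; apply: le_trans; rewrite ler_norm.
Qed.

Lemma clin_adj H K (Y : set (H -> K)) Z : Y `<=` @bounded_op R H K -> clin Y ->
  clin Z -> clin [set T | Y T /\ Z (adj T)].
Proof.
move=> bY cY cZ; split.
- by split; [case: cY | rewrite adj0; case: cZ].
- move=> c S T [YS ZS] [YT ZT]; split; first by case: cY => _ h _; exact: h.
  by rewrite adj_lin; [case: cZ => _ h _; exact: h | exact: bY | exact: bY].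
- move=> T /norm_closureP hT.
  have YT : Y T by apply: (clin_cl cY) => e /hT[S [YS _]]; exists S.
  split => //; apply: (clin_cl cZ) => e e0.
  have [S [YS ZS] hS] := hT _ e0; exists (adj S) => //.
  have bT := bY _ YT; have bS := bY _ YS.
  have -> : adj T - adj S = adj (T - S).
    by rewrite [T - S]addrC -[- S]scaleN1r adj_lin // rmorphN1 scaleN1r addrC.
  by apply: opn_adj; [exact: bop_sub | exact: ltW |].
Qed.

(** Taking adjoints is conjugate linear, so [cmap_into] does not cover it. *)
Lemma cspan_adj H K (E : set (H -> K)) Z : E `<=` @bounded_op R H K -> clin Z ->
  (forall T, E T -> Z (adj T)) -> forall T, cspan E T -> Z (adj T).
Proof.
move=> bE cZ h T hT; suff : [set T | bounded_op T /\ Z (adj T)] T by case.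
apply: cspan_min T hT; first by apply: clin_adj => //; exact: clin_bop.
by move=> S ES; split; [exact: bE | exact: h].
Qed.

End BoundedMaps.

(** * Bounded maps and C*-algebras on tensor products *)

Section TensorMaps.
Variable R : realType.
Variable tens : forall H K : hilbertType R, hilbertTensor H K.
Implicit Types H K L : hilbertType R.
Local Notation C := R[i].
Local Notation "H ⊗ K" := (tensor_space (tens H K))
  (at level 40, left associativity).
Local Notation "x ⊙ y" := (elt (tens _ _) x y)
  (at level 40, left associativity).

Lemma cmap_tmapr H K H' K' (S : H -> H') : bounded_op S ->
  cmap (@bounded_op R K K') (fun T => @tmap R tens _ _ _ _ S T).
Proof.
move=> bS; split; first by move=> c T T' bT bT'; exact: tmap_linr.
have [a a0 ha] := bop_opn bS; exists a; first exact: ltW.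
by move=> T e bT e0 oT; apply: opn_tmap => //; exact: ltW.
Qed.

Lemma cmap_tmapl H K H' K' (T : K -> K') : bounded_op T ->
  cmap (@bounded_op R H H') (fun S => @tmap R tens _ _ _ _ S T).
Proof.
move=> bT; split; first by move=> c S S' bS bS'; exact: tmap_linl.
have [a a0 ha] := bop_opn bT; exists a; first exact: ltW.
by move=> S e bS e0 oS; rewrite mulrC; apply: opn_tmap => //; exact: ltW.
Qed.

Lemma eltensP H K (A : set (H -> H)) (B : set (K -> K)) S T : A S -> B T ->
  @eltens R tens H K A B (@tmap R tens _ _ _ _ S T).
Proof. by move=> AS BT; exists S => //; exists T. Qed.

Lemma ctens_elt H K (A : set (H -> H)) (B : set (K -> K)) S T : A S -> B T ->
  @ctens R tens H K A B (@tmap R tens _ _ _ _ S T).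
Proof. by move=> AS BT; apply: cspan_sub; exact: eltensP. Qed.

Lemma eltens_bounded H K (A : set (H -> H)) (B : set (K -> K)) :
  A `<=` @bounded_op R H H -> B `<=` @bounded_op R K K ->
  @eltens R tens H K A B `<=` @bounded_op R _ _.
Proof. by move=> bA bB U [S AS [T BT ->]]; apply: bop_tmap; [exact: bA | exact: bB]. Qed.

Lemma ctens_star H K (A : set (H -> H)) (B : set (K -> K)) :
  star_algebra A -> star_algebra B -> cstar_algebra (@ctens R tens H K A B).
Proof.
move=> sA sB; have bA := star_algebra_bounded sA; have bB := star_algebra_bounded sB.
have bE := eltens_bounded bA bB; have cl := cspan_clin (@eltens R tens H K A B).
have bC := bop_cspan bE; split; last by case: cl.
split=> //.
- by case: cl.
- by case: cl.
- move=> S T hS hT.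
  have h1 U : @eltens R tens H K A B U ->
      forall S, @ctens R tens H K A B S -> @ctens R tens H K A B (S \o U).
    move=> EU; have bU := bE U EU.
    have clb := @clin_bop R (tens H K) (tens H K).
    apply: (cmap_into clb bE (cmap_compr _ bU) cl).
    move=> V [S1 AS1 [T1 BT1 ->]]; case: EU bU => S2 AS2 [T2 BT2 ->] bU.
    rewrite !optensE tmap_comp; try by [exact: bA|exact: bB].
    by apply: ctens_elt; exact: star_algebra_mul.
  have bS := bC _ hS.
  have clb := @clin_bop R (tens H K) (tens H K).
  move: T hT; apply: (cmap_into clb bE (cmap_compl _ bS) cl).
  by move=> U EU; exact: h1.
- move=> S hS.
  apply: (cspan_adj bE cl) hS => U [S1 AS1 [T1 BT1 ->]].
  rewrite optensE adj_tmap; [|exact: bA|exact: bB].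
  by apply: ctens_elt; exact: star_algebra_adj.
Qed.

End TensorMaps.

(** * The Haar state and the fundamental unitary *)

Section Assoc.
Variable R : realType.
Variable tens : forall H K : hilbertType R, hilbertTensor H K.
Implicit Types H K L : hilbertType R.
Local Notation "H ⊗ K" := (tensor_space (tens H K))
  (at level 40, left associativity).
Local Notation "x ⊙ y" := (elt (tens _ _) x y)
  (at level 40, left associativity).

(** [same_assoc] hides the reassociation under an existential. Elementary tensors determine it, so
    one map can be fixed and used for every pair of operators ([same_assocE]). *)
Definition assoc_map H K L (a : (H ⊗ K) ⊗ L -> H ⊗ (K ⊗ L)) : Prop :=
  bounded_op a /\ forall x y z, a ((x ⊙ y) ⊙ z) = x ⊙ (y ⊙ z).

Lemma same_assocE H K L U V (a : (H ⊗ K) ⊗ L -> H ⊗ (K ⊗ L)) :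
  assoc_map a -> @same_assoc R tens H K L U V -> a \o U = V \o a.
Proof.
move=> [ba ha] [a' [ba' ha' h]]; suff -> : a = a' by [].
by apply: tens_ext3 => // x y z; rewrite ha ha'.
Qed.

Lemma same_assoc_map H K L U V : @same_assoc R tens H K L U V ->
  exists a, @assoc_map H K L a.
Proof. by move=> [a [ba ha _]]; exists a. Qed.

Lemma assoc_slice H K L (a : (H ⊗ K) ⊗ L -> H ⊗ (K ⊗ L)) z : assoc_map a ->
  adj (@lten R tens H (K ⊗ L) z) \o a = tmap (adj (@lten R tens H K z)) idfun.
Proof.
move=> [ba ha]; have bl := @bop_lten R tens H K z.
have bt : bounded_op (tmap (adj (@lten R tens H K z)) idfun : (H ⊗ K) ⊗ L -> K ⊗ L).
  by apply: bop_tmap; [exact: bop_adj | exact: bop_id].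
apply: tens_ext3 => //.
  by apply: bop_comp => //; apply: bop_adj; exact: bop_lten.
move=> x y w /=; rewrite ha adj_ltenE tmapE ?adj_ltenE ?eltZl //.
  exact: bop_adj.
exact: bop_id.
Qed.

End Assoc.

(** * Vector slices, invariance of the Haar state, existence of U *)

Section CQGBasics.
Variable R : realType.
Variable tens : forall H K : hilbertType R, hilbertTensor H K.
Implicit Types H K L : hilbertType R.
Local Notation C := R[i].
Local Notation "H ⊗ K" := (tensor_space (tens H K))
  (at level 40, left associativity).
Local Notation "x ⊙ y" := (elt (tens _ _) x y)
  (at level 40, left associativity).
Local Notation lt K x := (@lten R tens _ K x).
Local Notation rt H y := (@rten R tens H _ y).

Definition haar_gns (G : compact_quantum_group tens) (phi : (G -> G) -> R[i]^o) (xi : G) :=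
  [/\ haar_state phi, faithful_on (@cqg_alg R tens G) phi
    & gns (@cqg_alg R tens G) phi xi].

Variables (G : compact_quantum_group tens) (phi : (G -> G) -> R[i]^o) (xi : G).
Hypothesis hx : haar_gns phi xi.
Local Notation A := (@cqg_alg R tens G).
Local Notation Dl := (@comult R tens G).
Local Notation A2 := (@ctens R tens G G A A).

Lemma cqg_star : star_algebra A. Proof. by case: (@cqg_cstar R tens G). Qed.
Lemma cqg_bop a : A a -> bounded_op a. Proof. exact: (star_algebra_bounded cqg_star). Qed.
Lemma comult_bop a : A a -> bounded_op (Dl a).
Proof. exact: (star_hom_bounded (@comult_hom R tens G)). Qed.
Lemma comultM a b : A a -> A b -> Dl (a \o b) = Dl a \o Dl b.
Proof. exact: (star_hom_mul (@comult_hom R tens G)). Qed.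
Lemma comult_adj a : A a -> Dl (adj a) = adj (Dl a).
Proof. exact: (star_hom_adj (@comult_hom R tens G)). Qed.
Lemma cqg_adj a : A a -> A (adj a). Proof. exact: (star_algebra_adj cqg_star). Qed.
Lemma cqg_mul a b : A a -> A b -> A (a \o b). Proof. exact: (star_algebra_mul cqg_star). Qed.
Lemma cqg2_cstar : cstar_algebra A2. Proof. by apply: ctens_star; exact: cqg_star. Qed.
Lemma cqg2_bop X : A2 X -> bounded_op X.
Proof. by case: cqg2_cstar => s _; exact: (star_algebra_bounded s). Qed.
Lemma cqg2_id : A2 idfun.
Proof. by rewrite -(@tmap_id R tens G G); apply: ctens_elt; exact: cqg_unital. Qed.
Lemma cqg2_elt_bop : @eltens R tens G G A A `<=` @bounded_op R _ _.
Proof. by apply: eltens_bounded; exact: cqg_bop. Qed.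

Lemma phiE a : A a -> phi a = ipd (a xi) xi.
Proof. by case: hx => _ _ [h _]; exact: h. Qed.

Lemma xi1 : ipd xi xi = 1.
Proof.
rewrite -[LHS](phiE (@cqg_unital R tens G)).
by case: hx => -[[_ _ ->]].
Qed.

Lemma nrm_xi : nrm xi = 1.
Proof.
have := xi1; rewrite ipdxx => /(congr1 (@complex.Re R)) /= h.
by apply/eqP; rewrite -(@eqrXn2 _ 2) ?nrm_ge0 // h expr1n.
Qed.

Lemma cyclic_vec : closure [set a xi | a in A] = setT.
Proof. by case: hx => _ _ []. Qed.

Lemma cyc_total : closure (lspan [set a xi | a in A]) = setT.
Proof.
apply/seteqP; split=> // x _; have : setT x by [].
by rewrite -cyclic_vec; apply: closureS; exact: lspan_sub.
Qed.

Lemma cyc_approx z (e : R) : 0 < e -> exists2 a, A a & nrm (z - a xi) <= e.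
Proof.
move=> e0; have : closure [set a xi | a in A] z by rewrite cyclic_vec.
by move=> /closure_nrm /(_ e e0)[_ [a Aa <-] h]; exists a.
Qed.

Lemma cyc_ext H (S T : G -> H) : bounded_op S -> bounded_op T ->
  (forall a, A a -> S (a xi) = T (a xi)) -> S = T.
Proof.
move=> bS bT h; apply: (bop_ext_dense bS bT cyc_total) => _ [a Aa <-]; exact: h.
Qed.

Lemma cqg_sep a : A a -> a xi = 0 -> a = 0.
Proof.
move=> Aa h; case: (hx) => _ hf _; apply: hf => //.
have Aaa : A (adj a \o a) by apply: cqg_mul => //; exact: cqg_adj.
by rewrite phiE //= h (bop0 (bop_adj (cqg_bop Aa))) ipd0l.
Qed.

Lemma cqg_slicel X e f : A2 X -> A (adj (lt G e) \o X \o lt G f).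
Proof.
have bl y := @bop_lten R tens G G y.
have clb := @clin_bop R (G ⊗ G) (G ⊗ G).
have cl := cstar_clin (@cqg_cstar R tens G).
move: X; apply: (cmap_into clb cqg2_elt_bop (cmap_comp _ (bop_adj (bl e)) (bl f)) cl).
move=> _ [S AS [T AT ->]]; rewrite optensE.
rewrite adj_lten_tmap; [|exact: cqg_bop|exact: cqg_bop].
rewrite (_ : _ \o _ = ipd f (adj S e) *: T); first exact: clinZ.
apply/funext => y /=; rewrite /lten adj_ltenE (bopZ _ _ (cqg_bop AT)) //.
Qed.

Lemma cqg_slicer X e f : A2 X -> A (adj (rt G e) \o X \o rt G f).
Proof.
have bl y := @bop_rten R tens G G y.
have clb := @clin_bop R (G ⊗ G) (G ⊗ G).
have cl := cstar_clin (@cqg_cstar R tens G).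
move: X; apply: (cmap_into clb cqg2_elt_bop (cmap_comp _ (bop_adj (bl e)) (bl f)) cl).
move=> _ [S AS [T AT ->]]; rewrite optensE.
rewrite adj_rten_tmap; [|exact: cqg_bop|exact: cqg_bop].
rewrite (_ : _ \o _ = ipd f (adj T e) *: S); first exact: clinZ.
apply/funext => y /=; rewrite /rten adj_rtenE (bopZ _ _ (cqg_bop AS)) //.
Qed.

(** The abstract slice map in [haar_state] and the concrete slice at xi are both bounded and agree
    on elementary tensors, so left invariance becomes an operator identity. *)
Lemma haar_left a : A a ->
  adj (lt G xi) \o Dl a \o lt G xi = (ipd (a xi) xi) *: (idfun : G -> G).
Proof.
move=> Aa; have [[_ [sl [sr [[l1 l2 l3] _ h]]]] _ _] := hx.
rewrite -phiE //; have [<- _] := h a Aa.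
have bl := @bop_lten R tens G G xi.
have EA2 : @eltens R tens G G A A `<=` A2 by exact: cspan_sub.
symmetry; apply: (cmap_agree (cstar_clin cqg2_cstar) EA2 (cmap_bounded l1 l2)
  (cmap_comp _ (bop_adj bl) bl)); last exact: comult_in.
move=> _ [S AS [T AT ->]]; rewrite l3 // phiE // optensE.
rewrite adj_lten_tmap; [|exact: cqg_bop|exact: cqg_bop].
apply/funext => y /=; rewrite /lten adj_ltenE (bopZ _ _ (cqg_bop AT)).
by rewrite adjP //; exact: cqg_bop.
Qed.

Lemma haar_right a : A a ->
  adj (rt G xi) \o Dl a \o rt G xi = (ipd (a xi) xi) *: (idfun : G -> G).
Proof.
move=> Aa; have [[_ [sl [sr [_ [l1 l2 l3] h]]]] _ _] := hx.
rewrite -phiE //; have [_ <-] := h a Aa.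
have bl := @bop_rten R tens G G xi.
have EA2 : @eltens R tens G G A A `<=` A2 by exact: cspan_sub.
symmetry; apply: (cmap_agree (cstar_clin cqg2_cstar) EA2 (cmap_bounded l1 l2)
  (cmap_comp _ (bop_adj bl) bl)); last exact: comult_in.
move=> _ [S AS [T AT ->]]; rewrite l3 // phiE // optensE.
rewrite adj_rten_tmap; [|exact: cqg_bop|exact: cqg_bop].
apply/funext => y /=; rewrite /rten adj_rtenE (bopZ _ _ (cqg_bop AS)).
by rewrite adjP //; exact: cqg_bop.
Qed.

(** The fundamental unitary, obtained as an isometry: right invariance says exactly that e (x) a xi
    |-> Delta(a)(e (x) xi) preserves inner products. *)
Lemma mulU_exists : exists U : G ⊗ G -> G ⊗ G, [/\ bounded_op U,
  forall x y, ipd (U x) (U y) = ipd x y &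
  forall e a, A a -> U (e ⊙ a xi) = Dl a (e ⊙ xi)].
Proof.
pose I := {p : G * (G -> G) | A p.2}.
pose u (i : I) := (sval i).1 ⊙ (sval i).2 xi.
pose v (i : I) := Dl (sval i).2 ((sval i).1 ⊙ xi).
have [||U [bU iU hU]] := @ext_isometry R I (G ⊗ G) (G ⊗ G) u v.
- move=> [[e a] /= Aa] [[f b] /= Ab]; rewrite /u /v /=.
  rewrite (adjPr (comult_bop Ab)) -comult_adj // -[Dl _ (Dl _ _)]/((Dl _ \o Dl _) _).
  have Aba : A (adj b \o a) by apply: cqg_mul => //; exact: cqg_adj.
  rewrite -comultM //; last exact: cqg_adj.
  rewrite ipd_rten; have /(congr1 (fun g => g e)) /= := haar_right Aba.
  rewrite /rten => ->; rewrite elt_dot -[(_ *: idfun) e]/(_ *: e) ipdZl mulrC; congr (_ * _).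
  by rewrite [in RHS]adjPr //; exact: cqg_bop.
- apply: total_of_orth => w hw; apply: (@tens_inj_l R tens) => e.
  rewrite (bop0 (bop_adj (@bop_lten R tens _ _ _))).
  apply: (dense_eq0 cyc_total) => _ [a Aa <-].
  have bl := @bop_lten R tens G G e.
  rewrite -adjP //; apply: (hw _); exists (exist _ (e, a) Aa) => //.
- by exists U; split => // e a Aa; exact: (hU (exist _ (e, a) Aa)).
Qed.

End CQGBasics.

(** * Rank-one operators and their closed span *)

Section CompactOps.
Variable R : realType.
Implicit Types H K L : hilbertType R.
Local Notation C := R[i].

Definition rank1 H K (a : H) (b : K) : H -> K := fun x => ipd x a *: b.

Lemma bop_rank1 H K (a : H) (b : K) : bounded_op (rank1 a b).
Proof.
apply: (@bop_mk _ _ _ _ (nrm a * nrm b)); first by rewrite mulr_ge0 ?nrm_ge0.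
  by move=> c x y; rewrite /rank1 ipdDl ipdZl scalerDl scalerA.
move=> x; rewrite /rank1 nrmZ mulrAC ler_wpM2r ?nrm_ge0 // mulrC.
exact: cauchy_schwarz.
Qed.

Lemma adj_rank1 H K (a : H) (b : K) : adj (rank1 a b) = rank1 b a.
Proof.
apply: adj_uniq; first exact: bop_rank1.
by move=> x y; rewrite /rank1 ipdZl ipdZr -ipdC mulrC.
Qed.

(** Compact operators as norm limits of finite-rank ones, convenient for span arguments;
    [compact_cpt] links them to the topological [compact_op]. *)
Definition cpt H K : set (H -> K) := cspan [set T : H -> K | exists a b, T = rank1 a b].

Lemma cpt_clin H K : clin (@cpt H K). Proof. exact: cspan_clin. Qed.
Lemma cpt_rank1 H K (a : H) (b : K) : cpt (rank1 a b).
Proof. by apply: cspan_sub; exists a, b. Qed.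
Lemma cpt_bop H K (T : H -> K) : cpt T -> bounded_op T.
Proof. by apply: bop_cspan => _ [a [b ->]]; exact: bop_rank1. Qed.

Lemma cpt_comp H K H' K' (P : K -> K') (Q : H' -> H) T : bounded_op P -> bounded_op Q ->
  cpt T -> cpt (P \o T \o Q).
Proof.
move=> bP bQ; move: T; apply: (cmap_into (@clin_bop _ _ _) _ (cmap_comp _ bP bQ) (@cpt_clin _ _)).
  by move=> _ [a [b ->]]; exact: bop_rank1.
move=> _ [a [b ->]]; rewrite (_ : _ \o _ = rank1 (adj Q a) (P b)); first exact: cpt_rank1.
by apply/funext => x; rewrite /rank1 /= (bopZ _ _ bP) (adjP bQ).
Qed.

Lemma cspan_ipd0 H K (E : set (H -> K)) v w :
  (forall T, E T -> ipd (T v) w = 0) -> forall T, cspan E T -> ipd (T v) w = 0.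
Proof.
move=> h; apply: (@cspan_min _ _ _ _ [set T | ipd (T v) w = 0]); last exact: h.
split=> /=.
- by rewrite op0E ipd0l.
- by move=> c S T hS hT; rewrite -[(_ + _) v]/(c *: S v + T v) ipdDl ipdZl hS hT mulr0 addr0.
- move=> T /norm_closureP hT; apply: (@le_nrm0 _ C^o) => e e0.
  have p0 : 0 < nrm v * nrm w + 1 by rewrite ltr_wpDl ?mulr_ge0 ?nrm_ge0.
  have [S /= hS oS] := hT _ (divr_gt0 e0 p0).
  have -> : ipd (T v) w = ipd ((T - S) v) w by rewrite ipdBl hS subr0.
  rewrite (le_trans (cauchy_schwarz _ _)) //.
  rewrite (le_trans (ler_wpM2r (nrm_ge0 w) (oS v))) // -mulrA mulrAC ler_pdivrMr //.
  by rewrite ler_wpM2l ?(ltW e0) // lerDl.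
Qed.

End CompactOps.

(** * Convolution operators and the Frobenius identity *)

Section CQG2.
Variable R : realType.
Variable tens : forall H K : hilbertType R, hilbertTensor H K.
Implicit Types H K L : hilbertType R.
Local Notation C := R[i].
Local Notation "H ⊗ K" := (tensor_space (tens H K))
  (at level 40, left associativity).
Local Notation "x ⊙ y" := (elt (tens _ _) x y)
  (at level 40, left associativity).
Local Notation lt K x := (@lten R tens _ K x).
Local Notation rt H y := (@rten R tens H _ y).
Variables (G : compact_quantum_group tens) (phi : (G -> G) -> R[i]^o) (xi : G).
Hypothesis hx : haar_gns phi xi.
Local Notation A := (@cqg_alg R tens G).
Local Notation Dl := (@comult R tens G).
Local Notation A2 := (@ctens R tens G G A A).

Definition mulU (xi : G) (U : G ⊗ G -> G ⊗ G) := [/\ bounded_op U,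
  forall x y, ipd (U x) (U y) = ipd x y &
  forall e a, A a -> U (e ⊙ a xi) = Dl a (e ⊙ xi)].

(** The density condition [comult_densel] applied to the vector xi (x) xi; it gives U dense
    range. *)
Lemma comult_total w : (forall a b, A a -> A b -> ipd (Dl a (b xi ⊙ xi)) w = 0) -> w = 0.
Proof.
move=> h; have h2 X : A2 X -> ipd (X (xi ⊙ xi)) w = 0.
  rewrite /= -(@comult_densel R tens G); apply: cspan_ipd0.
  move=> _ [_ [a Aa <-] [_ [b Ab [_ -> ->]] ->]] /=; rewrite optensE tmapE; first exact: h.
    exact: cqg_bop.
  exact: bop_id.
have bl e := @bop_lten R tens G G e; have br e := @bop_rten R tens G G e.
have h3 a : A a -> adj (lt G (a xi)) w = 0.
  move=> Aa; apply: (dense_eq0 (cyc_total hx)) => _ [b Ab <-].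
  rewrite -adjP // -[lt G _ _]/(a xi ⊙ b xi) -(@tmapE R tens _ _ _ _ a b xi xi (cqg_bop Aa) (cqg_bop Ab)).
  by apply: h2; exact: ctens_elt.
apply: (@tens_inj_r R tens) => v; rewrite (bop0 (bop_adj (br v))).
apply: (dense_eq0 (cyc_total hx)) => _ [a Aa <-].
by rewrite -(adjP (br v)) -[rt G _ _]/(lt G (a xi) v) adjP // h3 // ipd0r.
Qed.

Variable U : G ⊗ G -> G ⊗ G.
Hypothesis hU : mulU xi U.

Lemma bopU : bounded_op U. Proof. by case: hU. Qed.
Lemma isoU x y : ipd (U x) (U y) = ipd x y. Proof. by case: hU. Qed.
Lemma UE e a : A a -> U (e ⊙ a xi) = Dl a (e ⊙ xi). Proof. by case: hU => _ _; exact. Qed.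

Lemma Uxi e : U (e ⊙ xi) = e ⊙ xi.
Proof. have := UE e (@cqg_unital R tens G); by rewrite comult_unital. Qed.

Lemma U_total w : (forall x, ipd (U x) w = 0) -> w = 0.
Proof. by move=> h; apply: comult_total => a b Aa Ab; rewrite -(UE (b xi) Aa). Qed.

Lemma tcyc_ext H K (S T : H ⊗ G -> K) : bounded_op S -> bounded_op T ->
  (forall e a, A a -> S (e ⊙ a xi) = T (e ⊙ a xi)) -> S = T.
Proof.
move=> bS bT h; apply: tens_ext => // e z.
have bl := @bop_lten R tens H G e.
suff /(congr1 (fun g => g z)) : S \o lt G e = T \o lt G e by [].
apply: (cyc_ext hx (bop_comp bS bl) (bop_comp bT bl)) => a Aa; exact: h.
Qed.

Lemma comultU b : A b -> Dl b \o U = U \o tmap idfun b.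
Proof.
move=> Ab; have bb := cqg_bop Ab; have bid := @bop_id R G.
apply: tcyc_ext; [exact: bop_comp (comult_bop Ab) bopU | exact: bop_comp bopU (bop_tmap _ _ _) |].
move=> e a Aa; have Aba := cqg_mul Ab Aa.
rewrite -[LHS]/(Dl b (U (e ⊙ a xi))) (UE e Aa) -[RHS]/(U (tmap idfun b (e ⊙ a xi))).
rewrite (tmapE tens e (a xi) bid bb) -[RHS]/(U (e ⊙ (b \o a) xi)) (UE e Aba).
by rewrite (comultM Ab Aa).
Qed.

(** Convolution by omega_{e,f}, seen on vectors ([lam]) and on A ([csl]): [lam] sends a xi to
    (omega_{e,f} (x) iota)(Delta(a)) xi. The isometry [Th] sends a xi to Delta(a)(xi (x) xi) and
    acts as a comultiplication on L^2(G). *)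
Definition lam (e f : G) : G -> G := adj (lt G f) \o U \o lt G e.
Definition csl (e f : G) (a : G -> G) : G -> G := adj (lt G f) \o Dl a \o lt G e.
Definition Th : G -> G ⊗ G := U \o lt G xi.

Lemma bop_lam e f : bounded_op (lam e f).
Proof.
apply: bop_comp; last exact: bop_lten.
by apply: bop_comp bopU; apply: bop_adj; exact: bop_lten.
Qed.

Lemma bop_Th : bounded_op Th.
Proof. by apply: bop_comp bopU _; exact: bop_lten. Qed.

Lemma csl_in e f a : A a -> A (csl e f a).
Proof. by move=> Aa; apply: cqg_slicel; exact: comult_in. Qed.

Lemma lam_csl e f a : A a -> lam e f (a xi) = csl e f a xi.
Proof. by move=> Aa; rewrite -[LHS]/(adj (lt G f) (U (e ⊙ a xi))) (UE e Aa). Qed.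

Lemma csl_adj e f a : A a -> adj (csl e f a) = csl f e (adj a).
Proof.
move=> Aa; have bl e := @bop_lten R tens G G e; have bD := comult_bop Aa.
have blD := bop_comp (bop_adj (bl f)) bD.
by rewrite /csl (adj_comp blD (bl e)) (adj_comp (bop_adj (bl f)) bD) adjK // comult_adj.
Qed.

Lemma Th_xi : Th xi = xi ⊙ xi. Proof. exact: Uxi. Qed.

Lemma Th_cyc a : A a -> Th (a xi) = Dl a (xi ⊙ xi).
Proof. by move=> Aa; exact: UE. Qed.

Lemma comultTh a : A a -> Dl a \o Th = Th \o a.
Proof.
move=> Aa; have ba := cqg_bop Aa.
apply: (cyc_ext hx); [exact: bop_comp (comult_bop Aa) bop_Th | exact: bop_comp bop_Th ba |].
move=> b Ab; have Aab := cqg_mul Aa Ab.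
rewrite -[LHS]/(Dl a (Th (b xi))) (Th_cyc Ab) -[RHS]/(Th ((a \o b) xi)) (Th_cyc Aab).
by rewrite (comultM Aa Ab).
Qed.

Lemma Thadj_comult a : A a -> adj Th \o Dl a = a \o adj Th.
Proof.
move=> Aa; have ba := cqg_bop Aa; have Aa' := cqg_adj Aa.
have := comultTh Aa' => /(congr1 (fun T => adj T)).
rewrite (adj_comp (comult_bop Aa') bop_Th) (adj_comp bop_Th (cqg_bop Aa')).
by rewrite comult_adj // (adjK (comult_bop Aa)) (adjK ba).
Qed.

Lemma lam_Th f : lam xi f = adj (lt G f) \o Th. Proof. by []. Qed.

Lemma Thadj_rt : adj Th \o rt G xi = rank1 xi xi.
Proof.
have br := @bop_rten R tens G G xi.
have bT := bop_comp (bop_adj bop_Th) br.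
apply: (cyc_ext hx bT (bop_rank1 _ _)) => b Ab.
apply/eqP; rewrite -subr_eq0; apply/eqP.
apply: (dense_eq0 (cyc_total hx)) => _ [c Ac <-].
rewrite ipdBr -[(_ \o _) _]/(adj Th (b xi ⊙ xi)) -(adjP bop_Th) (Th_cyc Ac) ipd_rten.
have /(congr1 (fun g => g xi)) /= -> := haar_right hx Ac.
by rewrite /rank1 ipdZl ipdZr -ipdC mulrC subrr.
Qed.

(** The first identity is coassociativity evaluated at xi (x) xi (x) xi. The second is tested on the
    total vectors Delta(c)(b xi (x) xi). On both sides c can be moved out to the left, by the
    intertwining of [Th] and its adjoint with Delta and by coassociativity, which leaves a
    consequence of right invariance. *)
Lemma Th_frobenius : exists a : (G ⊗ G) ⊗ G -> G ⊗ (G ⊗ G), [/\ assoc_map a,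
  a \o tmap Th idfun \o Th = tmap idfun Th \o Th &
  Th \o adj Th = tmap idfun (adj Th) \o a \o tmap Th idfun].
Proof.
have [F1 [F2 [[hF1 iF1] [hF2 iF2] hF]]] := @comult_coassoc R tens G.
have A1 := @cqg_unital R tens G.
have [a ha] := same_assoc_map (hF _ A1); exists a.
have bid := @bop_id R G; have bT := bop_Th; have bT' := bop_adj bT; have [ba aE] := ha.
have cA2 := @cqg2_cstar R tens G; have A21 := @cqg2_id R tens G.
have F11 : F1 idfun = idfun.
  by rewrite -(@tmap_id R tens G G) iF1 // (@comult_unital R tens G) optensE tmap_id.
have F21 : F2 idfun = idfun.
  by rewrite -[in LHS](@tmap_id R tens G G) iF2 // (@comult_unital R tens G) optensE tmap_id.
have cF1 := cmap_hom cA2 A21 hF1 F11; have cF2 := cmap_hom cA2 A21 hF2 F21.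
have EA2 : @eltens R tens G G A A `<=` A2 by exact: cspan_sub.
have bT1 : bounded_op (tmap Th idfun : G ⊗ G -> (G ⊗ G) ⊗ G) by exact: bop_tmap.
have b1T : bounded_op (tmap idfun Th : G ⊗ G -> G ⊗ (G ⊗ G)) by exact: bop_tmap.
have b1T' : bounded_op (tmap idfun (adj Th) : G ⊗ (G ⊗ G) -> G ⊗ G) by exact: bop_tmap.
(* F1 and F2 are iota (x) Delta and Delta (x) iota, so the relations e1, e2 and e3 follow on
   elementary tensors from [comultTh] and [Thadj_comult]. *)
have e1 X : A2 X -> F1 X \o tmap idfun Th = tmap idfun Th \o X.
  move: X; apply: (cmap_agree (cstar_clin cA2) EA2).
  - exact: (cmap_then (L' := fun T => T \o tmap idfun Th) cF1 (fun _ _ => I) (cmap_compr setT b1T)).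
  - exact: cmap_compl.
  move=> _ [S AS [T AT ->]]; rewrite iF1 // !optensE !tmap_comp ?comultTh //.
  + exact: cqg_bop.
  + exact: cqg_bop.
  + exact: cqg_bop.
  + exact: comult_bop.
have e2 X : A2 X -> F2 X \o tmap Th idfun = tmap Th idfun \o X.
  move: X; apply: (cmap_agree (cstar_clin cA2) EA2).
  - exact: (cmap_then (L' := fun T => T \o tmap Th idfun) cF2 (fun _ _ => I) (cmap_compr setT bT1)).
  - exact: cmap_compl.
  move=> _ [S AS [T AT ->]]; rewrite iF2 // !optensE !tmap_comp ?comultTh //.
  + exact: cqg_bop.
  + exact: cqg_bop.
  + exact: comult_bop.
  + exact: cqg_bop.
have e3 X : A2 X -> tmap idfun (adj Th) \o F1 X = X \o tmap idfun (adj Th).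
  move: X; apply: (cmap_agree (cstar_clin cA2) EA2).
  - exact: (cmap_then (L' := fun T => tmap idfun (adj Th) \o T) cF1 (fun _ _ => I) (cmap_compl setT b1T')).
  - exact: cmap_compr.
  move=> _ [S AS [T AT ->]]; rewrite iF1 // !optensE !tmap_comp ?Thadj_comult //.
  + exact: cqg_bop.
  + exact: cqg_bop.
  + exact: cqg_bop.
  + exact: comult_bop.
have e4 b : A b -> a \o F2 (Dl b) = F1 (Dl b) \o a.
  by move=> Ab; exact: (same_assocE ha (hF b Ab)).
split => //.
- apply: (cyc_ext hx); [exact: bop_comp (bop_comp ba bT1) bT | exact: bop_comp b1T bT|].
  move=> b Ab /=; rewrite (Th_cyc Ab).
  have D2 := comult_in Ab.
  have /(congr1 (fun g => g (xi ⊙ xi))) /= <- := e2 _ D2.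
  have /(congr1 (fun g => g (xi ⊙ xi))) /= <- := e1 _ D2.
  rewrite !tmapE // Th_xi -aE.
  by have /(congr1 (fun g => g ((xi ⊙ xi) ⊙ xi))) /= -> := e4 _ Ab.
have br := @bop_rten R tens G G xi; have br2 := @bop_rten R tens (G ⊗ G) G xi.
(* Right invariance in the form [Thadj_rt], amplified by one leg. *)
have e5 : tmap idfun (adj Th) \o a \o rt (G ⊗ G) xi = rt G xi \o adj (rt G xi).
  apply: tens_ext; [exact: bop_comp (bop_comp b1T' ba) br2 | exact: bop_comp br (bop_adj br) |].
  move=> x y /=; rewrite /rten aE tmapE // -/(rten _ _ y) adj_rtenE.
  rewrite -/(rt G xi y) -[adj Th (rt G xi y)]/((adj Th \o rt G xi) y) Thadj_rt.
  by rewrite /rank1 eltZr -eltZl.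
apply: (bop_ext_dense (X := [set v | exists c b, [/\ A c, A b & v = Dl c (b xi ⊙ xi)]])).
- exact: bop_comp bT bT'.
- exact: bop_comp (bop_comp b1T' ba) bT1.
- by apply: total_of_orth => w hw; apply: comult_total => c b Ac Ab; apply: hw; exists c, b.
move=> _ [c [b [Ac Ab ->]]] /=; have D2 := comult_in Ac.
have /(congr1 (fun g => g (b xi ⊙ xi))) /= -> := Thadj_comult Ac.
have /(congr1 (fun g => g (b xi ⊙ xi))) /= <- := e2 _ D2.
have /(congr1 (fun g => g (tmap Th idfun (b xi ⊙ xi)))) /= -> := e4 _ Ac.
have /(congr1 (fun g => g (a (tmap Th idfun (b xi ⊙ xi))))) /= -> := e3 _ D2.
rewrite (tmapE tens (b xi) xi bT bid) -[idfun xi]/xi (Th_cyc Ab).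
have /(congr1 (fun g => g (Dl b (xi ⊙ xi)))) /= := e5; rewrite -[rt (G ⊗ G) xi _]/(_ ⊙ xi) => ->.
have /(congr1 (fun g => g xi)) /= := haar_right hx Ab; rewrite -[rt G xi xi]/(_ ⊙ xi) => ->.
have /(congr1 (fun g => g (b xi))) /= := Thadj_rt; rewrite -[rt G xi _]/(_ ⊙ xi) => ->.
rewrite /rank1 (bopZ _ xi (cqg_bop Ac)) (bopZ _ (c xi) bT) (Th_cyc Ac).
by rewrite -[rt G xi _]/((_ *: xi) ⊙ xi) eltZl (bopZ _ (xi ⊙ xi) (comult_bop Ac)).
Qed.

End CQG2.

(** * Intertwining, nondegeneracy and compactness of the convolution operators *)

Section CQG3.
Variable R : realType.
Variable tens : forall H K : hilbertType R, hilbertTensor H K.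
Implicit Types H K L : hilbertType R.
Local Notation C := R[i].
Local Notation "H ⊗ K" := (tensor_space (tens H K))
  (at level 40, left associativity).
Local Notation "x ⊙ y" := (elt (tens _ _) x y)
  (at level 40, left associativity).
Local Notation lt K x := (@lten R tens _ K x).
Local Notation rt H y := (@rten R tens H _ y).
Variables (G : compact_quantum_group tens) (phi : (G -> G) -> R[i]^o) (xi : G).
Hypothesis hx : haar_gns phi xi.
Local Notation A := (@cqg_alg R tens G).
Local Notation Dl := (@comult R tens G).
Local Notation A2 := (@ctens R tens G G A A).
Variable U : G ⊗ G -> G ⊗ G.
Hypothesis hU : mulU xi U.
Local Notation Th := (Th xi U).
Local Notation lam := (lam U).

Lemma lam_intertwine z : Th \o lam xi z = tmap (lam xi z) idfun \o Th.
Proof.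
have [a [ha h _]] := Th_frobenius hx hU.
have bid := @bop_id R G; have bT := bop_Th hU; have bl := bop_adj (@bop_lten R tens G G z).
have /(congr1 (fun T => adj (lt (G ⊗ G) z) \o T)) := h.
rewrite -[LHS]/((adj (lt (G ⊗ G) z) \o a) \o tmap Th idfun \o Th) (assoc_slice z ha).
rewrite (tmap_comp tens bT bid bl bid) -[RHS]/((adj (lt (G ⊗ G) z) \o tmap idfun Th) \o Th).
by rewrite (adj_lten_tmap tens z bid bT) adj_id => h2; exact: (esym h2).
Qed.

(** Slicing the first leg of the Frobenius identity at z gives a relation for [adj Th], whose
    adjoint is the claim; slicing coassociativity alone gives [lam_intertwine]. *)
Lemma lam_intertwine_adj z :
  Th \o adj (lam xi z) = tmap (adj (lam xi z)) idfun \o Th.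
Proof.
have [a [ha _ h]] := Th_frobenius hx hU.
have bid := @bop_id R G; have bT := bop_Th hU; have bT' := bop_adj bT.
have bl := bop_adj (@bop_lten R tens G G z); have bL := bop_lam hU xi z.
have E : lam xi z \o adj Th = adj Th \o tmap (lam xi z) idfun.
  have /(congr1 (fun T => adj (lt G z) \o T)) := h.
  rewrite -[LHS]/(lam xi z \o adj Th) => ->.
  rewrite -[LHS]/((adj (lt G z) \o tmap idfun (adj Th)) \o a \o tmap Th idfun).
  rewrite (adj_lten_tmap tens z bid bT') adj_id.
  rewrite -[LHS]/(adj Th \o (adj (lt (G ⊗ G) z) \o a) \o tmap Th idfun) (assoc_slice z ha).
  by rewrite -[LHS]/(adj Th \o (tmap (adj (lt G z)) idfun \o tmap Th idfun)) (tmap_comp tens bT bid bl bid).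
have bt : bounded_op (tmap (lam xi z) idfun : G ⊗ G -> G ⊗ G) by exact: bop_tmap.
have := congr1 (fun T => adj T) E.
by rewrite (adj_comp bL bT') (adj_comp bT' bt) (adjK bT) (adj_tmap tens bL bid) adj_id.
Qed.

(** The hypothesis says that the right slices of Delta(a) between xi and y kill xi. They lie in A,
    so they vanish, and xi (x) y is orthogonal to the total set of [comult_total]. *)
Lemma lam_nondeg y : (forall z, adj (lam xi z) y = 0) -> y = 0.
Proof.
move=> h; have bT := bop_Th hU; have bl z := @bop_lten R tens G G z.
have h1 a : A a -> adj (rt G y) \o Dl a \o rt G xi = 0.
  move=> Aa; apply: (cqg_sep hx); first by apply: cqg_slicer; exact: comult_in.
  apply/ipd_inj => z; rewrite ipd0l -[LHS]ipd_rten -[rt G xi xi]/(xi ⊙ xi) -(Th_cyc hU) //.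
  rewrite ipd_lten -[adj (lt G z) (Th _)]/(lam xi z (a xi)) (adjP (bop_lam hU xi z)) h ipd0r //.
have : xi ⊙ y = 0.
  apply: (comult_total hx) => a b Aa Ab; rewrite ipd_rten.
  by rewrite -[adj _ _]/((adj (rt G y) \o Dl a \o rt G xi) (b xi)) h1 // op0E ipd0l.
by move=> /(congr1 (fun v => nrm v)); rewrite nrm_elt (nrm_xi hx) mul1r nrm0 => /nrm_eq0.
Qed.

Lemma lam_linr e (c : C) f f' : lam e (c *: f + f') = c^*%C *: lam e f + lam e f'.
Proof.
have bl z := @bop_lten R tens G G z.
by rewrite /lam lten_linE adj_lin //.
Qed.

Lemma lam_linl (c : C) e e' f : lam (c *: e + e') f = c *: lam e f + lam e' f.
Proof.
have bl z := @bop_lten R tens G G z; have bU := bopU hU.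
by rewrite /lam lten_linE compl_lin //; apply: bop_comp => //; exact: bop_adj.
Qed.

Lemma opn_lam e f : opn (lam e f) (nrm e * nrm f).
Proof.
have bl z := @bop_lten R tens G G z; have ol z := @opn_lten R tens G G z.
have oU : opn U 1.
  move=> x; rewrite mul1r -(@ler_pXn2r _ 2) ?nnegrE ?nrm_ge0 //.
  by rewrite !nrm_sqr (isoU hU).
rewrite mulrC -[nrm f]mulr1; apply: (opn_comp _ _ (ol e)); first by rewrite mulr1 nrm_ge0.
apply: (opn_comp _ _ oU); rewrite ?nrm_ge0 //.
by apply: opn_adj => //; exact: nrm_ge0.
Qed.

Lemma opn_lamBr e f f' : opn (lam e f - lam e f') (nrm e * nrm (f - f')).
Proof.
suff -> : lam e f - lam e f' = lam e (f - f') by exact: opn_lam.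
by rewrite [f - f']addrC -[- f']scaleN1r lam_linr rmorphN1 scaleN1r addrC.
Qed.

Lemma opn_lamBl e e' f : opn (lam e f - lam e' f) (nrm (e - e') * nrm f).
Proof.
suff -> : lam e f - lam e' f = lam (e - e') f by exact: opn_lam.
by rewrite [e - e']addrC -[- e']scaleN1r lam_linl scaleN1r addrC.
Qed.

Lemma lam_xi : lam xi xi = rank1 xi xi.
Proof.
apply: (cyc_ext hx (bop_lam hU _ _) (bop_rank1 _ _)) => a Aa.
by rewrite (lam_csl hU) // /csl (haar_left hx).
Qed.

(** By left invariance [lam xi xi] has rank one. For z = b xi, approximate b (x) 1 by sums of
    Delta(c)(1 (x) d); each term contributes d^* (lam xi xi) c^*, of rank at most one. *)
Lemma lam_cpt z : cpt (lam xi z).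
Proof.
have bT := bop_Th hU; have bl z := @bop_lten R tens G G z; have bid := @bop_id R G.
have [_ _ cc] := @cpt_clin R G G.
apply: cc; apply/norm_closureP => e e0.
have [b Ab hb] := cyc_approx hx z e0.
exists (lam xi (b xi)); last first.
  have := @opn_lamBr xi z (b xi); rewrite (nrm_xi hx) mul1r; exact: opnW.
have bb := cqg_bop Ab; have bb' := bop_adj bb.
have -> : lam xi (b xi) = adj (lt G xi) \o adj (tmap b (idfun : G -> G)) \o Th.
  by rewrite (adj_tmap tens bb bid) adj_id adj_lten_tmap // (adjK bb) lam_Th.
have h : A2 (tmap b idfun) by apply: ctens_elt => //; exact: cqg_unital.
move: h; rewrite -(@comult_denser R tens G).
have bE : opmul (Dl @` A) (@eltens R tens G G [set idfun] A) `<=` @bounded_op R (G ⊗ G) (G ⊗ G).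
  move=> _ [_ [c Ac <-] [_ [_ -> [d Ad ->]] ->]]; apply: bop_comp (comult_bop Ac) _.
  by apply: bop_tmap => //; exact: cqg_bop.
have cz := clin_comp (bop_adj (bl xi)) bT (@cpt_clin R G G).
apply: (cspan_adj bE cz) => _ [_ [c Ac <-] [_ [_ -> [d Ad ->]] ->]] /=.
have bd := cqg_bop Ad; have bd' := bop_adj bd; have bc := comult_bop Ac.
have btd : bounded_op (tmap (idfun : G -> G) d : G ⊗ G -> G ⊗ G) by exact: bop_tmap.
rewrite optensE (adj_comp bc btd) (adj_tmap tens bid bd) adj_id -comult_adj //.
rewrite -[X in cpt X]/((adj (lt G xi) \o tmap idfun (adj d)) \o (Dl (adj c) \o Th)).
rewrite (comultTh hx hU) ?adj_lten_tmap ?adj_id //; last exact: cqg_adj.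
rewrite -[X in cpt X]/(adj d \o lam xi xi \o adj c) lam_xi.
by apply: cpt_comp => //; [apply: bop_adj; exact: cqg_bop | exact: cpt_rank1].
Qed.

End CQG3.

(** * Compact operators and central units *)

Section FiniteDim.
Variable R : realType.
Implicit Types H K L : hilbertType R.
Local Notation C := R[i].

Lemma lspanE H (I : finType) (e : I -> H) x :
  lspan (range e) x -> exists c : I -> C, x = \sum_k c k *: e k.
Proof.
move=> [m [c [f [hf ->]]]].
have /boolp.choice[g hg] : forall k, exists j, e j = f k.
  by move=> k; have [j _ <-] := hf k; exists j.
exists (fun j => \sum_(k | g k == j) c k).
rewrite (partition_big g xpredT) //=; apply: eq_bigr => j _.
by rewrite scaler_suml; apply: eq_bigr => k /eqP <-; rewrite hg.
Qed.

Lemma lspan_linmap H K (X : set H) (Y : set K) (T : H -> K) : bounded_op T -> csub Y ->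
  (forall x, X x -> Y (T x)) -> forall x, lspan X x -> Y (T x).
Proof.
move=> bT [Y0 YL Yc] h x [n [c [f [hf ->]]]].
rewrite (bop_sum _ _ _ bT); elim/big_ind : _ => //.
- by move=> a b Ya Yb; rewrite -[a]scale1r; exact: YL.
- move=> k _; rewrite (bopZ _ _ bT) -[_ *: _]addr0; apply: YL => //; exact: h.
Qed.

Lemma csub_fin H n (e : 'I_n -> H) : csub (lspan (range e)).
Proof.
have [m [f [_ fe hf]]] := gram_schmidt e.
pose P : H -> H := \sum_j rank1 (f j) (f j).
have bP : bounded_op P by apply: bop_sumop => j _; exact: bop_rank1.
have PE x : P x = \sum_j ipd x (f j) *: f j.
  by rewrite /P; elim/big_ind2 : _ => // u1 u2 v1 v2 /= <- <-.
split; [exact: lspan0 | exact: lspan_lin |] => x hx.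
have Pin y : lspan (range e) (P y).
  rewrite PE; elim/big_ind : _; first exact: lspan0.
    by move=> u v hu hv; rewrite -[u]scale1r; exact: lspan_lin.
  by move=> j _; rewrite -[_ *: _]addr0; apply: lspan_lin (fe j) _; exact: lspan0.
have Pid y : lspan (range e) y -> P y = y.
  move=> /lspanE[c ->]; rewrite (bop_sum _ _ _ bP); apply: eq_bigr => k _.
  by rewrite (bopZ _ _ bP) [in RHS](hf k) PE.
have [M M0 hM] := bop_opn bP.
suff -> : x = P x by [].
apply/eqP; rewrite -subr_eq0; apply/eqP; apply: le_nrm0 => d d0.
have M1 : 0 < M + 1 by lra.
have [y hy xy] := hx _ (divr_gt0 d0 M1).
have -> : x - P x = (x - y) - P (x - y) by rewrite (bopB _ _ bP) (Pid y hy); hring.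
rewrite (le_trans (nrmD _ _)) // nrmN.
have h1 := hM (x - y); move: xy; rewrite ler_pdivlMr //; lra.
Qed.

Lemma csub_finT H (I : finType) (e : I -> H) : csub (lspan (range e)).
Proof.
suff -> : range e = range (fun k : 'I_#|I| => e (enum_val k)) by exact: csub_fin.
apply/seteqP; split=> _ [k _ <-]; last by exists (enum_val k).
by exists (enum_rank k) => //; rewrite enum_rankK.
Qed.

Lemma cpt_weak H K I (F : set_system I) (x_ : I -> H) x M (T : H -> K) :
  ProperFilter F -> nrm x <= M -> (forall i, nrm (x_ i) <= M) ->
  (forall v (e : R), 0 < e -> \forall i \near F, nrm (ipd x v - ipd (x_ i) v : C^o) <= e) ->
  cpt T -> forall e : R, 0 < e -> \forall i \near F, nrm (T (x - x_ i)) <= e.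
Proof.
move=> PF xM hM hw; pose Z := [set T : H -> K | forall e : R, 0 < e ->
  \forall i \near F, nrm (T (x - x_ i)) <= e].
have M0 : 0 <= M by exact: le_trans (nrm_ge0 x) xM.
suff cZ : clin Z.
  apply: (@cspan_min _ _ _ _ Z) => // _ [a [b ->]] e e0.
  have b1 : 0 < nrm b + 1 by rewrite ltr_wpDl ?nrm_ge0.
  apply: filterS (hw a _ (divr_gt0 e0 b1)) => i h.
  rewrite /rank1 nrmZ ipdBl; move: h; rewrite ler_pdivlMr // => h.
  by have := @nrm_ge0 _ C^o (ipd x a - ipd (x_ i) a); lra.
split.
- by move=> e e0; apply: filterE => i; rewrite op0E nrm0 ltW.
- move=> c S T0 hS hT e e0.
  have c1 : 0 < nrm (c : C^o) + 1 by rewrite ltr_wpDl ?nrm_ge0.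
  have e2 : 0 < e / 2 by rewrite divr_gt0.
  apply: filterS2 (hS _ (divr_gt0 e2 c1)) (hT _ e2) => i; rewrite ler_pdivlMr // => h1 h2.
  rewrite -[(_ + _) _]/(c *: S _ + T0 _) (le_trans (nrmD _ _)) // [leRHS](splitr e) lerD //.
  by rewrite nrmZ; have := nrm_ge0 (S (x - x_ i)); lra.
- move=> T0 /norm_closureP hT e e0; have e2 : 0 < e / 2 by rewrite divr_gt0.
  have M1 : 0 < 2 * M + 1 by lra.
  have [S hS oS] := hT _ (divr_gt0 e2 M1).
  apply: filterS (hS _ e2) => i h; rewrite -[T0 _](subrK (S (x - x_ i))).
  rewrite (le_trans (nrmD _ _)) // [leRHS](splitr e) lerD //.
  apply: (le_trans (oS _)); rewrite mulrAC ler_pdivrMr // ler_wpM2l ?(ltW e2) //.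
  by have := nrmD x (- x_ i); rewrite nrmN; have := hM i; lra.
Qed.

(** The supremum a of <h x, x> over the unit ball of X is attained at a weak limit of maximising
    vectors, since h turns bounded weak convergence into norm convergence. Optimality makes the
    maximiser an eigenvector. *)
Lemma compact_eigen H (h : H -> H) (X : set H) x0 : cpt h -> adj h = h ->
  (forall x, 0 <= complex.Re (ipd (h x) x)) -> csub X -> (forall x, X x -> X (h x)) ->
  X x0 -> 0 < complex.Re (ipd (h x0) x0) ->
  exists (a : R) x, [/\ 0 < a, X x, x != 0 & h x = a%:C *: x].
Proof.
move=> ch ah ph cX hX Xx0 h0; have bh := cpt_bop ch; have [m m0 hm] := bop_opn bh.
pose r x := complex.Re (ipd (h x) x).
have rZ (s : R) x : r (s%:C *: x) = s ^+ 2 * r x.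
  rewrite /r (bopZ _ _ bh) ipdZl ipdZr conjc_real mulrA -rmorphM -expr2.
  by case: (ipd _ _) => p q /=; rewrite mul0r subr0.
pose S := [set t | exists x, [/\ X x, nrm x <= 1 & t = r x]].
have rm x : nrm x <= 1 -> r x <= m.
  move=> x1; have := Re_le_nrm (ipd (h x) x); rewrite -/(r x) => /(le_trans (ler_norm _)) h1.
  apply: (le_trans h1); apply: (le_trans (cauchy_schwarz _ _)).
  have := hm x; have := nrm_ge0 x; have := nrm_ge0 (h x) => a1 a2 a3.
  have : nrm (h x) * nrm x <= m * 1 * 1; last by rewrite !mulr1.
  by rewrite ler_pM // (le_trans a3) // ler_wpM2l ?(ltW m0).
have [X0 XL Xc] := cX.
have XZ (c : C) x : X x -> X (c *: x) by move=> Xx; rewrite -[_ *: _]addr0; exact: XL.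
have Sb : has_sup S.
  split; first by exists (r 0), 0; rewrite nrm0 ler01.
  by exists m => _ [x [_ x1 ->]]; exact: rm.
pose a := sup S.
have ra x : X x -> r x <= a * nrm x ^+ 2.
  move=> Xx; have [x0'|xn0] := eqVneq (nrm x) 0.
    by rewrite (nrm_eq0 x0') /r (bop0 bh) ipd0l nrm0 expr0n mulr0.
  have xp : 0 < nrm x by rewrite lt_neqAle eq_sym xn0 nrm_ge0.
  have : r (((nrm x)^-1)%:C *: x) <= a.
    apply: (ub_le_sup Sb.2); exists (((nrm x)^-1)%:C *: x); split => //; first exact: XZ.
    by rewrite nrmZ nrm_real ?mulVf // invr_ge0 nrm_ge0.
  by rewrite rZ exprVn mulrC ler_pdivrMr ?exprn_gt0.
have a0 : 0 < a.
  have h1 := lt_le_trans h0 (ra x0 Xx0).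
  have x0p : 0 < nrm x0 ^+ 2.
    rewrite lt_neqAle sqr_ge0 andbT eq_sym; apply/eqP => e; move: h1.
    by rewrite e mulr0 ltxx.
  by move: h1; rewrite pmulr_lgt0.
have /boolp.choice[x_ hx_] n : exists x, [/\ X x, nrm x <= 1 & a - n.+1%:R^-1 < r x].
  have n0 : 0 < n.+1%:R^-1 :> R by rewrite invr_gt0.
  by have [_ [x [h1 h2 ->]] h3] := sup_adherent n0 Sb; exists x.
have [F [UF oF]] := ultraFilterLemma (@eventually_filter).
have PF : ProperFilter F by exact: ultra_proper.
have x1 n : nrm (x_ n) <= 1 by have [] := hx_ n.
have [x nx hw] := ultra_weak UF x1.
have Xx : X x.
  have w0 : x - prj X x = 0.
    apply: ipd_eq0; rewrite ipdBr (prj_orth _ cX (prj_in x cX)) subr0.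
    rewrite ipdC; apply/eqP; rewrite conjc_eq0; apply/eqP.
    apply: (@le_nrm0 _ C^o) => e e0; have [n hn] := filter_ex (hw (x - prj X x) e e0).
    move: hn; rewrite [ipd (x_ n) _](_ : _ = 0) ?subr0 //.
    rewrite ipdC; apply/eqP; rewrite conjc_eq0; apply/eqP; apply: prj_orth => //.
    by have [] := hx_ n.
  by rewrite -[x](subrK (prj X x)) w0 add0r; exact: prj_in.
have ra1 : r x = a.
  apply/eqP; rewrite eq_le; apply/andP; split.
    apply: (le_trans (ra x Xx)); rewrite ler_piMr ?(ltW a0) //.
    by rewrite expr_le1 ?nrm_ge0.
  apply/ler_addgt0Pr => e e0; have e3 : 0 < e / 3 by rewrite divr_gt0.
  have nN : \forall n \near F, n.+1%:R^-1 <= e / 3.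
    apply: oF; have [N hN] : exists N, 0 <= e / 3 - N.+1%:R^-1 :> R.
      have [N hN] := ltr_add_invr (e3 : 0 < e / 3); exists N.
      by rewrite subr_ge0 ltW // -[_^-1]add0r.
    exists N => // n /= Nn; rewrite -subr_ge0 (le_trans hN) // lerD2l lerN2.
    by rewrite lef_pV2 ?posrE // ler_nat.
  have k1 := cpt_weak PF nx x1 hw ch e3; have k2 := hw (h x) _ e3.
  have [n [[n1 n2] n3]] := filter_ex (filterI (filterI nN k1) k2).
  have [_ xn1 n4] := hx_ n.
  have E : ipd (h (x_ n)) (x_ n) = ipd (h x) x - ipd (h (x - x_ n)) (x_ n) - ipd (h x) (x - x_ n).
    by rewrite (bopB _ _ bh) !ipdBl !ipdBr; ring.
  have h1 : `|complex.Re (ipd (h (x - x_ n)) (x_ n))| <= e / 3.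
    apply: (le_trans (Re_le_nrm _)); apply: (le_trans (cauchy_schwarz _ _)).
    by apply: le_trans n2; rewrite ler_piMr ?nrm_ge0.
  have h2 : `|complex.Re (ipd (h x) (x - x_ n))| <= e / 3.
    apply: (le_trans (Re_le_nrm _)); rewrite ipdC nrm_conj ipdBl; exact: n3.
  have E' : r (x_ n) = r x - complex.Re (ipd (h (x - x_ n)) (x_ n)) -
      complex.Re (ipd (h x) (x - x_ n)) by rewrite {1}/r E !raddfB.
  move: n1 n4 h1 h2; rewrite E' !ler_norml /=; move: (_^-1) => t.
  move: (complex.Re (ipd _ (x_ n))) (complex.Re (ipd _ (x - x_ n))) => p q.
  by move=> q0 q5 /andP[q1 q2] /andP[q3 q4]; lra.
(* For the defect d, comparing <h y, y> with a |y|^2 at y = x - d / a yields |d|^2 <= 0. *)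
have [d dE] : exists d, d = a%:C *: x - h x by exists (a%:C *: x - h x).
have Xd : X d by rewrite dE -scaleN1r addrC; apply: XL; [exact: hX | exact: XZ].
exists a, x; split => //.
  by apply/eqP => x0'; move: a0; rewrite -ra1 x0' /r (bop0 bh) ipd0l ltxx.
apply/esym/eqP; rewrite -subr_eq0; apply/eqP; rewrite -dE; apply: nrm_eq0.
have s0 : 0 < a^-1 by rewrite invr_gt0.
have Xy : X (x - (a^-1)%:C *: d).
  by rewrite addrC -scaleNr; exact: XL.
have := ra _ Xy.
have hsym u v : ipd (h u) v = ipd u (h v) by rewrite (adjP bh) ah.
have dd : complex.Re (ipd d d) = nrm d ^+ 2 by rewrite ipdxx.
have ReZ (t : R) (z : C) : complex.Re (t%:C * z) = t * complex.Re z.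
  by case: z => p q /=; rewrite mul0r subr0.
have ReC (u v : H) : complex.Re (ipd u v) = complex.Re (ipd v u).
  by rewrite ipdC; case: (ipd v u).
have -> : r (x - (a^-1)%:C *: d) = r x - 2 * a^-1 * complex.Re (ipd (h x) d) + a^-1 ^+ 2 * r d.
  rewrite /r (bopB _ _ bh) (bopZ _ _ bh) ipdBl !ipdBr !ipdZl !ipdZr conjc_real !raddfB /= !ReZ.
  have -> : complex.Re (ipd (h d) x) = complex.Re (ipd (h x) d) by rewrite hsym ReC.
  ring.
have -> : nrm (x - (a^-1)%:C *: d) ^+ 2 =
    nrm x ^+ 2 - 2 * a^-1 * complex.Re (ipd x d) + a^-1 ^+ 2 * nrm d ^+ 2.
  rewrite !nrm_sqr ipdBl !ipdBr !ipdZl !ipdZr conjc_real !raddfB /= !ReZ [complex.Re (ipd d x)]ReC.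
  ring.
have E2 : nrm d ^+ 2 = a * complex.Re (ipd x d) - complex.Re (ipd (h x) d).
  by rewrite -dd {1}dE ipdBl ipdZl raddfB /= ReZ.
have rd : 0 <= r d by exact: ph.
have nx2 : nrm x ^+ 2 <= 1 by rewrite expr_le1 ?nrm_ge0.
move: E2 rd; rewrite ra1; set p := complex.Re (ipd x d); set q := complex.Re _.
set n2 := nrm d ^+ 2 => E2 rd hle.
have h1 := ler_wpM2l (ltW a0) hle.
have e1 : a * (a - 2 * a^-1 * q + a^-1 ^+ 2 * r d) = a * a - 2 * q + a^-1 * r d.
  by field; rewrite gt_eqF.
have e2 : a * (a * (nrm x ^+ 2 - 2 * a^-1 * p + a^-1 ^+ 2 * n2)) =
    a * a * nrm x ^+ 2 - 2 * (a * p) + n2 by field; rewrite gt_eqF.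
rewrite e1 e2 in h1.
have h2 : 0 <= a^-1 * r d by rewrite mulr_ge0 ?(ltW s0).
have h3 : a * a * nrm x ^+ 2 <= a * a by rewrite ler_piMr // mulr_ge0 ?(ltW a0).
have n20 : 0 <= n2 by exact: sqr_ge0.
have : n2 = 0 by apply/eqP; rewrite eq_le n20 andbT; move: h1 h2 h3 E2; lra.
by rewrite /n2 => /eqP; rewrite expf_eq0 /= => /eqP.
Qed.

End FiniteDim.

(** * Finite-dimensional central summands of the convolution algebra *)

Section Frobenius.
Variable R : realType.
Variable tens : forall H K : hilbertType R, hilbertTensor H K.
Variable H : hilbertType R.
Local Notation C := R[i].
Local Notation "H ⊗ K" := (tensor_space (tens H K))
  (at level 40, left associativity).
Local Notation "x ⊙ y" := (elt (tens _ _) x y)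
  (at level 40, left associativity).
Local Notation lt x := (@lten R tens H H x).
Local Notation rt y := (@rten R tens H H y).
Variable Th : H -> H ⊗ H.
(** The two convolutions of an abstract comultiplication; for the [Th] of the quantum group, [lm z]
    is convertible to [lam xi z]. Operators satisfying [intertw] commute with every [rho w]
    ([rho_comp]). *)
Definition lm (z : H) : H -> H := adj (lt z) \o Th.
Definition rho (w : H) : H -> H := adj (rt w) \o Th.
Definition intertw (P : H -> H) := bounded_op P /\ Th \o P = tmap P idfun \o Th.
Hypothesis bT : bounded_op Th.
Hypothesis lm_sat : forall z, intertw (lm z).
Hypothesis lma_sat : forall z, intertw (adj (lm z)).
Hypothesis lm_nd : forall y, (forall z, adj (lm z) y = 0) -> y = 0.
Hypothesis cpt_lm : forall z, cpt (lm z).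

Lemma bop_lm z : bounded_op (lm z). Proof. by case: (lm_sat z). Qed.
Lemma bop_rho w : bounded_op (rho w).
Proof. by apply: bop_comp bT; apply: bop_adj; exact: bop_rten. Qed.

(** An intertwiner on the right is absorbed by the parameter. Hence the operators [lm z] are stable
    under composition on the right with each other and with each other's adjoints. *)
Lemma lm_comp P z : intertw P -> lm z \o P = lm (adj P z).
Proof.
move=> [bP hP]; have bid := @bop_id R H.
rewrite -[LHS]/(adj (lt z) \o (Th \o P)) hP.
by rewrite -[LHS]/((adj (lt z) \o tmap P idfun) \o Th) (adj_lten_tmap tens z bP bid).
Qed.

Lemma rho_comp P w : intertw P -> rho w \o P = P \o rho w.
Proof.
move=> [bP hP]; have bid := @bop_id R H.
rewrite -[LHS]/(adj (rt w) \o (Th \o P)) hP.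
by rewrite -[LHS]/((adj (rt w) \o tmap P idfun) \o Th) (adj_rten_tmap tens w bP bid) adj_id.
Qed.

Lemma lmM z z' : lm z \o lm z' = lm (adj (lm z') z).
Proof. exact: lm_comp. Qed.

Lemma lmMa z z' : lm z \o adj (lm z') = lm (lm z' z).
Proof. by rewrite lm_comp // adjK //; exact: bop_lm. Qed.

Lemma rhoa_lm z w : adj (rho w) \o lm z = lm z \o adj (rho w).
Proof.
have := congr1 (fun T => adj T) (rho_comp w (lma_sat z)).
have bl := bop_lm z; have br := bop_rho w; have bl' := bop_adj bl.
by rewrite (adj_comp br bl') (adj_comp bl' br) (adjK bl) => ->.
Qed.

Lemma lm_lin (c : C) z z' : lm (c *: z + z') = c^*%C *: lm z + lm z'.
Proof.
have bl x := @bop_lten R tens H H x.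
by rewrite /lm lten_linE adj_lin.
Qed.

Lemma lm0 : lm 0 = 0.
Proof. by have := lm_lin (-1) 0 0; rewrite rmorphN1 !scaleN1r !addNr. Qed.

Lemma adj_lmE z y : adj (lm z) y = adj Th (z ⊙ y).
Proof.
have bl := @bop_lten R tens H H z.
by rewrite /lm (adj_comp (bop_adj bl) bT) (adjK bl).
Qed.

Lemma ipd_lm z x w : ipd (lm z x) w = ipd (rho w x) z.
Proof. by rewrite /lm /rho /= -ipd_lten ipd_rten. Qed.

(* Let b = lm z and let p be the projection on X.  As c c^* maps X into X for    *)
(* every c = lm z', all the c^* kill (1 - p) b^* x.                             *)
Lemma lm_invariant (X : set H) : csub X -> (forall z x, X x -> X (lm z x)) ->
  forall z x, X x -> X (adj (lm z) x).
Proof.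
move=> cX hX z x Xx; have [X0 XL _] := cX.
pose y := adj (lm z) x - prj X (adj (lm z) x).
have py v : X v -> ipd y v = 0 by move=> Xv; exact: prj_orth.
suff y0 : y = 0 by rewrite -[adj _ x](subrK (prj X (adj (lm z) x))) -/y y0 add0r; exact: prj_in.
apply: lm_nd => z'; have bl := bop_lm z; have bl' := bop_lm z'.
apply: ipd_eq0; rewrite -(adjPr bl').
rewrite [X in ipd y X](_ : _ = lm z' (adj (lm z') (adj (lm z) x)) -
    lm z' (adj (lm z') (prj X (adj (lm z) x)))); last first.
  by rewrite /y (bopB _ _ (bop_adj bl')) (bopB _ _ bl').
apply: py; rewrite -scaleN1r addrC; apply: XL.
  rewrite -[lm z' _]/((lm z' \o adj (lm z')) _) lmMa; apply: hX; exact: prj_in.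
rewrite -[adj (lm z') _]/((adj (lm z') \o adj (lm z)) x) -(adj_comp bl bl') lmM.
by rewrite -[lm z' _]/((lm z' \o adj (lm _)) x) lmMa; exact: hX.
Qed.

Definition central_unit (u : H) := [/\ adj (lm u) = lm u, lm u \o lm u = lm u &
  forall z, lm u \o lm z = lm z \o lm u].

(* lm z0 = \sum_p lm (f p) (lm (f p))^* is selfadjoint and injective on the     *)
(* finite-dimensional X, hence onto, and u is the solution of lm z0 u = z0.     *)
Lemma finite_unit n (b : 'I_n -> H) (E := lspan (range b)) :
  (forall w x, E x -> E (rho w x)) -> (forall w x, E x -> E (adj (rho w) x)) ->
  exists u, central_unit u /\ forall z x, E x -> lm u (lm z x) = lm z x.
Proof.
move=> Er Era; have cE : csub E by exact: csub_fin.
pose f (p : 'I_n * 'I_n) := lm (b p.1) (b p.2).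
pose X := lspan (range f); have cX : csub X by exact: csub_finT.
have [X0 XL _] := cX; have [E0 EL _] := cE.
have Eb k : E (b k) by apply: lspan_sub; exists k.
have Xlin T : bounded_op T -> (forall p, X (T (f p))) -> forall x, X x -> X (T x).
  move=> bTT h; apply: lspan_linmap => // _ [p _ <-]; exact: h.
(* By [ipd_lm], and since [rho] preserves E, only the component of z in E acts on E. The operators f
   p = lm (b i) (b j) therefore generate everything. *)
have XlE z x : E x -> X (lm z x).
  have s1 : E x -> lm z x = lm (prj E z) x.
    move=> Ex; apply/ipd_inj => w; rewrite !ipd_lm.
    apply/eqP; rewrite -subr_eq0 -ipdBr ipdC conjc_eq0; apply/eqP.
    by apply: prj_orth => //; exact: Er.
  move=> Ex; rewrite s1 //; have [c ->] := lspanE (prj_in z cE).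
  have {Ex} : E x by []. 
  apply: (lspan_linmap (bop_lm _) cX) => _ [j _ <-].
  elim/big_rec : _ => [|k v _ hv]; first by rewrite lm0 op0E.
  rewrite lm_lin -[(_ + _) _]/(_ *: lm (b k) (b j) + lm v (b j)); apply: XL => //.
  by apply: lspan_sub; exists (k, j).
have Xlm z x : X x -> X (lm z x).
  apply: Xlin; first exact: bop_lm.
  by move=> [i j]; rewrite -[lm z _]/((lm z \o lm (b i)) (b j)) lmM; exact: XlE.
have Xlma := lm_invariant cX Xlm.
have Xrho w x : X x -> X (rho w x).
  apply: Xlin; first exact: bop_rho.
  move=> [i j]; rewrite -[rho w _]/((rho w \o lm (b i)) (b j)) rho_comp //.
  by apply: XlE; exact: Er.
have Xrhoa w x : X x -> X (adj (rho w) x).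
  apply: Xlin; first by apply: bop_adj; exact: bop_rho.
  move=> [i j]; rewrite -[adj (rho w) _]/((adj (rho w) \o lm (b i)) (b j)) rhoa_lm.
  by apply: XlE; exact: Era.
have bp := bop_prj cX.
have pl z x : prj X (lm z x) = lm z (prj X x).
  by apply: (prj_comm cX (bop_lm z)) => y; [exact: Xlm | exact: Xlma].
(* X reduces every [rho w]; as the slices at all w separate vectors of the tensor product, commuting
   with them is enough. *)
have psat : intertw (prj X).
  split => //; apply/funext => x; apply: (@tens_inj_r R tens) => w.
  have bid := @bop_id R H.
  rewrite -[RHS]/((adj (rt w) \o tmap (prj X) idfun) (Th x)) (adj_rten_tmap tens w bp bid) adj_id.
  rewrite -[LHS]/(rho w (prj X x)) -[RHS]/(prj X (rho w x)); symmetry.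
  by apply: (prj_comm cX (bop_rho w)) => y; [exact: Xrho | exact: Xrhoa].
have lmp z : lm z \o prj X = lm (prj X z) by rewrite lm_comp // adj_prj.
pose z0 := \sum_p lm (f p) (f p); pose T := lm z0.
have bTT : bounded_op T := bop_lm z0.
have Xf p : X (f p) by apply: lspan_sub; exists p.
have Xz0 : X z0.
  rewrite /z0; elim/big_rec : _ => // p x _ Xx; rewrite -[lm _ _]scale1r; apply: XL => //.
  exact: Xlm.
have lm_sum (I : finType) (g : I -> H) x : lm (\sum_p g p) x = \sum_p lm (g p) x.
  elim/big_rec2 : _ => [|p s v _ <-]; first by rewrite lm0.
  by rewrite -[g p]scale1r lm_lin conjc1 !scale1r.
have TE x w : ipd (T x) w = \sum_p ipd (adj (lm (f p)) x) (adj (lm (f p)) w).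
  rewrite /T /z0 lm_sum ipd_suml; apply: eq_bigr => p _.
  have bl := bop_lm (f p); rewrite -lmMa /= (adjP bl) //.
have aT : adj T = T.
  apply: adj_uniq => // x w; rewrite TE [RHS]ipdC TE rmorph_sum; apply: eq_bigr => p _.
  by rewrite [LHS]ipdC.
(* <T v, v> is the sum of the |(lm (f p))^* v|^2, so all these vectors vanish. By linearity every
   (lm x)^* v with x in X vanishes, and [lm_nd] concludes. *)
have inj v : X v -> T v = 0 -> v = 0.
  move=> Xv Tv; apply: lm_nd => z.
  have h1 p : adj (lm (f p)) v = 0.
    have : \sum_p (nrm (adj (lm (f p)) v)) ^+ 2 = 0.
      apply: complexI; rewrite rmorph_sum /= -[RHS](ipd0l v) -Tv TE.
      by apply: eq_bigr => q _; rewrite ipdxx.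
    move=> /eqP; rewrite psumr_eq0 => [/allP/(_ p)|q _]; last exact: sqr_ge0.
    by rewrite mem_index_enum => /(_ isT) /=; rewrite expf_eq0 /= => /eqP/nrm_eq0.
  have h2 x : X x -> adj (lm x) v = 0.
    pose Q : H -> H := adj Th \o rt v.
    have bQ : bounded_op Q by apply: bop_comp (bop_adj bT) _; exact: bop_rten.
    move=> Xx; rewrite adj_lmE -[adj Th _]/(Q x).
    have c0 : csub [set 0 : H].
      split=> //; first by move=> c x1 y1 -> ->; rewrite scaler0 addr0.
      move=> x1 h; apply: le_nrm0 => e e0; have [y1 -> ] := h e e0.
      by rewrite subr0.
    apply: (lspan_linmap bQ c0) Xx => _ [p _ <-].
    by rewrite /Q /= -[rt v _]/(f p ⊙ v) -adj_lmE h1.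
  have h3 := h2 _ (prj_in z cX); rewrite -lmp (adj_comp (bop_lm z) bp) adj_prj //= in h3.
  by rewrite prj_id // in h3; exact: Xlma.
pose Y := lspan (range (fun p => T (f p))); have cY : csub Y by exact: csub_finT.
have XY x : X x -> exists2 v, X v & T v = x.
  move=> Xx; have YX y : Y y -> X y.
    have bid := @bop_id R H.
    apply: (lspan_linmap bid cX) => _ [p _ <-]; exact: Xlm.
  have w0 : x - prj Y x = 0.
    have Xw : X (x - prj Y x).
      by rewrite -scaleN1r addrC; apply: XL => //; apply: YX; exact: prj_in.
    apply: inj => //; have XT : X (T (x - prj Y x)) by exact: Xlm.
    apply: ipd_eq0; move: XT; set w := T _ => XT.
    have [c wE] := lspanE XT.
    rewrite [X in ipd _ X]wE ipd_sumr big1 // => p _; rewrite ipdZr /w (adjP bTT) aT.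
    rewrite prj_orth ?mulr0 //; by apply: lspan_sub; exists p.
  have : Y x by rewrite -[x](subrK (prj Y x)) w0 add0r; exact: prj_in.
  move=> /lspanE[c ->]; exists (\sum_p c p *: f p).
    elim/big_rec : _ => // p v _ Xv; exact: XL.
  by rewrite (bop_sum _ _ _ bTT); apply: eq_bigr => p _; rewrite (bopZ _ _ bTT).
have [u Xu Tu] := XY _ Xz0.
have uT : lm u \o T = T by rewrite -[X in _ \o X]aT /T lmMa -/T Tu.
have uX x : X x -> lm u x = x.
  by move=> /XY[v _ <-]; rewrite -[lm u _]/((lm u \o T) v) uT.
have uE : lm u = prj X.
  rewrite -[u](prj_id cX Xu) -lmp; apply/funext => x /=; apply: uX; exact: prj_in.
exists u; split; last by move=> z x Ex; apply: uX; exact: XlE.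
rewrite /central_unit uE adj_prj //; split => //.
  by apply/funext => x /=; rewrite prj_id //; exact: prj_in.
by move=> z; apply/funext => x /=; rewrite pl.
Qed.

(* The finite-dimensional summand is generated by an eigenspace of the compact  *)
(* operator (lm z) (lm z)^*.                                                    *)
Lemma central_unit_ex (X : set H) x0 : csub X -> (forall z x, X x -> X (lm z x)) ->
  (forall w x, X x -> X (rho w x)) -> (forall w x, X x -> X (adj (rho w) x)) ->
  X x0 -> x0 <> 0 -> exists u x, [/\ central_unit u, X x & lm u x <> 0].
Proof.
move=> cX Xl Xr Xra Xx0 n0.
have [z hz] : exists z, adj (lm z) x0 <> 0.
  apply: contrapT => h; apply: n0; apply: lm_nd => z.
  by apply: contrapT => h1; apply: h; exists z.
have bl := bop_lm z; have bl' := bop_adj bl.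
pose h := lm z \o adj (lm z); have hE : h = lm (lm z z) by exact: lmMa.
have ch : cpt h by rewrite hE.
have ah : adj h = h by rewrite /h (adj_comp bl bl') (adjK bl).
have hh x : ipd (h x) x = (nrm (adj (lm z) x) ^+ 2)%:C.
  by rewrite /h /= (adjP bl) ipdxx.
have ph x : 0 <= complex.Re (ipd (h x) x) by rewrite hh /= sqr_ge0.
have hX x : X x -> X (h x) by rewrite hE; exact: Xl.
have h0 : 0 < complex.Re (ipd (h x0) x0).
  rewrite hh /= lt_neqAle sqr_ge0 andbT eq_sym expf_eq0 /=.
  by apply/eqP => /nrm_eq0.
have [a [x [a0 Xx xn0 hx]]] := compact_eigen ch ah ph cX hX Xx0 h0.
have bh := cpt_bop ch; have [X0 XL Xc] := cX.
pose E := [set y | X y /\ h y = a%:C *: y].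
have cE : csub E.
  split.
  - by split => //; rewrite (bop0 bh) scaler0.
  - move=> c y y' [Xy hy] [Xy' hy']; split; first exact: XL.
    by rewrite (bopL bh) hy hy' scalerDr !scalerA mulrC.
  - move=> y hy; have Xy : X y by apply: Xc => e e0; have [y' [] ] := hy e e0; exists y'.
    split => //; apply/eqP; rewrite -subr_eq0; apply/eqP; apply: le_nrm0 => e e0.
    have [m m0 hm] := bop_opn bh; have ma : 0 < m + a by lra.
    have [y' [_ hy'] d] := hy _ (divr_gt0 e0 ma).
    have -> : h y - a%:C *: y = h (y - y') - a%:C *: (y - y').
      rewrite (bopB _ _ bh) hy'; hring.
    rewrite (le_trans (nrmD _ _)) // nrmN nrmZ nrm_real ?(ltW a0) //.
    by have := hm (y - y'); move: d; rewrite ler_pdivlMr //; lra.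
have [E0 EL _] := cE.
(* Approximate h within a / 2 by a finite-rank F. A vector w of E orthogonal to the projections of
   the range vectors has <F w, w> = 0, whereas <h w, w> = a |w|^2, so w = 0. *)
have [n [b Eb]] : exists n (b : 'I_n -> H), E = lspan (range b).
  have a2 : 0 < a / 2 by rewrite divr_gt0.
  have [F [n [c [r [hr FE]]]] hF] := (iffLR (norm_closureP _ _) ch) _ a2.
  have /boolp.choice[g hg] : forall k, exists p, r k = rank1 p.1 p.2.
    by move=> k; have [p [q ->]] := hr k; exists (p, q).
  exists n, (fun k => prj E (g k).2).
  set Y := lspan _; have cY : csub Y by exact: csub_fin.
  have bid := @bop_id R H.
  have YE y : Y y -> E y by apply: (lspan_linmap bid cE) => _ [k _ <-]; exact: prj_in.
  apply/seteqP; split => [y Ey|]; last exact: YE.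
  have Ew : E (y - prj Y y).
    by rewrite -scaleN1r addrC; apply: EL => //; apply: YE; exact: prj_in.
  suff w0 : y - prj Y y = 0.
    by rewrite -[y](subrK (prj Y y)) w0 add0r; exact: prj_in.
  set w := y - prj Y y in Ew *.
  have Fw : ipd (F w) w = 0.
    have -> : F w = \sum_k c k *: r k w.
      by rewrite FE; elim/big_ind2 : _ => // u1 u2 v1 v2 /= <- <-.
    rewrite ipd_suml big1 // => k _; rewrite ipdZl hg /rank1 ipdZl.
    rewrite [ipd (g k).2 w](_ : _ = 0) ?mulr0 //.
    rewrite -{1}[w](prj_id cE) // -ipd_prj // ipdC; apply/eqP; rewrite conjc_eq0; apply/eqP.
    by apply: prj_orth => //; apply: lspan_sub; exists k.
  have h1 := cauchy_schwarz ((h - F) w) w.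
  have h2 : ipd ((h - F) w) w = (a * nrm w ^+ 2)%:C.
    rewrite -[(_ - _) w]/(h w - F w) ipdBl Fw subr0 (proj2 Ew) ipdZl ipdxx.
    by rewrite -rmorphM.
  have p0 : 0 <= a * nrm w ^+ 2 by rewrite mulr_ge0 ?(ltW a0) // sqr_ge0.
  rewrite h2 (nrm_real p0) in h1.
  have h3 := ler_wpM2r (nrm_ge0 w) (hF w); have h4 := le_trans h1 h3.
  have h5 : a / 2 * nrm w * nrm w = a / 2 * nrm w ^+ 2 by rewrite expr2 mulrA.
  apply: nrm_eq0; apply/eqP; rewrite -sqrf_eq0 eq_le sqr_ge0 andbT.
  have h6 : a / 2 * nrm w ^+ 2 <= 0 by rewrite h5 in h4; lra.
  by rewrite -(ler_pM2l a2) mulr0.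
have Er w y : E y -> E (rho w y).
  move=> [Xy hy]; split; first exact: Xr.
  have -> : h (rho w y) = rho w (h y).
    by rewrite hE -[LHS]/((lm _ \o rho w) y) -rho_comp.
  by rewrite hy (bopZ _ _ (bop_rho w)).
have Era w y : E y -> E (adj (rho w) y).
  move=> [Xy hy]; split; first exact: Xra.
  have -> : h (adj (rho w) y) = adj (rho w) (h y).
    by rewrite hE -[RHS]/((adj (rho w) \o lm _) y) rhoa_lm.
  by rewrite hy (bopZ _ _ (bop_adj (bop_rho w))).
rewrite Eb in Er Era; have [u [cu hu]] := finite_unit Er Era.
exists u, x; split => // ux0.
have Ex : E x by [].
rewrite Eb in Ex; have := hu (lm z z) x Ex; rewrite -hE hx (bopZ _ _ (bop_lm u)) ux0 scaler0.
move=> /esym/eqP; rewrite scaler_eq0 (negbTE xn0) orbF => /eqP/complexI a00.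
by rewrite a00 ltxx in a0.
Qed.

End Frobenius.

(** * Central projections increase to the identity *)

Section CentralUnits.
Variable R : realType.
Variable tens : forall H K : hilbertType R, hilbertTensor H K.
Variable H : hilbertType R.
Local Notation C := R[i].
Local Notation "H ⊗ K" := (tensor_space (tens H K))
  (at level 40, left associativity).
Variable Th : H -> H ⊗ H.
Local Notation lm := (lm Th).
Local Notation rho := (rho Th).
Hypothesis bT : bounded_op Th.
Hypothesis lm_sat : forall z, intertw Th (lm z).
Hypothesis lma_sat : forall z, intertw Th (adj (lm z)).
Hypothesis lm_nd : forall y, (forall z, adj (lm z) y = 0) -> y = 0.
Hypothesis cpt_lm : forall z, cpt (lm z).
Local Notation central_unit := (central_unit Th).

Lemma csub_kernels (I : Type) (T : I -> H -> H) : (forall i, bounded_op (T i)) ->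
  csub [set w | forall i, T i w = 0].
Proof.
move=> bt; split=> [i|c x y hx hy i|x hx i]; first exact: bop0.
  by rewrite (bopL (bt i)) hx hy scaler0 addr0.
apply: le_nrm0 => e e0; have [m m0 hm] := bop_opn (bt i).
have [y hy xy] := hx _ (divr_gt0 e0 m0).
have -> : T i x = T i (x - y) by rewrite (bopB _ _ (bt i)) hy subr0.
by apply: (le_trans (hm _)); rewrite mulrC -ler_pdivlMr.
Qed.

(** The common kernel of all central units is invariant under [lm], [rho] and the adjoints of [rho].
    If nonzero, it would by [central_unit_ex] contain a vector that some central unit does not
    kill. *)
Lemma cu_total w : (forall u, central_unit u -> lm u w = 0) -> w = 0.
Proof.
move=> hw; pose T (i : {u | central_unit u}) := lm (sval i).
have bl u : bounded_op (lm u) by exact: bop_lm.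
have := @csub_kernels _ T (fun i => bl (sval i)).
set X := [set w | _] => cX; apply: contrapT => w0.
have comm u : central_unit u -> forall z x, lm u (lm z x) = lm z (lm u x).
  by move=> [_ _ h] z x; rewrite -[LHS]/((lm u \o lm z) x) h.
have rc u w' x : lm u (rho w' x) = rho w' (lm u x).
  by rewrite -[RHS]/((rho w' \o lm u) x) rho_comp.
have rac u w' x : lm u (adj (rho w') x) = adj (rho w') (lm u x).
  by rewrite -[RHS]/((adj (rho w') \o lm u) x) rhoa_lm.
have [||||u [x [cu Xx]]] := @central_unit_ex R tens H Th bT lm_sat lma_sat lm_nd cpt_lm X w cX _ _ _ _ w0.
- by move=> z x Xx [u cu]; rewrite -[LHS]/(lm u (lm z x)) comm // -[lm u x]/(T (exist _ u cu) x) Xx (bop0 (bl z)).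
- move=> w' x Xx [u cu]; rewrite -[LHS]/(lm u (rho w' x)) rc -[lm u x]/(T (exist _ u cu) x) Xx.
  exact: (bop0 (bop_rho bT w')).
- move=> w' x Xx [u cu]; rewrite -[LHS]/(lm u (adj (rho w') x)) rac -[lm u x]/(T (exist _ u cu) x) Xx.
  exact: (bop0 (bop_adj (bop_rho bT w'))).
- by move=> [u cu]; exact: hw.
- by apply; exact: (Xx (exist _ u cu)).
Qed.

Lemma cu_zero : central_unit 0.
Proof.
rewrite /central_unit (lm0 Th) adj0; split => // z.
by apply/funext => x; rewrite /= op0E (bop0 (bop_lm lm_sat z)).
Qed.

(** The supremum of commuting projections p1 and p2 is p1 + p2 - p1 p2, and the product is
    [lm (lm u2 u1)] by [lmMa]. *)
Lemma cu_join u1 u2 : central_unit u1 -> central_unit u2 -> exists u,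
  [/\ central_unit u, lm u \o lm u1 = lm u1 & lm u \o lm u2 = lm u2].
Proof.
move=> [a1 i1 c1] [a2 i2 c2].
have b1 := bop_lm lm_sat u1; have b2 := bop_lm lm_sat u2.
pose u := u1 + u2 - lm u2 u1.
have lmuE x : lm u x = lm u1 x + lm u2 x - lm u1 (lm u2 x).
  have -> : u = (-1) *: lm u2 u1 + (1 *: u1 + u2) by rewrite scaleN1r scale1r addrC.
  rewrite lm_lin lm_lin rmorphN1 rmorph1 scaleN1r scale1r -lmMa // a2.
  by rewrite addrC.
have c12 x : lm u2 (lm u1 x) = lm u1 (lm u2 x).
  by rewrite -[LHS]/((lm u2 \o lm u1) x) c2.
have i1x x : lm u1 (lm u1 x) = lm u1 x by rewrite -[LHS]/((lm u1 \o lm u1) x) i1.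
have i2x x : lm u2 (lm u2 x) = lm u2 x by rewrite -[LHS]/((lm u2 \o lm u2) x) i2.
have E1 x : lm u (lm u1 x) = lm u1 x.
  by rewrite lmuE i1x c12 i1x -addrA subrr addr0.
have E2 x : lm u (lm u2 x) = lm u2 x.
  by rewrite lmuE i2x addrAC subrr add0r.
have bu := bop_lm lm_sat u.
exists u; split; [split|by apply/funext|by apply/funext].
- apply: adj_uniq => // x y; rewrite !lmuE !(ipdBl, ipdBr, ipdDl, ipdDr).
  rewrite (adjP b1) a1 (adjP b2) a2 (adjP b1) a1 (adjP b2) a2 c12 //.
- apply/funext => x /=; rewrite [X in lm u X]lmuE (bopB _ _ bu) (bopD _ _ bu) !E1 E2.
  by rewrite -lmuE.
- move=> z; apply/funext => x /=; have bz := bop_lm lm_sat z.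
  have k1 y : lm u1 (lm z y) = lm z (lm u1 y) by rewrite -[LHS]/((lm u1 \o lm z) y) c1.
  have k2 y : lm u2 (lm z y) = lm z (lm u2 y) by rewrite -[LHS]/((lm u2 \o lm z) y) c2.
  by rewrite !lmuE (bopB _ _ bz) (bopD _ _ bz) k1 k2 k1.
Qed.

Lemma cu_opn u : central_unit u -> opn (lm u) 1.
Proof.
move=> [a i _] x; rewrite mul1r; have b := bop_lm lm_sat u.
have [->|n0] := eqVneq (nrm (lm u x)) 0; first exact: nrm_ge0.
have p0 : 0 < nrm (lm u x) by rewrite lt_neqAle eq_sym n0 nrm_ge0.
rewrite -(ler_pM2r p0) -expr2 nrm_sqr (adjP b) a -[lm u (lm u x)]/((lm u \o lm u) x) i.
apply: le_trans (cauchy_schwarz _ _).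
by apply: le_trans (Re_le_nrm _); exact: ler_norm.
Qed.

Lemma csub_strong_limit (L : hilbertType R) (I : Type) (F : set_system I) (T_ : I -> L -> L) :
  ProperFilter F -> (forall u, bounded_op (T_ u)) -> (\forall u \near F, opn (T_ u) 1) ->
  csub [set x | forall e : R, 0 < e -> \forall u \near F, nrm (x - T_ u x) <= e].
Proof.
move=> PF bt o1; split.
- by move=> e e0; apply: filterE => u; rewrite (bop0 (bt u)) subr0 nrm0 ltW.
- move=> c x y hx hy e e0.
  have c1 : 0 < nrm (c : C^o) + 1 by rewrite ltr_wpDl ?nrm_ge0.
  have e2 : 0 < e / 2 by rewrite divr_gt0.
  apply: filterS2 (hx _ (divr_gt0 e2 c1)) (hy _ e2) => u; rewrite ler_pdivlMr // => h1 h2.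
  rewrite (bopL (bt u)) opprD addrACA -scalerBr.
  rewrite (le_trans (nrmD _ _)) // [leRHS](splitr e) lerD // nrmZ.
  by have := nrm_ge0 (x - T_ u x); lra.
- move=> x hx e e0; have e3 : 0 < e / 3 by rewrite divr_gt0.
  have [y hy xy] := hx _ e3.
  apply: filterS2 o1 (hy _ e3) => u hu h.
  have -> : x - T_ u x = (x - y) - T_ u (x - y) + (y - T_ u y).
    by rewrite (bopB _ _ (bt u)); hring.
  have h1 := nrmD (x - y - T_ u (x - y)) (y - T_ u y).
  have h2 := nrmD (x - y) (- T_ u (x - y)); rewrite nrmN in h2.
  have h3 := hu (x - y); lra.
Qed.

(** Central units are directed by [cu_join]. The vectors on which they converge to the identity form
    a closed subspace containing all their ranges, and [cu_total] leaves no room for its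
    complement. *)
Lemma cu_filter : exists F : set_system H, [/\ ProperFilter F, F central_unit,
  forall u0, central_unit u0 -> \forall u \near F, lm u \o lm u0 = lm u0 &
  forall x (e : R), 0 < e -> \forall u \near F, nrm (x - lm u x) <= e].
Proof.
pose F : set_system H := [set S : set H | exists2 u0, central_unit u0 &
  forall u, central_unit u -> lm u \o lm u0 = lm u0 -> S u].
have PF : ProperFilter F.
  apply: Build_ProperFilter_ex.
    by move=> S [u0 c0 h]; exists u0; apply: h => //; case: c0.
  split.
  - by exists 0 => //; exact: cu_zero.
  - move=> P Q [u1 c1 h1] [u2 c2 h2]; have [u [cu e1 e2]] := cu_join c1 c2.
    exists u => // v cv ev; split; [apply: h1 => // | apply: h2 => //].
      by rewrite -e1 -[LHS]/((lm v \o lm u) \o lm u1) ev.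
    by rewrite -e2 -[LHS]/((lm v \o lm u) \o lm u2) ev.
  - by move=> P Q PQ [u0 c0 h]; exists u0 => // u cu eu; apply: PQ; exact: h.
have FE : F central_unit by exists 0 => //; exact: cu_zero.
have F0 u0 : central_unit u0 -> \forall u \near F, lm u \o lm u0 = lm u0.
  by move=> c0; exists u0.
exists F; split => //.
pose X := [set x | forall e : R, 0 < e -> \forall u \near F, nrm (x - lm u x) <= e].
have o1 : \forall u \near F, opn (lm u) 1 by apply: filterS FE => u; exact: cu_opn.
have cX : csub X := csub_strong_limit PF (bop_lm lm_sat) o1.
apply: (prj_dense cX) => x hx; apply: cu_total => u cu.
have [a _ _] := cu; have b := bop_lm lm_sat u.
apply: ipd_eq0; rewrite (adjP b) a; apply: hx => e e0.
apply: filterS (F0 u cu) => v /(congr1 (fun g => g (lm u x))) /= ->.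
by rewrite subrr nrm0 ltW.
Qed.

End CentralUnits.

(** * The von Neumann algebra of the quantum group *)

Section LinftyFacts.
Variable R : realType.
Variable tens : forall H K : hilbertType R, hilbertTensor H K.
Implicit Types H K L : hilbertType R.
Local Notation C := R[i].
Local Notation "H ⊗ K" := (tensor_space (tens H K))
  (at level 40, left associativity).
Local Notation "x ⊙ y" := (elt (tens _ _) x y)
  (at level 40, left associativity).
Local Notation lt K x := (@lten R tens _ K x).
Local Notation rt H y := (@rten R tens H _ y).
Variables (G : compact_quantum_group tens) (phi : (G -> G) -> R[i]^o) (xi : G).
Hypothesis hx : haar_gns phi xi.
Local Notation A := (@cqg_alg R tens G).
Local Notation Dl := (@comult R tens G).
Local Notation A2 := (@ctens R tens G G A A).
Local Notation W := (@Linfty R tens G).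

Lemma Linfty_vn : von_neumann_algebra W.
Proof. by apply: vn_strong_closure; [exact: cqg_star | exact: cqg_unital]. Qed.

Lemma Linfty_star : star_algebra W. Proof. by case: Linfty_vn. Qed.

Lemma cqg_Linfty : A `<=` W.
Proof.
move=> a Aa; apply: opn_strong; last exact: cqg_bop.
apply/norm_closureP => e e0; exists a => // x.
by rewrite -[(_ - _) x]/(a x - a x) subrr nrm0 mulr_ge0 ?nrm_ge0 ?ltW.
Qed.

Lemma Linfty_bop y : W y -> bounded_op y. Proof. exact: (star_algebra_bounded Linfty_star). Qed.

Lemma Linfty_bicomm y : W y -> commutant (commutant A) y.
Proof. exact: strong_closure_bicomm. Qed.

Variable U : G ⊗ G -> G ⊗ G.
Hypothesis hU : mulU xi U.
Local Notation Th := (Th xi U).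
Local Notation lam := (lam U).

Lemma cqg2_commutant a' X : commutant A a' -> A2 X ->
  X \o tmap a' idfun = tmap a' idfun \o X.
Proof.
move=> [ba' ha']; have bid := @bop_id R G.
have bt : bounded_op (tmap a' (idfun : G -> G) : G ⊗ G -> G ⊗ G) by exact: bop_tmap.
have EA2 : @eltens R tens G G A A `<=` A2 by exact: cspan_sub.
move: X; apply: (cmap_agree (cstar_clin (@cqg2_cstar R tens G)) EA2).
- exact: cmap_compr.
- exact: cmap_compl.
move=> _ [S AS [T AT ->]]; have bS := cqg_bop AS; have bTT := cqg_bop AT.
rewrite optensE (tmap_comp tens ba' bid bS bTT) (tmap_comp tens bS bTT ba' bid).
by rewrite ha'.
Qed.

(** Since a' (x) 1 commutes with Delta(A), it passes through U at xi and is moved to the other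
    vector. Together with [commutant_dense] this reduces [lam e f] to operators [lam xi z]. *)
Lemma lam_comm a' f : commutant A a' -> lam (a' xi) f = lam xi (adj a' f).
Proof.
move=> ha; have [ba' _] := ha; have bid := @bop_id R G; have bU := bopU hU.
have bl := @bop_lten R tens G G.
have bt : bounded_op (tmap a' (idfun : G -> G) : G ⊗ G -> G ⊗ G) by exact: bop_tmap.
have E : U \o lt G (a' xi) = tmap a' idfun \o (U \o lt G xi).
  apply: (cyc_ext hx); [exact: bop_comp | exact: bop_comp bt (bop_comp bU _) |].
  move=> a Aa; rewrite -[LHS]/(U (a' xi ⊙ a xi)) (UE hU _ Aa).
  rewrite -[RHS]/(tmap a' idfun (U (xi ⊙ a xi))) (UE hU _ Aa).
  have /(congr1 (fun g => g (xi ⊙ xi))) /= <- := cqg2_commutant ha (comult_in Aa).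
  by rewrite (tmapE tens xi xi ba' bid).
rewrite -[LHS]/(adj (lt G f) \o (U \o lt G (a' xi))) E.
by rewrite -[LHS]/((adj (lt G f) \o tmap a' idfun) \o (U \o lt G xi)) (adj_lten_tmap tens f ba' bid).
Qed.

Variable dG : (G -> G) -> (G ⊗ G -> G ⊗ G).
Hypothesis hdG : Linfty_comult dG.

Lemma dG_hom : star_hom W dG. Proof. by case: hdG. Qed.
Lemma dG_normal : normal_on W dG. Proof. by case: hdG. Qed.
Lemma dG_comult a : A a -> dG a = Dl a. Proof. by case: hdG => _ _; exact. Qed.
Lemma dG_bop y : W y -> bounded_op (dG y). Proof. exact: (star_hom_bounded dG_hom). Qed.

Lemma dG_U y e v : W y -> dG y (U (e ⊙ v)) = U (e ⊙ y v).
Proof.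
move=> Wy; have bU := bopU hU; have bl := @bop_lten R tens G G e.
have bUl := bop_comp bU bl; have bid := @bop_id R.
suff /(congr1 (fun g => g v)) : idfun \o dG y \o (U \o lt G e) = (U \o lt G e) \o id y \o idfun by [].
apply: (@normal_agree _ _ _ _ _ _ A W dG id idfun (U \o lt G e) (U \o lt G e) idfun y
  (@cqg_star R tens G) (@cqg_unital R tens G) cqg_Linfty Wy (Linfty_bicomm Wy)
  dG_normal dG_bop (@normal_on_id R G W) Linfty_bop (bid _) bUl bUl (bid _)) => a Aa.
rewrite dG_comult //; have := comultU hx hU Aa => /(congr1 (fun T => T \o lt G e)) h.
have ba := cqg_bop Aa.
rewrite -[LHS]/((Dl a \o U) \o lt G e) h; apply/funext => x.
by rewrite -[LHS]/(U (tmap idfun a (e ⊙ x))) (tmapE tens e x (bid _) ba).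
Qed.

Lemma dG_haar z u v : W z ->
  ipd (dG z (xi ⊙ u)) (xi ⊙ v) = ipd (z xi) xi * ipd u v.
Proof.
move=> Wz; have bid := @bop_id R.
pose p (T : G -> G) : C := ipd (dG T (xi ⊙ u)) (xi ⊙ v).
pose q (T : G -> G) : C := ipd (((ipd u v) *: (idfun : G -> G)) (T (idfun xi))) xi.
have qE T : q T = ipd (T xi) xi * ipd u v.
  by rewrite /q -[(_ *: _) _]/(ipd u v *: T xi) ipdZl mulrC.
rewrite -qE -[LHS]/(p z).
apply: (swc_agree (@cqg_star R tens G) (@cqg_unital R tens G) cqg_Linfty Wz (Linfty_bicomm Wz)).
- exact: (swc_op (A := idfun) (B := idfun) (xi ⊙ u) (xi ⊙ v) dG_normal dG_bop (bid _) (bid _)).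
- apply: (swc_op (B := idfun) xi xi (@normal_on_id R G W) Linfty_bop _ (bid _)).
  by apply: bop_scale; exact: bid.
- move=> a Aa; rewrite qE /p dG_comult // ipd_lten.
  have /(congr1 (fun g => g u)) := haar_left hx Aa.
  rewrite -[(adj _ \o _ \o _) u]/(adj (lt G xi) (Dl a (xi ⊙ u))) => ->.
  by rewrite -[(_ *: _) u]/(_ *: u) ipdZl.
Qed.

Lemma Linfty_mul x y : W x -> W y -> W (x \o y). Proof. exact: (star_algebra_mul Linfty_star). Qed.
Lemma Linfty_adj x : W x -> W (adj x). Proof. exact: (star_algebra_adj Linfty_star). Qed.

Lemma dG_haar_slice z u : W z -> adj (lt G xi) (dG z (xi ⊙ u)) = ipd (z xi) xi *: u.
Proof.
by move=> Wz; apply/ipd_inj => v; rewrite -ipd_lten dG_haar // ipdZl.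
Qed.

(** For X = Delta(c)(1 (x) d) and X' = Delta(c')(1 (x) d'), left invariance gives <c^* w c' xi, xi>
    d^* d'. This lies in A although w is only in the von Neumann algebra; density gives the general
    case. *)
Lemma Linfty_sandwich w X X' : W w -> A2 X -> A2 X' ->
  A (adj (lt G xi) \o (adj X \o dG w \o X') \o lt G xi).
Proof.
move=> Ww; have bw := dG_bop Ww; have bl := @bop_lten R tens G G xi.
have bid := @bop_id R G; have cl := cstar_clin (@cqg_cstar R tens G).
have clb := @clin_bop R (G ⊗ G) (G ⊗ G).
pose E := opmul (Dl @` A) (@eltens R tens G G [set idfun] A).
have bE : E `<=` @bounded_op R (G ⊗ G) (G ⊗ G).
  move=> _ [_ [c Ac <-] [_ [_ -> [d Ad ->]] ->]]; apply: bop_comp (comult_bop Ac) _.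
  by apply: bop_tmap => //; exact: cqg_bop.
have sand w' V V' : W w' -> E V -> E V' -> A (adj (lt G xi) \o (adj V \o dG w' \o V') \o lt G xi).
  move=> Ww' [_ [c Ac <-] [_ [_ -> [d Ad ->]] ->]] [_ [c' Ac' <-] [_ [_ -> [d' Ad' ->]] ->]].
  have bd := cqg_bop Ad; have bd' := cqg_bop Ad'; have bc := comult_bop Ac.
  have bt : bounded_op (tmap (idfun : G -> G) d : G ⊗ G -> G ⊗ G) by exact: bop_tmap.
  have Wc := cqg_Linfty (cqg_adj Ac); have Wc' := cqg_Linfty Ac'.
  pose v := adj c \o w' \o c'.
  have Wv : W v by apply: Linfty_mul => //; exact: Linfty_mul.
  have vE : dG v = adj (Dl c) \o dG w' \o Dl c'.
    rewrite /v (star_hom_mul dG_hom (Linfty_mul Wc Ww') Wc') (star_hom_mul dG_hom Wc Ww').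
    by rewrite (dG_comult (cqg_adj Ac)) (dG_comult Ac') (comult_adj Ac).
  have -> : adj (lt G xi) \o (adj (Dl c \o @optens R tens G G idfun d) \o dG w' \o (Dl c' \o @optens R tens G G idfun d')) \o lt G xi
     = ipd (v xi) xi *: (adj d \o d').
    rewrite !optensE (adj_comp bc bt) (adj_tmap tens bid bd) adj_id.
    apply/funext => x.
    rewrite -[LHS]/((adj (lt G xi) \o tmap idfun (adj d)) ((adj (Dl c) \o dG w' \o Dl c') (tmap idfun d' (xi ⊙ x)))).
    rewrite -vE (adj_lten_tmap tens xi bid (bop_adj bd)) adj_id (tmapE tens xi x bid bd').
    rewrite -[LHS]/(adj d (adj (lt G xi) (dG v (xi ⊙ d' x)))) dG_haar_slice //.
    exact: (bopZ _ _ (bop_adj bd)).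
  by apply: clinZ => //; apply: cqg_mul => //; exact: cqg_adj.
have AE : A2 = cspan E by rewrite /E (@comult_denser R tens G).
rewrite AE => hX hX'.
have bX : bounded_op X by move: hX; apply: bop_cspan.
have h1 V : E V -> A (adj (lt G xi) \o (adj X \o dG w \o V) \o lt G xi).
  move=> EV; have bV := bE _ EV.
  have cz := clin_comp (bop_adj bl) (bop_comp (bop_comp bw bV) bl) cl.
  by apply: (cspan_adj bE cz) hX => V' EV'; exact: sand.
have cz := clin_comp (bop_comp (bop_adj bl) (bop_comp (bop_adj bX) bw)) bl cl.
by apply: (cspan_min cz) hX' => V EV; exact: h1.
Qed.

(* For w = y^* y the slices of dG w at the vectors a xi lie in A, since a (x) 1 *)
(* is a limit of sums of Delta(c)(1 (x) d); they kill xi, hence they vanish.    *)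
Lemma Linfty_sep y : W y -> y xi = 0 -> y = 0.
Proof.
move=> Wy yx; have by_ := Linfty_bop Wy; have bDy := dG_bop Wy; have bU := bopU hU.
have Wyy : W (adj y \o y) by apply: Linfty_mul => //; exact: Linfty_adj.
have bid := @bop_id R G; have bl := @bop_lten R tens G G.
have DE : dG (adj y \o y) = adj (dG y) \o dG y.
  by rewrite (star_hom_mul dG_hom (Linfty_adj Wy) Wy) (star_hom_adj dG_hom Wy).
have h1 a : A a -> dG y \o lt G (a xi) = 0.
  move=> Aa; have ba := cqg_bop Aa.
  have Xa : A2 (tmap a idfun) by apply: ctens_elt => //; exact: cqg_unital.
  have bX := cqg2_bop Xa.
  pose Q := dG y \o lt G (a xi).
  have bQ : bounded_op Q by exact: bop_comp.
  have E : adj Q \o Q = adj (lt G xi) \o (adj (tmap a idfun) \o dG (adj y \o y) \o tmap a idfun) \o lt G xi.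
    have lE : lt G (a xi) = tmap a idfun \o lt G xi.
      by apply/funext => x; rewrite -[RHS]/(tmap a idfun (xi ⊙ x)) (tmapE tens xi x ba bid).
    by rewrite /Q (adj_comp bDy (bl _)) lE (adj_comp bX (bl _)) DE.
  have Qx : Q xi = 0.
    rewrite -[LHS]/(dG y (a xi ⊙ xi)) -(Uxi hU) (dG_U _ _ Wy) yx.
    by rewrite -[_ ⊙ 0]/(lt G (a xi) 0) (bop0 (bl _)) (bop0 bU).
  have Z0 : adj Q \o Q = 0.
    apply: (cqg_sep hx); first by rewrite E; exact: Linfty_sandwich.
    by rewrite -[LHS]/(adj Q (Q xi)) Qx (bop0 (bop_adj bQ)).
  apply/funext => x; apply: ipd_eq0; rewrite -[dG y \o _]/Q (adjP bQ).
  by rewrite -[adj Q _]/((adj Q \o Q) x) Z0 op0E ipd0r.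
have D0 : dG y = 0.
  apply: tens_ext => //; first exact: bop_zero.
  move=> e v; suff /(congr1 (fun g => g e)) : dG y \o rt G v = 0 by [].
  have br := @bop_rten R tens G G v.
  apply: (cyc_ext hx (bop_comp bDy br) (bop_zero _ _)) => a Aa.
  by have /(congr1 (fun g => g v)) := h1 a Aa.
apply/funext => v; rewrite op0E; apply: nrm_eq0.
have : nrm (U (xi ⊙ y v)) = 0 by rewrite -(dG_U _ _ Wy) D0 op0E nrm0.
have -> : nrm (U (xi ⊙ y v)) = nrm (xi ⊙ y v).
  by apply/eqP; rewrite -(@eqrXn2 _ 2) ?nrm_ge0 // !nrm_sqr (isoU hU).
by rewrite nrm_elt (nrm_xi hx) mul1r.
Qed.

(** A separating vector is cyclic for the commutant: the projection p onto the closure of A' xi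
    belongs to the bicommutant of A, and 1 - p kills xi, so [Linfty_sep] gives p = 1. *)
Lemma commutant_dense z (e : R) : 0 < e ->
  exists2 a', commutant A a' & nrm (z - a' xi) <= e.
Proof.
move=> e0; pose S := [set a' xi | a' in commutant A].
have sA := @cqg_star R tens G.
have S0 : S 0 by exists 0 => //; split; [exact: bop_zero | move=> a Aa; apply/funext => x /=; exact: (bop0 (cqg_bop Aa))].
have SL (c : C) x y : S x -> S y -> S (c *: x + y).
  by move=> [a ca <-] [b cb <-]; exists (c *: a + b) => //; exact: commutant_lin.
have cY := closure_csub S0 SL; set Y := closure S in cY.
have SY x : S x -> Y x by exact: subset_closure.
have bp := bop_prj cY.
have Yinv T : commutant A T -> forall x, Y x -> Y (T x).
  move=> cT x /closure_nrm hx0; apply/closure_nrm => d d0; have [bTT _] := cT.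
  have [m m0 hm] := bop_opn bTT; have [y [b cb <-] hy] := hx0 _ (divr_gt0 d0 m0).
  exists (T (b xi)); first by exists (T \o b) => //; exact: commutant_comp.
  rewrite -(bopB _ _ bTT) (le_trans (hm _)) // mulrC -ler_pdivlMr //.
have Wp : W (prj Y).
  apply: (bicommutant sA (@cqg_unital R tens G)); split => // T cT.
  have cT' := commutant_adj sA cT; have [bTT _] := cT.
  apply/funext => x /=; symmetry.
  by apply: (prj_comm cY bTT) => y; [exact: Yinv | exact: Yinv].
have W1 : W (idfun - prj Y).
  apply: clinB => //; first by apply: cstar_clin; apply: vn_cstar; exact: Linfty_vn.
  exact: cqg_Linfty (@cqg_unital R tens G).
have h : (idfun - prj Y) xi = 0.
  rewrite -[LHS]/(xi - prj Y xi) prj_id ?subrr //; apply: SY.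
  by exists idfun => //; exact: commutant_id.
have /(congr1 (fun g => g z)) := Linfty_sep W1 h.
rewrite -[(_ - _) z]/(z - prj Y z) => /eqP; rewrite op0E subr_eq0 => /eqP ->.
by have /closure_nrm /(_ e e0)[_ [a ca <-] ha] := prj_in z cY; exists a.
Qed.

End LinftyFacts.

(** * A two-sided approximate unit for convolution *)

Section ApproxUnit.
Variable R : realType.
Variable tens : forall H K : hilbertType R, hilbertTensor H K.
Implicit Types H K L : hilbertType R.
Local Notation C := R[i].
Local Notation "H ⊗ K" := (tensor_space (tens H K))
  (at level 40, left associativity).
Local Notation "x ⊙ y" := (elt (tens _ _) x y)
  (at level 40, left associativity).
Local Notation lt K x := (@lten R tens _ K x).
Local Notation rt H y := (@rten R tens H _ y).
Variables (G : compact_quantum_group tens) (phi : (G -> G) -> R[i]^o) (xi : G).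
Hypothesis hx : haar_gns phi xi.
Local Notation A := (@cqg_alg R tens G).
Local Notation Dl := (@comult R tens G).
Local Notation A2 := (@ctens R tens G G A A).
Variable U : G ⊗ G -> G ⊗ G.
Hypothesis hU : mulU xi U.
Local Notation Th := (Th xi U).
Local Notation lam := (lam U).
Variable dG : (G -> G) -> (G ⊗ G -> G ⊗ G).
Hypothesis hdG : Linfty_comult dG.
Local Notation cu := (central_unit Th).

Lemma lam_closure e f (d : R) : 0 < d -> exists z, opn (lam e f - lam xi z) d.
Proof.
move=> d0; have f1 : 0 < nrm f + 1 by rewrite ltr_wpDl ?nrm_ge0.
have [a' ca ha] := commutant_dense hx hU hdG e (divr_gt0 d0 f1).
exists (adj a' f); rewrite -(lam_comm hx hU f ca).
apply: opnW (opn_lamBl hU _ _ _); move: ha; rewrite ler_pdivlMr // => ha.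
by have := nrm_ge0 (e - a' xi); lra.
Qed.

Lemma frob_sat z : intertw Th (lm Th z).
Proof. by split; [exact: (bop_lam hU xi z) | exact: (lam_intertwine hx hU z)]. Qed.
Lemma frob_sata z : intertw Th (adj (lm Th z)).
Proof.
by split; [exact: (bop_adj (bop_lam hU xi z)) | exact: (lam_intertwine_adj hx hU z)].
Qed.
Lemma frob_nd y : (forall z, adj (lm Th z) y = 0) -> y = 0.
Proof. exact: (lam_nondeg hx hU). Qed.
Lemma frob_cpt z : cpt (lm Th z). Proof. exact: (lam_cpt hx hU). Qed.

Lemma cu_lam u e f : cu u -> lam xi u \o lam e f = lam e f \o lam xi u.
Proof.
move=> [_ _ cu_c]; have bu := bop_lam hU xi u; have bid := @bop_id R G.
have [_ _ cl] := @clin_equal R G G G G (lam xi u) idfun idfun (lam xi u) bu bid bid bu.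
apply: cl; apply/norm_closureP => d d0; have [z hz] := lam_closure e f d0.
by exists (lam xi z) => //=; exact: (cu_c z).
Qed.

Lemma csl_eq e f e' f' a b : A a -> A b -> lam e f (a xi) = lam e' f' (b xi) ->
  csl e f a = csl e' f' b.
Proof.
move=> Aa Ab h; apply/eqP; rewrite -subr_eq0; apply/eqP.
have cl := cstar_clin (@cqg_cstar R tens G).
apply: (cqg_sep hx); first by apply: clinB => //; exact: csl_in.
by rewrite -[LHS]/(csl e f a xi - csl e' f' b xi) -!(lam_csl hU) // h subrr.
Qed.

Lemma csl_central u e f a : cu u -> A a ->
  csl xi u (csl e f a) = csl e f (csl xi u a).
Proof.
move=> hu Aa; apply: csl_eq; [exact: csl_in | exact: csl_in |].
by rewrite -!(lam_csl hU _ _ Aa); exact: (congr1 (fun g => g (a xi)) (cu_lam e f hu)).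
Qed.

(** Adjoints in A exchange [csl e f] and [csl f e]. This transports the centrality of [lam xi u] to
    [lam u xi], whose vectors appear in the opposite order. *)
Lemma csl_swap u e f a : cu u -> A a ->
  csl u xi (csl e f a) = csl e f (csl u xi a).
Proof.
move=> hu Aa; have Aa' := cqg_adj Aa.
have E b : A b -> csl u xi b = adj (csl xi u (adj b)).
  by move=> Ab; rewrite csl_adj ?adjK //; [exact: cqg_bop | exact: cqg_adj].
have Ac := csl_in e f Aa.
rewrite (E _ Ac) (csl_adj e f Aa) csl_central // csl_adj; last exact: csl_in.
by rewrite -E.
Qed.

Lemma csl_idem u a : cu u -> A a -> csl u xi (csl u xi a) = csl u xi a.
Proof.
move=> hu Aa; have Aa' := cqg_adj Aa; have [_ i _] := hu.
have E b : A b -> csl u xi b = adj (csl xi u (adj b)).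
  by move=> Ab; rewrite csl_adj ?adjK //; [exact: cqg_bop | exact: cqg_adj].
rewrite (E _ (csl_in _ _ Aa)) (csl_adj u xi Aa) [RHS]E //; congr (adj _).
apply: csl_eq => //; first exact: csl_in.
rewrite -(lam_csl hU) //; exact: (congr1 (fun g => g (adj a xi)) i).
Qed.

Lemma lamr_lam u e f : cu u -> lam u xi \o lam e f = lam e f \o lam u xi.
Proof.
move=> hu; have b1 := bop_lam hU u xi; have b2 := bop_lam hU e f.
apply: (cyc_ext hx (bop_comp b1 b2) (bop_comp b2 b1)) => a Aa.
rewrite -[LHS]/(lam u xi (lam e f (a xi))) -[RHS]/(lam e f (lam u xi (a xi))).
rewrite !(lam_csl hU _ _ Aa) !(lam_csl hU _ _ (csl_in _ _ Aa)).
by rewrite csl_swap.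
Qed.

Lemma lamr_idem u : cu u -> lam u xi \o lam u xi = lam u xi.
Proof.
move=> hu; have b1 := bop_lam hU u xi.
apply: (cyc_ext hx (bop_comp b1 b1) b1) => a Aa.
rewrite -[LHS]/(lam u xi (lam u xi (a xi))).
by rewrite !(lam_csl hU _ _ Aa) !(lam_csl hU _ _ (csl_in _ _ Aa)) csl_idem.
Qed.

(* The kernel of this idempotent is invariant under all the lm z, hence under    *)
(* its own adjoint by lm_invariant: the idempotent is an orthogonal projection.  *)
Lemma lamr_opn u : cu u -> opn (lam u xi) 1.
Proof.
move=> hu; pose p := lam u xi; have bp : bounded_op p := bop_lam hU u xi.
have pp x : p (p x) = p x by exact: (congr1 (fun g => g x) (lamr_idem hu)).
pose Y := [set w | forall i : unit, p w = 0].
have cY : csub Y := csub_kernels (fun _ : unit => bp).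
have Yl z x : Y x -> Y (lm Th z x).
  move=> Yx i; have := congr1 (fun g => g x) (lamr_lam xi z hu).
  rewrite -[X in X = _ -> _]/(p (lm Th z x)) => ->.
  by rewrite -[LHS]/(lam xi z (p x)) (Yx tt) (bop0 (bop_lam hU xi z)).
have Yla := lm_invariant frob_sat frob_sata frob_nd cY Yl.
have Yp x : Y x -> adj p x = 0.
  move=> Yx; have Ypx : Y (adj p x).
    have [_ _ Yc] := cY; apply: Yc => e e0.
    have x1 : 0 < nrm x + 1 by rewrite ltr_wpDl ?nrm_ge0.
    have [z hz] := lam_closure u xi (divr_gt0 e0 x1).
    exists (adj (lm Th z) x); first exact: Yla.
    have bz := bop_lam hU xi z.
    have -> : adj p x - adj (lm Th z) x = adj (p - lam xi z) x.
      by rewrite addrC [p - _]addrC -[- lam xi z]scaleN1r adj_lin // rmorphN1 scaleN1r.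
    have k0 : 0 <= e / (nrm x + 1) by rewrite divr_ge0 ?ltW.
    apply: (le_trans (opn_adj (bop_sub bp bz) k0 hz x)).
    by rewrite mulrAC ler_pdivrMr // ler_wpM2l ?(ltW e0) // lerDl.
  by apply: ipd_eq0; rewrite -(adjPr bp) (Ypx tt) ipd0r.
move=> v; rewrite mul1r.
have [h0|n0] := eqVneq (nrm (p v)) 0; first by rewrite -/p h0 nrm_ge0.
have p0 : 0 < nrm (p v) by rewrite lt_neqAle eq_sym n0 nrm_ge0.
have E : ipd (p v) (p v) = ipd (p v) v.
  apply/eqP; rewrite eq_sym -subr_eq0 -ipdBr (adjP bp) Yp ?ipd0r // => i.
  by rewrite (bopB _ _ bp) pp subrr.
rewrite -(ler_pM2l p0) -expr2 nrm_sqr E.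
apply: le_trans (cauchy_schwarz _ _).
by apply: le_trans (Re_le_nrm _); exact: ler_norm.
Qed.

(** Once u dominates u0, the operator [lam u xi] fixes the range of every convolution whose
    parameter lies in the range of [lm Th u0]; the proof again passes through adjoints in A. *)
Lemma lamr_fix u u0 v : cu u -> cu u0 -> lm Th u \o lm Th u0 = lm Th u0 ->
  lam u xi \o lam (lm Th u0 v) xi = lam (lm Th u0 v) xi.
Proof.
move=> hu hu0 uu0; pose z := lm Th u0 v.
have E b w : A b -> csl w xi b = adj (csl xi w (adj b)).
  by move=> Ab; rewrite csl_adj ?adjK //; [exact: cqg_bop | exact: cqg_adj].
have zE : lm Th z = lm Th v \o lm Th u0.
  by have [a0 _ _] := hu0; rewrite -[X in _ \o X]a0 lmMa //; exact: frob_sata || exact: frob_sat.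
have uz : lm Th u \o lm Th z = lm Th z.
  have [_ _ c] := hu; rewrite zE -[LHS]/((lm Th u \o lm Th v) \o lm Th u0) c.
  by rewrite -[LHS]/(lm Th v \o (lm Th u \o lm Th u0)) uu0.
have b1 := bop_lam hU u xi; have b2 := bop_lam hU z xi.
apply: (cyc_ext hx (bop_comp b1 b2) b2) => a Aa; have Aa' := cqg_adj Aa.
rewrite -[LHS]/(lam u xi (lam z xi (a xi))) -[RHS]/(lam z xi (a xi)).
rewrite !(lam_csl hU _ _ Aa) (lam_csl hU _ _ (csl_in _ _ Aa)); congr (_ xi).
rewrite (E _ u (csl_in _ _ Aa)) (csl_adj z xi Aa) [RHS]E //; congr (adj _).
apply: csl_eq => //; first exact: csl_in.
rewrite -(lam_csl hU) //; exact: (congr1 (fun g => g (adj a xi)) uz).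
Qed.

(** Only convergence of [lam u xi] is new. A vector x orthogonal to the convergence space is
    orthogonal to the ranges of all [lam z xi], since z is approximated by [lm Th u z]. Then xi (x)
    x is orthogonal to the range of U, and x = 0. *)
Lemma approx_unit : exists F : set_system G, [/\ ProperFilter F,
  \forall u \near F, opn (lam xi u) 1 /\ opn (lam u xi) 1,
  forall x (e : R), 0 < e -> \forall u \near F, nrm (x - lam xi u x) <= e &
  forall x (e : R), 0 < e -> \forall u \near F, nrm (x - lam u xi x) <= e].
Proof.
have bTh := bop_Th hU.
have [F [PF FE F0 F1]] := cu_filter bTh frob_sat frob_sata frob_nd frob_cpt.
exists F; split => //.
  by apply: filterS FE => u hu; split; [exact: (cu_opn frob_sat hu) | exact: lamr_opn].
pose X := [set x | forall e : R, 0 < e -> \forall u \near F, nrm (x - lam u xi x) <= e].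
have o1 : \forall u \near F, opn (lam u xi) 1 by apply: filterS FE => u; exact: lamr_opn.
have cX : csub X := csub_strong_limit PF (fun u => bop_lam hU u xi) o1.
apply: (prj_dense cX) => x hx1.
have h1 u0 v y : cu u0 -> ipd x (lam (lm Th u0 v) xi y) = 0.
  move=> hu0; apply: hx1 => e e0; apply: filterS2 FE (F0 u0 hu0) => u hu uu0.
  have := congr1 (fun g => g y) (lamr_fix v hu hu0 uu0).
  rewrite -[X in X = _ -> _]/(lam u xi (lam (lm Th u0 v) xi y)) => ->.
  by rewrite subrr nrm0 ltW.
have h2 z y : ipd (lam z xi y) x = 0.
  apply: (@le_nrm0 _ C^o) => e e0.
  have k1 : 0 < nrm y * nrm x + 1 by rewrite ltr_wpDl ?mulr_ge0 ?nrm_ge0.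
  have [u [hu hz]] := filter_ex (filterI FE (F1 z _ (divr_gt0 e0 k1))).
  have -> : ipd (lam z xi y) x = ipd ((lam z xi - lam (lm Th u z) xi) y) x.
    rewrite -[(_ - _) y]/(lam z xi y - lam (lm Th u z) xi y) ipdBl.
    by rewrite [X in _ - X]ipdC h1 // conjc0 subr0.
  apply: (le_trans (cauchy_schwarz _ _)).
  apply: (le_trans (ler_wpM2r (nrm_ge0 x) (opn_lamBl hU z (lm Th u z) xi y))).
  rewrite (nrm_xi hx) mulr1 -mulrA; move: hz; rewrite ler_pdivlMr // => hz.
  by have := nrm_ge0 (z - lm Th u z); lra.
have : xi ⊙ x = 0.
  have bU := bopU hU; apply: (U_total hx hU) => w.
  have bt := bop_adj bU; rewrite (adjP bU).
  suff -> : adj U (xi ⊙ x) = 0 by rewrite ipd0r.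
  apply: tens_eq0 => z y; rewrite -(adjP bU) ipd_lten; exact: h2.
by move=> /(congr1 (fun v => nrm v)); rewrite nrm_elt (nrm_xi hx) mul1r nrm0 => /nrm_eq0.
Qed.

End ApproxUnit.

(** * Slices of the coaction *)

Section NLevel.
Variable R : realType.
Variable tens : forall H K : hilbertType R, hilbertTensor H K.
Local Notation C := R[i].
Local Notation "H ⊗ K" := (tensor_space (tens H K))
  (at level 40, left associativity).
Local Notation "x ⊙ y" := (elt (tens _ _) x y)
  (at level 40, left associativity).
Local Notation lt K x := (@lten R tens _ K x).
Local Notation rt H y := (@rten R tens H _ y).
Variables (G : compact_quantum_group tens) (phi : (G -> G) -> R[i]^o) (xi : G).
Variable U : G ⊗ G -> G ⊗ G.
Variables (K : hilbertType R) (N : set (K -> K)) (dN : (K -> K) -> (G ⊗ K -> G ⊗ K)).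
Variables (dG : (G -> G) -> (G ⊗ G -> G ⊗ G))
  (F1 : (G ⊗ K -> G ⊗ K) -> (G ⊗ (G ⊗ K) -> G ⊗ (G ⊗ K)))
  (F2 : (G ⊗ K -> G ⊗ K) -> (G ⊗ G ⊗ K -> G ⊗ G ⊗ K)).
Local Notation A := (@cqg_alg R tens G).
Local Notation Dl := (@comult R tens G).
Local Notation A2 := (@ctens R tens G G A A).
Local Notation W := (@Linfty R tens G).
Local Notation M := (@wtens R tens G K W N).
Local Notation lam := (lam U).

(** Fixes the witnesses of the coassociativity of the coaction: F1 is iota (x) dN and F2 is dG (x)
    iota on the von Neumann tensor product. *)
Record coact_data : Prop := CoactData {
  cd_haar : haar_gns phi xi;
  cd_U : mulU xi U;
  cd_dG : Linfty_comult dG;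
  cd_vn : von_neumann_algebra N;
  cd_coact : coaction N dN;
  cd_erg : ergodic N dN;
  cd_F1 : [/\ star_hom M F1, normal_on M F1 & @id_tens R tens G K (G ⊗ K) W N dN F1];
  cd_F2 : [/\ star_hom M F2, normal_on M F2 & @tens_id R tens G K (G ⊗ G) W N dG F2];
  cd_assoc : forall x, N x -> same_assoc (F2 (dN x)) (F1 (dN x)) }.

Hypothesis hs : coact_data.
Let hx := cd_haar hs.
Let hU := cd_U hs.
Let hdG := cd_dG hs.
Let hc := cd_coact hs.

Lemma coactN_star : star_algebra N. Proof. by case: (cd_vn hs). Qed.
Lemma coactN_id : N idfun. Proof. by case: (cd_vn hs). Qed.
Lemma coactN_bop x : N x -> bounded_op x. Proof. exact: (star_algebra_bounded coactN_star). Qed.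
Lemma coactN_mul x y : N x -> N y -> N (x \o y). Proof. exact: (star_algebra_mul coactN_star). Qed.
Lemma coactN_adj x : N x -> N (adj x). Proof. exact: (star_algebra_adj coactN_star). Qed.
Lemma coactN_cstar : cstar_algebra N. Proof. exact: (vn_cstar (cd_vn hs)). Qed.
Lemma dN_bop x : N x -> bounded_op (dN x).
Proof. exact: (star_hom_bounded (coaction_hom hc)). Qed.

Definition WN := lspan (@eltens R tens G K W N).

Lemma eltWN_bop : @eltens R tens G K W N `<=` @bounded_op R _ _.
Proof. by apply: eltens_bounded; [exact: Linfty_bop | exact: coactN_bop]. Qed.

Lemma lspan_eq (H1 H2 H3 H4 : hilbertType R) (X Y : set (H1 -> H2))
    (L L' : (H1 -> H2) -> (H3 -> H4)) :
  X `<=` Y -> Y 0 -> (forall (c : C) S T, Y S -> Y T -> Y (c *: S + T)) ->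
  linear_on Y L -> linear_on Y L' -> (forall T, X T -> L T = L' T) ->
  forall T, lspan X T -> L T = L' T.
Proof.
move=> XY Y0 YL lL lL' h T [n [c [f [hf ->]]]].
have z (L1 : (H1 -> H2) -> (H3 -> H4)) : linear_on Y L1 -> L1 0 = 0.
  by move=> l; rewrite -[0](subrr (0 : H1 -> H2)) (linear_on_B l) ?subrr.
have : Y (\sum_k c k *: f k) /\ L (\sum_k c k *: f k) = L' (\sum_k c k *: f k).
  elim/big_rec : _ => [|k S _ [YS ES]]; first by rewrite (z _ lL) (z _ lL').
  have Yf : Y (f k) by exact: XY.
  by split; [exact: YL | rewrite lL // lL' // ES h].
by case.
Qed.

Lemma WN_star : star_algebra WN.
Proof.
have bW := @Linfty_bop R tens G; have bN := coactN_bop.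
have lin (c : C) S T : WN S -> WN T -> WN (c *: S + T) by exact: lspan_lin.
have elt S T : W S -> N T -> WN (@tmap R tens _ _ _ _ S T).
  by move=> WS NT; apply: lspan_sub; exact: eltensP.
split.
- move=> _ [n [c [f [hf ->]]]]; apply: bop_sumop => k _; apply: bop_scale.
  exact: eltWN_bop.
- exact: lspan0.
- exact: lin.
- move=> S T [n [c [f [hf ->]]]] [m [d [g [hg ->]]]].
  rewrite (_ : _ \o _ = \sum_k \sum_j (c k * d j) *: (f k \o g j)); last first.
    apply/funext => x /=.
    have sE p (h : 'I_p -> (G ⊗ K -> G ⊗ K)) y : (\sum_k h k) y = \sum_k h k y.
      by elim/big_ind2 : _ => // u1 u2 v1 v2 <- <-.
    rewrite !sE; apply: eq_bigr => k _; rewrite sE.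
    have bf := eltWN_bop (hf k).
    rewrite -[(c k *: f k) _]/(c k *: f k _) (bop_sum _ _ _ bf) scaler_sumr.
    by apply: eq_bigr => j _; rewrite -[(d j *: g j) x]/(d j *: g j x) (bopZ _ _ bf) scalerA.
  have add0 S1 T1 : WN S1 -> WN T1 -> WN (S1 + T1).
    by move=> h1 h2; rewrite -[S1]scale1r; exact: lin.
  apply: (big_ind WN (lspan0 _) add0) => k _.
  apply: (big_ind WN (lspan0 _) add0) => j _.
  rewrite -[_ *: _]addr0; apply: lin; last exact: lspan0.
  have [S3 WS3 [T1 NT1 ->]] := hf k; have [S4 WS4 [T2 NT2 ->]] := hg j.
  rewrite !optensE tmap_comp; [|exact: bW|exact: bN|exact: bW|exact: bN].
  by apply: elt; [exact: Linfty_mul | exact: coactN_mul].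
- move=> _ [n [c [f [hf ->]]]].
  suff : bounded_op (\sum_k c k *: f k) /\ WN (adj (\sum_k c k *: f k)) by case.
  elim/big_rec : _ => [|k S _ [bS hS]].
    by rewrite adj0; split; [exact: bop_zero | exact: lspan0].
  have bf := eltWN_bop (hf k); split; first exact: bop_lin.
  rewrite adj_lin //; apply: lin => //; have [S1 WS1 [T1 NT1 ->]] := hf k.
  rewrite optensE adj_tmap; [|exact: bW|exact: bN].
  by apply: elt; [exact: Linfty_adj | exact: coactN_adj].
Qed.

Lemma WN_id : WN idfun.
Proof.
rewrite -(@tmap_id R tens G K); apply: lspan_sub; apply: eltensP; last exact: coactN_id.
by case: (@Linfty_vn R tens G).
Qed.

Lemma wtens_vn : von_neumann_algebra M.
Proof. by apply: vn_strong_closure; [exact: WN_star | exact: WN_id]. Qed.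
Lemma wtens_star : star_algebra M. Proof. by case: wtens_vn. Qed.
Lemma wtens_cstar : cstar_algebra M. Proof. exact: vn_cstar wtens_vn. Qed.
Lemma wtens_bop X : M X -> bounded_op X. Proof. exact: (star_algebra_bounded wtens_star). Qed.
Lemma WN_M : WN `<=` M.
Proof.
move=> X WX; apply: opn_strong; last exact: (star_algebra_bounded WN_star).
apply/norm_closureP => e e0; exists X => // x.
by rewrite -[(_ - _) x]/(X x - X x) subrr nrm0 mulr_ge0 ?nrm_ge0 ?ltW.
Qed.
Lemma wtens_bicomm X : M X -> commutant (commutant WN) X.
Proof. exact: strong_closure_bicomm. Qed.
Lemma wtens_elt S T : W S -> N T -> M (@tmap R tens _ _ _ _ S T).
Proof. by move=> WS NT; apply: WN_M; apply: lspan_sub; exact: eltensP. Qed.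
Lemma dN_in x : N x -> M (dN x). Proof. exact: (coaction_in hc). Qed.

Lemma lspan_commutant (H : hilbertType R) (X : set (H -> H)) c :
  commutant X c -> commutant (lspan X) c.
Proof.
move=> [bc hcx]; split=> // _ [n [d [f [hf ->]]]].
apply/funext => x /=.
have sE (y : H) : (\sum_k d k *: f k) y = \sum_k d k *: f k y.
  by elim/big_ind2 : _ => // u1 u2 v1 v2 <- <-.
rewrite !sE (bop_sum _ _ _ bc); apply: eq_bigr => k _; rewrite (bopZ _ _ bc).
by have := congr1 (fun g => g x) (hcx _ (hf k)) => /= ->.
Qed.

Lemma wtens_commutant_r c X : commutant N c -> M X -> X \o tmap idfun c = tmap idfun c \o X.
Proof.
move=> [bc hcx] /wtens_bicomm[_ h]; have bid := @bop_id R G.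
symmetry; apply: h; apply: lspan_commutant; split; first exact: bop_tmap.
move=> _ [S WS [T NT ->]]; rewrite optensE; have bS := Linfty_bop WS; have bTT := coactN_bop NT.
by rewrite (tmap_comp tens bid bc bS bTT) (tmap_comp tens bS bTT bid bc) hcx.
Qed.

Lemma wtens_commutant_l c X : commutant A c -> M X -> X \o tmap c idfun = tmap c idfun \o X.
Proof.
move=> cA /wtens_bicomm[_ h]; have bid := @bop_id R K; have [bc _] := cA.
symmetry; apply: h; apply: lspan_commutant; split; first exact: bop_tmap.
move=> _ [S WS [T NT ->]]; rewrite optensE; have bS := Linfty_bop WS; have bTT := coactN_bop NT.
rewrite (tmap_comp tens bc bid bS bTT) (tmap_comp tens bS bTT bc bid).
have [_ hS] := Linfty_bicomm WS.
by rewrite -(hS c cA).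
Qed.

Definition op_slice (e f : G) (X : G ⊗ K -> G ⊗ K) : K -> K :=
  adj (lt K f) \o X \o lt K e.

Lemma nslice_bop e f X : bounded_op X -> bounded_op (op_slice e f X).
Proof.
move=> bX; have bl := @bop_lten R tens G K.
by apply: bop_comp (bl e); apply: bop_comp bX; apply: bop_adj; exact: bl.
Qed.

Lemma nslice_lin e f (c : C) X Y :
  op_slice e f (c *: X + Y) = c *: op_slice e f X + op_slice e f Y.
Proof. by apply: comp_lin; apply: bop_adj; exact: bop_lten. Qed.

Lemma nslice_elt e f S T : bounded_op S -> bounded_op T ->
  op_slice e f (tmap S T) = ipd (S e) f *: T.
Proof.
move=> bS bTT; apply/funext => k.
rewrite -[LHS]/(adj (lt K f) (tmap S T (e ⊙ k))) (tmapE tens e k bS bTT).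
by rewrite adj_ltenE.
Qed.

(** If c commutes with N then 1 (x) c commutes with M, so the slice commutes with c, and N is its
    own bicommutant. *)
Lemma nslice_in e f X : M X -> N (op_slice e f X).
Proof.
move=> MX; apply: (vn_bicommutant (cd_vn hs)); split; first by apply: nslice_bop; exact: wtens_bop.
move=> c cN; have [bc _] := cN; have bid := @bop_id R G.
have h := wtens_commutant_r cN MX.
apply/funext => k; rewrite -[RHS]/(adj (lt K f) (X (e ⊙ c k))).
rewrite -[LHS]/((c \o adj (lt K f)) (X (e ⊙ k))).
have -> : c \o adj (lt K f) = adj (lt K f) \o tmap idfun c.
  by rewrite (adj_lten_tmap tens f bid bc) adj_id.
rewrite -[LHS]/(adj (lt K f) ((tmap idfun c \o X) (e ⊙ k))) -h.
by rewrite -[LHS]/(adj (lt K f) (X (tmap idfun c (e ⊙ k)))) (tmapE tens e k bid bc).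
Qed.

Definition co_slice e f x := op_slice e f (dN x).

Lemma nsl_in e f x : N x -> N (co_slice e f x).
Proof. by move=> Nx; apply: nslice_in; exact: dN_in. Qed.

End NLevel.

(** * Coassociativity on slices and the use of ergodicity *)

Section NLevel2.
Variable R : realType.
Variable tens : forall H K : hilbertType R, hilbertTensor H K.
Local Notation C := R[i].
Local Notation "H ⊗ K" := (tensor_space (tens H K))
  (at level 40, left associativity).
Local Notation "x ⊙ y" := (elt (tens _ _) x y)
  (at level 40, left associativity).
Local Notation lt K x := (@lten R tens _ K x).
Local Notation rt H y := (@rten R tens H _ y).
Variables (G : compact_quantum_group tens) (phi : (G -> G) -> R[i]^o) (xi : G).
Variable U : G ⊗ G -> G ⊗ G.
Variables (K : hilbertType R) (N : set (K -> K)) (dN : (K -> K) -> (G ⊗ K -> G ⊗ K)).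
Variables (dG : (G -> G) -> (G ⊗ G -> G ⊗ G))
  (F1 : (G ⊗ K -> G ⊗ K) -> (G ⊗ (G ⊗ K) -> G ⊗ (G ⊗ K)))
  (F2 : (G ⊗ K -> G ⊗ K) -> (G ⊗ G ⊗ K -> G ⊗ G ⊗ K)).
Local Notation A := (@cqg_alg R tens G).
Local Notation Dl := (@comult R tens G).
Local Notation A2 := (@ctens R tens G G A A).
Local Notation W := (@Linfty R tens G).
Local Notation M := (@wtens R tens G K W N).
Local Notation lam := (lam U).
Hypothesis hs : @coact_data R tens G phi xi U K N dN dG F1 F2.
Let hx := cd_haar hs.
Let hU := cd_U hs.
Let hdG := cd_dG hs.
Let hc := cd_coact hs.
Local Notation WN := (@WN R tens G K N).
Local Notation nslice e f := (@op_slice R tens G K e f).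
Local Notation nsl e f := (@co_slice R tens G K dN e f).
Lemma F1_hom : star_hom M F1. Proof. by case: (cd_F1 hs). Qed.
Lemma F2_hom : star_hom M F2. Proof. by case: (cd_F2 hs). Qed.
Lemma F1_normal : normal_on M F1. Proof. by case: (cd_F1 hs). Qed.
Lemma F2_normal : normal_on M F2. Proof. by case: (cd_F2 hs). Qed.
Lemma F1_elt S T : W S -> N T -> F1 (tmap S T) = tmap S (dN T).
Proof. by case: (cd_F1 hs) => _ _; exact. Qed.
Lemma F2_elt S T : W S -> N T -> F2 (tmap S T) = tmap (dG S) T.
Proof. by case: (cd_F2 hs) => _ _; exact. Qed.
Lemma F1_bop X : M X -> bounded_op (F1 X). Proof. exact: (star_hom_bounded F1_hom). Qed.
Lemma F2_bop X : M X -> bounded_op (F2 X). Proof. exact: (star_hom_bounded F2_hom). Qed.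

Lemma normal_nslice e f : normal_on M (fun X => dN (nslice e f X)).
Proof.
move=> I F PF x_ x hM Mx hcv; apply: (coaction_normal hc) => //.
- by move=> i; exact: (nslice_in hs).
- exact: (nslice_in hs).
move=> w nw; have bl := @bop_lten R tens G K.
exact: (hcv _ (normal_comp (bop_adj (bl f)) (bl e) nw)).
Qed.

Lemma wtens_agree (L L' H1 H2 : hilbertType R) (f : (G ⊗ K -> G ⊗ K) -> (H1 -> H1))
    (g : (G ⊗ K -> G ⊗ K) -> (H2 -> H2)) (P : H1 -> L') (Q : H2 -> L')
    (B : L -> H1) (B' : L -> H2) X :
  normal_on M f -> (forall X, M X -> bounded_op (f X)) -> linear_on M f ->
  normal_on M g -> (forall X, M X -> bounded_op (g X)) -> linear_on M g ->
  bounded_op P -> bounded_op B -> bounded_op Q -> bounded_op B' ->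
  (forall S T, W S -> N T -> forall k, P (f (tmap S T) (B k)) = Q (g (tmap S T) (B' k))) ->
  M X -> P \o f X \o B = Q \o g X \o B'.
Proof.
move=> nf bf lf ng bg lg bP bB bQ bB' h MX.
have sM := wtens_star hs; have EM : @eltens R tens G K W N `<=` M.
  by move=> _ [S WS [T NT ->]]; exact: (wtens_elt hs).
apply: (normal_agree (WN_star hs) (WN_id hs) (WN_M hs) MX (wtens_bicomm MX) nf bf ng bg bP bB bQ bB').
apply: (lspan_eq EM (star_algebra0 sM) (star_algebra_linear sM)
  (L := fun X => P \o f X \o B) (L' := fun X => Q \o g X \o B')).
- by move=> c S T MS MT; rewrite lf // comp_lin.
- by move=> c S T MS MT; rewrite lg // comp_lin.
- by move=> _ [S WS [T NT ->]]; apply/funext => k; exact: h.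
Qed.

Lemma linear_on_id (V : lmodType C) (X : set V) : linear_on X id.
Proof. by []. Qed.

Lemma dN_nslice e f X : M X ->
  dN (nslice e f X) = adj (lt (G ⊗ K) f) \o F1 X \o lt (G ⊗ K) e.
Proof.
move=> MX; have bl := @bop_lten R tens G (G ⊗ K); have bid := @bop_id R.
suff : idfun \o (fun X => dN (nslice e f X)) X \o idfun =
  adj (lt (G ⊗ K) f) \o F1 X \o lt (G ⊗ K) e by [].
apply: (@wtens_agree _ _ _ _ (fun X => dN (nslice e f X)) F1 idfun (adj (lt (G ⊗ K) f)) idfun
  (lt (G ⊗ K) e) X (@normal_nslice e f) _ _ F1_normal F1_bop (star_hom_linear F1_hom)
  (bid _) (bid _) (bop_adj (bl f)) (bl e) _ MX).
- by move=> Y MY; apply: (dN_bop hs); exact: (nslice_in hs).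
- move=> c S T MS MT; rewrite nslice_lin (star_hom_linear (coaction_hom hc)) //; exact: (nslice_in hs).
move=> S T WS NT k; have bS := Linfty_bop WS; have bTT := coactN_bop hs NT; have bd := dN_bop hs NT.
rewrite (F1_elt WS NT) (nslice_elt _ _ bS bTT).
rewrite -[RHS]/(adj (lt (G ⊗ K) f) (tmap S (dN T) (e ⊙ k))) (tmapE tens e k bS bd) adj_ltenE.
have z : dN 0 = 0.
  by rewrite -[in LHS](subrr T) (linear_on_B (star_hom_linear (coaction_hom hc))) ?subrr.
have -> : dN (ipd (S e) f *: T) = ipd (S e) f *: dN T.
  rewrite -[in LHS](addr0 (_ *: T)) (star_hom_linear (coaction_hom hc)) ?z ?addr0 //.
  exact: star_algebra0 (coactN_star hs).
by [].
Qed.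

(** The relation [dG_U] amplified by N; it is checked on elementary tensors and extended by
    normality. *)
Lemma F2_U X e : M X ->
  F2 X \o tmap (U \o lt G e) idfun = tmap (U \o lt G e) idfun \o X.
Proof.
move=> MX; have bid := @bop_id R; have bU := bopU hU; have bl := @bop_lten R tens G G e.
have bUl := bop_comp bU bl.
have bt : bounded_op (tmap (U \o lt G e) (idfun : K -> K) : G ⊗ K -> (G ⊗ G) ⊗ K) by exact: bop_tmap.
suff : idfun \o F2 X \o tmap (U \o lt G e) idfun =
  tmap (U \o lt G e) idfun \o id X \o idfun by [].
apply: (@wtens_agree _ _ _ _ F2 id idfun (tmap (U \o lt G e) idfun) (tmap (U \o lt G e) idfun) idfun X
  F2_normal F2_bop (star_hom_linear F2_hom) (@normal_on_id R _ M) (@wtens_bop _ _ _ _ _ _ _ _ _ _ _ _ hs) (@linear_on_id _ _)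
  (bid _) bt bt (bid _) _ MX).
move=> S T WS NT; have bS := Linfty_bop WS; have bTT := coactN_bop hs NT.
have E : @tmap R tens _ _ _ _ (dG S) T \o @tmap R tens _ _ _ _ (U \o lt G e) (idfun : K -> K) =
    @tmap R tens _ _ _ _ (U \o lt G e) (idfun : K -> K) \o @tmap R tens _ _ _ _ S T.
  rewrite (tmap_comp tens bUl (bid _) (dG_bop hdG WS) bTT) (tmap_comp tens bS bTT bUl (bid _)).
  congr (tmap _ T); apply/funext => x; exact: (dG_U hx hU hdG).
by move=> k; rewrite (F2_elt WS NT); exact: (congr1 (fun g => g k) E).
Qed.

(** Left invariance of the Haar state amplified by N. *)
Lemma F2_haar X e : M X ->
  tmap (adj (lt G xi)) idfun \o F2 X \o lt K (xi ⊙ e) = lt K e \o nslice xi xi X.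
Proof.
move=> MX; have bid := @bop_id R; have bl := @bop_lten R tens G; have bl2 := @bop_lten R tens (G ⊗ G) K.
have bla := bop_adj (bl G xi).
have bt : bounded_op (tmap (adj (lt G xi)) (idfun : K -> K) : (G ⊗ G) ⊗ K -> G ⊗ K) by exact: bop_tmap.
have bQ := bop_comp (bl K e) (bop_adj (bl K xi)).
suff : tmap (adj (lt G xi)) idfun \o F2 X \o lt K (xi ⊙ e) =
  (lt K e \o adj (lt K xi)) \o id X \o lt K xi by [].
apply: (@wtens_agree _ _ _ _ F2 id (tmap (adj (lt G xi)) idfun) (lt K e \o adj (lt K xi)) (lt K (xi ⊙ e)) (lt K xi) X
  F2_normal F2_bop (star_hom_linear F2_hom) (@normal_on_id R _ M) (@wtens_bop _ _ _ _ _ _ _ _ _ _ _ _ hs) (@linear_on_id _ _)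
  bt (bl2 _) bQ (bl K xi) _ MX).
move=> S T WS NT k; have bS := Linfty_bop WS; have bTT := coactN_bop hs NT; have bD := dG_bop hdG WS.
rewrite (F2_elt WS NT) -[lt K (xi ⊙ e) k]/((xi ⊙ e) ⊙ k) (tmapE tens _ _ bD bTT).
rewrite (tmapE tens _ _ bla (bid _)) (dG_haar_slice hx hdG _ WS).
rewrite -[RHS]/(e ⊙ (adj (lt K xi) (tmap S T (xi ⊙ k)))) (tmapE tens xi k bS bTT) adj_ltenE.
by rewrite eltZl eltZr.
Qed.

Lemma assoc_ex : exists a : (G ⊗ G) ⊗ K -> G ⊗ (G ⊗ K), assoc_map a.
Proof. exact: same_assoc_map (cd_assoc hs (coactN_id hs)). Qed.

(** Coassociativity sliced in its first leg: F1 produces dN of the slice, F2 the right-hand side. *)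
Lemma dN_nsl e f x v k : N x ->
  dN (nsl e f x) (v ⊙ k) = tmap (adj (lt G f)) idfun (F2 (dN x) ((e ⊙ v) ⊙ k)).
Proof.
move=> Nx; have [a ha] := assoc_ex; have MX := dN_in hs Nx.
rewrite -[nsl e f x]/(nslice e f (dN x)) dN_nslice //.
rewrite -[LHS]/(adj (lt (G ⊗ K) f) (F1 (dN x) (e ⊙ (v ⊙ k)))).
have [ba aE] := ha; rewrite -aE.
have := congr1 (fun g => g ((e ⊙ v) ⊙ k)) (same_assocE ha (cd_assoc hs Nx)).
rewrite -[X in _ = X -> _]/(F1 (dN x) (a ((e ⊙ v) ⊙ k))) => <-.
exact: (congr1 (fun g => g _) (assoc_slice f ha)).
Qed.

(** U fixes e (x) xi, so [F2_U] can be applied inside [dN_nsl]. Convergence of convolution operators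
    to 1 thus becomes convergence of slices to x. *)
Lemma dN_nsl_xi e f x : N x ->
  dN (nsl e f x) \o lt K xi = tmap (lam e f) idfun \o (dN x \o lt K xi).
Proof.
move=> Nx; have MX := dN_in hs Nx; have bid := @bop_id R K.
have bU := bopU hU; have bl := @bop_lten R tens G G; have bUl := bop_comp bU (bl e).
apply/funext => k; rewrite -[LHS]/(dN (nsl e f x) (xi ⊙ k)) dN_nsl // -[e ⊙ xi](Uxi hU).
rewrite -[U (e ⊙ xi)]/((U \o lt G e) xi) -[k in LHS]/(idfun k) -(tmapE tens xi k bUl bid).
have := congr1 (fun g => g (xi ⊙ k)) (F2_U e MX).
rewrite -[X in X = _ -> _]/(F2 (dN x) (tmap (U \o lt G e) idfun (xi ⊙ k))) => ->.
rewrite -[LHS]/((tmap (adj (lt G f)) idfun \o tmap (U \o lt G e) idfun) (dN x (xi ⊙ k))).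
by rewrite (tmap_comp tens bUl bid (bop_adj (bl f)) bid).
Qed.

(** By [dN_nsl] and left invariance the slice is a fixed point of the coaction, and ergodicity
    applies. *)
Lemma nsl_xi_scalar x : N x -> exists c : C, nsl xi xi x = c *: idfun.
Proof.
move=> Nx; have MX := dN_in hs Nx.
have h : [set y | N y /\ dN y = @optens R tens G K idfun y] (nsl xi xi x).
  split; first exact: (nsl_in hs).
  have bn : bounded_op (nsl xi xi x) by apply: (coactN_bop hs); exact: (nsl_in hs).
  have bid := @bop_id R G.
  apply: tens_ext; first by apply: (dN_bop hs); exact: (nsl_in hs).
    by rewrite optensE; exact: bop_tmap.
  move=> v k; rewrite dN_nsl // optensE (tmapE tens v k bid bn).
  exact: (congr1 (fun g => g k) (F2_haar v MX)).
by rewrite (cd_erg hs) in h; have [c _ <-] := h; exists c.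
Qed.

(** The slice of x^* x at xi is a scalar, and pairing it with k gives |dN x (xi (x) k)|^2. One
    nonzero k therefore determines the operator norm of k |-> dN x (xi (x) k). *)
Lemma dN_xi_norm x : N x -> exists2 c : R, 0 <= c & forall k, nrm (dN x (xi ⊙ k)) = c * nrm k.
Proof.
move=> Nx; have Nxx : N (adj x \o x) by apply: (coactN_mul hs) => //; exact: (coactN_adj hs).
have [c hcc] := nsl_xi_scalar Nxx; have bd := dN_bop hs Nx.
have E k : nrm (dN x (xi ⊙ k)) ^+ 2 = complex.Re c * nrm k ^+ 2.
  rewrite nrm_sqr (adjP bd) -(star_hom_adj (coaction_hom hc) Nx).
  rewrite -[dN (adj x) _]/((dN (adj x) \o dN x) (xi ⊙ k)).
  rewrite -(star_hom_mul (coaction_hom hc) (coactN_adj hs Nx) Nx).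
  rewrite ipdC ipd_lten -[adj _ _]/(nsl xi xi (adj x \o x) k) hcc.
  rewrite -[(_ *: _) k]/(c *: k) ipdZl ipdxx.
  by case: (c) => p q /=; rewrite mulr0 subr0.
have [[k0 kn0]|all0] := pselect (exists k : K, k <> 0); last first.
  have k0 (k : K) : k = 0 by apply: contrapT => h; apply: all0; exists k.
  exists 0 => // k; rewrite (k0 k) -[xi ⊙ 0]/(lt K xi 0) (bop0 (@bop_lten R tens _ _ _)) (bop0 bd).
  by rewrite !nrm0 mulr0.
have nk0 : 0 < nrm k0 by rewrite lt_neqAle nrm_ge0 andbT eq_sym; apply/eqP => /nrm_eq0.
have c0 : 0 <= complex.Re c.
  by rewrite -(@pmulr_lge0 _ (nrm k0 ^+ 2)) ?exprn_gt0 // -E sqr_ge0.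
exists (Num.sqrt (complex.Re c)); first exact: sqrtr_ge0.
move=> k; apply/eqP; rewrite -(@eqrXn2 _ 2) ?nrm_ge0 ?mulr_ge0 ?sqrtr_ge0 ?nrm_ge0 //.
by rewrite exprMn sqr_sqrtr // E.
Qed.

End NLevel2.

(** * The C*-algebra of slices *)

Section SliceAlgebra.
Variable R : realType.
Variable tens : forall H K : hilbertType R, hilbertTensor H K.
Local Notation C := R[i].
Local Notation "H ⊗ K" := (tensor_space (tens H K))
  (at level 40, left associativity).
Local Notation "x ⊙ y" := (elt (tens _ _) x y)
  (at level 40, left associativity).
Local Notation lt K x := (@lten R tens _ K x).
Local Notation rt H y := (@rten R tens H _ y).
Variables (G : compact_quantum_group tens) (phi : (G -> G) -> R[i]^o) (xi : G).
Variable U : G ⊗ G -> G ⊗ G.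
Variables (K : hilbertType R) (N : set (K -> K)) (dN : (K -> K) -> (G ⊗ K -> G ⊗ K)).
Variables (dG : (G -> G) -> (G ⊗ G -> G ⊗ G))
  (F1 : (G ⊗ K -> G ⊗ K) -> (G ⊗ (G ⊗ K) -> G ⊗ (G ⊗ K)))
  (F2 : (G ⊗ K -> G ⊗ K) -> (G ⊗ G ⊗ K -> G ⊗ G ⊗ K)).
Local Notation A := (@cqg_alg R tens G).
Local Notation Dl := (@comult R tens G).
Local Notation A2 := (@ctens R tens G G A A).
Local Notation W := (@Linfty R tens G).
Local Notation M := (@wtens R tens G K W N).
Local Notation lam := (lam U).
Hypothesis hs : @coact_data R tens G phi xi U K N dN dG F1 F2.
Let hx := cd_haar hs.
Let hU := cd_U hs.
Let hdG := cd_dG hs.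
Let hc := cd_coact hs.
Local Notation WN := (@WN R tens G K N).
Local Notation nslice e f := (@op_slice R tens G K e f).
Local Notation nsl e f := (@co_slice R tens G K dN e f).
Definition sliceD : set (K -> K) :=
  cspan [set T | exists x e f, N x /\ T = nsl e f x].
Local Notation D := sliceD.
Local Notation AD := (@ctens R tens G K A D).
Local Notation tm S T := (@tmap R tens _ _ _ _ S T).
(** Slices with vectors a xi and xi, the shape in which [Psi] can be evaluated; they already span D
    ([sliceD_gen]). *)
Let E0 : set (K -> K) := [set T | exists x a, [/\ N x, A a & T = nsl (a xi) xi x]].
Let P := cspan (opmul (dN @` D) (@eltens R tens G K A [set idfun])).

Lemma sliceD_clin : clin D. Proof. exact: cspan_clin. Qed.

Lemma sliceD_nsl e f x : N x -> D (nsl e f x).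
Proof. by move=> Nx; apply: cspan_sub; exists x, e, f. Qed.

Lemma sliceD_N : D `<=` N.
Proof.
apply: cspan_min; first by apply: cstar_clin; exact: (coactN_cstar hs).
by move=> _ [x [e [f [Nx ->]]]]; exact: (nsl_in hs).
Qed.

Lemma sliceD_bop d : D d -> bounded_op d. Proof. by move=> /sliceD_N; exact: (coactN_bop hs). Qed.

Lemma nsl_adj e f x : N x -> adj (nsl e f x) = nsl f e (adj x).
Proof.
move=> Nx; have bl := @bop_lten R tens G K; have bd := dN_bop hs Nx.
rewrite /co_slice /op_slice (adj_comp (bop_comp (bop_adj (bl f)) bd) (bl e)).
by rewrite (adj_comp (bop_adj (bl f)) bd) (adjK (bl f)) (star_hom_adj (coaction_hom hc)).
Qed.

Lemma sliceD_adj d : D d -> D (adj d).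
Proof.
move: d; apply: cspan_adj; [|exact: sliceD_clin|].
  by move=> _ [x [e [f [Nx ->]]]]; apply: (coactN_bop hs); exact: (nsl_in hs).
by move=> _ [x [e [f [Nx ->]]]]; rewrite nsl_adj //; apply: sliceD_nsl; exact: (coactN_adj hs).
Qed.

Lemma sliceD_id : D idfun.
Proof.
have -> : (idfun : K -> K) = nsl xi xi idfun.
  apply/funext => k; rewrite /co_slice /op_slice (coaction_unital hc).
  rewrite -[RHS]/(adj (lt K xi) (xi ⊙ k)) adj_ltenE (xi1 hx) scale1r //.
by apply: sliceD_nsl; exact: (coactN_id hs).
Qed.

Lemma opn_nsl e f x m : 0 <= m -> opn (dN x) m -> opn (nsl e f x) (nrm f * m * nrm e).
Proof.
move=> m0 om; have bl := @bop_lten R tens G K.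
apply: opn_comp (@opn_lten R tens G K e); first by rewrite mulr_ge0 ?nrm_ge0.
apply: opn_comp om; first exact: nrm_ge0.
by apply: opn_adj; [exact: bl | exact: nrm_ge0 | exact: opn_lten].
Qed.

Lemma nsl_Bl e e' f x : N x -> nsl e f x - nsl e' f x = nsl (e - e') f x.
Proof.
move=> Nx; have bl := @bop_lten R tens G K; have bd := dN_bop hs Nx.
have bb := bop_comp (bop_adj (bl f)) bd.
apply/funext => k; rewrite -[RHS]/((adj (lt K f) \o dN x) ((e - e') ⊙ k)).
have -> : (e - e') ⊙ k = lt K e k - lt K e' k.
  by rewrite -[LHS]/(lt K (e - e') k) ltenB.
by rewrite (bopB _ _ bb).
Qed.

Lemma nsl_Br e f f' x : N x -> nsl e f x - nsl e f' x = nsl e (f - f') x.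
Proof.
move=> Nx; have bl := @bop_lten R tens G K; have bd := dN_bop hs Nx.
apply/funext => k; apply/ipd_inj => z.
rewrite -[(_ - _) k]/(nsl e f x k - nsl e f' x k) ipdBl.
rewrite -!ipd_lten.
have -> : (f - f') ⊙ z = lt K f z - lt K f' z.
  by rewrite -[LHS]/(lt K (f - f') z) ltenB.
by rewrite ipdBr.
Qed.

Lemma nsl_comm e a' x : N x -> commutant A a' ->
  nsl e (a' xi) x = nsl (adj a' e) xi x.
Proof.
move=> Nx cA; have [ba _] := cA; have bid := @bop_id R K; have bl := @bop_lten R tens G K.
have cA' := commutant_adj (@cqg_star R tens G) cA; have [ba' _] := cA'.
have bt : bounded_op (tm a' (idfun : K -> K)) by exact: bop_tmap.
have lE (c : G -> G) (v : G) : bounded_op c -> lt K (c v) = tm c idfun \o lt K v.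
  move=> bcc; apply/funext => k.
  by rewrite -[RHS]/(tm c idfun (v ⊙ k)) (tmapE tens v k bcc bid).
rewrite /co_slice /op_slice (lE a' xi ba) (adj_comp bt (bl xi)) (adj_tmap tens ba bid) adj_id.
rewrite (lE _ e ba') -[LHS]/(adj (lt K xi) \o (tm (adj a') idfun \o dN x) \o lt K e).
by rewrite -(wtens_commutant_l hs cA' (dN_in hs Nx)).
Qed.

(** The second vector is approximated by a' xi with a' in the commutant of A, and a' is moved past
    dN x to the first vector, which is then approximated from A xi. *)
Lemma sliceD_gen : D `<=` cspan E0.
Proof.
have c0 := cspan_clin E0; apply: cspan_min => // _ [x [e [f [Nx ->]]]].
have bd := dN_bop hs Nx; have [m m0 hm] := bop_opn bd.
have s1 e' : cspan E0 (nsl e' xi x).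
  apply: (clin_cl c0) => d d0; have [a Aa ha] := cyc_approx hx e' (divr_gt0 d0 m0).
  exists (nsl (a xi) xi x); first by apply: cspan_sub; exists x, a.
  rewrite nsl_Bl //; apply: opnW (opn_nsl _ _ (ltW m0) hm).
  by rewrite (nrm_xi hx) mul1r mulrC -ler_pdivlMr.
apply: (clin_cl c0) => d d0.
have p0 : 0 < m * nrm e + 1 by rewrite ltr_wpDl // mulr_ge0 ?nrm_ge0 ?ltW.
have [a' ca ha] := commutant_dense hx hU hdG f (divr_gt0 d0 p0).
exists (nsl e (a' xi) x); first by rewrite nsl_comm.
rewrite nsl_Br //; apply: opnW (opn_nsl _ _ (ltW m0) hm).
move: ha; rewrite ler_pdivlMr // -mulrA => ha; have := nrm_ge0 (f - a' xi); lra.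
Qed.

Lemma cyclic_slice_N : E0 `<=` N.
Proof. by move=> _ [x [a [Nx _ ->]]]; exact: (nsl_in hs). Qed.
Lemma ctensD_clin : clin AD. Proof. exact: cspan_clin. Qed.
Lemma ctensD_elt a d : A a -> D d -> AD (tm a d). Proof. exact: ctens_elt. Qed.
Lemma ctensD_M : AD `<=` M.
Proof.
apply: cspan_min; first by apply: cstar_clin; exact: (wtens_cstar hs).
by move=> _ [S AS [T DT ->]]; apply: (wtens_elt hs); [exact: cqg_Linfty | exact: sliceD_N].
Qed.

(* Psi x Y slices the coassociativity law at xi.  Tensors a (x) b and products    *)
(* Delta(c)(1 (x) d) both span A (x) A, and comparing the values of Psi x on     *)
(* the two families yields the continuity of the coaction on D.                  *)
Definition Psi x (Y : G ⊗ G -> G ⊗ G) : G ⊗ K -> G ⊗ K :=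
  tm (adj (lt G xi)) idfun \o F2 (dN x) \o tm (Y \o lt G xi) idfun.

Lemma cmap_Psi x : N x -> cmap (@bounded_op R (G ⊗ G) (G ⊗ G)) (Psi x).
Proof.
move=> Nx; have bl := @bop_lten R tens G G xi; have bid := @bop_id R K.
have bF := F2_bop hs (dN_in hs Nx).
have bt : bounded_op (tm (adj (lt G xi)) (idfun : K -> K) : (G ⊗ G) ⊗ K -> G ⊗ K).
  by apply: bop_tmap => //; exact: bop_adj.
have c1 := cmap_compr (@bounded_op R (G ⊗ G) (G ⊗ G)) bl.
have c2 := @cmap_tmapl R tens G K (G ⊗ G) K idfun bid.
have c3 := cmap_compl setT (bop_comp bt bF : bounded_op (_ : (G ⊗ G) ⊗ K -> G ⊗ K)).
have c12 := cmap_then c1 (fun T bT => bop_comp bT bl) c2.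
exact: (cmap_then c12 (fun _ _ => I) (c3 (G ⊗ K))).
Qed.

Lemma Psi_elt x a b : N x -> A a -> A b ->
  Psi x (tm a b) = dN (nsl (a xi) xi x) \o tm b idfun.
Proof.
move=> Nx Aa Ab; have ba := cqg_bop Aa; have bb := cqg_bop Ab; have bid := @bop_id R K.
have bl := @bop_lten R tens G G xi; have bF := F2_bop hs (dN_in hs Nx).
have bt : bounded_op (tm a b \o lt G xi) by apply: bop_comp bl; exact: bop_tmap.
have Nn := nsl_in hs (a xi) xi Nx.
apply: tens_ext.
- apply: bop_comp; last exact: bop_tmap.
  by apply: bop_comp bF; apply: bop_tmap => //; exact: bop_adj.
- by apply: bop_comp (dN_bop hs Nn) _; exact: bop_tmap.
move=> v k.
rewrite -[LHS]/(tm (adj (lt G xi)) idfun (F2 (dN x) (tm (tm a b \o lt G xi) idfun (v ⊙ k)))).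
rewrite (tmapE tens v k bt bid) -[(_ \o _) v]/(tm a b (xi ⊙ v)) (tmapE tens xi v ba bb).
rewrite -[RHS]/(dN (nsl (a xi) xi x) (tm b idfun (v ⊙ k))) (tmapE tens v k bb bid).
by rewrite (dN_nsl hs).
Qed.

(** F2 is multiplicative and F2(c (x) 1) = Delta(c) (x) 1, so c merges with dN x; left invariance
    then collapses the first leg. *)
Lemma Psi_comult x c d : N x -> A c -> A d ->
  Psi x (Dl c \o tm idfun d) = tm d (nsl (c xi) xi x).
Proof.
move=> Nx Ac Ad; have bc := cqg_bop Ac; have bd := cqg_bop Ad; have bid := @bop_id R.
have bl := @bop_lten R tens G G xi; have bF := F2_bop hs (dN_in hs Nx).
have bD := comult_bop Ac; have bt1 : bounded_op (tm (idfun : G -> G) d) by exact: bop_tmap.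
have bt : bounded_op ((Dl c \o tm idfun d) \o lt G xi) by exact: bop_comp (bop_comp bD bt1) bl.
have Nn := nsl_in hs (c xi) xi Nx; have bn := coactN_bop hs Nn.
apply: tens_ext.
- apply: bop_comp; last exact: bop_tmap.
  by apply: bop_comp bF; apply: bop_tmap => //; exact: bop_adj.
- exact: bop_tmap.
move=> v k.
rewrite -[LHS]/(tm (adj (lt G xi)) idfun (F2 (dN x) (tm ((Dl c \o tm idfun d) \o lt G xi) idfun (v ⊙ k)))).
rewrite (tmapE tens v k bt (bid _)) -[(_ \o lt G xi) v]/(Dl c (tm idfun d (xi ⊙ v))).
rewrite (tmapE tens xi v (bid _) bd) (tmapE tens v k bd bn).
have Wc := cqg_Linfty Ac; have Mc := wtens_elt hs Wc (coactN_id hs); have MX := dN_in hs Nx.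
have -> : Dl c (xi ⊙ d v) ⊙ idfun k = F2 (tm c idfun) ((xi ⊙ d v) ⊙ k).
  by rewrite (F2_elt hs Wc (coactN_id hs)) (dG_comult hdG Ac) (tmapE tens _ k bD (bid _)).
rewrite -[F2 (dN x) _]/((F2 (dN x) \o F2 (tm c idfun)) ((xi ⊙ d v) ⊙ k)).
rewrite -(star_hom_mul (F2_hom hs) MX Mc).
have MXc : M (dN x \o tm c idfun) by exact: (star_algebra_mul (wtens_star hs)).
have := congr1 (fun g => g k) (F2_haar hs (d v) MXc).
rewrite -[X in X = _ -> _]/(tm (adj (lt G xi)) idfun (F2 (dN x \o tm c idfun) ((xi ⊙ d v) ⊙ k))) => ->.
rewrite -[LHS]/(d v ⊙ adj (lt K xi) (dN x (tm c idfun (xi ⊙ k)))).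
by rewrite (tmapE tens xi k bc (bid _)).
Qed.

Lemma dN_cmap : cmap N dN.
Proof.
exact: (cmap_hom (coactN_cstar hs) (coactN_id hs) (coaction_hom hc) (coaction_unital hc)).
Qed.

Lemma comult_gen_bop : opmul (Dl @` A) (@eltens R tens G G [set idfun] A) `<=`
  @bounded_op R (G ⊗ G) (G ⊗ G).
Proof.
move=> _ [_ [c Ac <-] [_ [_ -> [d Ad ->]] ->]]; apply: bop_comp (comult_bop Ac) _.
by apply: bop_tmap; [exact: bop_id | exact: cqg_bop].
Qed.

Lemma dN_slice_AD x a b : N x -> A a -> A b ->
  AD (dN (nsl (a xi) xi x) \o tm b idfun).
Proof.
move=> Nx Aa Ab; rewrite -Psi_elt //.
have : A2 (tm a b) by exact: ctens_elt.
rewrite -(@comult_denser R tens G); move: (tm a b).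
apply: (cmap_into (@clin_bop R _ _) comult_gen_bop (cmap_Psi Nx) ctensD_clin).
move=> _ [_ [c Ac <-] [_ [_ -> [d Ad ->]] ->]]; rewrite optensE Psi_comult //.
by apply: ctensD_elt => //; exact: sliceD_nsl.
Qed.

Lemma elt_slice_P x c d : N x -> A c -> A d -> P (tm d (nsl (c xi) xi x)).
Proof.
move=> Nx Ac Ad; rewrite -Psi_comult //.
have : A2 (Dl c \o tm idfun d).
  have [s _] := @cqg2_cstar R tens G; apply: (star_algebra_mul s); first exact: comult_in.
  by apply: ctens_elt => //; exact: cqg_unital.
move: (Dl c \o _).
have cP := cspan_clin (opmul (dN @` D) (@eltens R tens G K A [set idfun])).
apply: (cmap_into (@clin_bop R _ _) (@cqg2_elt_bop R tens G) (cmap_Psi Nx) cP).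
move=> _ [a Aa [b Ab ->]]; rewrite optensE Psi_elt //; apply: cspan_sub.
exists (dN (nsl (a xi) xi x)); first by exists (nsl (a xi) xi x) => //; exact: sliceD_nsl.
by exists (tm b idfun) => //; exact: eltensP.
Qed.

(** [Psi x] is bounded. For one inclusion a (x) b is approximated by sums of Delta(c)(1 (x) d)
    through [comult_denser]; for the other, Delta(c)(1 (x) d) is approximated by elementary
    tensors. *)
Lemma sliceD_continuous : P = AD.
Proof.
have cP := cspan_clin (opmul (dN @` D) (@eltens R tens G K A [set idfun])).
have cN := cstar_clin (coactN_cstar hs).
apply/seteqP; split; apply: cspan_min => //; try exact: ctensD_clin.
- move=> _ [_ [d Dd <-] [_ [b Ab [_ -> ->]] ->]]; rewrite optensE.
  have bt : bounded_op (tm b (idfun : K -> K)) by apply: bop_tmap; [exact: cqg_bop | exact: bop_id].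
  move: d {Dd}(sliceD_gen Dd).
  apply: (cmap_into cN cyclic_slice_N (cmap_then dN_cmap (fun _ _ => I) (cmap_compr setT bt)) ctensD_clin).
  by move=> _ [x [a [Nx Aa ->]]]; exact: dN_slice_AD.
- move=> _ [a Aa [d Dd ->]]; rewrite optensE; have ba := cqg_bop Aa.
  have bE0 : E0 `<=` @bounded_op R K K by move=> T /cyclic_slice_N; exact: (coactN_bop hs).
  move: d {Dd}(sliceD_gen Dd).
  apply: (cmap_into (@clin_bop R K K) bE0 (@cmap_tmapr R tens G K G K a ba) cP).
  by move=> _ [x [c [Nx Ac ->]]]; exact: elt_slice_P.
Qed.

(* By continuity a (x) T is a limit of sums of dN(d)(b (x) 1). *)
Lemma sliceD_mul S T : D S -> D T -> D (S \o T).
Proof.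
move=> DS DT; have bTT := sliceD_bop DT; have bl := @bop_lten R tens G K xi.
have bid := @bop_id R K; have bE0 : E0 `<=` @bounded_op R K K by move=> V /cyclic_slice_N; exact: (coactN_bop hs).
move: S {DS}(sliceD_gen DS).
apply: (cmap_into (@clin_bop R K K) bE0 (cmap_compr _ bTT) sliceD_clin).
move=> _ [x [a [Nx Aa ->]]]; have bd := dN_bop hs Nx; have ba := cqg_bop Aa.
have h : AD (tm a T) by exact: ctensD_elt.
have -> : nsl (a xi) xi x \o T = adj (lt K xi) \o dN x \o tm a T \o lt K xi.
  apply/funext => k; rewrite -[RHS]/(adj (lt K xi) (dN x (tm a T (xi ⊙ k)))).
  by rewrite (tmapE tens xi k ba bTT).
move: h; rewrite -sliceD_continuous => h.
have cz := clin_comp (bop_comp (bop_adj bl) bd) bl sliceD_clin.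
apply: (cspan_min cz) h => _ [_ [d Dd <-] [_ [b Ab [_ -> ->]] ->]] /=.
rewrite optensE; have Nd := sliceD_N Dd; have bb := cqg_bop Ab.
(* As dN is multiplicative, each term is again a slice, now of the product x d in N. *)
have -> : (adj (lt K xi) \o dN x) \o (dN d \o tm b idfun) \o lt K xi = nsl (b xi) xi (x \o d).
  apply/funext => k; rewrite /co_slice /op_slice (star_hom_mul (coaction_hom hc) Nx Nd).
  rewrite -[LHS]/(adj (lt K xi) (dN x (dN d (tm b idfun (xi ⊙ k))))).
  by rewrite (tmapE tens xi k bb bid).
by apply: sliceD_nsl; exact: (coactN_mul hs).
Qed.

Lemma sliceD_star : star_algebra D.
Proof.
have [d0 dl _] := sliceD_clin.
by split=> //; [exact: sliceD_bop | exact: sliceD_mul | exact: sliceD_adj].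
Qed.

Lemma sliceD_cstar : cstar_algebra D.
Proof. by split; [exact: sliceD_star | case: sliceD_clin]. Qed.

Lemma ctensD_cstar : cstar_algebra AD.
Proof. by apply: ctens_star; [exact: cqg_star | exact: sliceD_star]. Qed.

Lemma ctensD_id : AD idfun.
Proof. by rewrite -(@tmap_id R tens G K); apply: ctensD_elt; [exact: cqg_unital | exact: sliceD_id]. Qed.

Lemma dN_AD d : D d -> AD (dN d).
Proof.
move=> Dd; have cN := cstar_clin (coactN_cstar hs); move: d {Dd}(sliceD_gen Dd).
apply: (cmap_into cN cyclic_slice_N dN_cmap ctensD_clin).
move=> _ [x [a [Nx Aa ->]]]; have := dN_slice_AD Nx Aa (@cqg_unital R tens G).
by rewrite tmap_id.
Qed.

End SliceAlgebra.

(** * Multipliers and strictness *)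

Section CompactOperators.
Variable R : realType.
Implicit Types H K L : hilbertType R.
Local Notation C := R[i].

(** The closed image of the unit ball lies on the line through b with coefficients bounded by |a|;
    along an ultrafilter these coefficients converge. *)
Lemma compact_rank1 H (a b : H) : compact_op (rank1 a b).
Proof.
split; first exact: bop_rank1.
rewrite precompactE compact_ultra => F UF Fcl; set S := closure _ in Fcl *.
have PF : ProperFilter F by exact: ultra_proper.
have [b0|bn0] := eqVneq b 0.
  have S0 : S 0.
    by apply: subset_closure; exists 0; rewrite /= ?normr0 ?ler01 // /rank1 ipd0l scale0r.
  have Sz y : S y -> y = 0.
    move=> /closure_nrm hy; apply: le_nrm0 => e e0; have [_ [x _ <-]] := hy e e0.
    by rewrite /rank1 b0 scaler0 subr0.
  exists 0; split => //; apply/(@cvg_nrm _ _ _ _ _ id) => e e0.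
  by apply: filterS Fcl => y /Sz ->; rewrite subr0 nrm0 ltW.
have nb : nrm b ^+ 2 != 0 by rewrite expf_eq0 /=; apply/eqP => /nrm_eq0 /eqP; rewrite (negbTE bn0).
have nbC : (nrm b ^+ 2)%:C != 0 by apply/eqP => /complexI /eqP; rewrite (negbTE nb).
pose r (y : H) : C := ipd y b / (nrm b ^+ 2)%:C.
have yr y : S y -> y = r y *: b /\ nrm (r y : C^o) <= nrm a.
  move=> /closure_nrm hy.
  have rE c : r (c *: b) = c by rewrite /r ipdZl ipdxx mulfK.
  have Xc : csub [set y | y = r y *: b].
    have -> : [set y | y = r y *: b] = lspan (range (fun _ : 'I_1 => b)).
      apply/seteqP; split=> z /=.
        by move=> ->; exists 1%N, (fun _ => r z), (fun _ => b); split => [k|]; [exists ord0 | rewrite big_ord1].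
      by move=> /lspanE[c ->]; rewrite big_ord1 rE.
    exact: csub_fin.
  have yE : y = r y *: b.
    have [_ _ cl] := Xc; apply: cl => e e0; have [_ [x _ <-] hxy] := hy e e0.
    by exists (rank1 a b x) => //=; rewrite /rank1 rE.
  split => //; apply/ler_addgt0Pr => e e0.
  have nbp : 0 < nrm b by rewrite lt_neqAle nrm_ge0 andbT eq_sym; apply/eqP => h; move: nb; rewrite h expr0n eqxx.
  have [_ [x x1 <-] hxy] := hy _ (mulr_gt0 e0 nbp).
  have h1 : nrm (r y - ipd x a : C^o) * nrm b <= e * nrm b.
    by rewrite -nrmZ scalerBl -yE; exact: hxy.
  rewrite ler_pM2r // in h1.
  have h2 : nrm (ipd x a : C^o) <= nrm a.
    apply: (le_trans (cauchy_schwarz _ _)); rewrite ler_piMl ?nrm_ge0 //.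
    by move: x1; rewrite /= nrmE -[1]/(1%:C : C) lecR.
  by have := @nrmD _ C^o (r y - ipd x a) (ipd x a); rewrite subrK; lra.
pose r' y : C := if `[< S y >] then r y else 0.
have r'b y : nrm (r' y : C^o) <= nrm a.
  by rewrite /r'; case: asboolP => [/yr[]//|_]; rewrite nrm0 nrm_ge0.
have [c hc] := ultra_limC UF r'b.
have cv e : 0 < e -> \forall y \near F, nrm (c *: b - y) <= e.
  move=> e0; have b1 : 0 < nrm b + 1 by rewrite ltr_wpDl ?nrm_ge0.
  apply: filterS2 Fcl (hc _ (divr_gt0 e0 b1)) => y Sy; rewrite /r' asboolT // ler_pdivlMr //.
  have [yE _] := yr y Sy; have -> : c *: b - y = (c - r y) *: b by rewrite scalerBl -yE.
  rewrite nrmZ.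
  by have := @nrm_ge0 _ C^o (c - r y); lra.
exists (c *: b); split; last by apply/(@cvg_nrm _ _ _ _ _ id) => e; exact: cv.
rewrite (iffLR (closure_id S) (@closed_closure _ _)); apply/closure_nrm => e e0.
by have [y [Sy hy]] := filter_ex (filterI Fcl (cv e e0)); exists y.
Qed.

(** A finite cover of the image of the unit ball by sets of radius e has centres spanning a subspace
    Y, and projecting T onto Y changes it by at most e. *)
Lemma compact_cpt H (T : H -> H) : compact_op T -> cpt T.
Proof.
move=> [bT]; rewrite precompactE => cT.
have [_ _ cl] := @cpt_clin R H H; apply: cl; apply/norm_closureP => e e0.
have e2 : 0 < e / 2 by rewrite divr_gt0.
pose B (y : H) : set H := [set z | nrm (y - z) <= e]°.
have By y : B y y.
  have h : (fun z : H => z) @ nbhs y --> y by exact: cvg_id.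
  exact: (iffLR (cvg_nrm _ _ _) h e e0).
have BE y z : B y z -> nrm (y - z) <= e by move=> /interior_subset.
have oB y : [set: H] y -> open (B y) by move=> _; exact: open_interior.
move: cT; rewrite compact_cover => /(_ H setT B oB).
case=> [z _|D _ hD]; first by exists z.
pose v (k : 'I_(size (finmap.enum_fset D))) : H := nth 0 (finmap.enum_fset D) k.
have cY := csub_fin v; set Y := lspan _ in cY; have bp := bop_prj cY.
have hT x : nrm x <= 1 -> exists2 y, Y y & nrm (y - T x) <= e.
  move=> x1; have : closure [set T x | x in [set x | `|x| <= 1]] (T x).
    by apply: subset_closure; exists x => //=; rewrite nrmE -[1]/(1%:C : C) lecR.
  move=> /hD[y /= Dy /BE h]; exists y => //.
  have iy : (index y (finmap.enum_fset D) < size (finmap.enum_fset D))%N by rewrite index_mem.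
  by apply: lspan_sub; exists (Ordinal iy) => //; rewrite /v /= nth_index.
exists (prj Y \o T).
  have [m [f [fo fY hf]]] := gram_schmidt v.
  have -> : prj Y \o T = \sum_k rank1 (adj T (f k)) (f k).
    apply/funext => x.
    have sE : (\sum_k rank1 (adj T (f k)) (f k)) x = \sum_k ipd (T x) (f k) *: f k.
      elim/big_ind2 : _ => // [u1 u2 v1 v2 <- <- //|k _].
      by rewrite /rank1 (adjP bT).
    rewrite sE /=; apply: prj_eq => //.
      have [Y0 YL _] := cY; elim/big_ind : _ => //.
        by move=> p q Yp Yq; rewrite -[p]scale1r; exact: YL.
      by move=> k _; rewrite -[_ *: _]addr0; apply: YL => //; exact: fY.
    move=> z /lspanE[c ->]; rewrite ipd_sumr big1 // => k _; rewrite ipdZr.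
    rewrite [ipd _ (v k)](_ : _ = 0) ?mulr0 // hf ipd_sumr big1 // => j _; rewrite ipdZr.
    suff -> : ipd (T x - \sum_k ipd (T x) (f k) *: f k) (f j) = 0 by rewrite mulr0.
    rewrite ipdBl ipd_suml (bigD1 j) //= big1 ?addr0.
      by rewrite ipdZl fo eqxx mulr1 subrr.
    by move=> i ij; rewrite ipdZl fo (negbTE ij) mulr0.
  have cc := @cpt_clin R H H.
  by apply: clin_sum => // k _; exact: cpt_rank1.
move=> x; rewrite -[(_ - _) x]/(T x - prj Y (T x)).
have [x0|n0] := eqVneq (nrm x) 0.
  by rewrite (nrm_eq0 x0) (bop0 bT) (bop0 bp) subr0 !nrm0 mulr0.
have xp : 0 < nrm x by rewrite lt_neqAle eq_sym n0 nrm_ge0.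
pose x' := ((nrm x)^-1)%:C *: x.
have nx' : nrm x' <= 1 by rewrite /x' nrmZ nrm_real ?mulVf // invr_ge0 nrm_ge0.
have -> : T x - prj Y (T x) = (nrm x)%:C *: (T x' - prj Y (T x')).
  by rewrite /x' (bopZ _ _ bT) (bopZ _ _ bp) -scalerBr scalerA -rmorphM mulfV // scale1r.
rewrite nrmZ nrm_real ?nrm_ge0 // mulrC ler_pM2r //.
have [y Yy hy] := hT x' nx'.
have -> : T x' - prj Y (T x') = (T x' - y) - prj Y (T x' - y).
  by rewrite (bopB _ _ bp) (prj_id cY Yy); hring.
apply: le_trans hy; rewrite [leRHS]nrmBC.
have h1 := nrm_prj (T x' - y) cY.
rewrite -(@ler_pXn2r _ 2) ?nnegrE ?nrm_ge0 // h1.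
by have := sqr_ge0 (nrm (prj Y (T x' - y))); lra.
Qed.

End CompactOperators.

(** * The coaction acts by multipliers and adjointable operators *)

Section ModuleFacts.
Variable R : realType.
Variable tens : forall H K : hilbertType R, hilbertTensor H K.
Local Notation C := R[i].
Local Notation "H ⊗ K" := (tensor_space (tens H K))
  (at level 40, left associativity).
Local Notation "x ⊙ y" := (elt (tens _ _) x y)
  (at level 40, left associativity).
Local Notation lt K x := (@lten R tens _ K x).
Local Notation rt H y := (@rten R tens H _ y).
Variables (G : compact_quantum_group tens) (phi : (G -> G) -> R[i]^o) (xi : G).
Variable U : G ⊗ G -> G ⊗ G.
Variables (K : hilbertType R) (N : set (K -> K)) (dN : (K -> K) -> (G ⊗ K -> G ⊗ K)).
Variables (dG : (G -> G) -> (G ⊗ G -> G ⊗ G))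
  (F1 : (G ⊗ K -> G ⊗ K) -> (G ⊗ (G ⊗ K) -> G ⊗ (G ⊗ K)))
  (F2 : (G ⊗ K -> G ⊗ K) -> (G ⊗ G ⊗ K -> G ⊗ G ⊗ K)).
Local Notation A := (@cqg_alg R tens G).
Local Notation Dl := (@comult R tens G).
Local Notation A2 := (@ctens R tens G G A A).
Local Notation W := (@Linfty R tens G).
Local Notation M := (@wtens R tens G K W N).
Local Notation lam := (lam U).
Hypothesis hs : @coact_data R tens G phi xi U K N dN dG F1 F2.
Let hx := cd_haar hs.
Let hU := cd_U hs.
Let hdG := cd_dG hs.
Let hc := cd_coact hs.
Local Notation WN := (@WN R tens G K N).
Local Notation nslice e f := (@op_slice R tens G K e f).
Local Notation nsl e f := (@co_slice R tens G K dN e f).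
Local Notation D := (@sliceD R tens G K N dN).
Local Notation AD := (@ctens R tens G K A D).
Local Notation tm S T := (@tmap R tens _ _ _ _ S T).
Local Notation E := (@modtens R tens G K D).
Local Notation CD := (@ctens R tens G K (@compact_op R G) D).

Lemma modD_clin : clin E. Proof. exact: cspan_clin. Qed.
Lemma modD_elt e d : D d -> E (lt K e \o d).
Proof. by move=> Dd; apply: cspan_sub; exists e, d. Qed.

Let gE : set (K -> G ⊗ K) :=
  [set v | exists (e : G) (d : K -> K), D d /\ v = (fun z => e ⊙ d z)].

Lemma modD_gen_bop : gE `<=` @bounded_op R _ _.
Proof.
move=> _ [e [d [Dd ->]]]; rewrite -[X in bounded_op X]/(lt K e \o d).
by apply: bop_comp; [exact: bop_lten | exact: (sliceD_bop hs)].
Qed.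

Lemma modD_right v d : E v -> D d -> E (v \o d).
Proof.
move=> Ev Dd; have bd := sliceD_bop hs Dd; move: v Ev.
apply: (cmap_into (@clin_bop R _ _) modD_gen_bop (cmap_compr _ bd) modD_clin).
move=> _ [e [d' [Dd' ->]]]; apply: (@modD_elt e (d' \o d)).
exact: (sliceD_mul hs).
Qed.

Lemma modD_left X : AD X -> E (X \o lt K xi).
Proof.
have bl := @bop_lten R tens G K xi.
have bE : @eltens R tens G K A D `<=` @bounded_op R _ _.
  by apply: eltens_bounded; [exact: cqg_bop | exact: (sliceD_bop hs)].
move: X; apply: (cmap_into (@clin_bop R _ _) bE (cmap_compr _ bl) modD_clin).
move=> _ [a Aa [d Dd ->]]; rewrite optensE; have ba := cqg_bop Aa; have bd := sliceD_bop hs Dd.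
have -> : tm a d \o lt K xi = lt K (a xi) \o d.
  by apply/funext => k; rewrite -[LHS]/(tm a d (xi ⊙ k)) (tmapE tens xi k ba bd).
exact: modD_elt.
Qed.

Lemma modD_tm a v : bounded_op a -> E v -> E (tm a idfun \o v).
Proof.
move=> ba; have bid := @bop_id R K; have bt : bounded_op (tm a (idfun : K -> K)) by exact: bop_tmap.
move: v; apply: (cmap_into (@clin_bop R _ _) modD_gen_bop (cmap_compl _ bt) modD_clin).
move=> _ [e [d [Dd ->]]].
have -> : tm a idfun \o (fun z => e ⊙ d z) = lt K (a e) \o d.
  by apply/funext => k; rewrite -[LHS]/(tm a idfun (e ⊙ d k)) (tmapE tens e (d k) ba bid).
exact: modD_elt.
Qed.

Lemma dN_lcomm x a' : N x -> commutant A a' ->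
  dN x \o lt K (a' xi) = tm a' idfun \o (dN x \o lt K xi).
Proof.
move=> Nx cA; have [ba _] := cA; have bid := @bop_id R K.
have lE : lt K (a' xi) = tm a' idfun \o lt K xi.
  apply/funext => k.
  by rewrite -[RHS]/(tm a' idfun (xi ⊙ k)) (tmapE tens xi k ba bid).
rewrite lE -[LHS]/((dN x \o tm a' idfun) \o lt K xi).
by rewrite (wtens_commutant_l hs cA (dN_in hs Nx)).
Qed.

Lemma dN_xi_opn y k0 (e : R) : N y -> k0 <> 0 -> nrm (dN y (xi ⊙ k0)) <= e * nrm k0 ->
  opn (dN y \o lt K xi) e.
Proof.
move=> Ny n0 h; have [c c0 hcc] := dN_xi_norm hs Ny.
have p0 : 0 < nrm k0 by rewrite lt_neqAle nrm_ge0 andbT eq_sym; apply/eqP => /nrm_eq0.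
rewrite hcc ler_pM2r // in h.
by move=> k; rewrite -[(_ \o _) k]/(dN y (xi ⊙ k)) hcc ler_wpM2r ?nrm_ge0.
Qed.

Lemma tmap_strong (F : set_system G) (T_ : G -> G -> G) w : ProperFilter F ->
  (forall u, bounded_op (T_ u)) -> (\forall u \near F, opn (T_ u) 1) ->
  (forall x (e : R), 0 < e -> \forall u \near F, nrm (x - T_ u x) <= e) ->
  forall e : R, 0 < e -> \forall u \near F, nrm (w - tm (T_ u) (idfun : K -> K) w) <= e.
Proof.
move=> PF bT_ o1 cv; have bid := @bop_id R K.
have bt u : bounded_op (tm (T_ u) (idfun : K -> K)) by exact: bop_tmap.
have ot u : opn (T_ u) 1 -> opn (tm (T_ u) (idfun : K -> K)) 1.
  move=> h; rewrite -[1]mulr1; apply: opn_tmap => //.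
  by move=> x; rewrite mul1r.
pose X := [set w | forall e : R, 0 < e -> \forall u \near F, nrm (w - tm (T_ u) (idfun : K -> K) w) <= e].
have ot1 : \forall u \near F, opn (tm (T_ u) (idfun : K -> K)) 1 by apply: filterS o1 => u; exact: ot.
have cX : csub X := csub_strong_limit PF bt ot1.
suff : X w by [].
apply: (prj_dense cX) => x hx1; apply: tens_eq0 => v k.
rewrite ipdC (hx1 (v ⊙ k)) ?conjc0 // => e e0.
have k1 : 0 < nrm k + 1 by rewrite ltr_wpDl ?nrm_ge0.
apply: filterS (cv v _ (divr_gt0 e0 k1)) => u; rewrite ler_pdivlMr // => h.
rewrite (tmapE tens v k (bT_ u) bid).
have -> : v ⊙ k - T_ u v ⊙ idfun k = (v - T_ u v) ⊙ k.
  by rewrite -[(v - T_ u v) ⊙ k]/(lt K (v - T_ u v) k) ltenB.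
by rewrite nrm_elt; have := nrm_ge0 (v - T_ u v); lra.
Qed.

(** The slices [nsl xi u x] lie in D, and by [dN_nsl_xi] their images converge to that of x at one
    vector xi (x) k0. By [dN_xi_norm] the operators then converge in norm. *)
Lemma dN_xi_E x : N x -> E (dN x \o lt K xi).
Proof.
move=> Nx; have [E0 _ _] := modD_clin; have bl := @bop_lten R tens G K xi.
have [[k0 kn0]|all0] := pselect (exists k : K, k <> 0); last first.
  have k0 (k : K) : k = 0 by apply: contrapT => h; apply: all0; exists k.
  have -> : dN x \o lt K xi = 0.
    by apply/funext => k; rewrite (k0 k) (bop0 (bop_comp (dN_bop hs Nx) bl)).
  exact: E0.
have p0 : 0 < nrm k0 by rewrite lt_neqAle nrm_ge0 andbT eq_sym; apply/eqP => /nrm_eq0.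
have [F [PF o1 cv _]] := approx_unit hx hU hdG.
have o1' : \forall u \near F, opn (lam xi u) 1 by apply: filterS o1 => u [].
have bL u : bounded_op (lam xi u) := bop_lam hU xi u.
apply: (clin_cl modD_clin) => e e0.
have [u hu] := filter_ex (tmap_strong (dN x (xi ⊙ k0)) PF bL o1' cv (mulr_gt0 e0 p0)).
have Nn := nsl_in hs xi u Nx.
exists (dN (nsl xi u x) \o lt K xi).
  by apply: modD_left; apply: (dN_AD hs); exact: sliceD_nsl.
have lN := star_hom_linear (coaction_hom hc).
have cN := cstar_clin (coactN_cstar hs).
have -> : (dN x \o lt K xi) - (dN (nsl xi u x) \o lt K xi) = dN (x - nsl xi u x) \o lt K xi.
  by rewrite (linear_on_B lN).
apply: (dN_xi_opn (clinB cN Nx Nn) kn0); rewrite (linear_on_B lN) //.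
have := congr1 (fun g => g k0) (dN_nsl_xi hs xi u Nx).
rewrite -[X in X = _ -> _]/(dN (nsl xi u x) (xi ⊙ k0)) => hE.
by rewrite -[(_ - _) _]/(dN x (xi ⊙ k0) - dN (nsl xi u x) (xi ⊙ k0)) hE.
Qed.

(** Vectors a' xi with a' in the commutant of A are dense, and a' (x) 1 commutes with dN x while
    preserving the module. *)
Lemma dN_lten_E x e : N x -> E (dN x \o lt K e).
Proof.
move=> Nx; have bd := dN_bop hs Nx; have [m m0 hm] := bop_opn bd.
apply: (clin_cl modD_clin) => d d0.
have [a' ca ha] := commutant_dense hx hU hdG e (divr_gt0 d0 m0).
exists (dN x \o lt K (a' xi)).
  by rewrite dN_lcomm //; apply: modD_tm; [case: ca | exact: dN_xi_E].
move=> k; rewrite -[(_ - _) k]/(dN x (lt K e k) - dN x (lt K (a' xi) k)) -(bopB _ _ bd).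
rewrite -[lt K e k - _]/((lt K e - lt K (a' xi)) k) -ltenB.
apply: (le_trans (hm _)); apply: (le_trans (ler_wpM2l (ltW m0) (opn_lten _ _ _))).
by rewrite mulrA ler_wpM2r ?nrm_ge0 // mulrC -ler_pdivlMr.
Qed.

Lemma dN_E x v : N x -> E v -> E (dN x \o v).
Proof.
move=> Nx; have bd := dN_bop hs Nx; move: v.
apply: (cmap_into (@clin_bop R _ _) modD_gen_bop (cmap_compl _ bd) modD_clin).
move=> _ [e [d [Dd ->]]]; rewrite -[X in E X]/((dN x \o lt K e) \o d).
by apply: modD_right => //; exact: dN_lten_E.
Qed.

Lemma dN_adjointable x : N x -> adjointable E (dN x).
Proof.
move=> Nx; split; first exact: (dN_bop hs).
move=> v Ev; split; first exact: dN_E.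
by rewrite -(star_hom_adj (coaction_hom hc) Nx); apply: dN_E => //; exact: (coactN_adj hs).
Qed.

Let R1 : set (G ⊗ K -> G ⊗ K) :=
  [set T | exists p q d, D d /\ T = tm (rank1 p q : G -> G) d].

Lemma rank1D_bop : R1 `<=` @bounded_op R _ _.
Proof.
by move=> _ [p [q [d [Dd ->]]]]; apply: bop_tmap; [exact: bop_rank1 | exact: (sliceD_bop hs)].
Qed.

Lemma cptD_R1 : CD `<=` cspan R1.
Proof.
have c1 := cspan_clin R1; apply: cspan_min => //.
move=> _ [T cT [d Dd ->]]; rewrite optensE; have bd := sliceD_bop hs Dd.
have gb : [set T : G -> G | exists a b, T = rank1 a b] `<=` @bounded_op R G G.
  by move=> _ [p [q ->]]; exact: bop_rank1.
have cmp : cmap (@bounded_op R G G) (fun S => tm S d) := @cmap_tmapl R tens G K G K d bd.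
have := compact_cpt cT; move: T {cT}.
apply: (cmap_into (@clin_bop R G G) gb cmp c1).
by move=> _ [p [q ->]]; apply: cspan_sub; exists p, q, d.
Qed.

Lemma cptD_adj S : CD S -> CD (adj S).
Proof.
move=> /cptD_R1; move: S; apply: (cspan_adj rank1D_bop); first exact: cspan_clin.
move=> _ [p [q [d [Dd ->]]]]; have bd := sliceD_bop hs Dd; have br := @bop_rank1 R G G p q.
rewrite (adj_tmap tens br bd) adj_rank1; apply: ctens_elt; first exact: compact_rank1.
exact: (sliceD_adj hs).
Qed.

Lemma cptD_bop S : CD S -> bounded_op S.
Proof. by move=> /cptD_R1; move: S; apply: bop_cspan; exact: rank1D_bop. Qed.

(** A generator factors through the module, rank1 p q (x) d being d composed with creation by q and
    annihilation by p, so the statement reduces to [dN_E]. *)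
Lemma dN_CD x S : N x -> CD S -> CD (dN x \o S).
Proof.
move=> Nx /cptD_R1; have bd := dN_bop hs Nx.
have cC : clin CD by exact: cspan_clin.
move: S; apply: (cmap_into (@clin_bop R _ _) rank1D_bop (cmap_compl _ bd) cC).
move=> _ [p [q [d [Dd ->]]]]; have bD := sliceD_bop hs Dd; have bl := @bop_lten R tens G K.
have br := @bop_rank1 R G G p q.
have -> : tm (rank1 p q) d = lt K q \o d \o adj (lt K p).
  apply: tens_ext; first exact: bop_tmap.
    by apply: bop_comp (bop_comp (bl q) bD) (bop_adj (bl p)).
  move=> x1 k; rewrite (tmapE tens x1 k br bD) -[RHS]/(q ⊙ d (adj (lt K p) (x1 ⊙ k))).
  by rewrite adj_ltenE (bopZ _ _ bD) eltZr /rank1 eltZl.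
rewrite -[X in CD X]/((dN x \o (lt K q \o d)) \o adj (lt K p)).
have : E (dN x \o (lt K q \o d)) by apply: dN_E => //; exact: modD_elt.
move: (dN x \o (lt K q \o d)).
apply: (cmap_into (@clin_bop R _ _) modD_gen_bop (cmap_compr _ (bop_adj (bl p))) cC).
move=> _ [e [d' [Dd' ->]]]; have bD' := sliceD_bop hs Dd'; have br' := @bop_rank1 R G G p e.
have -> : (fun z => e ⊙ d' z) \o adj (lt K p) = tm (rank1 p e) d'.
  apply: tens_ext; [|exact: bop_tmap|].
    by apply: (bop_comp (bop_comp (bl e) bD') (bop_adj (bl p))).
  move=> x1 k; rewrite (tmapE tens x1 k br' bD') -[LHS]/(e ⊙ d' (adj (lt K p) (x1 ⊙ k))).
  by rewrite adj_ltenE (bopZ _ _ bD') eltZr /rank1 eltZl.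
by apply: ctens_elt => //; exact: compact_rank1.
Qed.

Lemma dN_multiplier x : N x -> multiplier CD (dN x).
Proof.
move=> Nx; have bd := dN_bop hs Nx; split => // S CS; split; first exact: dN_CD.
have bS := cptD_bop CS; have Nx' := coactN_adj hs Nx.
have := cptD_adj (dN_CD Nx' (cptD_adj CS)).
rewrite (adj_comp (dN_bop hs Nx') (bop_adj bS)) (adjK bS).
by rewrite (star_hom_adj (coaction_hom hc) Nx) (adjK bd).
Qed.

End ModuleFacts.

(** * Strictness of the coaction *)

Section Strictness.
Variable R : realType.
Variable tens : forall H K : hilbertType R, hilbertTensor H K.
Local Notation C := R[i].
Local Notation "H ⊗ K" := (tensor_space (tens H K))
  (at level 40, left associativity).
Local Notation "x ⊙ y" := (elt (tens _ _) x y)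
  (at level 40, left associativity).
Local Notation lt K x := (@lten R tens _ K x).
Local Notation rt H y := (@rten R tens H _ y).
Variables (G : compact_quantum_group tens) (phi : (G -> G) -> R[i]^o) (xi : G).
Variable U : G ⊗ G -> G ⊗ G.
Variables (K : hilbertType R) (N : set (K -> K)) (dN : (K -> K) -> (G ⊗ K -> G ⊗ K)).
Variables (dG : (G -> G) -> (G ⊗ G -> G ⊗ G))
  (F1 : (G ⊗ K -> G ⊗ K) -> (G ⊗ (G ⊗ K) -> G ⊗ (G ⊗ K)))
  (F2 : (G ⊗ K -> G ⊗ K) -> (G ⊗ G ⊗ K -> G ⊗ G ⊗ K)).
Local Notation A := (@cqg_alg R tens G).
Local Notation Dl := (@comult R tens G).
Local Notation A2 := (@ctens R tens G G A A).
Local Notation W := (@Linfty R tens G).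
Local Notation M := (@wtens R tens G K W N).
Local Notation lam := (lam U).
Hypothesis hs : @coact_data R tens G phi xi U K N dN dG F1 F2.
Let hx := cd_haar hs.
Let hU := cd_U hs.
Let hdG := cd_dG hs.
Let hc := cd_coact hs.
Local Notation WN := (@WN R tens G K N).
Local Notation nslice e f := (@op_slice R tens G K e f).
Local Notation nsl e f := (@co_slice R tens G K dN e f).
Local Notation D := (@sliceD R tens G K N dN).
Local Notation AD := (@ctens R tens G K A D).
Local Notation tm S T := (@tmap R tens _ _ _ _ S T).
Local Notation E := (@modtens R tens G K D).

Lemma cvg_opn (H : hilbertType R) (I : Type) (F : set_system I) (x_ : I -> H) (x : H) : Filter F ->
  (x_ i @[i --> F] --> x) -> forall e : R, 0 < e -> \forall i \near F, nrm (x - x_ i) <= e.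
Proof. by move=> FF h; exact: (iffLR (cvg_nrm FF _ _) h). Qed.

(** Put y_i = x_i - x. The bounded net y_i^* y_i tends to 0 sigma-weakly, so normality makes
    dN(y_i)(xi (x) k0) tend to 0. By [dN_xi_norm] this is norm convergence at xi; the commutant of A
    and uniform boundedness extend it to the whole module. *)
Lemma strict_half I (F : set_system I) (x_ : I -> K -> K) x m : ProperFilter F ->
  (forall i, N (x_ i)) -> N x -> 0 <= m -> (forall i, opn (x_ i) m) ->
  (forall z (e : R), 0 < e -> \forall i \near F, nrm (x z - x_ i z) <= e) ->
  forall v, E v -> forall e : R, 0 < e -> \forall i \near F, opn ((dN (x_ i) \o v) - (dN x \o v)) e.
Proof.
move=> PF Nx_ Nx m0 om cv; have cN := cstar_clin (coactN_cstar hs).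
have bx := coactN_bop hs Nx; have [m' m'0 hm'] := bop_opn bx.
pose y i := x_ i - x; have Ny i : N (y i) by exact: clinB.
have by_ i := coactN_bop hs (Ny i).
pose c := m + m'; have c0 : 0 <= c by rewrite addr_ge0 // ltW.
have oy i : opn (y i) c.
  move=> z; rewrite -[y i z]/(x_ i z - x z) (le_trans (nrmD _ _)) // nrmN mulrDl lerD //; exact: om.
have lN := star_hom_linear (coaction_hom hc).
have odN i : opn (dN (y i)) c.
  exact: (star_hom_contr (coactN_cstar hs) (coactN_id hs) (coaction_hom hc) (coaction_unital hc) (Ny i) c0 (oy i)).
have bdN i : bounded_op (dN (y i)) := dN_bop hs (Ny i).
have yE i v : (dN (x_ i) \o v) - (dN x \o v) = dN (y i) \o v :> (K -> G ⊗ K).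
  by rewrite /y (linear_on_B lN).
have bl := @bop_lten R tens G K.
have yy_cvg : sigma_weak_cvg F (fun i => adj (y i) \o y i) 0.
  apply: (@sigma_weak_bounded R K I F _ _ (c * c)).
  - by move=> i; apply: bop_comp => //; exact: bop_adj.
  - exact: bop_zero.
  - by move=> i; apply: opn_selfcomp.
  move=> u v e e0.
  have p0 : 0 < c * nrm v + 1 by rewrite ltr_wpDl // mulr_ge0 ?nrm_ge0.
  apply: filterS (cv u _ (divr_gt0 e0 p0)) => i; rewrite ler_pdivlMr // => h.
  rewrite op0E ipd0l subr0 -[(_ \o _) u]/(adj (y i) (y i u)) -(adjPr (by_ i)).
  have h1 := cauchy_schwarz (y i u) (y i v); apply: (le_trans h1).
  have h2 := ler_wpM2l (nrm_ge0 (y i u)) (oy i v).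
  have h3 : nrm (y i u) = nrm (x u - x_ i u) by rewrite -[y i u]/(x_ i u - x u) nrmBC.
  rewrite h3 in h2 *; apply: (le_trans h2); apply: le_trans h.
  by rewrite ler_wpM2l ?nrm_ge0 // lerDl.
have step_xi e : 0 < e -> \forall i \near F, opn (dN (y i) \o lt K xi) e.
  move=> e0; have [[k0 kn0]|all0] := pselect (exists k : K, k <> 0); last first.
    have k0 (k : K) : k = 0 by apply: contrapT => h; apply: all0; exists k.
    apply: filterE => i k; rewrite (k0 k) (bop0 (bop_comp (bdN i) (bl xi))).
    by rewrite !nrm0 mulr0.
  have p0 : 0 < nrm k0 by rewrite lt_neqAle nrm_ge0 andbT eq_sym; apply/eqP => /nrm_eq0.
  have Nyy i : N (adj (y i) \o y i) by apply: (coactN_mul hs) => //; exact: (coactN_adj hs).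
  have N0 : N 0 := star_algebra0 (coactN_star hs).
  have dN0 : dN 0 = 0 by rewrite -[in LHS](subrr (idfun : K -> K)) (linear_on_B lN) ?subrr //; exact: (coactN_id hs).
  have := coaction_normal hc PF Nyy N0 yy_cvg (normal_vec (xi ⊙ k0) (xi ⊙ k0)).
  rewrite dN0 => /(cvg_nrm _ _ _) h.
  have ep : 0 < (e * nrm k0) ^+ 2 by rewrite exprn_gt0 // mulr_gt0.
  apply: filterS (h _ ep) => i; rewrite op0E ipd0l (@nrmBC _ C^o) subr0.
  rewrite (star_hom_mul (coaction_hom hc) (coactN_adj hs (Ny i)) (Ny i)) (star_hom_adj (coaction_hom hc) (Ny i)).
  rewrite -[(_ \o _) _]/(adj (dN (y i)) (dN (y i) (xi ⊙ k0))) -(adjPr (bdN i)) ipdxx.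
  rewrite (nrm_real (sqr_ge0 _)) ler_pXn2r ?nnegrE ?nrm_ge0 ?mulr_ge0 ?nrm_ge0 ?(ltW e0) //.
  exact: (dN_xi_opn hs).
have step_e f e : 0 < e -> \forall i \near F, opn (dN (y i) \o lt K f) e.
  move=> e0; have e2 : 0 < e / 2 by rewrite divr_gt0.
  have c1 : 0 < c + 1 by rewrite ltr_wpDl.
  have [a' ca ha] := commutant_dense hx hU hdG f (divr_gt0 e2 c1); have [ba _] := ca.
  have [p p0 hp] := bop_opn ba.
  have bid := @bop_id R K.
  have ot : opn (tm a' (idfun : K -> K)) p.
    by rewrite -[p]mulr1; apply: opn_tmap => //; [exact: ltW | move=> z; rewrite mul1r].
  apply: filterS (step_xi _ (divr_gt0 e2 p0)) => i hi.
  have h1 : opn (dN (y i) \o lt K (a' xi)) (e / 2).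
    rewrite (dN_lcomm hs (Ny i) ca); have -> : e / 2 = p * (e / 2 / p) by rewrite [RHS]mulrC divfK // gt_eqF.
    by apply: opn_comp hi => //; exact: ltW.
  move=> k; have -> : (dN (y i) \o lt K f) k = dN (y i) (lt K (f - a' xi) k) + (dN (y i) \o lt K (a' xi)) k.
    rewrite ltenB -[(_ - _) k]/(lt K f k - lt K (a' xi) k) (bopB _ _ (bdN i)) subrK //.
  rewrite (le_trans (nrmD _ _)) // [e in leRHS](splitr e) mulrDl lerD ?(h1 k) //.
  apply: (le_trans (odN i _)); apply: (le_trans (ler_wpM2l c0 (opn_lten _ _ _))).
  rewrite mulrA ler_wpM2r ?nrm_ge0 //; move: ha; rewrite ler_pdivlMr // => ha.
  by have := nrm_ge0 (f - a' xi); lra.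
pose Z := [set v : K -> G ⊗ K | forall e, 0 < e -> \forall i \near F, opn (dN (y i) \o v) e].
suff : forall v, E v -> Z v.
  by move=> h v /h hv e e0; apply: filterS (hv e e0) => i; rewrite yE.
have cZ : clin Z.
  split.
  - move=> e e0; apply: filterE => i k; rewrite -[(_ \o _) k]/(dN (y i) 0) (bop0 (bdN i)) nrm0.
    by rewrite mulr_ge0 ?nrm_ge0 ?ltW.
  - move=> q S T hS hT e e0.
    have q1 : 0 < nrm (q : C^o) + 1 by rewrite ltr_wpDl ?nrm_ge0.
    have e2 : 0 < e / 2 by rewrite divr_gt0.
    apply: filterS2 (hS _ (divr_gt0 e2 q1)) (hT _ e2) => i h1 h2 k.
    rewrite -[(_ \o _) k]/(dN (y i) (q *: S k + T k)) (bopL (bdN i)).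
    rewrite (le_trans (nrmD _ _)) // [e in leRHS](splitr e) mulrDl lerD ?(h2 k) //.
    rewrite nrmZ; have h3 := ler_wpM2l (@nrm_ge0 _ C^o q) (h1 k); apply: (le_trans h3).
    rewrite mulrA ler_wpM2r ?nrm_ge0 // mulrA ler_pdivrMr // mulrC ler_wpM2l ?(ltW e2) //.
    by rewrite lerDl.
  - move=> T /norm_closureP hT e e0; have e2 : 0 < e / 2 by rewrite divr_gt0.
    have c1 : 0 < c + 1 by rewrite ltr_wpDl.
    have [S hS oS] := hT _ (divr_gt0 e2 c1).
    apply: filterS (hS _ e2) => i h1 k.
    have -> : (dN (y i) \o T) k = dN (y i) ((T - S) k) + dN (y i) (S k).
      by rewrite -[(_ - _) k]/(T k - S k) (bopB _ _ (bdN i)) subrK.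
    rewrite (le_trans (nrmD _ _)) // [e in leRHS](splitr e) mulrDl lerD ?(h1 k) //.
    apply: (le_trans (odN i _)); apply: (le_trans (ler_wpM2l c0 (oS k))).
    rewrite mulrA ler_wpM2r ?nrm_ge0 // mulrA ler_pdivrMr // mulrC ler_wpM2l ?(ltW e2) //.
    by rewrite lerDl.
apply: cspan_min => // _ [f [d [Dd ->]]] e e0.
have bd := sliceD_bop hs Dd; have [p p0 hp] := bop_opn bd.
apply: filterS (step_e f _ (divr_gt0 e0 p0)) => i h.
have -> : e = (e / p) * p by rewrite divfK // gt_eqF.
rewrite -[X in opn X]/((dN (y i) \o lt K f) \o d).
by apply: opn_comp hp => //; rewrite divr_ge0 ?ltW.
Qed.

Lemma dN_strict : strict N E dN.
Proof.
move=> I F PF x_ x Nx_ Nx [B hB] cv cva v Ev.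
have om i : opn (x_ i) (nrm (B : C^o)).
  move=> z; have := hB i z; rewrite !nrmE lecE /= => /andP[_ h].
  apply: (le_trans h); have := Re_le_nrm (B * (nrm z)%:C).
  by rewrite (@nrmM _) nrm_real ?nrm_ge0 //; apply: le_trans; rewrite ler_norm.
have B0 := @nrm_ge0 _ C^o B.
(* Stated for an arbitrary net so that it serves for the x_i and for their adjoints. *)
have cv' T_ T : (forall i, N (T_ i)) -> N T -> (forall i, opn (T_ i) (nrm (B : C^o))) ->
    (forall z, T_ i z @[i --> F] --> T z) -> opnorm_cvg F (fun i => dN (T_ i) \o v) (dN T \o v).
  move=> NT_ NT oT cT e e0.
  have er : e = (complex.Re e)%:C.
    by move: e0; case: (e) => p q; rewrite ltcE /= => /andP[/eqP -> _].
  have e0' : 0 < complex.Re e by move: e0; rewrite er ltcR.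
  have FF : Filter F by exact: filter_filter.
  have h := strict_half PF NT_ NT B0 oT (fun z => cvg_opn FF (cT z)) Ev e0'.
  have : \forall i \near F, opn ((dN (T_ i) \o v) - (dN T \o v)) (complex.Re e) := h.
  apply: filterS => i hi; rewrite er; apply/opnorm_leR; exact: hi.
split; first exact: cv'.
apply: cv' => //.
- by move=> i; exact: (coactN_adj hs).
- exact: (coactN_adj hs).
- by move=> i; apply: opn_adj => //; exact: (coactN_bop hs).
Qed.

End Strictness.

(** * Strong density *)

Section StrongDensity.
Variable R : realType.
Variable tens : forall H K : hilbertType R, hilbertTensor H K.
Local Notation C := R[i].
Local Notation "H ⊗ K" := (tensor_space (tens H K))
  (at level 40, left associativity).
Local Notation "x ⊙ y" := (elt (tens _ _) x y)
  (at level 40, left associativity).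
Local Notation lt K x := (@lten R tens _ K x).
Local Notation rt H y := (@rten R tens H _ y).
Variables (G : compact_quantum_group tens) (phi : (G -> G) -> R[i]^o) (xi : G).
Variable U : G ⊗ G -> G ⊗ G.
Variables (K : hilbertType R) (N : set (K -> K)) (dN : (K -> K) -> (G ⊗ K -> G ⊗ K)).
Variables (dG : (G -> G) -> (G ⊗ G -> G ⊗ G))
  (F1 : (G ⊗ K -> G ⊗ K) -> (G ⊗ (G ⊗ K) -> G ⊗ (G ⊗ K)))
  (F2 : (G ⊗ K -> G ⊗ K) -> (G ⊗ G ⊗ K -> G ⊗ G ⊗ K)).
Local Notation A := (@cqg_alg R tens G).
Local Notation Dl := (@comult R tens G).
Local Notation A2 := (@ctens R tens G G A A).
Local Notation W := (@Linfty R tens G).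
Local Notation M := (@wtens R tens G K W N).
Local Notation lam := (lam U).
Hypothesis hs : @coact_data R tens G phi xi U K N dN dG F1 F2.
Let hx := cd_haar hs.
Let hU := cd_U hs.
Let hdG := cd_dG hs.
Let hc := cd_coact hs.
Local Notation WN := (@WN R tens G K N).
Local Notation nslice e f := (@op_slice R tens G K e f).
Local Notation nsl e f := (@co_slice R tens G K dN e f).
Local Notation D := (@sliceD R tens G K N dN).
Local Notation tm S T := (@tmap R tens _ _ _ _ S T).

Lemma resolvent_dN d g : N d -> N g -> (forall z, g (d z + imC 1 *: z) = z) ->
  (forall z, d (g z) + imC 1 *: g z = z) ->
  (forall w, dN g (dN d w + imC 1 *: w) = w) /\ (forall w, dN d (dN g w) + imC 1 *: dN g w = w).
Proof.
move=> Nd Ng h1 h2; have bg := coactN_bop hs Ng; have bdg := dN_bop hs Ng.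
have lN := star_hom_linear (coaction_hom hc); have hm := star_hom_mul (coaction_hom hc).
have E1 : imC 1 *: g + (g \o d) = idfun.
  apply/funext => z; rewrite -[LHS]/(imC 1 *: g z + g (d z)) addrC.
  by rewrite -(bopZ _ _ bg) -(bopD _ _ bg) h1.
have E2 : imC 1 *: g + (d \o g) = idfun.
  by apply/funext => z; rewrite -[LHS]/(imC 1 *: g z + d (g z)) addrC h2.
have Ngd : N (g \o d) by exact: (coactN_mul hs).
have Ndg : N (d \o g) by exact: (coactN_mul hs).
have k1 : imC 1 *: dN g + (dN g \o dN d) = idfun.
  by rewrite -hm // -lN // E1 (coaction_unital hc).
have k2 : imC 1 *: dN g + (dN d \o dN g) = idfun.
  by rewrite -hm // -lN // E2 (coaction_unital hc).
split=> w.
  rewrite (bopD _ _ bdg) (bopZ _ _ bdg) addrC.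
  exact: (congr1 (fun f => f w) k1).
rewrite addrC; exact: (congr1 (fun f => f w) k2).
Qed.

(** The test vectors a' xi (x) k are those at which the approximations of the density proof are
    known to converge. *)
Lemma commutant_xi_total (S T : G ⊗ K -> G ⊗ K) : bounded_op S -> bounded_op T ->
  (forall a' k, commutant A a' -> S (a' xi ⊙ k) = T (a' xi ⊙ k)) -> S = T.
Proof.
move=> bS bTT h.
apply: (bop_ext_dense (X := [set v | exists a' k, commutant A a' /\ v = a' xi ⊙ k]) bS bTT); last first.
  by move=> _ [a' [k [ca ->]]]; exact: h.
apply: total_of_orth => w hw; apply: tens_eq0 => z k.
apply: (@le_nrm0 _ C^o) => e e0.
have p0 : 0 < nrm k * nrm w + 1 by rewrite ltr_wpDl ?mulr_ge0 ?nrm_ge0.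
have [a' ca ha] := commutant_dense hx hU hdG z (divr_gt0 e0 p0).
have -> : ipd (z ⊙ k) w = ipd ((z - a' xi) ⊙ k) w.
  rewrite -[(z - a' xi) ⊙ k]/(lt K (z - a' xi) k) ltenB.
  by rewrite ipdBl (hw (a' xi ⊙ k)) ?subr0 //; exists a', k.
apply: (le_trans (cauchy_schwarz _ _)); rewrite nrm_elt -mulrA.
by move: ha; rewrite ler_pdivlMr //; have := nrm_ge0 (z - a' xi); lra.
Qed.

Lemma half_sum (V : lmodType C) (v : V) : (2^-1 : C) *: (v + v) = v.
Proof. by rewrite -mulr2n -[v *+ 2]scaler_nat scalerA mulVf ?scale1r // pnatr_eq0. Qed.

Lemma nrm_half : nrm ((2^-1 : C) : C^o) = 2^-1.
Proof.
by rewrite -[2^-1](_ : (2^-1 : R)%:C = _) ?nrm_real // rmorphV ?unitfE ?pnatr_eq0 // rmorph_nat.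
Qed.

Lemma adjZ (H L : hilbertType R) (c : C) (T : H -> L) : bounded_op T ->
  adj (c *: T) = (c^*)%C *: adj T.
Proof.
by move=> bTT; rewrite -[c *: T]addr0 adj_lin ?adj0 ?addr0 //; exact: bop_zero.
Qed.

(* The d u converge to x only after applying dN, and need not be bounded in u; *)
(* their resolvents are bounded.                                               *)
Lemma density_selfadj x : N x -> adj x = x -> commutant (commutant D) x.
Proof.
move=> Nx ax; have bx := coactN_bop hs Nx.
have [F [PF oF cv1 cv2]] := approx_unit hx hU hdG.
have oF1 : \forall u \near F, opn (lam xi u) 1 by apply: filterS oF => u [].
have oF2 : \forall u \near F, opn (lam u xi) 1 by apply: filterS oF => u [].
have [V [UV FV]] := ultraFilterLemma PF.
have PV : ProperFilter V by exact: ultra_proper.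
have cD := sliceD_clin N dN; have cN := cstar_clin (coactN_cstar hs).
have lN := star_hom_linear (coaction_hom hc).
(* The adjoint of one slice is the other because x is selfadjoint; their average is selfadjoint and
   has a resolvent. *)
pose d u : K -> K := (2^-1 : C) *: (nsl xi u x + nsl u xi x).
have Dd u : D (d u) by exact: (clinZ _ cD (clinD cD (sliceD_nsl _ xi u Nx) (sliceD_nsl _ u xi Nx))).
have Nd u : N (d u) := sliceD_N hs (Dd u).
have N1 u : N (nsl xi u x) := nsl_in hs xi u Nx.
have N2 u : N (nsl u xi x) := nsl_in hs u xi Nx.
have ad u : adj (d u) = d u.
  have b1 := coactN_bop hs (N1 u); have b2 := coactN_bop hs (N2 u).
  have bs := bop_add b1 b2.
  have E : adj (nsl xi u x + nsl u xi x) = nsl xi u x + nsl u xi x.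
    rewrite -[X in adj (X + _)]scale1r adj_lin // (nsl_adj hs xi u Nx) (nsl_adj hs u xi Nx) ax.
    by rewrite conjc1 scale1r addrC.
  by rewrite /d adjZ // E conjc_inv conjc_nat.
have /boolp.choice[g hg] u := resolvent (sliceD_cstar hs) (sliceD_id hs) (Dd u) (ad u).
have Dg u : D (g u) by have [] := hg u.
have og u : opn (g u) 1 by have [] := hg u.
have Ng u : N (g u) := sliceD_N hs (Dg u).
have bg u : bounded_op (g u) := coactN_bop hs (Ng u).
have [gx [Ngx ogx hgx1 hgx2]] := resolvent (coactN_cstar hs) (coactN_id hs) Nx ax.
have odg u : opn (dN (g u)) 1.
  exact: (star_hom_contr (coactN_cstar hs) (coactN_id hs) (coaction_hom hc) (coaction_unital hc) (Ng u) ler01 (og u)).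
have dNd u : dN (d u) = (2^-1 : C) *: (dN (nsl xi u x) + dN (nsl u xi x)).
  have N0 : N 0 := star_algebra0 (coactN_star hs).
  have dN0 : dN 0 = 0 by rewrite -[in LHS](subrr (idfun : K -> K)) (linear_on_B lN) ?subrr //; exact: (coactN_id hs).
  rewrite /d -[(2^-1 : C) *: _ in LHS]addr0 lN // ?dN0 ?addr0; last exact: clinD.
  by rewrite -[nsl xi u x in LHS]scale1r lN // scale1r.
have cvxi k e : 0 < e -> \forall u \near V, nrm (dN x (xi ⊙ k) - dN (d u) (xi ⊙ k)) <= e.
  move=> e0; apply: FV; set w := dN x (xi ⊙ k).
  have t1 := tmap_strong w PF (fun u => bop_lam hU xi u) oF1 cv1 e0.
  have t2 := tmap_strong w PF (fun u => bop_lam hU u xi) oF2 cv2 e0.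
  apply: filterS2 t1 t2 => u h1 h2.
  have e1 := congr1 (fun f => f k) (dN_nsl_xi hs xi u Nx).
  have e2 := congr1 (fun f => f k) (dN_nsl_xi hs u xi Nx).
  rewrite -[X in X = _]/(dN (nsl xi u x) (xi ⊙ k)) in e1.
  rewrite -[X in X = _]/(dN (nsl u xi x) (xi ⊙ k)) in e2.
  have -> : w - dN (d u) (xi ⊙ k) = (2^-1 : C) *: ((w - tm (lam xi u) idfun w) + (w - tm (lam u xi) idfun w)).
    rewrite dNd -[(_ *: _) (xi ⊙ k)]/((2^-1 : C) *: (dN (nsl xi u x) (xi ⊙ k) + dN (nsl u xi x) (xi ⊙ k))).
    rewrite e1 e2 -[X in X - _](half_sum w) -scalerBr; congr (_ *: _).
    rewrite -[(_ \o _) k]/(tm (lam xi u) idfun w) -[(_ \o _) k]/(tm (lam u xi) idfun w).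
    by rewrite opprD addrACA.
  rewrite nrmZ nrm_half mulrC ler_pdivrMr // mulr_natr mulr2n.
  by apply: (le_trans (nrmD _ _)); rewrite lerD.
have cva a' k e : commutant A a' -> 0 < e ->
    \forall u \near V, nrm (dN x (a' xi ⊙ k) - dN (d u) (a' xi ⊙ k)) <= e.
  move=> ca e0; have [ba _] := ca; have [p p0 hp] := bop_opn ba; have bid := @bop_id R K.
  have ot : opn (tm a' (idfun : K -> K)) p.
    by rewrite -[p]mulr1; apply: opn_tmap => //; [exact: ltW | move=> z; rewrite mul1r].
  have bt : bounded_op (tm a' (idfun : K -> K)) by exact: bop_tmap.
  apply: filterS (cvxi k _ (divr_gt0 e0 p0)) => u hu.
  have c1 := congr1 (fun f => f k) (dN_lcomm hs Nx ca).
  have c2 := congr1 (fun f => f k) (dN_lcomm hs (Nd u) ca).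
  rewrite -[X in X = _]/(dN x (a' xi ⊙ k)) in c1.
  rewrite -[X in X = _]/(dN (d u) (a' xi ⊙ k)) in c2.
  rewrite c1 c2 -[(_ \o _) k]/(tm a' idfun (dN x (xi ⊙ k))) -[(_ \o _) k]/(tm a' idfun (dN (d u) (xi ⊙ k))).
  rewrite -(bopB _ _ bt); apply: (le_trans (ot _)); by rewrite mulrC -ler_pdivlMr.
(* The resolvents are contractions in D, so they have a weak limit y in the bicommutant of D. The
   aim is to show that y is the resolvent [gx] of x. *)
have [y [by_ oy hy]] := ultra_op UV ler01 bg og.
have Dy : commutant (commutant D) y.
  split=> // c [bc hcD]; apply/funext => u /=; apply/ipd_inj => v.
  apply: (lim_uniqC PV (r := fun i => ipd (c (g i u)) v)) => e e0.
    apply: filterS (hy u (adj c v) e e0) => i.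
    by rewrite !(adjP bc).
  apply: filterS (hy (c u) v e e0) => i.
  by have := congr1 (fun f => f u) (hcD _ (Dg i)) => /= ->.
have Ny : N y.
  apply: (vn_bicommutant (cd_vn hs)); case: Dy => b h; split => // c [bc hcN].
  by apply: h; split=> // S /(sliceD_N hs); exact: hcN.
have sw : sigma_weak_cvg V g y.
  apply: (sigma_weak_bounded PV bg by_ og) => u v e e0.
  by apply: filterS (hy u v e e0) => i; rewrite (@nrmBC _ C^o).
have swd := coaction_normal hc PV Ng Ny sw.
have key : dN y = dN gx.
  have [r1 r2] := resolvent_dN Nx Ngx hgx2 hgx1.
  have bdy := dN_bop hs Ny; have bdx := dN_bop hs Nx; have bid := @bop_id R (G ⊗ K).
  pose S : G ⊗ K -> G ⊗ K := imC 1 *: idfun + dN x.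
  have bS : bounded_op S by exact: bop_lin.
  (* For a test vector z, dN(g u)(S z) - z = dN(g u)(dN x z - dN(d u) z), which tends to 0 because
     the dN(g u) are contractions. *)
  have h : dN y \o S = idfun.
    apply: commutant_xi_total => [|//|a' k ca]; first exact: bop_comp.
    set z := a' xi ⊙ k; apply/ipd_inj => w.
    rewrite -[LHS]/(ipd (dN y (S z)) w).
    apply: (lim_uniqC PV (r := fun i => ipd (dN (g i) (S z)) w)) => e e0.
      have := swd _ (normal_vec (S z) w) => /(cvg_nrm _ _ _); exact.
    have p0 : 0 < nrm w + 1 by rewrite ltr_wpDl ?nrm_ge0.
    apply: filterS (cva a' k _ ca (divr_gt0 e0 p0)) => i; rewrite ler_pdivlMr // => hi.
    have [_ _ g1 g2] := hg i; have [s1 _] := resolvent_dN (Nd i) (Ng i) g2 g1.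
    have bdg := dN_bop hs (Ng i).
    have -> : ipd (idfun z) w - ipd (dN (g i) (S z)) w = - ipd (dN (g i) (dN x z - dN (d i) z)) w.
      rewrite -[idfun z]/z -{1}(s1 z) -ipdBl -(bopB _ _ bdg) -ipdNl -(bopN _ bdg).
      congr (ipd (dN (g i) _) w); rewrite -[S z]/(imC 1 *: z + dN x z); hring.
    rewrite nrmN; apply: (le_trans (cauchy_schwarz _ _)).
    have := ler_wpM2r (nrm_ge0 w) (odg i (dN x z - dN (d i) z)); rewrite mul1r.
    by have := nrm_ge0 (dN x z - dN (d i) z); lra.
  apply/funext => w; rewrite -[in LHS](r2 w).
  rewrite -[LHS]/(dN y (dN x (dN gx w) + imC 1 *: dN gx w)) addrC.
  exact: (congr1 (fun f => f (dN gx w)) h).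
have yE : y = gx := coaction_inj hc Ny Ngx key.
(* An operator commuting with D commutes with the resolvent of x, hence with x. *)
rewrite yE in Dy; case: Dy => bgx hcg; split => // c [bc hcD].
have cg z : c (gx z) = gx (c z) by apply: (congr1 (fun f => f z) (hcg c _)); split.
apply/funext => z /=.
pose z' := x z + imC 1 *: z; have zE : gx z' = z by exact: hgx2.
have E : x (c z) + imC 1 *: c z = c (x z) + imC 1 *: c z.
  rewrite -[in LHS]zE cg hgx1 /z' (bopD _ _ bc) (bopZ _ _ bc) //.
by have := addIr _ E => ->.
Qed.

Lemma sliceD_dense x : N x -> strong_closure D x.
Proof.
move=> Nx; apply: (bicommutant (sliceD_star hs) (sliceD_id hs)).
have bx := coactN_bop hs Nx; have Nx' := coactN_adj hs Nx; have bx' := coactN_bop hs Nx'.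
have cN := cstar_clin (coactN_cstar hs).
have DL (c : C) S T : commutant (commutant D) S -> commutant (commutant D) T ->
    commutant (commutant D) (c *: S + T).
  move=> [bS hS] [bTT hT]; split; first exact: bop_lin.
  move=> p hp; have [bp _] := hp; apply/funext => z.
  rewrite -[LHS]/(p (c *: S z + T z)) (bopL bp) -[RHS]/(c *: S (p z) + T (p z)).
  have := congr1 (fun f => f z) (hS p hp) => /= ->.
  by have := congr1 (fun f => f z) (hT p hp) => /= ->.
pose h1 : K -> K := (2^-1 : C) *: (x + adj x).
(* The imaginary part of x: the scalar is 1 / (2 i) = - i / 2. *)
pose h2 : K -> K := (imC (- 2^-1)) *: (x - adj x).
have ad1 : adj (x + adj x) = x + adj x.
  by have := adj_lin 1 bx bx'; rewrite (adjK bx) conjc1 !scale1r => ->; exact: addrC.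
have ad2 : adj (x - adj x) = - (x - adj x).
  have := adj_lin (-1) bx' bx; rewrite (adjK bx) rmorphN1 !scaleN1r.
  by rewrite [x - adj x]addrC opprD opprK => ->; exact: addrC.
have Ns : N (x + adj x) by exact: clinD.
have Nd : N (x - adj x) by exact: clinB.
have -> : x = imC 1 *: h2 + h1.
  rewrite /h2 /h1 scalerA.
  have -> : imC 1 * imC (- 2^-1) = (2^-1 : C).
    have -> : (2^-1 : C) = (2^-1 : R)%:C by rewrite rmorphV ?unitfE ?pnatr_eq0 // rmorph_nat.
    by apply/eqP; rewrite eq_complex /=; apply/andP; split; apply/eqP; ring.
  by rewrite -scalerDr addrACA addNr addr0 half_sum.
apply: DL; apply: density_selfadj.
- exact: clinZ.
- rewrite /h2 adjZ ?ad2; last exact: (coactN_bop hs).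
  rewrite scalerN -scaleNr; congr (_ *: _); rewrite /imC /=; simpc => //.
- exact: clinZ.
- rewrite /h1 adjZ ?ad1; last exact: (coactN_bop hs).
  by congr (_ *: _); rewrite conjc_inv conjc_nat.
Qed.

End StrongDensity.

(** * The algebra of slices as a G-C*-algebra *)

Section GAlgebra.
Variable R : realType.
Variable tens : forall H K : hilbertType R, hilbertTensor H K.
Local Notation C := R[i].
Local Notation "H ⊗ K" := (tensor_space (tens H K))
  (at level 40, left associativity).
Local Notation "x ⊙ y" := (elt (tens _ _) x y)
  (at level 40, left associativity).
Local Notation lt K x := (@lten R tens _ K x).
Local Notation rt H y := (@rten R tens H _ y).
Variables (G : compact_quantum_group tens) (phi : (G -> G) -> R[i]^o) (xi : G).
Variable U : G ⊗ G -> G ⊗ G.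
Variables (K : hilbertType R) (N : set (K -> K)) (dN : (K -> K) -> (G ⊗ K -> G ⊗ K)).
Variables (dG : (G -> G) -> (G ⊗ G -> G ⊗ G))
  (F1 : (G ⊗ K -> G ⊗ K) -> (G ⊗ (G ⊗ K) -> G ⊗ (G ⊗ K)))
  (F2 : (G ⊗ K -> G ⊗ K) -> (G ⊗ G ⊗ K -> G ⊗ G ⊗ K)).
Local Notation A := (@cqg_alg R tens G).
Local Notation Dl := (@comult R tens G).
Local Notation A2 := (@ctens R tens G G A A).
Local Notation W := (@Linfty R tens G).
Local Notation M := (@wtens R tens G K W N).
Local Notation lam := (lam U).
Hypothesis hs : @coact_data R tens G phi xi U K N dN dG F1 F2.
Let hx := cd_haar hs.
Let hU := cd_U hs.
Let hdG := cd_dG hs.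
Let hc := cd_coact hs.
Local Notation WN := (@WN R tens G K N).
Local Notation nslice e f := (@op_slice R tens G K e f).
Local Notation nsl e f := (@co_slice R tens G K dN e f).
Local Notation D := (@sliceD R tens G K N dN).
Local Notation AD := (@ctens R tens G K A D).
Local Notation tm S T := (@tmap R tens _ _ _ _ S T).

Lemma star_hom_sub (H L : hilbertType R) (X Y : set (H -> H)) (f : (H -> H) -> (L -> L)) :
  X `<=` Y -> star_hom Y f -> star_hom X f.
Proof.
move=> XY [h1 h2 h3 h4]; split.
- by move=> S /XY; exact: h1.
- by move=> c S T /XY YS /XY YT; exact: h2.
- by move=> S T /XY YS /XY YT; exact: h3.
- by move=> S /XY; exact: h4.
Qed.

Lemma mor_unital (H L : hilbertType R) (X : set (H -> H)) (Y : set (L -> L))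
    (f : (H -> H) -> (L -> L)) :
  X idfun -> cstar_algebra Y -> star_hom X f -> f idfun = idfun ->
  (forall S, X S -> Y (f S)) -> mor X Y f.
Proof.
move=> X1 cY hf f1 fY; have [sY _] := cY; split => //.
  move=> S XS; split; first exact: (star_hom_bounded hf).
  by move=> T YT; split; apply: (star_algebra_mul sY) => //; exact: fY.
apply/seteqP; split.
  apply: cspan_min; first exact: cstar_clin.
  by move=> _ [_ [S XS <-] [T YT ->]]; apply: (star_algebra_mul sY) => //; exact: fY.
move=> T YT; apply: cspan_sub; exists idfun; last by exists T.
by exists idfun.
Qed.

Lemma sliceD_G_cstar : G_cstar_algebra D dN.
Proof.
have D1 := sliceD_id hs; have DN := sliceD_N hs; have AD1 := ctensD_id hs; have ADM := ctensD_M hs.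
have cAD := ctensD_cstar hs; have [sAD _] := cAD.
(* AD is unital and hence equal to its multiplier algebra, so the extensions required by [mor_ext]
   are restrictions of F1 and F2. *)
have mAD : multiplier AD `<=` AD.
  by move=> T [_ h]; have [] := h idfun AD1.
have M1 : M idfun by rewrite -(@tmap_id R tens G K); apply: (wtens_elt hs) (coactN_id hs); case: (@Linfty_vn R tens G).
have W1 : W idfun by case: (@Linfty_vn R tens G).
have dN1 := coaction_unital hc.
have F11 : F1 idfun = idfun.
  by rewrite -[in LHS](@tmap_id R tens G K) (F1_elt hs W1 (coactN_id hs)) dN1 tmap_id.
have F21 : F2 idfun = idfun.
  rewrite -[in LHS](@tmap_id R tens G K) (F2_elt hs W1 (coactN_id hs)).
  by rewrite (dG_comult hdG (@cqg_unital R tens G)) comult_unital tmap_id.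
have eM : @eltens R tens G K A D `<=` M by move=> T /cspan_sub; exact: ADM.
have cM := cstar_clin (wtens_cstar hs).
split.
- exact: (sliceD_cstar hs).
- apply/seteqP; split=> // v _; apply: subset_closure; apply: lspan_sub.
  by exists idfun, v.
- apply: mor_unital => //; first exact: star_hom_sub DN (coaction_hom hc).
  exact: (dN_AD hs).
- by move=> x y /DN Nx /DN Ny; exact: (coaction_inj hc).
- exists F1, F2; split.
  + split; last by move=> S T AS /DN NT; apply: (F1_elt hs) => //; exact: cqg_Linfty.
    have hF := star_hom_sub ADM (F1_hom hs).
    split; last by apply: star_hom_sub (F1_hom hs) => T /mAD /ADM.
    apply: mor_unital => //; first by apply: ctens_star => //; exact: cqg_star.
    have cF := cmap_hom (wtens_cstar hs) M1 (F1_hom hs) F11.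
    apply: (cmap_into cM eM cF); first exact: cspan_clin.
    move=> _ [a Aa [d Dd ->]]; rewrite optensE (F1_elt hs (cqg_Linfty Aa) (DN _ Dd)).
    by apply: ctens_elt => //; exact: (dN_AD hs).
  + split; last first.
      move=> S T AS /DN NT; rewrite optensE (F2_elt hs (cqg_Linfty AS) NT).
      by rewrite (dG_comult hdG AS).
    have hF := star_hom_sub ADM (F2_hom hs).
    split; last by apply: star_hom_sub (F2_hom hs) => T /mAD /ADM.
    apply: mor_unital => //.
      by apply: ctens_star; [case: (@cqg2_cstar R tens G) | exact: (sliceD_star hs)].
    have cF := cmap_hom (wtens_cstar hs) M1 (F2_hom hs) F21.
    apply: (cmap_into cM eM cF); first exact: cspan_clin.
    move=> _ [a Aa [d Dd ->]]; rewrite optensE (F2_elt hs (cqg_Linfty Aa) (DN _ Dd)).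
    by rewrite (dG_comult hdG Aa); apply: ctens_elt => //; exact: comult_in.
  + by move=> x /DN Nx; exact: (cd_assoc hs).
- exact: (sliceD_continuous hs).
Qed.

End GAlgebra.

Theorem theorem6p8 (R : realType)
    (tens : forall H K : hilbertType R, hilbertTensor H K)
    (G : compact_quantum_group tens)
    (phi : (G -> G) -> R[i]^o) (xi : G)
    (phi_haar : haar_state phi)
    (phi_faithful : faithful_on (@cqg_alg R tens G) phi)
    (phi_gns : gns (@cqg_alg R tens G) phi xi)
    (K : hilbertType R) (N : set (K -> K))
    (dN : (K -> K) -> (tens G K -> tens G K))
    (N_vn : von_neumann_algebra N)
    (dN_coaction : coaction N dN)
    (dN_ergodic : ergodic N dN) :
  quantum_homogeneous_space N dN.
Proof.
have hx : haar_gns phi xi by split.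
have [U hU] := mulU_exists hx.
have [dG [F1 [F2 [hdG hF1 hF2 hco]]]] := coaction_coassoc dN_coaction.
have hs : @coact_data R tens G phi xi U K N dN dG F1 F2 by split.
split => //; exists (@sliceD R tens G K N dN), dN; split => //.
- exact: (sliceD_G_cstar hs).
- by split; [exact: (sliceD_N hs) | exact: (sliceD_dense hs)].
- by move=> x Nx; split; [exact: (dN_multiplier hs) | exact: (dN_adjointable hs)].
- exact: (dN_strict hs).
Qed.
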